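(* Let $\theta>2$ be a non-integer and fix $\tau>0$. For a positive real number $R$, let $X=(R/s)^{1/\theta}$ and $Y=c\sqrt{X}$, where $c>(\lfloor s/2\rfloor(\theta-1))^{-1/2}$ is a fixed constant. Then for any positive integer $s\ge(\lfloor 2\theta\rfloor+1)(\lfloor 2\theta\rfloor+2)+1$, the bound $$N_{s,\theta}^{\tau}(R,Y)\gg_{s,\theta}\tau X^{1-\theta}Y^{s-1}$$ holds for all sufficiently large real $R>0$.
   Context: For $s\in\mathbb{N}$, $\theta>2$ non-integer, $\tau>0$, $R>0$ real, $X=(R/s)^{1/\theta}$ and real $Y$ with $0\le Y\le X$, the quantity $N_{s,\theta}^{\tau}(R,Y)$ is the number of $s$-tuples of positive integers $(x_1,\ldots,x_s)$ satisfying $$|x_1^\theta+\cdots+x_s^\theta-R|<\tau\quad\text{and}\quad X-Y<x_i\le X+Y\quad(1\le i\le s).$$ Here $P\gg_{s,\theta}Q$ is Vinogradov's notation: $P\ge CQ$ for some constant $C>0$ depending only on $s$ and $\theta$. *)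

(* Defs.v *)
From HB Require Import structures.
From mathcomp Require Import all_boot all_order all_algebra finmap.
From mathcomp Require Import all_classical all_reals all_analysis.

Set Implicit Arguments.
Unset Strict Implicit.
Unset Printing Implicit Defensive.

Import Order.TTheory GRing.Theory Num.Theory.
Import numFieldNormedType.Exports.

Local Open Scope classical_set_scope.
Local Open Scope ring_scope.

Definition central {R : realType} (s : nat) (theta r : R) : R :=
  (r / s%:R) `^ theta^-1.

Definition solutions {R : realType} (s : nat) (theta tau r Y : R) :
    set (s.-tuple nat) :=
  [set x | [/\ forall i, (0 < tnth x i)%N,
               `|(\sum_(i < s) (tnth x i)%:R `^ theta) - r| < tau &
               forall i, central s theta r - Y < (tnth x i)%:R
                         <= central s theta r + Y]].
Arguments solutions {R} s theta tau r Y.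

(* [fset_set] is [fset0] on infinite sets; [solutions] never is one. *)
Lemma finite_solutions {R : realType} (s : nat) (theta tau r Y : R) :
  finite_set (solutions s theta tau r Y).
Proof.
pose b := (Num.truncn (central s theta r + Y)).+1.
apply: (@sub_finite_set _ _
  ((fun t : s.-tuple 'I_b => map_tuple (@nat_of_ord b) t) @` setT)).
  move=> x [_ _ hx].
  have hb i : (tnth x i < b)%N.
    have /andP[_ h] := hx i.
    rewrite /b -(ltr_nat R); apply: le_lt_trans h _.
    exact: truncnS_gt.
  exists [tuple Ordinal (hb i) | i < s] => //.
  by apply: eq_from_tnth => i; rewrite tnth_map tnth_mktuple.
exact/finite_image/finite_finset.
Qed.

Definition Ncount {R : realType} (s : nat) (theta tau r Y : R) : nat :=
  #|` fset_set (solutions s theta tau r Y)|.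

(* Main.v *)
Require Import Defs.
From mathcomp Require Import all_boot all_order all_algebra.
From mathcomp Require Import all_classical all_reals all_analysis.
From mathcomp Require Import zify ring lra.

Set Implicit Arguments.
Unset Strict Implicit.
Unset Printing Implicit Defensive.

Import Order.TTheory GRing.Theory Num.Theory.
Import numFieldNormedType.Exports.

Local Open Scope classical_set_scope.
Local Open Scope ring_scope.

(* Put y = X^(1/2), k = floor (2 theta) and r = k (k + 1) / 2, so that s > 2 r. For a tuple a of
   integers of the window let V(a) be the sum of the a_i^theta minus R; then |V| = O(y^(2 theta - 1)),
   and we let A be a normalisation with |A V| <= 1.

   The function (cos u - cos (A tau)) |sum_j t_j e^(iju)|^2, with tent weights t_j of length about
   1 / (A tau), is positive on [-1, 1] only for |u| < A tau, so its sum over the A V(a) bounds the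
   count from below. For frequencies m <= y^(13/12) its Fourier coefficients are nearly constant, and
   so are those of a much shorter tent kernel, which only detects |V| <= y^(2 theta - 11/4). Hence the
   two sums are proportional up to the contribution of the frequencies m > y^(13/12).

   The coarse problem |V| <= y^(2 theta - 11/4) is solved by hand: balance the first and second order
   Taylor terms (this needs the lower bound on c), then move a pair of variables with constant sum and
   use a discrete intermediate value theorem.

   At a high frequency, one factor of the exponential sum over the window is bounded by van der
   Corput differencing and 2 r factors are averaged. The average over m counts pairs of r-tuples
   with |V(a) - V(b) - T| <= 1. Taylor expansion to degree k puts the differences of their power
   sums of degrees 1, ..., k in a small set. The number of pairs with given differences is bounded
   by the Vinogradov mean value theorem, which is proved by decoupling for the moment curve over
   the p-adic integers, for one fixed prime p > k, with induction on the degree and a bilinear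
   iteration in the style of Guo, Li, Yung and Zorin-Kranich. *)

(** The exponents are tied together as follows. On the window around y^2 the phase m A x^theta has a
    quadratic part of size about m / y; the differencing bound asks for at least y^(1/12), hence the
    cut at y^(13/12). A second order Taylor expansion leaves an error y^(2 theta - 3), so the coarse
    width is taken larger by y^(1/4); its kernel then has length y^(7/4), and comparing coefficients
    up to the cut costs a factor y^(3 (13/12) - 7/2) = y^(-1/4). Comparing two kernels replaces the
    evaluation of a main term by a construction of solutions. The mean value of the 2 r averaged
    factors loses y^eps. The pointwise saving on one further factor is a power of y fixed before
    eps, and pays for it. The bound on c comes from integrality: the variables have an integer sum,
    so the linear Taylor term can be prescribed only up to one unit, and the quadratic term, which
    has a sign, must be able to compensate a whole unit while the variables stay within c y of
    y^2. *)

(** * Convexity, Minkowski and Hoelder inequalities for natural powers *)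

Section PowerInequalities.
Variable R : realType.
Implicit Types x y z : R.

Lemma sqr_sum_le (I : Type) (s : seq I) (P : pred I) (a : I -> R) :
  (\sum_(i <- s | P i) a i) ^+ 2 <= (size s)%:R * \sum_(i <- s | P i) a i ^+ 2.
Proof.
elim: s => [|i s IH]; first by rewrite !big_nil expr0n mulr0.
rewrite !big_cons /=.
set A := \sum_(j <- s | P j) a j in IH *.
set B := \sum_(j <- s | P j) a j ^+ 2 in IH *.
have B0 : 0 <= B by apply: sumr_ge0 => j _; exact: sqr_ge0.
have n0 : (0 : R) <= (size s)%:R by [].
rewrite -natr1; case: ifP => _; last by apply: le_trans IH _; nra.
have [/size0nil s0|ns0] := eqVneq (size s) 0%N.
  have -> : A = 0 by rewrite /A s0 big_nil.
  rewrite s0 /= in n0 *; nra.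
have n1 : (0 : R) < (size s)%:R by rewrite ltr0n lt0n.
have h : 2 * (a i * A) <= (size s)%:R * a i ^+ 2 + B.
  rewrite -(ler_pM2l n1).
  have := sqr_ge0 ((size s)%:R * a i - A); nra.
nra.
Qed.

(** Convexity of the power function on the half-line, in the form of a tangent line at [y]. The
    Minkowski and Hoelder inequalities below both rest on it. *)
Lemma exprn_tangent x y n :
  0 <= x -> 0 <= y -> y ^+ n + n%:R * y ^+ n.-1 * (x - y) <= x ^+ n.
Proof.
move=> x0 y0; elim: n => [|n IH]; first by rewrite !expr0 mul0r mul0r addr0.
rewrite /= exprS [x ^+ _]exprS.
have [->|n0] := posnP n; first by rewrite !expr0 /=; lra.
have yn : 0 <= y ^+ n.-1 by exact: exprn_ge0.
have -> : y ^+ n = y * y ^+ n.-1 by rewrite -exprS prednK.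
apply: le_trans (ler_wpM2l x0 IH).
have -> : y ^+ n = y * y ^+ n.-1 by rewrite -exprS prednK.
rewrite -natr1 -subr_ge0.
set t := y ^+ n.-1.
have -> : x * (y * t + n%:R * t * (x - y)) -
   (y * (y * t) + (n%:R + 1) * (y * t) * (x - y)) = n%:R * t * (x - y) ^+ 2 by ring.
by apply: mulr_ge0; [exact: mulr_ge0 | exact: sqr_ge0].
Qed.

(** The tangent of z^(n+1) at [y], evaluated at the weighted mean [M], equals x y^n. *)
Lemma amgm_exprS x y n :
  0 <= x -> 0 <= y -> x * y ^+ n <= ((x + n%:R * y) / n.+1%:R) ^+ n.+1.
Proof.
move=> x0 y0; set M := _ / _.
have M0 : 0 <= M by rewrite divr_ge0// addr_ge0// mulr_ge0.
have := exprn_tangent n.+1 M0 y0; apply: le_trans => /=.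
have -> : n.+1%:R * y ^+ n * (M - y) = y ^+ n * (n.+1%:R * M - n.+1%:R * y) by ring.
have -> : n.+1%:R * M = x + n%:R * y by rewrite /M mulrC divfK// pnatr_eq0.
by rewrite exprS -natr1; lra.
Qed.

Lemma root_exists n y : (0 < n)%N -> 0 <= y -> exists2 w, 0 <= w & w ^+ n = y.
Proof.
move=> n0 y0; exists (y `^ n%:R^-1); first exact: powR_ge0.
rewrite -powR_mulrn ?powR_ge0// -powRrM mulVf ?powRr1//.
by rewrite pnatr_eq0 -lt0n.
Qed.

(** The triangle inequality in L^n, phrased through upper bounds for the norms so that no root has
    to be taken: each [g i] has norm at most Z^(1/n) [u i]. It allows decoupling on fibres to be
    averaged over the remaining frequencies. *)
Lemma weighted_minkowski (T I : finType) (P : pred I) n (mu : T -> R) (g : I -> T -> R)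
    (u : I -> R) (Z : R) :
  (0 < n)%N -> (forall t, 0 <= mu t) -> (forall i t, 0 <= g i t) ->
  (forall i, 0 <= u i) -> 0 <= Z ->
  (forall i, P i -> \sum_t mu t * g i t ^+ n <= Z * u i ^+ n) ->
  \sum_t mu t * (\sum_(i | P i) g i t) ^+ n <= Z * (\sum_(i | P i) u i) ^+ n.
Proof.
move=> n0 mu0 g0 u0 Z0 H.
set U := \sum_(i | P i) u i.
have U0 : 0 <= U by apply: sumr_ge0.
have gzero i t : P i -> u i = 0 -> mu t != 0 -> g i t = 0.
  move=> Pi ui mt; have := H i Pi; rewrite ui expr0n (gtn_eqF n0) mulr0 => h.
  have hs : forall t, 0 <= mu t * g i t ^+ n.
    by move=> t'; rewrite mulr_ge0// exprn_ge0.
  have /eqP : \sum_t mu t * g i t ^+ n = 0 by apply/eqP; rewrite eq_le h sumr_ge0.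
  rewrite psumr_eq0// => /allP/(_ t); rewrite mem_index_enum => /(_ isT).
  by rewrite /= mulf_eq0 (negbTE mt) /= expf_eq0 n0 => /eqP.
have [Uz|Unz] := eqVneq U 0.
  have uz i : P i -> u i = 0.
    move=> Pi; move/eqP: Uz; rewrite psumr_eq0; last by move=> *; exact: u0.
    by move=> /allP/(_ i); rewrite mem_index_enum => /(_ isT); rewrite Pi => /eqP.
  rewrite Uz expr0n (gtn_eqF n0) mulr0 big1// => t _.
  have [->|mt] := eqVneq (mu t) 0; first by rewrite mul0r.
  by rewrite big1 ?expr0n ?(gtn_eqF n0) ?mulr0// => i Pi; apply: gzero => //; exact: uz.
have Up : 0 < U by rewrite lt_def Unz.
(* Jensen with the weights [u i / U]; the tangent is taken at the value [G] of the full sum. *)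
have key t : mu t * (\sum_(i | P i) g i t) ^+ n
    <= \sum_(i | P i) (U ^+ n.-1 / u i ^+ n.-1) * (mu t * g i t ^+ n).
  have [->|mt] := eqVneq (mu t) 0; first by rewrite mul0r big1// => i _; rewrite mul0r mulr0.
  set G := \sum_(i | P i) g i t.
  have G0 : 0 <= G by apply: sumr_ge0.
  have h1 i : P i -> (u i / U) * G ^+ n + n%:R * G ^+ n.-1 * (g i t - G * (u i / U))
      <= U ^+ n.-1 / u i ^+ n.-1 * g i t ^+ n.
    move=> Pi; have [uz|unz] := eqVneq (u i) 0.
      rewrite uz (gzero i t Pi uz mt) mul0r mulr0 !mul0r subrr mulr0 addr0.
      by rewrite mulr_ge0 ?exprn_ge0// mulr_ge0 ?exprn_ge0// invr_ge0 exprn_ge0.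
    have up : 0 < u i by rewrite lt_def unz u0.
    have z0 : 0 <= g i t * (U / u i) by rewrite mulr_ge0// divr_ge0// ltW.
    have := exprn_tangent n z0 G0.
    have l0 : 0 <= u i / U by rewrite divr_ge0.
    move=> /(ler_wpM2l l0) h; apply: le_trans (le_trans _ h) _.
      rewrite [leRHS]mulrDr lerD2l.
      suff -> : u i / U * (n%:R * G ^+ n.-1 * (g i t * (U / u i) - G)) =
         n%:R * G ^+ n.-1 * (g i t - G * (u i / U)) by [].
      by field; rewrite unz gt_eqF.
    have -> : n = n.-1.+1 by rewrite prednK.
    rewrite /= exprMn exprMn exprVn !exprS.
    suff -> : u i / U * (g i t * g i t ^+ n.-1 * (U * U ^+ n.-1 * (u i * u i ^+ n.-1)^-1)) =
      U ^+ n.-1 / u i ^+ n.-1 * (g i t * g i t ^+ n.-1) by [].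
    by field; rewrite ?expf_neq0 ?unz ?Unz.
  have -> : \sum_(i | P i) U ^+ n.-1 / u i ^+ n.-1 * (mu t * g i t ^+ n) =
      mu t * \sum_(i | P i) U ^+ n.-1 / u i ^+ n.-1 * g i t ^+ n.
    by rewrite mulr_sumr; apply: eq_bigr => i _; rewrite mulrCA.
  apply: ler_wpM2l => //; apply: le_trans (ler_sum _ h1).
  rewrite big_split /= -mulr_suml -mulr_suml divff// mul1r -mulr_sumr.
  by rewrite sumrB -mulr_sumr -mulr_suml -/G divff// mulr1 subrr mulr0 addr0.
apply: le_trans (ler_sum _ (fun t _ => key t)) _.
rewrite exchange_big /=.
have -> : Z * U ^+ n = \sum_(i | P i) Z * U ^+ n.-1 * u i.
  by rewrite -mulr_sumr -/U -mulrA -exprSr prednK.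
apply: ler_sum => i Pi; rewrite -mulr_sumr.
have [uz|unz] := eqVneq (u i) 0.
  rewrite uz mulr0 big1 ?mulr0// => t _.
  have [->|mt] := eqVneq (mu t) 0; first by rewrite mul0r.
  by rewrite (gzero i t Pi uz mt) expr0n (gtn_eqF n0) mulr0.
have l0 : 0 <= U ^+ n.-1 / u i ^+ n.-1 by rewrite divr_ge0// exprn_ge0.
apply: le_trans (ler_wpM2l l0 (H i Pi)) _.
have -> : u i ^+ n = u i * u i ^+ n.-1 by rewrite -exprS prednK.
suff -> : U ^+ n.-1 / u i ^+ n.-1 * (Z * (u i * u i ^+ n.-1)) = Z * U ^+ n.-1 * u i by [].
by field; rewrite expf_neq0.
Qed.

(** Hoelder with the exponents n + 1 and (n + 1) / n. Dividing [f] and [g] by the bounds of their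
    means reduces it to the pointwise inequality [amgm_exprS]. *)
Lemma holder_exprS (T : finType) (mu f g h : T -> R) n (A B Q : R) :
  \sum_t mu t = 1 ->
  (forall t, 0 <= mu t) -> (forall t, 0 <= f t) -> (forall t, 0 <= g t) ->
  (forall t, 0 <= h t) -> (forall t, h t ^+ n.+1 <= f t * g t ^+ n) ->
  0 < A -> 0 < B -> 0 <= Q ->
  \sum_t mu t * f t <= A -> \sum_t mu t * g t <= B -> A * B ^+ n <= Q ^+ n.+1 ->
  \sum_t mu t * h t <= Q.
Proof.
move=> mu1 mu0 f0 g0 h0 H A0 B0 Q0 fA gB ABQ.
have key t : h t <= Q * ((f t / A + n%:R * (g t / B)) / n.+1%:R).
  have x0 : 0 <= f t / A by rewrite divr_ge0// ltW.
  have y0 : 0 <= g t / B by rewrite divr_ge0// ltW.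
  rewrite -(ler_pXn2r (ltn0Sn n)) ?nnegrE//; last first.
    by rewrite mulr_ge0// divr_ge0// addr_ge0// mulr_ge0.
  apply: le_trans (H t) _; rewrite exprMn.
  have := amgm_exprS n x0 y0.
  move=> /(ler_wpM2l (exprn_ge0 n.+1 Q0)); apply: le_trans.
  have : 0 <= f t / A * (g t / B) ^+ n by rewrite mulr_ge0// exprn_ge0.
  move=> /ler_wpM2r/(_ _ _ ABQ); apply: le_trans.
  rewrite exprMn exprVn.
  suff -> : A * B ^+ n * (f t / A * (g t ^+ n / B ^+ n)) = f t * g t ^+ n by [].
  by field; rewrite expf_neq0 ?gt_eqF.
have : \sum_t mu t * h t <= \sum_t mu t * (Q * ((f t / A + n%:R * (g t / B)) / n.+1%:R)).
  by apply: ler_sum => t _; exact: ler_wpM2l.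
move=> /le_trans; apply.
have -> : \sum_t mu t * (Q * ((f t / A + n%:R * (g t / B)) / n.+1%:R)) =
   Q / n.+1%:R * ((\sum_t mu t * f t) / A + n%:R * ((\sum_t mu t * g t) / B)).
  rewrite !mulr_suml mulr_sumr -big_split mulr_sumr; apply: eq_bigr => t _ /=; ring.
have a1 : (\sum_t mu t * f t) / A <= 1 by rewrite ler_pdivrMr// mul1r.
have b1 : (\sum_t mu t * g t) / B <= 1 by rewrite ler_pdivrMr// mul1r.
have n0 : (0 : R) <= n%:R by [].
rewrite mulrAC ler_pdivrMr// -[in leRHS]natr1; apply: ler_wpM2l => //.
nra.
Qed.

End PowerInequalities.

(** * Squared moduli of exponential sums in real form *)

Section ExponentialSums.
Variable R : realType.

Lemma cosDz (x : R) (z : int) : cos (x + z%:~R * (2 * pi)) = cos x.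
Proof.
have h (n : nat) y : cos (y + n%:R * (2 * pi)) = cos y :> R.
  by rewrite !mulr_natl; exact: (periodicn (@cosD2pi R)).
case: z => n; first exact: h.
by rewrite NegzE mulrNz mulNr -(h n.+1 (x - _)) subrK.
Qed.

Lemma sinDz (x : R) (z : int) : sin (x + z%:~R * (2 * pi)) = sin x.
Proof.
have h (n : nat) y : sin (y + n%:R * (2 * pi)) = sin y :> R.
  by rewrite !mulr_natl; exact: (periodicn (@sinD2pi R)).
case: z => n; first exact: h.
by rewrite NegzE mulrNz mulNr -(h n.+1 (x - _)) subrK.
Qed.

(* |sum_(x in s) e^(i h(x))|^2. Only even moments are needed, so all exponential sums stay real. *)
Definition nrm2 (I : Type) (s : seq I) (h : I -> R) : R :=
  (\sum_(x <- s) cos (h x)) ^+ 2 + (\sum_(x <- s) sin (h x)) ^+ 2.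

Lemma nrm2_ge0 (I : Type) (s : seq I) (h : I -> R) : 0 <= nrm2 s h.
Proof. by rewrite addr_ge0// sqr_ge0. Qed.

Lemma nrm2_le_size (I : Type) (s : seq I) (h : I -> R) : nrm2 s h <= (size s)%:R ^+ 2.
Proof.
rewrite /nrm2 expr2; apply: le_trans (lerD (sqr_sum_le _ _ _) (sqr_sum_le _ _ _)) _.
rewrite -mulrDr -big_split /= ler_wpM2l//.
under eq_bigr => i _ do rewrite cos2Dsin2.
by rewrite big_const_seq count_predT iter_addr_0 -mulr_natr mul1r.
Qed.

Lemma nrm2_map (I J : Type) (g : J -> I) (s : seq J) (h : I -> R) :
  nrm2 (map g s) h = nrm2 s (h \o g).
Proof. by rewrite /nrm2 !big_map. Qed.

(** A common phase [d] multiplies the sum by a complex number of modulus one, and multiples of 2 pi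
    are invisible. Changes of variable and shifts of frequency pass through this invariance. *)
Lemma nrm2_eqmod (I : eqType) (s : seq I) (h h' : I -> R) (d : R) :
  {in s, forall x, exists z : int, h x = h' x + d + z%:~R * (2 * pi)} ->
  nrm2 s h = nrm2 s h'.
Proof.
move=> H; rewrite /nrm2.
have -> : \sum_(x <- s) cos (h x) =
    cos d * (\sum_(x <- s) cos (h' x)) - sin d * (\sum_(x <- s) sin (h' x)).
  rewrite !mulr_sumr -sumrB; apply: eq_big_seq => x /H [z ->].
  by rewrite cosDz cosD; ring.
have -> : \sum_(x <- s) sin (h x) =
    cos d * (\sum_(x <- s) sin (h' x)) + sin d * (\sum_(x <- s) cos (h' x)).
  rewrite !mulr_sumr -big_split; apply: eq_big_seq => x /H [z ->] /=.
  by rewrite sinDz sinD; ring.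
set C := \sum_(_ <- _) _; set S := \sum_(_ <- _) _.
have h1 := cos2Dsin2 d.
have -> : (cos d * C - sin d * S) ^+ 2 + (cos d * S + sin d * C) ^+ 2
   = ((cos d)^+2 + (sin d) ^+2) * (C ^+ 2 + S ^+ 2) by ring.
by rewrite h1 mul1r.
Qed.

Lemma eq_nrm2 (I : eqType) (s : seq I) (h h' : I -> R) :
  {in s, h =1 h'} -> nrm2 s h = nrm2 s h'.
Proof.
by move=> H; apply: (@nrm2_eqmod _ _ _ _ 0) => x /H ->; exists 0; rewrite mul0r !addr0.
Qed.

Lemma sum_classes (I : eqType) (s : seq I) (kap : I -> nat) (M : nat) (P : pred nat)
    (g : I -> R) :
  {in s, forall x, (kap x < M)%N && P (kap x)} ->
  \sum_(x <- s) g x = \sum_(xi < M | P xi) \sum_(x <- [seq x <- s | kap x == xi]) g x.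
Proof.
move=> H; under [RHS]eq_bigr => xi _ do rewrite big_filter big_mkcond.
rewrite exchange_big /=; apply: eq_big_seq => x /H /andP [hM hP].
by rewrite (bigD1 (Ordinal hM))//= eqxx big1 ?addr0// => i /andP[_ ni];
   case: eqP => // e; case/eqP: ni; apply: val_inj; rewrite /= e.
Qed.

(** Cauchy-Schwarz over the classes, with the number [M] of all labels as the factor. *)
Lemma nrm2_classes (I : eqType) (s : seq I) (kap : I -> nat) (M : nat) (P : pred nat)
    (h : I -> R) :
  {in s, forall x, (kap x < M)%N && P (kap x)} ->
  nrm2 s h <= M%:R * \sum_(xi < M | P xi) nrm2 [seq x <- s | kap x == xi] h.
Proof.
move=> H; rewrite /nrm2 2!(sum_classes _ H) big_split mulrDr /=.
have e : M = size (index_enum (fintype_ordinal__canonical__fintype_Finite M)).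
  by rewrite /index_enum unlock /= -enumT size_enum_ord.
by apply: lerD; rewrite [X in X%:R * _]e; exact: sqr_sum_le.
Qed.

(** The point is the factor 1 + t in front of the main part: in the recursion for the decoupling
    constant it is raised to a fixed power at every scale, so it must be arbitrarily close to
    one. *)
Lemma nrm2_split (I : Type) (s : seq I) (P : pred I) (h : I -> R) (t : R) : 0 < t ->
  nrm2 s h <= (1 + t) * nrm2 [seq x <- s | P x] h
            + (1 + t^-1) * nrm2 [seq x <- s | ~~ P x] h.
Proof.
move=> t0; rewrite /nrm2 !big_filter.
rewrite [X in X ^+ 2 + _ <= _](bigID P) [X in _ + X ^+ 2 <= _](bigID P) /=.
have key a b : (a + b) ^+ 2 <= (1 + t) * a ^+ 2 + (1 + t^-1) * b ^+ 2.
  rewrite -subr_ge0.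
  have -> : (1 + t) * a ^+ 2 + (1 + t^-1) * b ^+ 2 - (a + b) ^+ 2 = t^-1 * (t * a - b) ^+ 2.
    by field; rewrite gt_eqF.
  by rewrite mulr_ge0 ?sqr_ge0// invr_ge0 ltW.
set a := \sum_(i <- s | P i) cos _; set b := \sum_(i <- s | ~~ P i) cos _.
set c := \sum_(i <- s | P i) sin _; set d := \sum_(i <- s | ~~ P i) sin _.
have := key a b; have := key c d; lra.
Qed.

Lemma nrm2_prod (I J : Type) (s : seq I) (t : seq J) (h : I -> R) (h' : J -> R) :
  nrm2 [seq (x, y) | x <- s, y <- t] (fun z => h z.1 + h' z.2) = nrm2 s h * nrm2 t h'.
Proof.
rewrite /nrm2 !big_allpairs.
have -> : \sum_(x <- s) \sum_(y <- t) cos (h x + h' y) =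
   (\sum_(x <- s) cos (h x)) * (\sum_(y <- t) cos (h' y)) -
   (\sum_(x <- s) sin (h x)) * (\sum_(y <- t) sin (h' y)).
  rewrite !mulr_suml -sumrB; apply: eq_bigr => x _.
  by rewrite !mulr_sumr -sumrB; apply: eq_bigr => y _; rewrite cosD.
have -> : \sum_(x <- s) \sum_(y <- t) sin (h x + h' y) =
   (\sum_(x <- s) sin (h x)) * (\sum_(y <- t) cos (h' y)) +
   (\sum_(x <- s) cos (h x)) * (\sum_(y <- t) sin (h' y)).
  rewrite !mulr_suml -big_split; apply: eq_bigr => x _.
  by rewrite !mulr_sumr -big_split; apply: eq_bigr => y _ /=; rewrite sinD.
ring.
Qed.

(** The real part of e^(id) |S|^2, opened as a double sum. With [d] zero it expands a squared
    modulus; a general [d] inserts an inhomogeneous right-hand side. *)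
Lemma nrm2_pair_sum (I : Type) (s : seq I) (h : I -> R) (d : R) :
  \sum_(x <- s) \sum_(y <- s) cos (h x - h y + d) = nrm2 s h * cos d.
Proof.
have -> : \sum_(x <- s) \sum_(y <- s) cos (h x - h y + d) =
  cos d * ((\sum_(x <- s) cos (h x)) * (\sum_(y <- s) cos (h y)) +
           (\sum_(x <- s) sin (h x)) * (\sum_(y <- s) sin (h y)))
  - sin d * ((\sum_(x <- s) sin (h x)) * (\sum_(y <- s) cos (h y)) -
           (\sum_(x <- s) cos (h x)) * (\sum_(y <- s) sin (h y))).
  rewrite !mulr_suml -sumrB -big_split !mulr_sumr -sumrB; apply: eq_bigr => x _ /=.
  rewrite !mulr_sumr -sumrB -big_split !mulr_sumr -sumrB; apply: eq_bigr => y _ /=.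
  by rewrite cosD cosB sinB; ring.
by rewrite /nrm2; ring.
Qed.

(** The Dirichlet kernel, written without division so that it also holds where sin (d / 2)
    vanishes. *)
Lemma nrm2_geometric (H : nat) (d : R) :
  sin (d / 2) ^+ 2 * nrm2 (iota 0 H) (fun u => u%:R * d) = sin (H%:R * d / 2) ^+ 2.
Proof.
have hc : 2 * sin (d / 2) * \sum_(u <- iota 0 H) cos (u%:R * d) =
    sin (H%:R * d - d / 2) + sin (d / 2).
  elim: H => [|H IH]; first by rewrite big_nil mul0r sub0r sinN; ring.
  rewrite -[in iota _ _]addn1 iotaD big_cat big_seq1 mulrDr IH add0n -[H.+1%:R]natr1.
  have -> : (H%:R + 1) * d - d / 2 = H%:R * d + d / 2 by field.
  by rewrite sinB sinD; ring.
have hs : 2 * sin (d / 2) * \sum_(u <- iota 0 H) sin (u%:R * d) =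
    cos (d / 2) - cos (H%:R * d - d / 2).
  elim: H {hc} => [|H IH]; first by rewrite big_nil mul0r sub0r cosN; ring.
  rewrite -[in iota _ _]addn1 iotaD big_cat big_seq1 mulrDr IH add0n -[H.+1%:R]natr1.
  have -> : (H%:R + 1) * d - d / 2 = H%:R * d + d / 2 by field.
  by rewrite cosB cosD; ring.
suff : (2 * sin (d / 2)) ^+ 2 * nrm2 (iota 0 H) (fun u => u%:R * d)
   = 2 ^+ 2 * sin (H%:R * d / 2) ^+ 2.
  move=> h; apply: (@mulfI _ (2 ^+ 2)); first by rewrite expf_neq0.
  by rewrite -h exprMn mulrA.
rewrite /nrm2 mulrDr -!exprMn hc hs.
have e : H%:R * d / 2 = (H%:R * d - d / 2 + d / 2) / 2 by rewrite subrK.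
rewrite [in RHS]e.
set A := H%:R * d - d / 2; set B := d / 2.
have c2 : cos (A + B) = 1 - 2 * sin ((A + B) / 2) ^+ 2.
  have {1}-> : A + B = (A + B) / 2 + (A + B) / 2 by field.
  rewrite cosD; have := cos2Dsin2 ((A + B) / 2); lra.
have := cos2Dsin2 A; have := cos2Dsin2 B; rewrite cosD in c2.
lra.
Qed.

End ExponentialSums.

(** * Finite frequency groups and averages over them *)

Notation vec l q := {ffun 'I_l -> 'I_(q.-1.+1)}.

Section Averages.
Variable R : realType.

Definition avg (T : finType) (G : T -> R) : R := (\sum_t G t) / #|T|%:R.

Lemma avg_ge0 (T : finType) (G : T -> R) : (forall t, 0 <= G t) -> 0 <= avg G.
Proof. by move=> G0; rewrite divr_ge0// sumr_ge0. Qed.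

Lemma ler_avg (T : finType) (G H : T -> R) :
  (forall t, G t <= H t) -> avg G <= avg H.
Proof. by move=> GH; rewrite ler_wpM2r ?invr_ge0// ler_sum. Qed.

Lemma eq_avg (T : finType) (G H : T -> R) : G =1 H -> avg G = avg H.
Proof. by move=> GH; rewrite /avg (eq_bigr _ (fun t _ => GH t)). Qed.

Lemma avgD (T : finType) (G H : T -> R) : avg (fun t => G t + H t) = avg G + avg H.
Proof. by rewrite /avg big_split mulrDl. Qed.

Lemma avg_sum (T : finType) (I : Type) (s : seq I) (P : pred I) (G : I -> T -> R) :
  avg (fun t => \sum_(i <- s | P i) G i t) = \sum_(i <- s | P i) avg (G i).
Proof. by rewrite /avg exchange_big /= mulr_suml. Qed.

Lemma avgZ (T : finType) (a : R) (G : T -> R) : avg (fun t => a * G t) = a * avg G.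
Proof. by rewrite /avg -mulr_sumr mulrA. Qed.

Lemma avgC (T U : finType) (G : T -> U -> R) :
  avg (fun t => avg (G t)) = avg (fun u => avg (G^~ u)).
Proof.
rewrite /avg -!mulr_suml exchange_big /= -!mulrA; congr (_ * _).
by rewrite mulrC.
Qed.

Lemma avg_weight (T : finType) (G : T -> R) : avg G = \sum_t #|T|%:R^-1 * G t.
Proof. by rewrite -mulr_sumr mulrC. Qed.

Lemma avg_cst (T : finType) (a : R) (t0 : T) : avg (fun _ : T => a) = a.
Proof.
rewrite /avg sumr_const -[a *+ _]mulr_natr mulfK// pnatr_eq0 -lt0n.
by apply/card_gt0P; exists t0.
Qed.

Lemma avg_translate (l q : nat) (G : vec l q -> R) (b : vec l q) :
  avg (fun c : vec l q => G (c + b)) = avg G.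
Proof. by rewrite /avg [in RHS](reindex_inj (addIr b)). Qed.

(** Averaging each value over a family of translates changes nothing. The family is arbitrary, and
    the inner average, at a fixed [c], is the one to which decoupling for another curve will be
    applied. *)
Lemma avg_translates (l q : nat) (U : finType) (u0 : U) (B : U -> vec l q)
    (G : vec l q -> R) :
  avg G = avg (fun c : vec l q => avg (fun u => G (c + B u))).
Proof.
rewrite (avgC (fun (c : vec l q) u => G (c + B u))).
transitivity (avg (fun _ : U => avg G)); first by rewrite (avg_cst _ u0).
by apply: eq_avg => u; rewrite (avg_translate G (B u)).
Qed.

Definition ang (q : nat) (v : int) : R := 2 * pi * v%:~R / q%:R.

Lemma angD q v w : ang q (v + w) = ang q v + ang q w.
Proof. by rewrite /ang intrD; ring. Qed.

Lemma ang_dvd q v : (0 < q)%N -> (q%:Z %| v)%Z -> exists z : int, ang q v = z%:~R * (2 * pi).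
Proof.
move=> q0 /dvdzP [z ->]; exists z; rewrite /ang intrM.
have q1 : q%:R != 0 :> R by rewrite pnatr_eq0 -lt0n.
by have -> : (q%:Z)%:~R = q%:R :> R; [|field].
Qed.

Lemma ang_eqmod q v w : (0 < q)%N -> (q%:Z %| v - w)%Z ->
  exists z : int, ang q v = ang q w + z%:~R * (2 * pi).
Proof.
by move=> q0 /(ang_dvd q0) [z h]; exists z; rewrite -h -angD addrC subrK.
Qed.

Lemma ang_scale q1 q2 v : (0 < q1)%N -> ang (q1 * q2) (q1%:Z * v) = ang q2 v.
Proof.
move=> q0; rewrite /ang intrM natrM invfM.
have q1n : q1%:R != 0 :> R by rewrite pnatr_eq0 -lt0n.
have -> : (q1%:Z)%:~R = q1%:R :> R by [].
have [->|q2n] := eqVneq (q2%:R : R) 0; first by rewrite invr0 !mulr0.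
by field; rewrite ?q1n ?q2n.
Qed.

End Averages.

(** * p-adic decoupling for the moment curve *)

Section Combinations.

Definition comb l (chi : 'I_l -> {poly int}) (c : 'I_l -> int) : {poly int} :=
  \sum_i c i *: chi i.

Definition vz l q (c : vec l q) : 'I_l -> int := fun i => (c i : nat)%:Z.

Definition red l q (B : 'I_l -> int) : vec l q := [ffun i => inord `|(B i %% q%:Z)%Z|].

Lemma redP l q (B : 'I_l -> int) (i : 'I_l) : (0 < q)%N ->
  (q%:Z %| vz (red q B) i - B i)%Z.
Proof.
move=> q0; rewrite /vz ffunE inordK; last first.
  have := ltz_mod (B i) (_ : q%:Z != 0); have := modz_ge0 (B i) (_ : q%:Z != 0); lia.
have := divz_eq (B i) q%:Z; have := modz_ge0 (B i) (_ : q%:Z != 0).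
move=> /(_ ltac:(lia)) h1 h2; apply/dvdzP; exists (- (B i %/ q%:Z)%Z); lia.
Qed.

Lemma vzD l q (c d : vec l q) (i : 'I_l) : (0 < q)%N ->
  (q%:Z %| vz (c + d) i - (vz c i + vz d i))%Z.
Proof.
move=> q0; rewrite /vz ffunE /=.
move: (nat_of_ord (c i)) (nat_of_ord (d i)) => a b; rewrite prednK//.
have h := divn_eq (a + b) q.
by apply/dvdzP; exists (- ((a + b) %/ q)%:Z); rewrite -[a%:Z + b]/((a + b)%N%:Z) {2}h; lia.
Qed.

Lemma comb_eqmod l (chi : 'I_l -> {poly int}) (c d : 'I_l -> int) (m x : int) :
  (forall i, (m %| c i - d i)%Z) -> (m %| (comb chi c).[x] - (comb chi d).[x])%Z.
Proof.
move=> H; rewrite /comb !horner_sum -sumrB.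
apply: (big_ind (fun z => (m %| z)%Z)) => [|? ?|i _]; first exact: dvdz0.
  exact: rpredD.
by rewrite !hornerZ -mulrBl dvdz_mulr.
Qed.

Lemma combD l (chi : 'I_l -> {poly int}) (c d : 'I_l -> int) :
  comb chi (fun i => c i + d i) = comb chi c + comb chi d.
Proof. by rewrite /comb -big_split; apply: eq_bigr => i _; rewrite scalerDl. Qed.

Lemma combZ l (chi : 'I_l -> {poly int}) (a : int) (c : 'I_l -> int) :
  comb chi (fun i => a * c i) = a *: comb chi c.
Proof. by rewrite /comb scaler_sumr; apply: eq_bigr => i _; rewrite scalerA. Qed.

Lemma comb_sum l m (chi : 'I_l -> {poly int}) (a : 'I_m -> int) (B : 'I_m -> 'I_l -> int) :
  comb chi (fun i => \sum_j a j * B j i) = \sum_j a j *: comb chi (B j).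
Proof.
rewrite /comb; under eq_bigr => i _ do rewrite scaler_suml.
rewrite exchange_big; apply: eq_bigr => j _ /=.
by rewrite scaler_sumr; apply: eq_bigr => i _; rewrite scalerA.
Qed.

Definition taylor (P : {poly int}) (xi : nat) : {poly int} := P \Po ('X + (xi%:Z)%:P).

Lemma taylor_horner P xi (u : int) : P.[xi%:Z + u] = (taylor P xi).[u].
Proof. by rewrite horner_comp hornerD hornerX hornerC addrC. Qed.

Lemma coef_taylor_comb l (chi : 'I_l -> {poly int}) (c : 'I_l -> int) xi j :
  (taylor (comb chi c) xi)`_j = \sum_i c i * (taylor (chi i) xi)`_j.
Proof.
rewrite /taylor /comb raddf_sum coef_sum; apply: eq_bigr => i _.
by rewrite /= comp_polyZ coefZ.
Qed.

End Combinations.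

(** * Dual vectors of a nondegenerate curve *)

Section DualVectors.
Variables (p : nat) (pp : prime p).

Definition redF (P : {poly int}) : {poly 'F_p} := map_poly (intr : int -> 'F_p) P.

Lemma dvdp_F (z : int) : (p%:Z %| z)%Z = (z%:~R == 0 :> 'F_p).
Proof. exact: (dvdz_pcharf (pchar_Fp pp)). Qed.

(* Nondegeneracy of the curve chi at xi: its Taylor coefficients of orders 1, ..., l at xi are
   linearly independent modulo p. *)
Definition inj_at l (chi : 'I_l -> {poly int}) (xi : nat) :=
  forall c : 'I_l -> 'F_p,
    (forall j : 'I_l, ((\sum_i c i *: redF (chi i)) \Po ('X + (xi%:R)%:P))`_j.+1 = 0) ->
    forall i, c i = 0.

Lemma redF_taylor P xi : redF (taylor P xi) = redF P \Po ('X + (xi%:R)%:P).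
Proof.
rewrite /redF /taylor map_comp_poly rmorphD /= map_polyX map_polyC /=.
by rewrite -[in LHS](natr_Zp ((xi%:Z)%:~R : 'F_p)) natr_Zp.
Qed.

(** Nondegeneracy says that the square matrix of Taylor coefficients modulo p has trivial left
    kernel, hence is invertible. *)
Lemma dual_mod_p l (chi : 'I_l -> {poly int}) xi (e : 'I_l -> int) : inj_at chi xi ->
  exists B : 'I_l -> int, forall j : 'I_l,
    (p%:Z %| (taylor (comb chi B) xi)`_j.+1 - e j)%Z.
Proof.
move=> inj.
pose A : 'M['F_p]_l := \matrix_(i, j) (redF (taylor (chi i) xi))`_j.+1.
have Au : A \in unitmx.
  rewrite -row_free_unit; apply: inj_row_free => v vA0; apply/rowP => i.
  rewrite mxE; apply: (inj (fun i => v 0 i)) => j.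
  move/rowP: vA0 => /(_ j); rewrite !mxE => h; rewrite -[RHS]h.
  rewrite raddf_sum coef_sum; apply: eq_bigr => i' _.
  by rewrite /= comp_polyZ coefZ mxE redF_taylor.
pose v : 'rV['F_p]_l := (\row_j (e j)%:~R) *m invmx A.
exists (fun i => ((v 0 i : nat))%:Z) => j.
rewrite dvdp_F rmorphB /= subr_eq0 coef_taylor_comb rmorph_sum /=; apply/eqP.
have -> : ((e j)%:~R : 'F_p) = (v *m A) 0 j by rewrite mulmxKV// mxE.
rewrite mxE; apply: eq_bigr => i _.
rewrite intrM [A i j]mxE /redF coef_map /=; congr (_ * _).
exact: natr_Zp.
Qed.

(** Hensel lifting: the error left modulo p^N is divided by p^N and corrected by a solution modulo
    p. *)
Lemma dual_vector l (chi : 'I_l -> {poly int}) xi (e : 'I_l -> int) N : inj_at chi xi ->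
  exists B : 'I_l -> int, forall j : 'I_l,
    ((p ^ N)%:Z %| (taylor (comb chi B) xi)`_j.+1 - e j)%Z.
Proof.
move=> inj; elim: N => [|N [B hB]].
  by exists (fun=> 0) => j; rewrite expn0 dvd1z.
pose e' j := (((e j - (taylor (comb chi B) xi)`_j.+1) %/ (p ^ N)%:Z))%Z.
have [B' hB'] := dual_mod_p e' inj.
exists (fun i => B i + (p ^ N)%:Z * B' i) => j.
rewrite combD combZ /taylor comp_polyD comp_polyZ coefD coefZ -!/(taylor _ _).
have /dvdzP [z hz] := hB' j.
have he : e' j * (p ^ N)%:Z = e j - (taylor (comb chi B) xi)`_j.+1.
  by rewrite divzK// -opprB rpredN.
apply/dvdzP; exists z; rewrite expnS PoszM.
have -> : (taylor (comb chi B) xi)`_j.+1 = e j - e' j * (p ^ N)%:Z by rewrite he; ring.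
have -> : (taylor (comb chi B') xi)`_j.+1 = z * p%:Z + e' j by rewrite -hz subrK.
ring.
Qed.

End DualVectors.

Definition tri l := (l * l.+1)./2.

Arguments tri : simpl never.

Lemma tri2 l : (tri l * 2 = l * l.+1)%N.
Proof. by rewrite muln2 /tri -[RHS]odd_double_half oddM oddS andbN. Qed.

Lemma tri_gt0 l : (0 < l)%N -> (0 < tri l)%N.
Proof. by move=> l0; have := tri2 l; case: (tri l) => //; lia. Qed.

Lemma modn_class m xi z : (xi < m)%N -> ((xi + m * z) %% m = xi)%N.
Proof. by move=> h; rewrite addnC mulnC modnMDl modn_small. Qed.

Lemma divn_class m xi z : (xi < m)%N -> ((xi + m * z) %/ m = z)%N.
Proof. by move=> h; rewrite addnC mulnC divnMDl ?divn_small ?addn0//; lia. Qed.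

Lemma classE m xi x : (x %% m = xi)%N -> (xi + m * (x %/ m) = x)%N.
Proof. by move=> <-; rewrite [in RHS](divn_eq x m) addnC mulnC. Qed.

Section Decoupling.
Variables (R : realType) (p : nat) (pp : prime p).
Implicit Types (S : seq nat) (rho w : nat -> R).

Let p_gt0 : (0 < p)%N. Proof. exact: prime_gt0. Qed.
Let pX_gt0 a : (0 < p ^ a)%N. Proof. by rewrite expn_gt0 p_gt0. Qed.

(* Curves congruent modulo p to the moment curve (x, x^2, ..., x^k). This class is stable under
   the affine rescalings of the induction on scales. *)
Definition cls k (phi : 'I_k -> {poly int}) :=
  forall (j : 'I_k) i, (p%:Z %| (phi j)`_i - (i == j.+1)%:Z)%Z.

Definition fr (a xi : nat) S := [seq x <- S | (x %% p ^ a == xi)%N].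

(* The frequency c/p^N ranges over a finite group, so that averages over c replace the integrals of
   decoupling theory. The phase rho plays the role of arbitrary unimodular coefficients. *)
Definition FS l N (chi : 'I_l -> {poly int}) rho S (c : vec l (p ^ N)) : R :=
  nrm2 S (fun x => rho x + ang R (p ^ N) (comb chi (vz c)).[x%:Z]).

(* Decoupling into residue classes modulo p^n at the critical exponent k(k+1) = 2 tri k. The number
   w z stands for the square of the L^(2 tri k) norm of the piece at z. *)
Definition Dec k n (K : R) := forall N (phi : 'I_k -> {poly int}) S rho w,
  (k * n <= N)%N -> cls phi -> (forall z, 0 <= w z) ->
  (forall z, (z < p ^ n)%N ->
    avg (fun c => FS (N := N) phi rho (fr n z S) c ^+ tri k) <= w z ^+ tri k) ->
  avg (fun c => FS (N := N) phi rho S c ^+ tri k) <= K * (\sum_(z < p ^ n) w z) ^+ tri k.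

(** Restricted to one class modulo p^a, the sum of weights that decoupling puts on its right-hand
    side. *)
Definition WS n a xi w := \sum_(z < p ^ n | (z %% p ^ a == xi)%N) w z.

Lemma FS_ge0 l N (chi : 'I_l -> {poly int}) rho S (c : vec l (p ^ N)) : 0 <= FS chi rho S c.
Proof. exact: nrm2_ge0. Qed.

(** A shift of the frequency is absorbed into the phase [rho]. This is why decoupling is stated for
    arbitrary [rho]. *)
Lemma FS_shift l N (chi : 'I_l -> {poly int}) rho S (c : vec l (p ^ N)) (B : 'I_l -> int) :
  FS chi rho S (c + red (p ^ N) B) =
  FS chi (fun x => rho x + ang R (p ^ N) (comb chi B).[x%:Z]) S c.
Proof.
apply: (@nrm2_eqmod _ _ _ _ _ 0) => x _.
have H i : ((p ^ N)%:Z %| vz (c + red (p ^ N) B : vec l (p ^ N)) i - (vz c i + B i))%Z.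
  have h1 := vzD c (red (p ^ N) B) i (pX_gt0 N).
  have h2 := redP B i (pX_gt0 N).
  have -> : vz (c + red (p ^ N) B : vec l (p ^ N)) i - (vz c i + B i) =
    (vz (c + red (p ^ N) B : vec l (p ^ N)) i - (vz c i + vz (red (p ^ N) B) i)) +
    (vz (red (p ^ N) B) i - B i) by ring.
  by rewrite rpredD.
have [z hz] := ang_eqmod R (pX_gt0 N) (comb_eqmod chi (x%:Z) H).
by exists z; rewrite hz combD hornerD angD; ring.
Qed.

Lemma WS_sub n a xi w : (a <= n)%N -> (xi < p ^ a)%N ->
  \sum_(z < p ^ (n - a)) w (xi + p ^ a * z)%N = WS n a xi w.
Proof.
move=> an hxi; rewrite /WS.
have e : (p ^ n = p ^ a * p ^ (n - a))%N by rewrite -expnD subnKC.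
have hl (z : 'I_(p ^ (n - a))) : (xi + p ^ a * z < p ^ n)%N.
  rewrite e; apply: leq_trans (_ : p ^ a * z.+1 <= _)%N; first by rewrite mulnS ltn_add2r.
  by rewrite leq_mul2l ltn_ord orbT.
have hd (z : 'I_(p ^ n)) : (z %/ p ^ a < p ^ (n - a))%N.
  by rewrite ltn_divLR// mulnC -e.
rewrite (reindex_onto (fun z => Ordinal (hl z)) (fun z => Ordinal (hd z))) /=; last first.
  by move=> z /eqP hz; apply: val_inj => /=; rewrite classE.
apply: eq_bigl => z /=; rewrite modn_class// eqxx /=.
by apply/esym/eqP/val_inj; rewrite /= divn_class.
Qed.

Lemma WS_split n a b xi w : (a <= b <= n)%N ->
  \sum_(z < p ^ b | (z %% p ^ a == xi)%N) WS n b z w = WS n a xi w.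
Proof.
move=> /andP[ab bn]; rewrite /WS.
pose f (z : 'I_(p ^ n)) : 'I_(p ^ b) := Ordinal (ltn_pmod z (pX_gt0 b)).
rewrite [RHS](partition_big f (fun z => (z %% p ^ a == xi)%N)) /=; last first.
  by move=> i h; rewrite modn_dvdm// dvdn_exp2l.
apply: eq_bigr => z /eqP hz; apply: eq_bigl => i.
apply/eqP/andP => [h|[_ /eqP <-]//].
split; last by apply/eqP/val_inj.
by rewrite -hz -h modn_dvdm// dvdn_exp2l.
Qed.

Lemma WS_ge0 n a xi w : (forall z, 0 <= w z) -> 0 <= WS n a xi w.
Proof. by move=> w0; apply: sumr_ge0. Qed.

(** On x = xi + p^a u the combination dual to the Taylor coefficient of order j + 1 becomes, up to a
    constant, p^(a (j + 1)) times a polynomial congruent to u^(j + 1) modulo p: the other orders up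
    to l vanish to the given precision, and the higher ones carry further factors p. So a piece of
    the curve is again a curve of [cls]. *)
Lemma rescale_curve l (chi : 'I_l -> {poly int}) xi a N : (0 < a)%N -> inj_at p chi xi ->
  exists2 phi : 'I_l -> {poly int}, cls phi &
  exists2 B : vec l (p ^ N) -> 'I_l -> int, True &
  forall tau, exists d : int, forall u : int,
    ((p ^ (N + a * l))%:Z %| (comb chi (B tau)).[xi%:Z + (p ^ a)%:Z * u] -
        (d + (p ^ (a * l))%:Z * (comb phi (vz tau)).[u]))%Z.
Proof.
move=> a0 inj.
have /choice [B hB] : forall j : 'I_l, exists B : 'I_l -> int, forall i : 'I_l,
    ((p ^ (N + a * l))%:Z %| (taylor (comb chi B) xi)`_i.+1 - (i == j)%:Z)%Z.
  by move=> j; exact: (dual_vector pp (fun i => (i == j)%:Z)).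
pose T j := taylor (comb chi (B j)) xi.
(* Degrees up to l are set to their exact dual values. Beyond l the Taylor coefficient is scaled by
   p^(a (i - j - 1)), a multiple of p because a > 0. *)
pose co (j : 'I_l) (i : nat) : int :=
  if i == j.+1 then 1 else if (i <= l)%N then 0 else (p ^ (a * (i - j.+1)))%:Z * (T j)`_i.
pose phi j := \poly_(i < size (T j) + l.+2) co j i.
have sz (j : 'I_l) i : (size (T j) + l.+2 <= i)%N -> co j i = 0.
  move=> h; rewrite /co; have hj := ltn_ord j.
  case: eqP => [|_]; first lia.
  case: ifP => [|_]; first lia.
  by rewrite nth_default ?mulr0// (leq_trans _ h)// leq_addr.
have cphi : cls phi.
  move=> j i; rewrite coef_poly.
  have -> : (if (i < size (T j) + l.+2)%N then co j i else 0) = co j i.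
    by case: ltnP => // /sz ->.
  rewrite /co; case: eqP => [_|ne]; first by rewrite subrr dvdz0.
  rewrite subr0; case: leqP => [_|h]; first by rewrite dvdz0.
  apply: dvdz_mulr; have hj := ltn_ord j.
  have -> : (a * (i - j.+1) = (a * (i - j.+1)).-1.+1)%N.
    by rewrite prednK// muln_gt0 a0; lia.
  by rewrite expnS PoszM dvdz_mulr.
have val j (u : int) : ((p ^ (N + a * l))%:Z %| (comb chi (B j)).[xi%:Z + (p ^ a)%:Z * u] -
    ((T j)`_0 + (p ^ (a * j.+1))%:Z * (phi j).[u]))%Z.
  rewrite taylor_horner -/(T j) (@horner_coef_wide _ (size (T j) + l.+2)) ?leq_addr//.
  rewrite horner_poly mulr_sumr.
  have -> : (T j)`_0 = \sum_(i < size (T j) + l.+2) (i == 0%N :> nat)%:Z * (T j)`_0.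
    rewrite addnS big_ord_recl /= mul1r big1 ?addr0// => i _.
    by rewrite mul0r.
  rewrite -big_split -sumrB /=.
  apply: (big_ind (fun z => (_ %| z)%Z)) => [|? ?|i _]; [exact: dvdz0|exact: rpredD|].
  rewrite exprMn.
  have [i0|i0] := posnP i.
    by rewrite i0 /co /= !expr0 !mulr1 mul1r mulr0 addr0 subrr dvdz0.
  rewrite mul0r add0r.
  have pe m n : ((p ^ m)%:Z) ^+ n = (p ^ (m * n))%:Z.
    by rewrite expnM; elim: n => [|n IH]; rewrite ?expr0 ?expn0// exprS IH expnS PoszM.
  have main : ((p ^ (N + a * l))%:Z %| (T j)`_i * (p ^ (a * i))%:Z - (p ^ (a * j.+1))%:Z * co j i)%Z.
    have [il|il] := leqP i l.
      have hi : (i.-1 < l)%N by lia.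
      have := hB j (Ordinal hi); rewrite /= prednK// -/(T j) => h.
      have -> : (p ^ (a * j.+1))%:Z * co j i = (p ^ (a * i))%:Z * (Ordinal hi == j)%:Z.
        rewrite /co il; have -> : (Ordinal hi == j) = (i == j.+1 :> nat).
          by rewrite -val_eqE /=; lia.
        by case: eqP => [->//|_]; rewrite !mulr0.
      rewrite [X in X - _]mulrC -mulrBr; exact: dvdz_mull.
    have ij : (j.+1 < i)%N by have := ltn_ord j; lia.
    rewrite /co (gtn_eqF ij).
    rewrite leqNgt il /= mulrA -PoszM -expnD -mulnDr subnKC ?(ltnW ij)//.
    by rewrite [X in X - _]mulrC subrr dvdz0.
  have -> : (T j)`_i * ((p ^ a)%:Z ^+ i * u ^+ i) - (p ^ (a * j.+1))%:Z * (co j i * u ^+ i) =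
    ((T j)`_i * (p ^ (a * i))%:Z - (p ^ (a * j.+1))%:Z * co j i) * u ^+ i.
    by rewrite pe; ring.
  exact: dvdz_mulr.
exists phi => //.
(* The weights p^(a (l - j - 1)) bring all coordinates to the common factor p^(a l). *)
exists (fun tau i => \sum_j (vz tau j * (p ^ (a * (l - j.+1)))%:Z) * B j i) => // tau.
exists (\sum_j (vz tau j * (p ^ (a * (l - j.+1)))%:Z) * (T j)`_0) => u.
rewrite comb_sum /comb !horner_sum mulr_sumr -big_split -sumrB /=.
apply: (big_ind (fun z => (_ %| z)%Z)) => [|? ?|j _]; [exact: dvdz0|exact: rpredD|].
rewrite !hornerZ.
have e : (p ^ (a * l))%:Z = (p ^ (a * (l - j.+1)))%:Z * (p ^ (a * j.+1))%:Z.
  by rewrite -PoszM -expnD -mulnDr subnK.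
rewrite e.
set X := (comb chi (B j)).[_].
have -> : vz tau j * (p ^ (a * (l - j.+1)))%:Z * X -
   (vz tau j * (p ^ (a * (l - j.+1)))%:Z * (T j)`_0 +
    (p ^ (a * (l - j.+1)))%:Z * (p ^ (a * j.+1))%:Z * (vz tau j * (phi j).[u])) =
  vz tau j * (p ^ (a * (l - j.+1)))%:Z * (X - ((T j)`_0 + (p ^ (a * j.+1))%:Z * (phi j).[u])).
  ring.
by apply: dvdz_mull; exact: val.
Qed.

(** For a fixed [c] the frequencies [c + B tau] see the residue class as a full interval on the
    rescaled curve, so decoupling over b - a scales applies in [tau]. Minkowski then averages the
    result over [c]. *)
Lemma rescale l (chi : 'I_l -> {poly int}) xi a b K N S rho w :
  (0 < l)%N -> (0 < a <= b)%N -> (xi < p ^ a)%N -> inj_at p chi xi ->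
  Dec l (b - a) K -> 0 <= K -> (l * b <= N)%N ->
  {in S, forall x, (x %% p ^ a)%N = xi} -> (forall z, 0 <= w z) ->
  (forall z, (z < p ^ b)%N ->
    avg (fun c => FS (N := N) chi rho (fr b z S) c ^+ tri l) <= w z ^+ tri l) ->
  avg (fun c => FS (N := N) chi rho S c ^+ tri l) <= K * WS b a xi w ^+ tri l.
Proof.
move=> l0 /andP[a0 ab] hxi inj D K0 lbN hS w0 hw.
have lN : (a * l <= N)%N by apply: leq_trans lbN; rewrite mulnC leq_mul2l ab orbT.
have [N' NE] : exists N', N = (N' + a * l)%N by exists (N - a * l)%N; rewrite subnK.
subst N.
have [phi cphi [B _ hB]] := rescale_curve N' a0 inj.
pose f x := (x %/ p ^ a)%N.
pose rho' (c : vec l (p ^ (N' + a * l))) (u : nat) : R :=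
  rho (xi + p ^ a * u)%N + ang R (p ^ (N' + a * l)) (comb chi (vz c)).[(xi + p ^ a * u)%:Z].
have key S0 c tau : {in S0, forall x, (x %% p ^ a)%N = xi} ->
    FS chi rho S0 (c + red _ (B tau)) = FS phi (rho' c) (map f S0) tau.
  move=> hS0; rewrite FS_shift /FS nrm2_map.
  have [d hd] := hB tau.
  apply: (@nrm2_eqmod _ _ _ _ _ (ang R (p ^ (N' + a * l)) d)) => x xS.
  rewrite /rho' /= /f (classE (hS0 x xS)).
  have := hd (x %/ p ^ a)%N%:Z.
  rewrite -PoszM -PoszD (classE (hS0 x xS)) => /(ang_eqmod R (pX_gt0 _)) [z ->].
  exists z; rewrite angD.
  have -> v : ang R (p ^ (N' + a * l)) ((p ^ (a * l))%:Z * v) = ang R (p ^ N') v.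
    by rewrite addnC expnD ang_scale.
  ring.
have frmap S0 z : {in S0, forall x, (x %% p ^ a)%N = xi} ->
    fr (b - a) z (map f S0) = map f (fr b (xi + p ^ a * z) S0).
  move=> hS0; rewrite /fr filter_map; congr (map _ _); apply: eq_in_filter => x xS /=.
  have hx := hS0 _ xS; rewrite -{2}(classE hx).
  have e : (p ^ b = p ^ a * p ^ (b - a))%N by rewrite -expnD subnKC.
  rewrite /f; set u := (x %/ p ^ a)%N.
  have -> : ((xi + p ^ a * u) %% p ^ b = xi + p ^ a * (u %% p ^ (b - a)))%N.
    rewrite {1}(divn_eq u (p ^ (b - a))) mulnDr addnCA.
    have -> : (p ^ a * (u %/ p ^ (b - a) * p ^ (b - a)) = u %/ p ^ (b - a) * p ^ b)%N.
      by rewrite e; ring.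
    rewrite modnMDl modn_small// e.
    have := ltn_pmod u (pX_gt0 (b - a)); move: hxi; move: (pX_gt0 a); nia.
  by rewrite eqn_add2l eqn_pmul2l.
have t0 : (0 < tri l)%N by exact: tri_gt0.
have avg0 (T : finType) (G : T -> R) : (forall t, 0 <= G t) -> 0 <= avg (fun t => G t ^+ tri l).
  by move=> G0; apply: avg_ge0 => t; exact: exprn_ge0.
(* For each [c] the weights of the inner decoupling are the exact norms of its pieces in [tau], so
   that its hypothesis holds with equality. *)
have hvex : forall cz : (vec l (p ^ (N' + a * l)) * nat)%type, exists v : R, 0 <= v /\ v ^+ tri l =
   avg (fun tau : vec l (p ^ N') => FS phi (rho' cz.1) (fr (b - a) cz.2 (map f S)) tau ^+ tri l).
  move=> [c z].
  have [|v v0 hv] := @root_exists R (tri l) (avg (fun tau : vec l (p ^ N') =>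
      FS phi (rho' c) (fr (b - a) z (map f S)) tau ^+ tri l)) t0.
    by apply: avg0 => tau; exact: FS_ge0.
  by exists v.
have [v hv] := choice hvex.
rewrite (@avg_translates _ _ _ _ (0 : vec l (p ^ N')) (fun tau => red _ (B tau))).
apply: le_trans (_ : avg (fun c => K * (\sum_(z < p ^ (b - a)) v (c, z : nat)) ^+ tri l) <= _).
  apply: ler_avg => c.
  rewrite (eq_avg (fun tau => congr1 (fun y => y ^+ tri l) (key S c tau hS))).
  apply: (D N' phi (map f S) (rho' c) (fun z => v (c, z))) => //.
  - by rewrite mulnBr; move: lbN; rewrite [(a * l)%N]mulnC; lia.
  - by move=> z; have [] := hv (c, z).
  - by move=> z _; have [_ ->] := hv (c, z).
rewrite avgZ ler_wpM2l// -(WS_sub _ ab hxi) avg_weight.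
rewrite -[leRHS]mul1r.
apply: (@weighted_minkowski R _ _ predT) => //.
- by move=> z c; have [] := hv (c, z : nat).
move=> z _; rewrite mul1r -avg_weight.
have hz : (xi + p ^ a * z < p ^ b)%N.
  have -> : (p ^ b = p ^ a * p ^ (b - a))%N by rewrite -expnD subnKC.
  by have := ltn_ord z; move: hxi; move: (pX_gt0 a); nia.
apply: le_trans (hw _ hz).
rewrite [leRHS](@avg_translates _ _ _ _ (0 : vec l (p ^ N')) (fun tau => red _ (B tau))).
rewrite le_eqVlt; apply/orP; left; apply/eqP.
apply: eq_avg => c; have [_ ->] := hv (c, z : nat).
apply: eq_avg => tau; congr (_ ^+ _); rewrite frmap// key// => x.
by rewrite mem_filter => /andP[_ /hS].
Qed.

End Decoupling.

(** Exponents of the interpolation in [Bil_holder]: the pair (tri l, tri k - tri l) is the mean,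
    with weights 1 and k - l, of the pairs belonging to the swapped level k - l and to the level l -
    1. *)
Lemma tri_exponents k l : (0 < l < k)%N ->
  (tri l * (k - l).+1 = (tri k - tri (k - l)) + tri l.-1 * (k - l))%N /\
  ((tri k - tri l) * (k - l).+1 = tri (k - l) + (tri k - tri l.-1) * (k - l))%N.
Proof.
move=> /andP[l0 lk].
have [m E] : exists m, k = (l + m)%N by exists (k - l)%N; lia.
have [l' E'] : exists l', l = l'.+1 by exists l.-1; lia.
subst k l; rewrite addKn /=.
have H1 : (tri l'.+1 * m.+1 * 2 + tri m * 2 = tri (l'.+1 + m) * 2 + tri l' * 2 * m)%N.
  by rewrite mulnAC !tri2; ring.
have H2 : (tri l'.+1 = tri l' + l'.+1)%N.
  by have := tri2 l'.+1; have := tri2 l'; lia.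
have : (tri l'.+1 <= tri (l'.+1 + m))%N.
  by rewrite half_leq// leq_mul// ltnS leq_addr.
have : (tri m <= tri (l'.+1 + m))%N.
  by rewrite half_leq// leq_mul ?ltnS ?leq_addl.
move: (tri l'.+1) (tri l') (tri m) (tri (l'.+1 + m)) H1 H2 => a b c d H1 H2 cd ad.
have H3 : ((d - a) * m.+1 + a * m.+1 = d * m.+1)%N by rewrite -mulnDl subnK.
have H4 : ((d - b) * m + b * m = d * m)%N by rewrite -mulnDl subnK//; lia.
rewrite !mulnS in H1 H3 *; split; lia.
Qed.

(** * The bilinear form and its interpolation *)

Section Bilinear.
Variables (R : realType) (p : nat) (pp : prime p).
Implicit Types (S : seq nat) (rho w : nat -> R).

Let p_gt0 : (0 < p)%N. Proof. exact: prime_gt0. Qed.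
Let pX_gt0 a : (0 < p ^ a)%N. Proof. by rewrite expn_gt0 p_gt0. Qed.

(* The bilinear form of Dec, for two residue classes that are distinct modulo p. *)
Definition Bil k l a b n (K : R) := forall N (phi : 'I_k -> {poly int}) S rho w xi eta,
  (k * n <= N)%N -> cls p phi -> (forall z, 0 <= w z) ->
  (forall z, (z < p ^ n)%N ->
    avg (fun c => FS (p := p) (N := N) phi rho (fr p n z S) c ^+ tri k) <= w z ^+ tri k) ->
  (xi < p ^ a)%N -> (eta < p ^ b)%N -> (xi %% p != eta %% p)%N ->
  avg (fun c => FS (p := p) (N := N) phi rho (fr p a xi S) c ^+ tri l *
                FS (p := p) (N := N) phi rho (fr p b eta S) c ^+ (tri k - tri l)) <=
  K * (WS p n a xi w ^+ tri l * WS p n b eta w ^+ (tri k - tri l)).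

Lemma fr_fr a b xi z S : (a <= b)%N -> (z %% p ^ a)%N = xi -> fr p b z (fr p a xi S) = fr p b z S.
Proof.
move=> ab hz; rewrite /fr -filter_predI; apply: eq_filter => x /=.
by case: eqP => // h; rewrite /= -(modn_dvdm x (dvdn_exp2l p ab)) h hz eqxx.
Qed.

Lemma fr_fr0 a b xi z S : (a <= b)%N -> (z %% p ^ a)%N != xi -> fr p b z (fr p a xi S) = [::].
Proof.
move=> ab hz; rewrite /fr -filter_predI (eq_filter (a2 := pred0)) ?filter_pred0// => x /=.
by case: eqP => // h; rewrite /= -(modn_dvdm x (dvdn_exp2l p ab)) h (negbTE hz).
Qed.

Lemma mem_fr a xi S x : x \in fr p a xi S -> (x %% p ^ a)%N = xi.
Proof. by rewrite mem_filter => /andP[/eqP]. Qed.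

Lemma FS_nil l N (chi : 'I_l -> {poly int}) rho (c : vec l (p ^ N)) : FS chi rho [::] c = 0.
Proof. by rewrite /FS /nrm2 !big_nil expr0n addr0. Qed.

Lemma FS_classes l N (chi : 'I_l -> {poly int}) rho a b xi S (c : vec l (p ^ N)) :
  (a <= b)%N ->
  FS chi rho (fr p a xi S) c <=
  (p ^ b)%:R * \sum_(z < p ^ b | (z %% p ^ a == xi)%N) FS chi rho (fr p b z S) c.
Proof.
move=> ab.
apply: le_trans (@nrm2_classes R _ _ (fun x => x %% p ^ b)%N (p ^ b)
   (fun z => z %% p ^ a == xi)%N _ _) _.
  move=> x /mem_fr hx; rewrite ltn_pmod//= modn_dvdm ?dvdn_exp2l// hx eqxx //.
rewrite ler_wpM2l// ler_sum// => z /eqP hz.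
by rewrite -[X in nrm2 X]/(fr p b z (fr p a xi S)) fr_fr.
Qed.

Section Fixed.
Variables (k n N : nat) (phi : 'I_k -> {poly int}) (S : seq nat) (rho w : nat -> R).
Hypotheses (k0 : (0 < k)%N) (w0 : forall z, 0 <= w z).
Hypothesis hw : forall z, (z < p ^ n)%N ->
  avg (fun c => FS (p := p) (N := N) phi rho (fr p n z S) c ^+ tri k) <= w z ^+ tri k.

(** Settles the degenerate weights, so that the arguments below may divide by the two sums of
    weights. *)
Lemma FS_zero a xi (c : vec k (p ^ N)) : (a <= n)%N -> WS p n a xi w = 0 ->
  FS phi rho (fr p a xi S) c = 0.
Proof.
move=> an W0; have t0 := tri_gt0 k0.
apply/eqP; rewrite eq_le FS_ge0 andbT.
apply: le_trans (FS_classes _ _ _ _ _ an) _.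
rewrite big1 ?mulr0// => z hz.
have wz : w z = 0.
  move/eqP: W0; rewrite psumr_eq0; last by move=> *; exact: w0.
  by move=> /allP/(_ z); rewrite mem_index_enum => /(_ isT); rewrite hz => /eqP.
have := hw (ltn_ord z); rewrite wz expr0n gtn_eqF//= => h.
have h0 (d : vec k (p ^ N)) : 0 <= FS phi rho (fr p n z S) d ^+ tri k.
  by rewrite exprn_ge0// FS_ge0.
have /eqP : avg (fun d : vec k (p ^ N) => FS phi rho (fr p n z S) d ^+ tri k) = 0.
  by apply/eqP; rewrite eq_le h avg_ge0.
rewrite /avg mulf_eq0 invr_eq0 pnatr_eq0 -leqn0 leqNgt.
have -> /= : (0 < #|{: vec k (p ^ N)}|)%N by apply/card_gt0P; exists c.
rewrite orbF psumr_eq0// => /allP/(_ c); rewrite mem_index_enum => /(_ isT) /=.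
by rewrite expf_eq0 t0 => /eqP.
Qed.

End Fixed.

(** A combination whose Taylor coefficients of orders 1 to k vanish has degree at most k, hence is
    constant modulo p, while its coefficient of degree i + 1 is [c i]. *)
Lemma inj_cls k (phi : 'I_k -> {poly int}) xi : cls p phi -> inj_at p phi xi.
Proof.
move=> H c hc i.
set P := \sum_i c i *: redF p (phi i) in hc.
have cP j : P`_j = \sum_i c i * (j == i.+1)%:R.
  rewrite coef_sum; apply: eq_bigr => i' _; rewrite coefZ coef_map /=.
  have := H i' j; rewrite (dvdp_F pp) rmorphB subr_eq0 => /eqP ->.
  by case: (j == _).
have sP : (size P <= k.+1)%N.
  apply/leq_sizeP => j hj; rewrite cP big1// => i' _.
  have := ltn_ord i'; case: eqP; rewrite ?mulr0//; lia.
have sQ : size (P \Po ('X + (xi%:R)%:P)) = size P by rewrite size_comp_poly2// size_XaddC.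
have hQ : P \Po ('X + (xi%:R)%:P) = ((P \Po ('X + (xi%:R)%:P))`_0)%:P.
  apply/polyP => j; rewrite coefC; case: eqP => [->//|/eqP j0].
  have [jk|kj] := ltnP j k.+1.
    have h : (j.-1 < k)%N by lia.
    by have := hc (Ordinal h); rewrite /= prednK// lt0n.
  by rewrite nth_default// sQ (leq_trans sP).
have s1 : (size P <= 1)%N by rewrite -sQ hQ size_polyC leq_b1.
have : P`_i.+1 = 0 by rewrite nth_default// (leq_trans s1).
rewrite cP (bigD1 i)//= eqxx mulr1 big1 ?addr0// => i' ne.
by rewrite eqSS val_eqE eq_sym (negbTE ne) mulr0.
Qed.

(** Rescaling by p^a leaves only n - a scales to decouple, and the pieces outside the class [xi] are
    empty. *)
Lemma rescale_cls k (phi : 'I_k -> {poly int}) n a K N S rho w xi :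
  (0 < k)%N -> (0 < a <= n)%N -> (xi < p ^ a)%N -> cls p phi -> Dec p k (n - a) K -> 0 <= K ->
  (k * n <= N)%N -> (forall z, 0 <= w z) ->
  (forall z, (z < p ^ n)%N ->
    avg (fun c => FS (p := p) (N := N) phi rho (fr p n z S) c ^+ tri k) <= w z ^+ tri k) ->
  avg (fun c => FS (p := p) (N := N) phi rho (fr p a xi S) c ^+ tri k) <=
    K * WS p n a xi w ^+ tri k.
Proof.
move=> k0 /andP[a0 an] hxi cphi D K0 kn w0 hw.
apply: (rescale pp k0 _ hxi (inj_cls cphi) D K0 kn) => //; first by rewrite a0.
  by move=> x /mem_fr.
move=> z hz; have [e|ne] := eqVneq (z %% p ^ a)%N xi; first by rewrite fr_fr// hw.
rewrite fr_fr0//; have t0 := tri_gt0 k0.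
apply: le_trans (_ : 0 <= _); last by rewrite exprn_ge0.
rewrite /avg big1 ?mul0r// => c _.
by rewrite FS_nil expr0n gtn_eqF.
Qed.

Lemma tri_lt l k : (l < k)%N -> (tri l < tri k)%N.
Proof. by move=> lk; have := tri2 l; have := tri2 k; nia. Qed.

(** At level zero the first factor is absent and the second lives on a class modulo p^b, so only n -
    b scales remain. This is the source of the gain in the iteration. *)
Lemma Bil0 k a b n K : (0 < k)%N -> (0 < b <= n)%N -> Dec p k (n - b) K -> 0 <= K ->
  Bil k 0 a b n K.
Proof.
move=> k0 hb D K0 N phi S rho w xi eta kn cphi w0 hw _ he _.
have t00 : tri 0 = 0%N by [].
rewrite t00 subn0 expr0 mul1r.
apply: le_trans (rescale_cls k0 hb he cphi D K0 kn w0 hw).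
by apply: ler_avg => c; rewrite expr0 mul1r.
Qed.

(** Start of the iteration: after normalisation by the weights, a monomial of total degree tri k in
    two variables is at most the sum of their pure powers, which leaves two linear estimates. *)
Lemma Bil_base k l a b n K : (0 < l < k)%N -> (0 < a <= n)%N -> (0 < b <= n)%N -> 0 <= K ->
  Dec p k (n - a) K -> Dec p k (n - b) K -> Bil k l a b n (2 * K).
Proof.
move=> /andP[l0 lk] ha hb K0 Da Db N phi S rho w xi eta kn cphi w0 hw hx he _.
have k0 : (0 < k)%N by lia.
have tl0 := tri_gt0 l0; have tkl := tri_lt lk.
have [an bn] : (a <= n)%N /\ (b <= n)%N by case/andP: ha; case/andP: hb.
set U := WS p n a xi w; set V := WS p n b eta w.
have U0 : 0 <= U by exact: WS_ge0.
have V0 : 0 <= V by exact: WS_ge0.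
have [Uz|Unz] := eqVneq U 0.
  rewrite Uz expr0n gtn_eqF//= mul0r mulr0 /avg big1 ?mul0r// => c _.
  by rewrite (FS_zero k0 w0 hw c an Uz) expr0n gtn_eqF//= mul0r.
have [Vz|Vnz] := eqVneq V 0.
  have t : (0 < tri k - tri l)%N by rewrite subn_gt0.
  rewrite Vz expr0n gtn_eqF//= mulr0 mulr0 /avg big1 ?mul0r// => c _.
  by rewrite (FS_zero k0 w0 hw c bn Vz) expr0n gtn_eqF//= mulr0.
have Up : 0 < U by rewrite lt_def Unz.
have Vp : 0 < V by rewrite lt_def Vnz.
have hU := rescale_cls k0 ha hx cphi Da K0 kn w0 hw.
have hV := rescale_cls k0 hb he cphi Db K0 kn w0 hw.
rewrite -/U in hU; rewrite -/V in hV.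
have key (x y : R) : 0 <= x -> 0 <= y ->
   x ^+ tri l * y ^+ (tri k - tri l) <= x ^+ tri k + y ^+ tri k.
  move=> x0 y0; have e : tri k = (tri l + (tri k - tri l))%N by rewrite subnKC// ltnW.
  have [xy|yx] := leP x y.
    apply: le_trans (_ : y ^+ tri k <= _); last by rewrite lerDr exprn_ge0.
    by rewrite [X in _ <= y ^+ X]e exprD ler_wpM2r ?exprn_ge0// lerXn2r.
  apply: le_trans (_ : x ^+ tri k <= _); last by rewrite lerDl exprn_ge0.
  by rewrite [X in _ <= x ^+ X]e exprD ler_wpM2l ?exprn_ge0// lerXn2r// ltW.
set C := U ^+ tri l * V ^+ (tri k - tri l).
have C0 : 0 <= C by rewrite mulr_ge0 ?exprn_ge0.
apply: le_trans (_ : avg (fun c : vec k (p ^ N) => C * (U ^- tri k * FS phi rho (fr p a xi S) c ^+ tri k +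
   V ^- tri k * FS phi rho (fr p b eta S) c ^+ tri k)) <= _).
  apply: ler_avg => c.
  have x0 := FS_ge0 phi rho (fr p a xi S) c; have y0 := FS_ge0 phi rho (fr p b eta S) c.
  move: x0 y0; set x := FS _ _ _ _; set y := FS _ _ _ _ => x0 y0.
  have := key (x / U) (y / V) (divr_ge0 x0 U0) (divr_ge0 y0 V0).
  move=> /(ler_wpM2l C0).
  have -> : C * ((x / U) ^+ tri l * (y / V) ^+ (tri k - tri l)) = x ^+ tri l * y ^+ (tri k - tri l).
    rewrite /C !exprMn !exprVn; field.
    by rewrite !expf_neq0.
  have ev (q u : R) : u ^- tri k * q ^+ tri k = (q / u) ^+ tri k.
    by rewrite exprMn exprVn mulrC.
  by rewrite !ev.
rewrite avgZ avgD !avgZ [X in _ <= X]mulrC ler_wpM2l//.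
have -> : 2 * K = K + K by ring.
apply: lerD.
  by rewrite mulrC ler_pdivrMr ?exprn_gt0.
by rewrite mulrC ler_pdivrMr ?exprn_gt0.
Qed.

(** Hoelder interpolation between the swapped level k - l, in which [a] becomes the second scale,
    and the level l - 1 at the same scales. *)
Lemma Bil_holder k l a b n K K' K'' : (0 < l < k)%N -> (a <= n)%N -> (b <= n)%N ->
  0 < K -> 0 < K' -> 0 < K'' -> K' * K'' ^+ (k - l) <= K ^+ (k - l).+1 ->
  Bil k (k - l) b a n K' -> Bil k l.-1 a b n K'' -> Bil k l a b n K.
Proof.
move=> /andP[l0 lk] an bn Kp K'p K''p HK B1 B2 N phi S rho w xi eta kn cphi w0 hw hx he ne.
have k0 : (0 < k)%N by lia.
have tl0 := tri_gt0 l0; have tkl := tri_lt lk.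
have tl1 : (tri l.-1 < tri k)%N by apply: tri_lt; lia.
have tk1 : (tri (k - l) < tri k)%N by apply: tri_lt; lia.
have [e1 e2] : (tri l * (k - l).+1 = (tri k - tri (k - l)) + tri l.-1 * (k - l))%N /\
    ((tri k - tri l) * (k - l).+1 = tri (k - l) + (tri k - tri l.-1) * (k - l))%N.
  by apply: tri_exponents; rewrite l0.
have mono (x y : R) : (x ^+ tri l * y ^+ (tri k - tri l)) ^+ (k - l).+1 =
   (y ^+ tri (k - l) * x ^+ (tri k - tri (k - l))) *
   (x ^+ tri l.-1 * y ^+ (tri k - tri l.-1)) ^+ (k - l).
  rewrite !exprMn -!exprM e1 e2 !exprD; ring.
set U := WS p n a xi w; set V := WS p n b eta w.
have U0 : 0 <= U by exact: WS_ge0.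
have V0 : 0 <= V by exact: WS_ge0.
have [Uz|Unz] := eqVneq U 0.
  rewrite Uz expr0n gtn_eqF//= mul0r mulr0 /avg big1 ?mul0r// => c _.
  by rewrite (FS_zero k0 w0 hw c an Uz) expr0n gtn_eqF//= mul0r.
have [Vz|Vnz] := eqVneq V 0.
  have t : (0 < tri k - tri l)%N by rewrite subn_gt0.
  rewrite Vz expr0n gtn_eqF//= mulr0 mulr0 /avg big1 ?mul0r// => c _.
  by rewrite (FS_zero k0 w0 hw c bn Vz) expr0n gtn_eqF//= mulr0.
have Up : 0 < U by rewrite lt_def Unz.
have Vp : 0 < V by rewrite lt_def Vnz.
have h1 := B1 N phi S rho w eta xi kn cphi w0 hw he hx.
rewrite eq_sym in h1; have {}h1 := h1 ne.
have h2 := B2 N phi S rho w xi eta kn cphi w0 hw hx he ne.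
have FSn (c : vec k (p ^ N)) T := FS_ge0 phi rho T c.
rewrite avg_weight.
apply: (@holder_exprS R _ (fun=> #|{: vec k (p ^ N)}|%:R^-1)
  (fun c => FS phi rho (fr p b eta S) c ^+ tri (k - l) *
            FS phi rho (fr p a xi S) c ^+ (tri k - tri (k - l)))
  (fun c => FS phi rho (fr p a xi S) c ^+ tri l.-1 *
            FS phi rho (fr p b eta S) c ^+ (tri k - tri l.-1)) _ (k - l)
  (K' * (V ^+ tri (k - l) * U ^+ (tri k - tri (k - l))))
  (K'' * (U ^+ tri l.-1 * V ^+ (tri k - tri l.-1)))).
- rewrite sumr_const -[_ *+ _]mulr_natl divff// pnatr_eq0 -lt0n.
  by apply/card_gt0P; exists (0 : vec k (p ^ N)).
- by [].
- by move=> c; rewrite mulr_ge0// exprn_ge0.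
- by move=> c; rewrite mulr_ge0// exprn_ge0.
- by move=> c; rewrite mulr_ge0// exprn_ge0.
- by move=> c; rewrite mono.
- by rewrite !mulr_gt0// exprn_gt0.
- by rewrite !mulr_gt0// exprn_gt0.
- by rewrite !mulr_ge0 ?exprn_ge0// ltW.
- by rewrite -avg_weight.
- by rewrite -avg_weight.
rewrite [in leRHS]exprMn mono exprMn.
have -> (P Q Q' T : R) : P * Q * (Q' * T) = (P * Q') * (Q * T) by ring.
by rewrite ler_wpM2r// !mulr_ge0 ?exprn_ge0// mulr_ge0 ?exprn_ge0.
Qed.

End Bilinear.

(** * Decoupling of lower degree for one factor of the bilinear form *)

Section LowerDegree.
Variables (R : realType) (p : nat) (pp : prime p).
Implicit Types (S : seq nat) (rho w : nat -> R).

Let p_gt0 : (0 < p)%N. Proof. exact: prime_gt0. Qed.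
Let pX_gt0 a : (0 < p ^ a)%N. Proof. by rewrite expn_gt0 p_gt0. Qed.

(** The power of ['X + d] has the nonzero constant term d^m, hence is invertible modulo X^l. *)
Lemma coef_low_shift_eq0 (F : fieldType) (m l : nat) (d : F) (Q : {poly F}) :
  d != 0 -> (size Q <= l)%N ->
  (forall j, (j < l)%N -> (('X + d%:P) ^+ m * Q)`_j = 0) -> Q = 0.
Proof.
move=> d0 sQ H.
suff HQ j : Q`_j = 0 by apply/polyP => j; rewrite coef0.
elim/ltn_ind: j => j IH.
have [lj|jl] := leqP l j; first by rewrite nth_default// (leq_trans sQ).
have := H j jl; rewrite coefM big_ord_recl big1 ?addr0 => [|i _]; last first.
  by rewrite lift0 IH ?mulr0//; have := ltn_ord i; lia.
rewrite subn0 => /eqP; rewrite mulf_eq0 -horner_coef0 horner_exp hornerD hornerX hornerC add0r.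
by rewrite expf_eq0 (negbTE d0) andbF /= => /eqP.
Qed.

(** Around [eta] a combination of these l coordinates has derivative X^m Q with Q of degree less
    than l. Around [xi] this reads (X + d)^m Q(X + d) with d = xi - eta nonzero modulo p, so if its
    first l coefficients vanish then Q = 0. The coefficients of Q are the [c i] times m + i + 1, and
    these factors are invertible because they are at most k < p. *)
Lemma inj_top k l m (phi : 'I_k -> {poly int}) (B : 'I_l -> 'I_k -> int) xi eta N :
  k = (m + l)%N -> (k < p)%N -> (0 < N)%N -> cls p phi -> (xi %% p != eta %% p)%N ->
  (forall (i : 'I_l) (j : 'I_k),
    ((p ^ N)%:Z %| (taylor (comb phi (B i)) eta)`_j.+1 - (j == m + i :> nat)%N%:Z)%Z) ->
  inj_at p (fun i => comb phi (B i)) xi.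
Proof.
move=> kml kp N0 cphi ne hB c hc.
pose chi i := comb phi (B i).
set P := \sum_i c i *: redF p (chi i) in hc.
pose G := P \Po ('X + (eta%:R)%:P).
pose d : 'F_p := xi%:R - eta%:R.
have d0 : d != 0.
  rewrite /d subr_eq0; apply: contra ne => /eqP h; apply/eqP.
  have := congr1 (@nat_of_ord _) h; rewrite !val_Fp_nat//.
have PG : P \Po ('X + (xi%:R)%:P) = G \Po ('X + d%:P).
  rewrite /G -comp_polyA; congr (_ \Po _).
  by rewrite comp_polyD comp_polyX comp_polyC -addrA -polyCD /d subrK.
have tayF i j : (j < k)%N -> (redF p (chi i) \Po ('X + (eta%:R)%:P))`_j.+1 = (j == m + i)%:R.
  move=> jk; rewrite -redF_taylor coef_map /=.
  have := hB i (Ordinal jk); rewrite /= => h.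
  have : (p%:Z %| (taylor (comb phi (B i)) eta)`_j.+1 - (j == m + i :> nat)%N%:Z)%Z.
    apply: dvdz_trans h; rewrite -(prednK N0) expnS PoszM dvdz_mulr//.
  by rewrite (dvdp_F pp) rmorphB subr_eq0 => /eqP ->; case: (j == _).
have sz i : (size (redF p (chi i)) <= k.+1)%N.
  apply/leq_sizeP => j hj; rewrite coef_map /= /chi /comb coef_sum rmorph_sum big1// => i' _.
  rewrite /= coefZ rmorphM /=; have := cphi i' j; rewrite (dvdp_F pp) rmorphB subr_eq0 => /eqP ->.
  have := ltn_ord i'; case: eqP => [|_]; first lia.
  by rewrite /= mulr0.
have Gj j : G`_j.+1 = \sum_i c i * (j == m + i)%:R.
  rewrite /G /P raddf_sum coef_sum; apply: eq_bigr => i _.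
  rewrite /= comp_polyZ coefZ; congr (_ * _).
  have [jk|kj] := ltnP j k; first exact: tayF.
  rewrite nth_default; last first.
    by rewrite size_comp_poly2 ?size_XaddC// (leq_trans (sz i)).
  have := ltn_ord i; case: eqP => //; lia.
pose Q : {poly 'F_p} := \sum_(i < l) (c i * (m + i).+1%:R) *: 'X^i.
have cQ j : Q`_j = \sum_i c i * (m + i).+1%:R * (j == i)%:R.
  by rewrite coef_sum; apply: eq_bigr => i _; rewrite coefZ coefXn.
have dG : G^`() = 'X ^+ m * Q.
  apply/polyP => j; rewrite coef_deriv Gj coefXnM.
  have [jm|mj] := ltnP j m.
    by rewrite big1 ?mul0rn// => i _; case: eqP; rewrite ?mulr0//; lia.
  rewrite cQ -mulr_natr mulr_suml; apply: eq_bigr => i _.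
  have -> : (j - m == i)%N = (j == m + i)%N by lia.
  by case: eqP => [->|_]; rewrite ?mulr1// !mulr0 mul0r.
have szQ : (size Q <= l)%N.
  apply/leq_sizeP => j hj; rewrite cQ big1// => i _.
  by have := ltn_ord i; case: eqP; rewrite ?mulr0//; lia.
have sQ : (size (Q \Po ('X + d%:P)) <= l)%N.
  by rewrite size_comp_poly2 ?size_XaddC.
have dH : (P \Po ('X + (xi%:R)%:P))^`() = ('X + d%:P) ^+ m * (Q \Po ('X + d%:P)).
  rewrite PG deriv_comp dG derivD derivX derivC addr0 mulr1 comp_polyM.
  by rewrite comp_Xn_poly.
have Q0 : Q \Po ('X + d%:P) = 0.
  apply: (coef_low_shift_eq0 d0 sQ (m := m)) => j jl; rewrite -dH coef_deriv.
  by have := hc (Ordinal jl) => /= ->; rewrite mul0rn.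
have Qz : Q = 0.
  by apply/eqP; rewrite -size_poly_eq0 -(size_comp_poly2 Q (size_XaddC d)) Q0 size_poly0.
move=> i; have : Q`_i = 0 by rewrite Qz coef0.
rewrite cQ (bigD1 i)//= eqxx mulr1 big1 ?addr0 => [/eqP|i' ne']; last first.
  by rewrite val_eqE eq_sym (negbTE ne') mulr0.
rewrite mulf_eq0.
have -> : ((m + i).+1%:R == 0 :> 'F_p) = false.
  rewrite -(dvdn_pcharf (pchar_Fp pp)); apply/negP => /dvdn_leq; have := ltn_ord i; lia.
by rewrite orbF => /eqP.
Qed.

(** With y = eta + p^b u, the Taylor terms of order above m carry p^(b (m + 1)), and those of orders
    1 to m vanish to precision N. *)
Lemma dvdz_taylor_shift (P : {poly int}) eta b m k N y :
  (b * m.+1 <= N)%N -> (b * m.+1 <= b * k.+1)%N -> (y %% p ^ b)%N = eta ->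
  (forall j, (j < k)%N -> (j < m)%N -> ((p ^ N)%:Z %| (taylor P eta)`_j.+1)%Z) ->
  ((p ^ (b * m.+1))%:Z %| P.[y%:Z] - (taylor P eta)`_0)%Z.
Proof.
move=> bN bk hy H.
pose u := (y %/ p ^ b)%N.
have -> : y%:Z = eta%:Z + ((p ^ b)%:Z * u%:Z) by rewrite -PoszM -PoszD classE.
rewrite taylor_horner.
set T := taylor P eta in H *.
rewrite (@horner_coef_wide _ (size T).+1)// big_ord_recl expr0 mulr1 /= addrAC subrr add0r.
apply: (big_ind (fun z => (_ %| z)%Z)) => [|? ?|i _]; [exact: dvdz0|exact: rpredD|].
rewrite /bump /= add1n exprMn.
have -> : (p ^ b)%:Z ^+ i.+1 = (p ^ (b * i.+1))%:Z.
  by rewrite expnM; elim: i.+1 => [|n IH]; rewrite ?expr0 ?expn0// exprS IH expnS PoszM.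
have dp m1 m2 : (m1 <= m2)%N -> ((p ^ m1)%:Z %| (p ^ m2)%:Z)%Z.
  by move=> h; rewrite dvdzE !absz_nat dvdn_exp2l.
have [im|mi] := ltnP i m; last first.
  by rewrite dvdz_mull// dvdz_mulr// dp// leq_mul2l ltnS mi orbT.
have [ik|ki] := ltnP i k; last first.
  by rewrite dvdz_mull// dvdz_mulr// dp// (leq_trans bk)// leq_mul2l ltnS ki orbT.
by rewrite dvdz_mulr// (dvdz_trans (dp _ _ bN))// H.
Qed.

(* Shifting the frequency along the duals of the top l Taylor coordinates at eta, by multiples of
   p^(-(k - l + 1) b), leaves the factor at eta unchanged. Restricted to these coordinates the curve
   is nondegenerate at xi, so that decoupling of degree l applies to the other factor. *)
Lemma Bil_lower k l a a' b n (K Kl : R) : (k < p)%N -> (0 < l < k)%N -> (0 < a)%N -> (a <= a' <= n)%N ->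
  (0 < b <= n)%N -> (l * a' <= b * (k - l).+1)%N -> 0 <= K -> 0 <= Kl ->
  Dec p l (a' - a) Kl -> Bil p k l a' b n K -> Bil p k l a b n (Kl * K).
Proof.
move=> kp /andP[l0 lk] a0 /andP[aa a'n] /andP[b0 bn] la K0 Kl0 D B N phi S rho w xi eta kn cphi w0 hw hx he ne.
pose m := (k - l)%N.
have kml : k = (m + l)%N by rewrite /m subnK// ltnW.
(* Modulo p^N' the top l coordinates are constant on the class of [eta]. Decoupling of degree l down
   to the scale a' fits into this precision because l a' <= N'. *)
pose N' := (b * m.+1)%N.
have N'N : (N' <= N)%N.
  apply: leq_trans kn; rewrite /N' mulnC leq_mul//; rewrite /m; lia.
have N0 : (0 < N)%N by apply: leq_trans N'N; rewrite muln_gt0 b0.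
have hBex : forall i : 'I_l, exists Bi : 'I_k -> int, forall j : 'I_k,
   ((p ^ N)%:Z %| (taylor (comb phi Bi) eta)`_j.+1 - (j == m + i :> nat)%N%:Z)%Z.
  move=> i.
  have [Bi h] := dual_vector pp (fun j : 'I_k => (j == m + i :> nat)%N%:Z) N (inj_cls pp (xi := eta) cphi).
  by exists Bi => j; exact: h.
have [Bv hB] := choice hBex.
pose chi i := comb phi (Bv i).
have injc : inj_at p chi xi := inj_top kml kp N0 cphi ne hB.
pose be (v : vec l (p ^ N')) : 'I_k -> int := fun j => \sum_i (vz v i * (p ^ (N - N'))%:Z) * Bv i j.
have combbe v : comb phi (be v) = (p ^ (N - N'))%:Z *: comb chi (vz v).
  rewrite comb_sum /comb scaler_sumr; apply: eq_bigr => i _.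
  by rewrite scalerA mulrC.
have angbe v (z : int) : ang R (p ^ N) (comb phi (be v)).[z] = ang R (p ^ N') (comb chi (vz v)).[z].
  have e : (p ^ N = p ^ (N - N') * p ^ N')%N by rewrite -expnD subnK.
  by rewrite combbe hornerZ {1}e ang_scale.
pose rh (c : vec k (p ^ N)) (x : nat) : R := rho x + ang R (p ^ N) (comb phi (vz c)).[x%:Z].
have Feta (c : vec k (p ^ N)) v : FS (p := p) (N := N) phi rho (fr p b eta S) (c + red (p ^ N) (be v)) = FS phi rho (fr p b eta S) c.
  rewrite (FS_shift pp) /FS.
  pose e := \sum_i vz v i * (taylor (chi i) eta)`_0.
  apply: (@nrm2_eqmod _ _ _ _ _ (ang R (p ^ N') e)) => y /mem_fr hy.
  rewrite angbe.
  have : ((p ^ N')%:Z %| (comb chi (vz v)).[y%:Z] - e)%Z.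
    rewrite /comb horner_sum -sumrB.
    apply: (big_ind (fun z => (_ %| z)%Z)) => [|? ?|i _]; [exact: dvdz0|exact: rpredD|].
    rewrite hornerZ -mulrBr dvdz_mull//.
    apply: (@dvdz_taylor_shift _ _ _ _ k N) => //.
      by rewrite leq_mul2l ltnS /m leq_subr orbT.
    move=> j jk jm; have := hB i (Ordinal jk) => /=.
    have -> : (j == m + i)%N = false by rewrite ltn_eqF// (leq_trans jm)// leq_addr.
    by rewrite subr0.
  move=> /(ang_eqmod R (pX_gt0 _)) [z ->]; exists z; ring.
have Fxi (c : vec k (p ^ N)) v T : FS (p := p) (N := N) phi rho T (c + red (p ^ N) (be v)) = FS chi (rh c) T v.
  rewrite (FS_shift pp) /FS; apply: eq_nrm2 => x _.
  by rewrite angbe /rh addrAC.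
have t0 := tri_gt0 l0.
have hvex : forall cz : (vec k (p ^ N) * nat)%type, exists v : R, 0 <= v /\ v ^+ tri l =
   avg (fun v : vec l (p ^ N') => FS chi (rh cz.1) (fr p a' cz.2 (fr p a xi S)) v ^+ tri l).
  move=> [c z].
  have [|v v0 hv] := @root_exists R (tri l) (avg (fun v : vec l (p ^ N') =>
      FS chi (rh c) (fr p a' z (fr p a xi S)) v ^+ tri l)) t0.
    by apply: avg_ge0 => v; rewrite exprn_ge0// FS_ge0.
  by exists v.
have [v hv] := choice hvex.
rewrite (@avg_translates _ _ _ _ (0 : vec l (p ^ N')) (fun v => red _ (be v))).
set t := (tri k - tri l)%N.
have step1 (c : vec k (p ^ N)) :
  avg (fun u : vec l (p ^ N') => FS phi rho (fr p a xi S) (c + red (p ^ N) (be u)) ^+ tri l *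
       FS phi rho (fr p b eta S) (c + red (p ^ N) (be u)) ^+ t) <=
  FS phi rho (fr p b eta S) c ^+ t * (Kl * WS p a' a xi (fun z => v (c, z)) ^+ tri l).
  rewrite (eq_avg (H := fun u : vec l (p ^ N') => FS phi rho (fr p b eta S) c ^+ t *
     FS chi (rh c) (fr p a xi S) u ^+ tri l)); last first.
    by move=> u; rewrite Feta Fxi mulrC.
  rewrite avgZ ler_wpM2l ?exprn_ge0 ?FS_ge0//.
  apply: (rescale pp l0 _ hx injc D Kl0) => //; first by rewrite a0.
  - by move=> x /mem_fr.
  - by move=> z; have [] := hv (c, z).
  - by move=> z _; have [_ ->] := hv (c, z).
apply: le_trans (ler_avg step1) _.
set U := WS p n a xi w; set V := WS p n b eta w.
have V0 : 0 <= V by exact: WS_ge0.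
rewrite (eq_avg (H := fun c : vec k (p ^ N) => Kl * (FS phi rho (fr p b eta S) c ^+ t *
   WS p a' a xi (fun z => v (c, z)) ^+ tri l))); last by move=> c; rewrite mulrCA.
rewrite avgZ -mulrA ler_wpM2l// [U ^+ _ * _]mulrC mulrA.
rewrite /U -(WS_split pp xi w (_ : (a <= a' <= n)%N)); last by rewrite aa.
rewrite avg_weight.
rewrite (eq_bigr (fun c : vec k (p ^ N) => (#|{: vec k (p ^ N)}|%:R^-1 * FS phi rho (fr p b eta S) c ^+ t) *
   WS p a' a xi (fun z => v (c, z)) ^+ tri l)); last by move=> c _; rewrite mulrA.
(* Minkowski with the factor at [eta] as part of the measure; the bound needed for each [z] is the
   bilinear hypothesis at scale a'. *)
apply: (@weighted_minkowski R _ _ (fun z : 'I_(p ^ a') => (z %% p ^ a == xi)%N) (tri l)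
  (fun c : vec k (p ^ N) => #|{: vec k (p ^ N)}|%:R^-1 * FS phi rho (fr p b eta S) c ^+ t)
  (fun z c => v (c, z : nat)) (fun z => WS p n a' z w)) => //.
- by move=> c; rewrite mulr_ge0// exprn_ge0// FS_ge0.
- by move=> z c; have [] := hv (c, z : nat).
- by move=> z; exact: WS_ge0.
- by rewrite mulr_ge0// exprn_ge0.
move=> z /eqP hz.
have nez : (z %% p != eta %% p)%N.
  have -> : (z %% p = xi %% p)%N; last by [].
  by rewrite -hz modn_dvdm// -{1}[p]expn1 dvdn_exp2l.
have := B N phi S rho w z eta kn cphi w0 hw (ltn_ord z) he nez.
rewrite -/t [WS p n a' z w ^+ _ * _]mulrC mulrA; apply: le_trans.
rewrite [leRHS](@avg_translates _ _ _ _ (0 : vec l (p ^ N')) (fun v => red _ (be v))).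
rewrite le_eqVlt; apply/orP; left; apply/eqP.
rewrite [RHS]avg_weight; apply: eq_bigr => c _; rewrite -mulrA; congr (_ * _).
have [_ ->] := hv (c, z : nat); rewrite -avgZ; apply: eq_avg => u.
by rewrite Feta Fxi fr_fr// mulrC.
Qed.

End LowerDegree.

(** * Orthogonality and the first decoupling estimates *)

Section Orthogonality.
Variable R : realType.

Lemma cos_eq1 (q : nat) (D : int) : (0 < q)%N -> cos (ang R q D) = 1 -> (q%:Z %| D)%Z.
Proof.
move=> q0 h; have qz : q%:Z != 0 by lia.
have dv : (q%:Z %| D - (D %% q%:Z)%Z)%Z by rewrite {1}(divz_eq D q%:Z) addrK dvdz_mull.
have [z hz] := ang_eqmod R q0 dv.
move: h; rewrite hz cosDz.
have [r hr] : exists r : nat, (D %% q%:Z)%Z = r by exists `|(D %% q%:Z)%Z|%N; rewrite gez0_abs ?modz_ge0.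
have rq : (r < q)%N by have := ltz_mod D qz; rewrite hr; lia.
rewrite hr; have [r0 _|r0] := posnP r; first by apply/dvdz_mod0P; rewrite hr r0.
have q1 : (0 : R) < q%:R by rewrite ltr0n.
have -> : ang R q r%:Z = (pi * (r%:R / q%:R)) *+ 2.
  by rewrite /ang mulr2n; have -> : (r%:Z)%:~R = r%:R :> R by []; field; rewrite gt_eqF.
have : 0 < sin (pi * (r%:R / q%:R)) :> R.
  apply: sin_gt0_pi; rewrite mulr_gt0 ?pi_gt0 ?divr_gt0 ?ltr0n//=.
  by rewrite gtr_pMr ?pi_gt0// ltr_pdivrMr// mul1r ltr_nat.
rewrite cos_mulr2n => s0 h; have := cos2Dsin2 (pi * (r%:R / q%:R) : R).
have : 0 < sin (pi * (r%:R / q%:R)) ^+ 2 :> R by rewrite exprn_gt0.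
move: h; rewrite mulr2n; set A := cos _ ^+ 2; set B := sin _ ^+ 2; lra.
Qed.

(** Translating [c] by [B] rotates the mean of e^(ih) by the angle [th], and a vector of the plane
    fixed by a nontrivial rotation is zero. *)
Lemma avg_cos_eq0 k (q : nat) (phi : 'I_k -> {poly int}) (B : 'I_k -> int) (al : R) (x y : int) :
  (0 < q)%N -> ~~ (q%:Z %| (comb phi B).[x] - (comb phi B).[y])%Z ->
  avg (fun c : vec k q => cos (al + (ang R q (comb phi (vz c)).[x] - ang R q (comb phi (vz c)).[y]))) = 0.
Proof.
move=> q0 nd.
pose th := ang R q ((comb phi B).[x] - (comb phi B).[y]).
pose h (c : vec k q) := al + (ang R q (comb phi (vz c)).[x] - ang R q (comb phi (vz c)).[y]).
have hs c : exists z : int, h (c + red q B) = h c + th + z%:~R * (2 * pi).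
  have H i : (q%:Z %| vz (c + red q B : vec k q) i - (vz c i + B i))%Z.
    have h1 := vzD c (red q B) i q0; have h2 := redP B i q0.
    have -> : vz (c + red q B : vec k q) i - (vz c i + B i) =
      (vz (c + red q B : vec k q) i - (vz c i + vz (red q B) i)) + (vz (red q B) i - B i) by ring.
    by rewrite rpredD.
  have [z1 e1] := ang_eqmod R q0 (comb_eqmod phi x H).
  have [z2 e2] := ang_eqmod R q0 (comb_eqmod phi y H).
  exists (z1 - z2); rewrite /h e1 e2 !combD !hornerD !angD /th angD.
  have -> : ang R q (- (comb phi B).[y]) = - ang R q (comb phi B).[y].
    by rewrite /ang intrN mulrN mulNr.
  by rewrite intrD intrN; ring.
pose C := avg (fun c => cos (h c)); pose Sn := avg (fun c => sin (h c)).
have eC : C = cos th * C - sin th * Sn.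
  transitivity (avg (fun c : vec k q => cos (h (c + red q B)))).
    by rewrite (avg_translate (fun c => cos (h c))).
  rewrite /C /Sn -!avgZ -mulN1r -avgZ -avgD.
  by apply: eq_avg => c; have [z ->] := hs c; rewrite cosDz cosD; ring.
have eS : Sn = sin th * C + cos th * Sn.
  transitivity (avg (fun c : vec k q => sin (h (c + red q B)))).
    by rewrite (avg_translate (fun c => sin (h c))).
  rewrite /C /Sn -!avgZ -avgD.
  by apply: eq_avg => c; have [z ->] := hs c; rewrite sinDz sinD; ring.
have c1 : cos th != 1 by apply: contra nd => /eqP /(cos_eq1 q0).
have : (cos th - 1) * (C ^+ 2 + Sn ^+ 2) = 0.
  have -> : (cos th - 1) * (C ^+ 2 + Sn ^+ 2) =
     C * ((cos th * C - sin th * Sn) - C) + Sn * ((sin th * C + cos th * Sn) - Sn) by ring.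
  by rewrite -eC -eS !subrr !mulr0 addr0.
move/eqP; rewrite mulf_eq0 subr_eq0 (negbTE c1) /= paddr_eq0 ?sqr_ge0// => /andP[].
by rewrite sqrf_eq0 => /eqP.
Qed.

End Orthogonality.

Section SmallCases.
Variables (R : realType) (p : nat) (pp : prime p).
Implicit Types (S : seq nat) (rho w : nat -> R) (K : R).

Let p_gt0 : (0 < p)%N. Proof. exact: prime_gt0. Qed.
Let pX_gt0 a : (0 < p ^ a)%N. Proof. by rewrite expn_gt0 p_gt0. Qed.

Lemma sumX_le (I : finType) (P : pred I) (x : I -> R) n : (0 < n)%N ->
  (forall i, 0 <= x i) -> \sum_(i | P i) x i ^+ n <= (\sum_(i | P i) x i) ^+ n.
Proof.
move=> n0 x0; set U := \sum_(i | P i) x i.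
have U0 : 0 <= U by exact: sumr_ge0.
have -> : U ^+ n = \sum_(i | P i) x i * U ^+ n.-1 by rewrite -mulr_suml -exprS prednK.
apply: ler_sum => i Pi; rewrite -[in leLHS](prednK n0) exprS ler_wpM2l//.
rewrite lerXn2r ?nnegrE// /U (bigD1 i)//= lerDl; exact: sumr_ge0.
Qed.

Lemma powsum_le (I : finType) (P : pred I) (x : I -> R) n : (0 < n)%N ->
  (forall i, 0 <= x i) ->
  (\sum_(i | P i) x i) ^+ n <= #|I|%:R ^+ n * \sum_(i | P i) x i ^+ n.
Proof.
move=> n0 x0.
have S0 : 0 <= \sum_(i | P i) x i ^+ n by apply: sumr_ge0 => i _; exact: exprn_ge0.
have [u u0 hu] := root_exists n0 S0.
rewrite -hu -exprMn lerXn2r ?nnegrE ?sumr_ge0 ?mulr_ge0//.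
rewrite mulr_natl -sumr_const big_mkcond /=; apply: ler_sum => i _.
case: ifP => // Pi; rewrite -(ler_pXn2r n0) ?nnegrE// hu (bigD1 i)//= lerDl.
by apply: sumr_ge0 => j _; exact: exprn_ge0.
Qed.

Lemma Dec_mono k n K K' : K <= K' -> Dec p k n K -> Dec p k n K'.
Proof.
move=> KK D N phi S rho w kn cphi w0 hw; apply: le_trans (D N phi S rho w kn cphi w0 hw) _.
by rewrite ler_wpM2r// exprn_ge0// sumr_ge0.
Qed.

Lemma FS_le_classes l N (chi : 'I_l -> {poly int}) rho b S (c : vec l (p ^ N)) :
  FS chi rho S c <= (p ^ b)%:R * \sum_(z < p ^ b) FS chi rho (fr p b z S) c.
Proof.
apply: (@nrm2_classes R _ _ (fun x => x %% p ^ b)%N (p ^ b) predT) => x _.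
by rewrite ltn_pmod.
Qed.

(** Cauchy-Schwarz over all classes, then Minkowski. It supplies the initial exponent and the case
    of few scales. *)
Lemma Dec_trivial k n : (0 < k)%N -> Dec p k n ((p ^ n)%:R ^+ tri k : R).
Proof.
move=> k0 N phi S rho w kn cphi w0 hw; have t0 := tri_gt0 k0.
apply: le_trans (_ : avg (fun c : vec k (p ^ N) => (p ^ n)%:R ^+ tri k *
    (\sum_(z < p ^ n) FS phi rho (fr p n z S) c) ^+ tri k) <= _).
  apply: ler_avg => c; rewrite -exprMn lerXn2r ?nnegrE ?FS_ge0//.
    by rewrite mulr_ge0// sumr_ge0// => z _; exact: FS_ge0.
  exact: FS_le_classes.
rewrite avgZ ler_wpM2l ?exprn_ge0// avg_weight -[leRHS]mul1r.
apply: (@weighted_minkowski R _ _ predT) => //; first by move=> i c; exact: FS_ge0.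
by move=> z _; rewrite -avg_weight mul1r; exact: hw.
Qed.

(** In degree one the moment is a mean square and the pieces are exactly orthogonal: modulo p^n a
    curve x + p r(x) separates the residue classes. *)
Lemma Dec1 n : Dec p 1 n (1 : R).
Proof.
move=> N phi S rho w; rewrite mul1n => kn cphi w0 hw.
have t1 : tri 1 = 1%N by [].
rewrite t1 expr1 mul1r.
pose A x y : R := avg (fun c : vec 1 (p ^ N) => cos ((rho x - rho y) +
   (ang R (p ^ N) (comb phi (vz c)).[x%:Z] - ang R (p ^ N) (comb phi (vz c)).[y%:Z]))).
have FA T : avg (fun c : vec 1 (p ^ N) => FS phi rho T c ^+ 1) = \sum_(x <- T) \sum_(y <- T) A x y.
  rewrite (eq_avg (H := fun c : vec 1 (p ^ N) => \sum_(x <- T) \sum_(y <- T) cos ((rho x - rho y) +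
   (ang R (p ^ N) (comb phi (vz c)).[x%:Z] - ang R (p ^ N) (comb phi (vz c)).[y%:Z])))).
    by rewrite avg_sum; apply: eq_bigr => x _; rewrite avg_sum.
  move=> c; rewrite expr1 -[LHS]mulr1 -(cos0 R) /FS -nrm2_pair_sum.
  by apply: eq_bigr => x _; apply: eq_bigr => y _; congr cos; ring.
have A0 x y : (x %% p ^ n)%N != (y %% p ^ n)%N -> A x y = 0.
  move=> ne; apply: (@avg_cos_eq0 R _ _ _ (fun=> 1)) => //.
  apply: contra ne; rewrite /comb big_ord1 scale1r => H.
  have H2 : ((p ^ n)%:Z %| (phi ord0).[x%:Z] - (phi ord0).[y%:Z])%Z.
    by apply: dvdz_trans H; rewrite dvdzE !absz_nat dvdn_exp2l.
  have [r hr] : exists r, phi ord0 = 'X + p%:Z *: r.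
    have := cphi ord0 => hc.
    exists (\poly_(i < (size (phi ord0)).+2) (((phi ord0)`_i - (i == 1%N)%:Z) %/ p%:Z)%Z).
    apply/polyP => i; rewrite coefD coefX coefZ coef_poly.
    case: ltnP => hi.
      rewrite mulrC divzK; last exact: hc.
      by case: (i == 1%N); rewrite /= ?mulr0n ?mulr1n; ring.
    rewrite nth_default ?mulr0 ?addr0; last by apply: leq_trans hi; rewrite -addn2 leq_addr.
    by case: i hi => // [[|i]].
  (* The difference quotient of x + p r(x) is 1 + p z, a unit modulo p^n. *)
  have [z hz] : exists z : int, (phi ord0).[x%:Z] - (phi ord0).[y%:Z] = (x%:Z - y%:Z) * (1 + p%:Z * z).
    have : (x%:Z - y%:Z %| r.[x%:Z] - r.[y%:Z])%Z.
      rewrite !horner_coef -sumrB.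
      apply: (big_ind (fun z => (_ %| z)%Z)) => [|? ?|i _]; [exact: dvdz0|exact: rpredD|].
      by rewrite -mulrBr dvdz_mull// subrXX dvdz_mulr.
    move=> /dvdzP [z hz]; exists z; rewrite hr !hornerD !hornerX !hornerZ.
    rewrite (_ : r.[x%:Z] = r.[y%:Z] + z * (x%:Z - y%:Z)); last by rewrite -hz; ring.
    ring.
  rewrite hz Gauss_dvdzl in H2; last first.
    rewrite /coprimez.
    have : coprimez (p ^ n)%:Z (1 + p%:Z * z).
      rewrite coprimezE absz_nat coprimeXl// prime_coprime//.
      apply/negP => hd; have : (p%:Z %| 1 + p%:Z * z)%Z by rewrite dvdzE.
      rewrite rpredDr ?dvdz_mulr// dvdzE /= dvdn1 => /eqP p1.
      by have := prime_gt1 pp; rewrite p1.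
    by [].
  have := H2; rewrite -eqz_mod_dvd => /eqP h3.
  by apply/eqP/eqP; rewrite -eqz_nat -!modz_nat; apply/eqP.
rewrite FA.
have cl : {in S, forall x, (x %% p ^ n < p ^ n)%N && predT (x %% p ^ n)%N}.
  by move=> x _; rewrite ltn_pmod.
rewrite (sum_classes _ cl); apply: ler_sum => z _.
apply: le_trans (_ : avg (fun c : vec 1 (p ^ N) => FS phi rho (fr p n z S) c ^+ 1) <= _); last first.
  by have := hw z (ltn_ord z); rewrite t1 expr1.
rewrite FA /fr le_eqVlt; apply/orP; left; apply/eqP.
apply: eq_big_seq => x; rewrite mem_filter => /andP[/eqP hx _].
rewrite (bigID (fun y => (y %% p ^ n == z)%N)) /= [X in _ + X]big1 ?addr0 ?big_filter//.
by move=> y hy; rewrite A0// hx eq_sym.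
Qed.

Lemma exists_argmax (I : finType) (P : pred I) (G : I -> R) i0 : P i0 ->
  exists2 i, P i & forall j, P j -> G j <= G i.
Proof.
by move=> Pi0; case: (@Order.TotalTheory.arg_maxP _ _ _ i0 P G Pi0) => i Pi imax; exists i.
Qed.

(** A dichotomy: either one class dominates all the others, at the price 1 + 2 t, or a second class
    is comparable to the largest one and the bilinear term takes over, with a constant depending on
    [t]. *)
Lemma bilinear_pointwise (G : 'I_(p ^ 1) -> R) (Fv t : R) r : (1 < r)%N -> 0 < t ->
  (forall i, 0 <= G i) -> 0 <= Fv ->
  (forall i, Fv <= (1 + t) * G i + (1 + t^-1) * ((p ^ 1)%:R * \sum_(j | j != i) G j)) ->
  Fv ^+ r <= (1 + 2 * t) ^+ r * (\sum_i G i ^+ r) +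
   ((1 + t) * ((1 + t^-1) * p%:R ^+ 2 / t) + (1 + t^-1) * p%:R ^+ 2) ^+ r *
     \sum_i \sum_(j | j != i) G i * G j ^+ r.-1.
Proof.
move=> r1 t0 G0 F0 H; rewrite expn1 in G G0 H *.
have r0 : (0 < r)%N by lia.
pose i0 : 'I_p := Ordinal p_gt0.
have [i _ imax] := @exists_argmax _ predT G i0 isT.
set M := p%:R : R; have M0 : 0 < M by rewrite ltr0n.
have t10 : 0 < 1 + t^-1 by rewrite addr_gt0// invr_gt0.
set C := (1 + t) * _ + _.
have Cp : 0 < C by rewrite addr_gt0 ?mulr_gt0 ?divr_gt0 ?exprn_gt0 ?invr_gt0// ?addr_gt0// ?mulr_gt0 ?exprn_gt0.
have P1 : 0 <= \sum_i G i ^+ r by apply: sumr_ge0 => j _; exact: exprn_ge0.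
have P2 : 0 <= \sum_i \sum_(j | j != i) G i * G j ^+ r.-1.
  by apply: sumr_ge0 => a _; apply: sumr_ge0 => b _; rewrite mulr_ge0// exprn_ge0.
(* The threshold below which all the other classes together add at most t times the largest one. *)
pose ka := t / ((1 + t^-1) * M ^+ 2).
have kap : 0 < ka by rewrite divr_gt0// mulr_gt0// exprn_gt0.
have [[j [ji jbig]]|small] := pselect (exists j, j != i /\ ka * G i < G j).
  have [j' [j'i j'max jj]] : exists j', [/\ j' != i, (forall k, k != i -> G k <= G j') & G j <= G j'].
    have [j' j'i j'max] := @exists_argmax _ (fun j => j != i) G j ji.
    by exists j'; split => //; apply: j'max.
  have hsum : \sum_(k | k != i) G k <= M * G j'.
    apply: le_trans (_ : \sum_(k < p) G j' <= _); last by rewrite sumr_const card_ord mulr_natl.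
    rewrite big_mkcond /=; apply: ler_sum => k _; case: ifP => // hk; exact: j'max.
  have hF : Fv <= C * G j'.
    apply: le_trans (H i) _; rewrite /C [leRHS]mulrDl; apply: lerD; last first.
      rewrite -!mulrA ler_wpM2l ?(ltW t10)//.
      by rewrite -/M ler_wpM2l// ltW.
    rewrite -mulrA ler_wpM2l//; first by rewrite addr_ge0// ltW.
    have : G i <= G j' / ka by rewrite ler_pdivlMr// mulrC; apply: ltW; exact: lt_le_trans jj.
    by rewrite /ka invf_div [_ / t * _]mulrC.
  apply: le_trans (_ : C ^+ r * (G i * G j' ^+ r.-1) <= _).
    apply: le_trans (_ : (C * G j') ^+ r <= _).
      by rewrite lerXn2r ?nnegrE ?mulr_ge0// ltW.
    rewrite exprMn ler_wpM2l ?exprn_ge0 ?(ltW Cp)//.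
    by rewrite -[in leLHS](prednK r0) exprS ler_wpM2r ?exprn_ge0//; apply: imax.
  apply: le_trans (_ : C ^+ r * \sum_i \sum_(j | j != i) G i * G j ^+ r.-1 <= _); last first.
    by rewrite lerDr mulr_ge0// exprn_ge0// addr_ge0// mulr_ge0// ltW.
  rewrite ler_wpM2l ?exprn_ge0 ?(ltW Cp)//.
  rewrite (bigD1 i)//= (bigD1 j')//= -addrA lerDl addr_ge0//.
    by apply: sumr_ge0 => b _; rewrite mulr_ge0// exprn_ge0.
  by apply: sumr_ge0 => a _; apply: sumr_ge0 => b _; rewrite mulr_ge0// exprn_ge0.
have hsum : \sum_(k | k != i) G k <= M * (ka * G i).
  apply: le_trans (_ : \sum_(k < p) ka * G i <= _); last by rewrite sumr_const card_ord mulr_natl.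
  rewrite big_mkcond /=; apply: ler_sum => k _; case: ifP => hk.
    by rewrite leNgt; apply/negP => hlt; apply: small; exists k.
  by rewrite mulr_ge0// ltW.
have hF : Fv <= (1 + 2 * t) * G i.
  apply: le_trans (H i) _.
  have -> : (1 + 2 * t) * G i = (1 + t) * G i + (1 + t^-1) * (M * (M * (ka * G i))).
    by rewrite /ka; field; rewrite !gt_eqF// ?mulr_gt0//; nra.
  by rewrite lerD2l ler_wpM2l ?(ltW t10)// ler_wpM2l// ltW.
apply: le_trans (_ : (1 + 2 * t) ^+ r * G i ^+ r <= _).
  by rewrite -exprMn lerXn2r ?nnegrE// mulr_ge0// addr_ge0// mulr_ge0// ltW.
apply: le_trans (_ : (1 + 2 * t) ^+ r * \sum_i G i ^+ r <= _); last first.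
  by rewrite lerDl mulr_ge0// exprn_ge0// ltW.
rewrite ler_wpM2l ?exprn_ge0//; first by rewrite addr_ge0// mulr_ge0// ltW.
by rewrite (bigD1 i)//= lerDl; apply: sumr_ge0 => b _; exact: exprn_ge0.
Qed.

End SmallCases.

(** * From bilinear to linear decoupling *)

Section LinearToBilinear.
Variables (R : realType) (p : nat) (pp : prime p).
Implicit Types (S : seq nat) (rho w : nat -> R) (K : R).

Let p_gt0 : (0 < p)%N. Proof. exact: prime_gt0. Qed.
Let pX_gt0 a : (0 < p ^ a)%N. Proof. by rewrite expn_gt0 p_gt0. Qed.

(** A dominant class is rescaled by p and uses n - 1 scales. A pair of distinct classes modulo p is
    cut into classes modulo p^a and p^b by Cauchy-Schwarz; the price p^(a + 2 b tri k) is what the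
    gain of the iteration has to beat. *)
Lemma Dec_of_Bil k n a b t K1 K2 : (1 < k)%N -> (0 < a <= n)%N -> (0 < b <= n)%N ->
  0 < t -> 0 <= K1 -> 0 <= K2 -> Dec p k (n - 1) K1 -> Bil p k 1 a b n K2 ->
  Dec p k n ((1 + 2 * t) ^+ tri k * K1 +
    ((1 + t) * ((1 + t^-1) * p%:R ^+ 2 / t) + (1 + t^-1) * p%:R ^+ 2) ^+ tri k *
    (p%:R ^+ (a + 2 * b * tri k) * K2)).
Proof.
move=> k1 /andP[a0 an] /andP[b0 bn] t0 K10 K20 D B N phi S rho w kn cphi w0 hw.
have k0 : (0 < k)%N by lia.
set r := tri k.
have r1 : (1 < r)%N by have := tri2 k; rewrite -/r; nia.
have r0 : (0 < r)%N by lia.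
have r10 : (0 < r.-1)%N by lia.
set M : R := p%:R.
have M1 : 1 <= M by rewrite ler1n.
set C := (1 + t) * _ + _.
have t10 : 0 <= 1 + t^-1 by rewrite addr_ge0// invr_ge0 ltW.
have C0 : 0 <= C.
  by rewrite addr_ge0 ?mulr_ge0 ?exprn_ge0 ?invr_ge0 ?(ltW t0)// addr_ge0// ltW.
pose G (i : 'I_(p ^ 1)) (c : vec k (p ^ N)) := FS phi rho (fr p 1 i S) c.
have G0 i c : 0 <= G i c by exact: FS_ge0.
pose V i := WS p n 1 i w.
have V0 i : 0 <= V i by exact: WS_ge0.
have VS : \sum_(i < p ^ 1) V i = \sum_(z < p ^ n) w z.
  have := WS_split pp 0 w (_ : (0 <= 1 <= n)%N).
  rewrite /WS expn0 => /(_ (leq_trans a0 an)).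
  have e x : (x %% 1 == 0)%N = true by rewrite modn1.
  rewrite (eq_bigl (fun=> true)); last by move=> z; rewrite e.
  by rewrite [in X in _ = X](eq_bigl (fun=> true)); last by move=> z; rewrite e.
have pw c : FS phi rho S c ^+ r <= (1 + 2 * t) ^+ r * (\sum_i G i c ^+ r) +
   C ^+ r * \sum_i \sum_(j | j != i) G i c * G j c ^+ r.-1.
  apply: (bilinear_pointwise pp (G := G^~ c)) => // [|i]; first exact: FS_ge0.
  apply: le_trans (@nrm2_split R _ S (fun x => x %% p ^ 1 == i)%N _ t t0) _.
  rewrite lerD2l ler_wpM2l//.
  apply: le_trans (@nrm2_classes R _ _ (fun x => x %% p ^ 1)%N (p ^ 1) (fun j => j != i)%N _ _) _.
    by move=> x; rewrite mem_filter ltn_pmod// => /andP[].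
  rewrite ler_wpM2l// ler_sum// => j ji.
  rewrite /G /FS /fr -filter_predI (eq_filter (a2 := fun x => (x %% p ^ 1 == j)%N))// => x /=.
  by case: eqP => // ->.
have t1 : tri 1 = 1%N by [].
have cross (i j : 'I_(p ^ 1)) : j != i ->
    avg (fun c => G i c * G j c ^+ r.-1) <= M ^+ (a + 2 * b * r) * K2 * (V i * V j ^+ r.-1).
  move=> ji.
  have Gi c : G i c <= M ^+ a * \sum_(z < p ^ a | (z %% p ^ 1 == i)%N) FS phi rho (fr p a z S) c.
    by rewrite -natrX; exact: FS_classes.
  have Gj c : G j c ^+ r.-1 <= M ^+ (2 * b * r.-1) *
      \sum_(z < p ^ b | (z %% p ^ 1 == j)%N) FS phi rho (fr p b z S) c ^+ r.-1.
    have s0 : 0 <= \sum_(z < p ^ b | (z %% p ^ 1 == j)%N) FS phi rho (fr p b z S) c.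
      by apply: sumr_ge0 => z _; exact: FS_ge0.
    apply: le_trans (_ : ((p ^ b)%:R * \sum_(z < p ^ b | (z %% p ^ 1 == j)%N) FS phi rho (fr p b z S) c) ^+ r.-1 <= _).
      by rewrite lerXn2r ?nnegrE ?mulr_ge0 ?G0// FS_classes.
    rewrite exprMn.
    have -> : M ^+ (2 * b * r.-1) = (p ^ b)%:R ^+ r.-1 * (p ^ b)%:R ^+ r.-1.
      by rewrite -exprD natrX -exprM; congr (_ ^+ _); ring.
    rewrite -mulrA ler_wpM2l ?exprn_ge0//.
    have := powsum_le (fun z : 'I_(p ^ b) => (z %% p ^ 1 == j)%N) r10 (x := fun z : 'I_(p ^ b) => FS phi rho (fr p b z S) c).
    by rewrite card_ord; apply => z; exact: FS_ge0.
  apply: le_trans (_ : M ^+ (a + 2 * b * r.-1) * (K2 * (V i * V j ^+ r.-1)) <= _); last first.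
    rewrite !mulrA ler_wpM2r ?exprn_ge0// ler_wpM2r// ler_wpM2r// ler_weXn2l//.
    by rewrite leq_add2l leq_mul2l leq_pred orbT.
  apply: le_trans (_ : avg (fun c : vec k (p ^ N) => M ^+ (a + 2 * b * r.-1) *
     (\sum_(z < p ^ a | (z %% p ^ 1 == i)%N) \sum_(y < p ^ b | (y %% p ^ 1 == j)%N)
        FS phi rho (fr p a z S) c ^+ tri 1 * FS phi rho (fr p b y S) c ^+ (tri k - tri 1))) <= _).
    apply: ler_avg => c.
    apply: le_trans (ler_pM (G0 _ _) _ (Gi c) (Gj c)) _; first by rewrite exprn_ge0.
    rewrite mulrACA -exprD ler_wpM2l ?exprn_ge0// mulr_suml ler_sum// => z _.
    by rewrite mulr_sumr ler_sum// => y _; rewrite t1 expr1 subn1.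
  rewrite avgZ ler_wpM2l ?exprn_ge0// avg_sum.
  apply: le_trans (_ : \sum_(z < p ^ a | (z %% p ^ 1 == i)%N) \sum_(y < p ^ b | (y %% p ^ 1 == j)%N)
      K2 * (WS p n a z w * WS p n b y w ^+ r.-1) <= _).
    apply: ler_sum => z /eqP hz; rewrite avg_sum; apply: ler_sum => y /eqP hy.
    have := B N phi S rho w z y kn cphi w0 hw (ltn_ord z) (ltn_ord y).
    have -> : (z %% p != y %% p)%N.
      apply: contra ji => /eqP e; rewrite -val_eqE /=; apply/eqP.
      by rewrite -hz -hy expn1 e.
    by move=> /(_ isT); rewrite [in leRHS]t1 expr1 subn1.
  have -> : \sum_(z < p ^ a | (z %% p ^ 1 == i)%N) \sum_(y < p ^ b | (y %% p ^ 1 == j)%N)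
      K2 * (WS p n a z w * WS p n b y w ^+ r.-1) =
     K2 * ((\sum_(z < p ^ a | (z %% p ^ 1 == i)%N) WS p n a z w) *
      \sum_(y < p ^ b | (y %% p ^ 1 == j)%N) WS p n b y w ^+ r.-1).
    by rewrite mulr_suml mulr_sumr; apply: eq_bigr => z _; rewrite !mulr_sumr.
  rewrite ler_wpM2l// (WS_split pp) ?a0// ler_wpM2l ?V0//.
  rewrite /V -(WS_split pp j w (_ : (1 <= b <= n)%N)) ?b0//.
  apply: (@sumX_le R _ (fun y : 'I_(p ^ b) => (y %% p ^ 1 == j)%N) (fun y : 'I_(p ^ b) => WS p n b y w)) => // y.
  exact: WS_ge0.
apply: le_trans (ler_avg pw) _; rewrite avgD !avgZ [leRHS]mulrDl; apply: lerD.
  rewrite -mulrA ler_wpM2l ?exprn_ge0//; first by rewrite addr_ge0// mulr_ge0// ltW.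
  rewrite avg_sum -VS.
  apply: le_trans (_ : \sum_(i < p ^ 1) K1 * V i ^+ r <= _).
    apply: ler_sum => i _.
    by apply: (rescale_cls pp k0 _ (ltn_ord i) cphi D K10 kn w0 hw); exact: leq_trans an.
  rewrite -mulr_sumr ler_wpM2l//.
  by apply: (@sumX_le R _ predT (fun i : 'I_(p ^ 1) => V i)).
rewrite -mulrA ler_wpM2l ?exprn_ge0// avg_sum.
set Z := M ^+ _ * K2.
have Z0 : 0 <= Z by rewrite mulr_ge0// exprn_ge0.
apply: le_trans (_ : \sum_(i < p ^ 1) \sum_(j < p ^ 1) Z * (V i * V j ^+ r.-1) <= _).
  apply: ler_sum => i _; rewrite avg_sum big_mkcond /=; apply: ler_sum => j _.
  by case: ifP => // ji; [exact: cross | rewrite mulr_ge0// mulr_ge0// exprn_ge0].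
have -> : \sum_(i < p ^ 1) \sum_(j < p ^ 1) Z * (V i * V j ^+ r.-1) =
   Z * ((\sum_(i < p ^ 1) V i) * \sum_(j < p ^ 1) V j ^+ r.-1).
  by rewrite mulr_suml mulr_sumr; apply: eq_bigr => i _; rewrite !mulr_sumr.
rewrite ler_wpM2l// VS -[in leRHS](prednK r0) exprS ler_wpM2l ?sumr_ge0//.
rewrite -VS.
by apply: (@sumX_le R _ predT (fun i : 'I_(p ^ 1) => V i)).
Qed.

End LinearToBilinear.

(** * The bilinear iteration *)

Section DecouplingExponents.
Variables (R : realType) (p : nat) (pp : prime p).
Implicit Types (K e : R).

Let p_gt1 : (1 < p)%N. Proof. exact: prime_gt1. Qed.

Definition pe e : R := p%:R `^ e.

Lemma pe_gt0 e : 0 < pe e. Proof. by rewrite powR_gt0// ltr0n; lia. Qed.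

Lemma pe_ge0 e : 0 <= pe e. Proof. exact/ltW/pe_gt0. Qed.

Lemma peD e e' : pe (e + e') = pe e * pe e'.
Proof. by rewrite /pe powRD// pnatr_eq0; apply/implyP => _; lia. Qed.

Lemma pe_le e e' : e <= e' -> pe e <= pe e'.
Proof. by move=> h; rewrite /pe ler_powR// ler1n; lia. Qed.

Lemma peX e n : pe e ^+ n = pe (n%:R * e).
Proof. by rewrite /pe mulrC powRrM powR_mulrn// powR_ge0. Qed.

Lemma pe_nat n : pe n%:R = p%:R ^+ n.
Proof. by rewrite /pe powR_mulrn. Qed.

Lemma pe_unbounded (x : R) : exists2 C : R, 0 <= C & x <= pe C.
Proof.
have [x0|x0] := leP x 0; first by exists 0 => //; rewrite (le_trans x0)// pe_ge0.
exists (Num.truncn x).+1%:R => //; rewrite pe_nat.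
apply: le_trans (ltW (truncnS_gt x)) _.
rewrite -natrX ler_nat; apply: ltnW; exact: ltn_expl.
Qed.

Lemma pe_ge2 : 2 <= pe 1. Proof. by rewrite -[1]/(1%:R) pe_nat expr1 ler_nat. Qed.

(* Decoupling with constant O(p^(eta n)). *)
Definition DecE k (eta : R) := exists2 C, 0 <= C & forall n, Dec p k n (pe (eta * n%:R + C)).

Lemma DecE_mono k eta eta' : eta <= eta' -> DecE k eta -> DecE k eta'.
Proof.
move=> h [C C0 D]; exists C => // n; apply: Dec_mono (D n).
by rewrite pe_le// lerD2r ler_wpM2r.
Qed.

Lemma Dec_uniform k (eps : R) : (forall l, (0 < l < k)%N -> DecE l eps) ->
  exists2 C, 0 <= C & forall l n, (0 < l < k)%N -> Dec p l n (pe (eps * n%:R + C)).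
Proof.
elim: k => [|k IH] H; first by exists 0 => // l n /andP[]; lia.
have [|C C0 HC] := IH; first by move=> l /andP[l0 lk]; apply: H; rewrite l0 ltnW.
have [k0|k0] := posnP k; first by exists 0 => // l n; rewrite k0; lia.
have [|C' C'0 HC'] := H k; first by rewrite k0 /=.
exists (C + C') => [|l n /andP[l0 lk]]; first exact: addr_ge0.
have [e|ne] := eqVneq l k.
  by rewrite e; apply: Dec_mono (HC' n); rewrite pe_le// lerD2l lerDr.
by apply: Dec_mono (HC l n _); [rewrite pe_le// lerD2l lerDl | rewrite l0; lia].
Qed.

Section IterationStep.
Variables (k : nat) (k1 : (1 < k)%N) (kp : (k < p)%N) (eta : R) (eta0 : 0 < eta).
Hypothesis IH : forall l, (0 < l < k)%N -> forall eps : R, 0 < eps -> DecE l eps.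
Hypothesis HD : DecE k eta.

Let K : R := k%:R.

Lemma Bil_mono l a b n (K1 K2 : R) : K1 <= K2 -> Bil p k l a b n K1 -> Bil p k l a b n K2.
Proof.
move=> h B N phi S rho w xi et kn cphi w0 hw hx he ne.
apply: le_trans (B N phi S rho w xi et kn cphi w0 hw hx he ne) _.
by rewrite ler_wpM2r// mulr_ge0 ?exprn_ge0 ?WS_ge0.
Qed.

(** The first scale is tied to the second by l a = (k - l + 1) b, the balance that [Bil_lower]
    permits. A gain proportional to l (k - l) b reproduces itself under the Hoelder step, because
    the swapped level k - l runs with second scale a; each round adds a share of the gain eta b
    available at level zero. Powers of k! keep all scales integral, and powers of k keep them below
    n. *)
Lemma iter_step r eps : 0 < eps -> exists2 C, 0 <= C & forall n b l,
  (0 < b)%N -> (k`! ^ r.+1 %| b)%N -> (k ^ r.+1 * b <= n)%N -> (0 < l < k)%N ->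
  Bil p k l ((k - l).+1 * (b %/ l)) b n
    (pe (eta * n%:R + eps * n%:R + C - r%:R * (eta / K ^+ 2) * (l%:R * (K - l%:R)) * b%:R)).
Proof.
have K0 : 0 < K by rewrite ltr0n; lia.
have hK n b r' : (k ^ r'.+1 * b <= n)%N -> (k * b <= n)%N.
  move=> h; apply: leq_trans h; rewrite leq_mul2r; apply/orP; right.
  by rewrite expnS leq_pmulr// expn_gt0; lia.
have dvl l b r' : (0 < l < k)%N -> (k`! ^ r'.+1 %| b)%N -> (l %| b)%N.
  move=> /andP[l0 lk] h; apply: dvdn_trans h; rewrite expnS dvdn_mulr// dvdn_fact// l0 ltnW//.
elim: r eps => [|r IHr] eps eps0.
  have [C C0 D] := HD; exists (C + 1) => [|n b l b0 db kb lk]; first exact: addr_ge0.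
  have := hK _ _ _ kb => kbn.
  have lb := dvl _ _ _ lk db.
  have [l0 lk'] := andP lk.
  have bl0 : (0 < b %/ l)%N by rewrite divn_gt0// dvdn_leq.
  have an : ((k - l).+1 * (b %/ l) <= n)%N.
    apply: leq_trans kbn; rewrite leq_mul ?leq_div//; move: l0 lk'; clear; lia.
  have bn : (b <= n)%N by apply: leq_trans kbn; rewrite leq_pmull// ltnW.
  apply: (@Bil_mono _ _ _ _ (2 * pe (eta * n%:R + C))).
    rewrite mul0r !mul0r subr0.
    apply: le_trans (_ : pe 1 * pe (eta * n%:R + C) <= _).
      by rewrite ler_wpM2r ?pe_ge0// pe_ge2.
    rewrite -peD pe_le//; have : 0 <= eps * n%:R by rewrite mulr_ge0// ltW.
    lra.
  apply: (Bil_base pp lk) => //.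
  - by rewrite muln_gt0 /= bl0.
  - by rewrite b0.
  - exact: pe_ge0.
  - by apply: Dec_mono (D _); rewrite pe_le// lerD2r ler_wpM2l ?(ltW eta0)// ler_nat leq_subr.
  - by apply: Dec_mono (D _); rewrite pe_le// lerD2r ler_wpM2l ?(ltW eta0)// ler_nat leq_subr.
have eps20 : 0 < eps / 2 by rewrite divr_gt0.
have [C1 C10 H1] := IHr _ eps20.
have [C0 C00 D0] := HD.
(* At most 2 k decouplings of lower degree are used, each costing eps' n; together they stay below
   half of eps n. *)
pose eps' := eps / (4 * K).
have eps'0 : 0 < eps' by rewrite divr_gt0// mulr_gt0.
have [|C2 C20 D2] := @Dec_uniform k eps'; first by move=> l lk; exact: IH.
exists (C0 + C1 + 2 * K * C2) => [|n b l b0 db kb lk].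
  by rewrite !addr_ge0// !mulr_ge0// ltW.
have kbn := hK _ _ _ kb.
have bn : (b <= n)%N by apply: leq_trans kbn; rewrite leq_pmull// ltnW.
pose t := r%:R * (eta / K ^+ 2).
pose X := eps' * n%:R + C2.
have X0 : 0 <= X by rewrite addr_ge0// mulr_ge0// ltW.
(* Target at level l: the old gain with the factor [t], and a new gain (k - l) / k times eta b,
   which is all of eta b at level zero and decreases linearly in l. *)
pose E l := eta * n%:R + eps / 2 * n%:R + (C0 + C1) + 2 * l%:R * X
   - t * (l%:R * (K - l%:R)) * b%:R - (K - l%:R) / K * eta * b%:R.
pose aa l := ((k - l).+1 * (b %/ l))%N.
have DX l' m : (0 < l' < k)%N -> (m <= n)%N -> Dec p l' m (pe X).
  move=> h mn; apply: Dec_mono (D2 l' m h).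
  by rewrite pe_le// lerD2r ler_wpM2l ?(ltW eps'0)// ler_nat.
(* Inner induction on the level. Any first scale up to [aa l'] is allowed, since it can be refined
   to [aa l'] by decoupling of degree l'. *)
have Q l' : (l' < k)%N -> forall a, (0 < a)%N -> ((0 < l')%N -> (a <= aa l')%N) ->
    Bil p k l' a b n (pe (E l')).
  elim: l' => [|l' IHl] lk' a a0 ha.
    apply: (@Bil_mono _ _ _ _ (pe (eta * (n - b)%:R + C0))).
      have -> : E 0%N = eta * n%:R + eps / 2 * n%:R + (C0 + C1) - eta * b%:R.
        by rewrite /E mulr0n; field; rewrite gt_eqF.
      rewrite pe_le// natrB//.
      have : 0 <= eps / 2 * n%:R by rewrite mulr_ge0// ltW.
      lra.
    by apply: (Bil0 pp) => //; [rewrite b0|exact: pe_ge0].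
  have lk0 : (0 < l'.+1 < k)%N by [].
  pose m := (k - l'.+1)%N.
  have m0 : (0 < m)%N by rewrite /m subn_gt0.
  have mk : (0 < m < k)%N by rewrite m0 /m ltn_subrL /= (leq_ltn_trans (leq0n _) lk').
  have lb := dvl _ _ _ lk0 db.
  have eaN : (l'.+1 * aa l'.+1 = m.+1 * b)%N.
    by rewrite /aa -/m mulnCA [(l'.+1 * _)%N]mulnC divnK.
  have bl0 : (0 < b %/ l'.+1)%N by rewrite divn_gt0// dvdn_leq.
  have al0 : (0 < aa l'.+1)%N by rewrite muln_gt0 /= bl0.
  have alk : (aa l'.+1 <= k * b)%N.
    by rewrite leq_mul ?leq_div//; case/andP: mk.
  have aln : (aa l'.+1 <= n)%N by exact: leq_trans kbn.
  have kK : K = l'.+1%:R + m%:R by rewrite -natrD /K /m subnKC// ltnW.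
  have eaR : l'.+1%:R * (aa l'.+1)%:R = (m%:R + 1) * b%:R :> R.
    by rewrite -natrM eaN natrM -natr1.
  have da : (k`! ^ r.+1 %| aa l'.+1)%N.
    apply: dvdn_mull; rewrite dvdn_divRL//; apply: dvdn_trans db.
    by rewrite [(k`! ^ r.+2)%N]expnSr dvdn_mul// dvdn_fact//= ltnW.
  have ka : (k ^ r.+1 * aa l'.+1 <= n)%N.
    apply: leq_trans kb; rewrite [(k ^ r.+2)%N]expnSr -mulnA leq_mul2l alk orbT//.
  have := H1 n (aa l'.+1) m al0 da ka mk.
  have -> : (k - m = l'.+1)%N by rewrite /m subKn// ltnW.
  have ma : (m %| aa l'.+1)%N by exact: dvl da.
  set a' := (l'.+2 * (aa l'.+1 %/ m))%N => Bm.
  have ea' : (m * a' = l'.+2 * aa l'.+1)%N.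
    by rewrite /a' mulnCA [(m * _)%N]mulnC divnK.
  have a'n : (a' <= n)%N.
    apply: leq_trans (_ : k * aa l'.+1 <= _)%N.
      by rewrite /a' leq_mul ?leq_div//; rewrite /m in m0; lia.
    exact: hK ka.
  have ba' : (b <= a')%N.
    rewrite -(leq_pmul2l (_ : 0 < m * l'.+1)%N); last by rewrite muln_gt0 m0.
    rewrite [(m * _)%N]mulnC -[leqRHS]mulnA ea' mulnCA eaN mulnA.
    by rewrite leq_mul2r; apply/orP; right; rewrite leq_mul.
  have km : (k - m = l'.+1)%N by rewrite /m subKn// ltnW.
  have h1 : (b <= a' <= n)%N by rewrite ba' a'n.
  have h2 : (0 < aa l'.+1 <= n)%N by rewrite al0 aln.
  have h3 : (m * a' <= aa l'.+1 * (k - m).+1)%N by rewrite ea' km mulnC.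
  (* The previous round gives the swapped form with first scale a' >= b; decoupling of degree m
     brings it to the scale b that the interpolation needs. *)
  have Bm2 := Bil_lower pp kp mk b0 h1 h2 h3 (pe_ge0 _) (pe_ge0 X)
    (DX m (a' - b)%N mk (leq_trans (leq_subr _ _) a'n)) Bm.
  rewrite -peD in Bm2.
  have Bl : Bil p k l' (aa l'.+1) b n (pe (E l')).
    apply: IHl => // [|l'0]; first exact: ltnW.
    have lb' : (l' %| b)%N by apply: dvl db; rewrite l'0 ltnW.
    rewrite -(leq_pmul2l (_ : 0 < l' * l'.+1)%N); last by rewrite muln_gt0 l'0.
    have e2 : (l' * aa l' = (k - l').+1 * b)%N.
      by rewrite /aa mulnCA [(l' * _)%N]mulnC divnK.
    rewrite -mulnA eaN [(l' * l'.+1)%N]mulnC -[leqRHS]mulnA e2 !mulnA leq_mul2r; apply/orP; right.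
    by rewrite leq_mul// ltnS leq_sub2l.
  pose Es := eta * n%:R + eps / 2 * n%:R + (C0 + C1) + (2 * l'.+1%:R - 1) * X
    - t * (l'.+1%:R * (K - l'.+1%:R)) * b%:R - (K - l'.+1%:R) / K * eta * b%:R.
  have BEs : Bil p k l'.+1 (aa l'.+1) b n (pe Es).
    apply: (Bil_holder pp lk0 aln bn (pe_gt0 _) (pe_gt0 _) (pe_gt0 _) _ Bm2 Bl).
    rewrite -/m !peX -peD pe_le// /E /Es -/t.
    have Kne : K != 0 by rewrite gt_eqF.
    have em : K - m%:R = l'.+1%:R by rewrite kK addrK.
    have el : K - l'.+1%:R = m%:R by rewrite kK addrAC subrr add0r.
    have el' : K - l'%:R = m%:R + 1 by rewrite -el -natr1; ring.
    rewrite em el el'.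
    have l1 : l'.+1%:R = l'%:R + 1 :> R by rewrite -natr1.
    have ht : t * (m%:R * l'.+1%:R) * (aa l'.+1)%:R = t * m%:R * ((m%:R + 1) * b%:R).
      by rewrite -eaR; ring.
    rewrite ht -[m.+1%:R]natr1 l1.
    have m1 : 1 <= m%:R :> R by rewrite ler1n.
    have l'0 : 0 <= l'%:R :> R by [].
    have -> : (m%:R + 1) / K * eta * b%:R = (m%:R / K * eta * b%:R) * ((m%:R + 1) / m%:R).
      by field; rewrite Kne gt_eqF// (lt_le_trans ltr01 m1).
    set Y := m%:R / K * eta * b%:R.
    have hY : m%:R * (Y * ((m%:R + 1) / m%:R)) = (m%:R + 1) * Y by field; rewrite gt_eqF// (lt_le_trans ltr01 m1).
    set A := eta * n%:R + eps / 2 * n%:R.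
    have -> : X + (A + C1 - t * m%:R * ((m%:R + 1) * b%:R)) +
      m%:R * (A + (C0 + C1) + 2 * l'%:R * X - t * (l'%:R * (m%:R + 1)) * b%:R - Y * ((m%:R + 1) / m%:R)) =
      X + (A + C1 - t * m%:R * ((m%:R + 1) * b%:R)) +
      m%:R * (A + (C0 + C1) + 2 * l'%:R * X - t * (l'%:R * (m%:R + 1)) * b%:R) - m%:R * (Y * ((m%:R + 1) / m%:R)) by ring.
    rewrite hY -subr_ge0.
    set Z := _ - _.
    have -> : Z = C0 + ((2 * l'%:R + 1) * (m%:R + 1) - 1 - m%:R * 2 * l'%:R) * X by rewrite /Z; ring.
    rewrite addr_ge0// mulr_ge0//.
    rewrite (_ : _ - _ - _ = 2 * l'%:R + m%:R); first by rewrite addr_ge0 ?mulr_ge0.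
    by ring.
  have -> : E l'.+1 = X + Es by rewrite /E /Es; ring.
  rewrite peD.
  apply: (@Bil_lower R p pp k l'.+1 a (aa l'.+1)) => //.
  - by rewrite ha.
  - by rewrite b0.
  - by rewrite eaN mulnC.
  - exact: pe_ge0.
  - exact: pe_ge0.
  - by apply: DX => //; apply: leq_trans (leq_subr _ _) aln.
have [l0 lk'] := andP lk.
have bl0 : (0 < b %/ l)%N by rewrite divn_gt0// dvdn_leq// (dvl _ _ _ lk db).
apply: (@Bil_mono _ _ _ _ (pe (E l))); last first.
  by apply: Q => //; rewrite muln_gt0 /= bl0.
rewrite pe_le// /E -[r.+1%:R]natr1 /X /eps'.
have lK : l%:R <= K by rewrite ler_nat ltnW.
have hl : 2 * l%:R * (eps / (4 * K) * n%:R + C2) <= eps / 2 * n%:R + 2 * K * C2.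
  apply: le_trans (_ : 2 * K * (eps / (4 * K) * n%:R + C2) <= _).
    by rewrite ler_wpM2r// ler_wpM2l.
  rewrite le_eqVlt; apply/orP; left; apply/eqP; field; rewrite gt_eqF//.
have hg : eta / K ^+ 2 * (l%:R * (K - l%:R)) * b%:R <= (K - l%:R) / K * eta * b%:R.
  rewrite ler_wpM2r//.
  have -> : (K - l%:R) / K * eta = eta / K ^+ 2 * (K * (K - l%:R)) by field; rewrite gt_eqF.
  by rewrite ler_wpM2l ?divr_ge0 ?exprn_ge0 ?(ltW eta0) ?(ltW K0)// ler_wpM2r// subr_ge0.
rewrite /t; lra.
Qed.

End IterationStep.
End DecouplingExponents.

(** * Decoupling with an arbitrarily small exponent *)

Section MeanValue.
Variables (R : realType) (p : nat) (pp : prime p).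
Implicit Types (e : R).

Let p_gt1 : (1 < p)%N. Proof. exact: prime_gt1. Qed.
Local Notation pw := (pe p).

Lemma pe_gt1 e : 0 < e -> 1 < pw e.
Proof.
move=> e0; have := @gt0_ltr_powR R e e0 1 p%:R.
by rewrite powR1; apply; rewrite ?nnegrE ?ltr1n.
Qed.

Lemma pe_inv_base e : 0 < e -> pw (- e) < 1.
Proof.
move=> e0; have := pe_gt0 pp e; have := peD pp e (- e).
rewrite subrr {1}/pe powRr0.
have := pe_gt1 e0.
set a := pw e; set b := pw (- e) => a1 ab a0.
by rewrite ltNge; apply/negP => b1; nra.
Qed.

(* Each application of iter_step gains a fixed multiple of b in the exponent, while passing from
   Dec to Bil at level b costs another fixed multiple of b; enough steps make the gain win. *)
Lemma DecE_improve k (eta0 : R) : (1 < k)%N -> (k < p)%N -> 0 < eta0 ->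
  (forall l, (0 < l < k)%N -> forall eps : R, 0 < eps -> DecE p l eps) ->
  exists2 d : R, 0 < d & forall eta, eta0 <= eta -> DecE p k eta -> DecE p k (eta - d).
Proof.
move=> k1 kp e00 IH.
have K0 : (0 : R) < k%:R by rewrite ltr0n; lia.
set K : R := k%:R in K0.
set rr := tri k.
have rr0 : (0 < rr)%N by apply: tri_gt0; lia.
pose x : R := (k + 2 * rr + 1)%:R / (eta0 / K ^+ 2 * (K - 1)).
have K1 : 0 < K - 1 by rewrite subr_gt0 ltr1n.
have den : 0 < eta0 / K ^+ 2 * (K - 1) by rewrite mulr_gt0// divr_gt0// exprn_gt0.
(* After [r] rounds the gain at level one, per unit of b, exceeds the cost k + 2 tri k of
   [Dec_of_Bil] by at least one. *)
have [r hr] : exists r : nat, (k + 2 * rr + 1)%:R <= r%:R * (eta0 / K ^+ 2 * (K - 1)).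
  by exists (Num.truncn x).+1; rewrite -ler_pdivrMr// ltW// truncnS_gt.
have [B eB] : exists B, B = (k`! ^ r.+1)%N by exists (k`! ^ r.+1)%N.
have [Q eQ] : exists Q, Q = (k ^ r.+1)%N by exists (k ^ r.+1)%N.
have B0 : (0 < B)%N by rewrite eB expn_gt0 fact_gt0.
have Q0 : (0 < Q)%N by rewrite eQ expn_gt0 (ltnW k1).
pose L := (B * Q)%N.
have L0 : (0 < L)%N by rewrite muln_gt0 B0.
(* With b close to n / Q the surplus b dominates 2 eps n, up to a constant: one half pays for the
   loss in [iter_step], the other for the improvement [d]. *)
pose eps : R := (4 * Q%:R)^-1.
have QR : (0 : R) < Q%:R by rewrite ltr0n.
have eps0 : 0 < eps by rewrite invr_gt0 mulr_gt0.
(* The same [d] serves all eta >= eta0, so finitely many improvements reach eta0. *)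
pose d := Num.min eps (eta0 / 4).
have d0 : 0 < d by rewrite lt_min eps0 divr_gt0.
have de : d <= eps by rewrite ge_min lexx.
have d4 : d <= eta0 / 4 by rewrite ge_min lexx orbT.
exists d => // eta he HD.
have eta_gt0 : 0 < eta by exact: lt_le_trans he.
have [C1 C10 H1] := iter_step pp k1 kp eta_gt0 IH HD r eps0.
(* Makes (1 + 2 t)^(tri k) equal to p^(eta0 / 4), which is less than what one scale saves. *)
pose t := (pw (eta0 / (4 * rr%:R)) - 1) / 2.
have rrR : (0 : R) < rr%:R by rewrite ltr0n.
have t0 : 0 < t.
  by rewrite divr_gt0// subr_gt0 pe_gt1// divr_gt0// mulr_gt0.
have ht : (1 + 2 * t) ^+ rr = pw (eta0 / 4).
  have -> : 1 + 2 * t = pw (eta0 / (4 * rr%:R)) by rewrite /t; field.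
  by rewrite peX//; congr pe; field; rewrite gt_eqF.
set Ct := ((1 + t) * ((1 + t^-1) * p%:R ^+ 2 / t) + (1 + t^-1) * p%:R ^+ 2) ^+ rr.
have Ct0 : 0 <= Ct.
  have t1 : 0 <= 1 + t^-1 by rewrite addr_ge0// invr_ge0 ltW.
  have t2 : 0 <= 1 + t by rewrite addr_ge0// ltW.
  by rewrite exprn_ge0// addr_ge0 ?mulr_ge0 ?exprn_ge0 ?invr_ge0 ?(ltW t0).
have g0 : 0 < 1 - pw (- (eta0 / 2)) by rewrite subr_gt0 pe_inv_base// divr_gt0.
have [C3 C30 hC3] := pe_unbounded pp (Ct * pw (C1 + B%:R) / (1 - pw (- (eta0 / 2)))).
rewrite ler_pdivrMr// in hC3.
pose C2 := C3 + (L * rr)%:R.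
have C23 : C3 <= C2 by rewrite lerDl.
exists C2; first by rewrite addr_ge0.
have ed : eta0 / 2 <= eta - d - eta0 / 4 by lra.
have ed0 : 0 <= eta - d by lra.
(* Induction on the number of scales: at each step the dominant class takes at most the share p^(-
   eta0 / 2) of the target, which leaves a fixed share to the bilinear term. Below [L] scales the
   trivial bound suffices. *)
elim=> [|n IHn].
  apply: Dec_mono (Dec_trivial (n := 0%N) pp (ltnW k1)).
  rewrite expn0 expr1n mulr0 add0r -[1](powRr0 p%:R) -/(pe p (0 : R)) pe_le//.
  by rewrite addr_ge0.
have [nL|Ln] := ltnP n.+1 L.
  apply: Dec_mono (Dec_trivial (n := n.+1) pp (ltnW k1)).
  rewrite natrX -exprM -pe_nat pe_le// -[leLHS]add0r lerD ?mulr_ge0//.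
  rewrite /C2 -[leLHS]add0r lerD// ler_nat leq_mul//; exact: ltnW.
(* A multiple of k!^(r + 1) with k^(r + 1) b <= n + 1, smaller than (n + 1) / k^(r + 1) by at most
   k!^(r + 1). *)
set b := (B * (n.+1 %/ L))%N.
have b0 : (0 < b)%N by rewrite muln_gt0 B0 divn_gt0.
have bL : (Q * b <= n.+1)%N.
  by rewrite /b mulnA [(Q * B)%N]mulnC -/L mulnC; exact: leq_divM.
have kb : (k * b <= n.+1)%N.
  apply: leq_trans bL; rewrite leq_mul2r; apply/orP; right.
  by rewrite eQ expnS leq_pmulr// expn_gt0 (ltnW k1).
have bR : n.+1%:R / Q%:R - B%:R <= b%:R :> R.
  rewrite lerBlDr ler_pdivrMr// -natrD -natrM ler_nat /b.
  by rewrite addnC -mulnS mulnAC -/L mulnC ltnW// ltn_ceil.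
have kb1 : (0 < k * b <= n.+1)%N by rewrite kb muln_gt0 b0 (ltnW k1).
have bn : (0 < b <= n.+1)%N by rewrite b0 (leq_trans _ kb)// leq_pmull// (ltnW k1).
have dB : (k`! ^ r.+1 %| b)%N by rewrite -eB; apply: dvdn_mulr; exact: dvdnn.
have lk1 : (0 < 1 < k)%N by rewrite k1.
have bL' : (k ^ r.+1 * b <= n.+1)%N by rewrite -eQ.
have := H1 n.+1 b 1%N b0 dB bL' lk1.
rewrite divn1 subn1 prednK ?(ltnW k1)// => HB.
have D1 : Dec p k (n.+1 - 1) (pw ((eta - d) * n%:R + C2)) by rewrite subn1.
have := Dec_of_Bil pp k1 kb1 bn t0 (pe_ge0 pp _) (pe_ge0 pp _) D1 HB.
apply: Dec_mono; rewrite -/rr ht -/Ct -pe_nat.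
have h1 : pw (eta0 / 4) * pw ((eta - d) * n%:R + C2) <= pw (- (eta0 / 2)) * pw ((eta - d) * n.+1%:R + C2).
  by rewrite -!peD// pe_le// -[n.+1%:R]natr1; lra.
have h2 : Ct * (pw (k * b + 2 * b * rr)%:R *
   pw (eta * n.+1%:R + eps * n.+1%:R + C1 - r%:R * (eta / K ^+ 2) * (1 * (K - 1)) * b%:R)) <=
   (1 - pw (- (eta0 / 2))) * pw ((eta - d) * n.+1%:R + C2).
  apply: le_trans (_ : Ct * (pw (C1 + B%:R) * pw ((eta - d) * n.+1%:R)) <= _).
    rewrite ler_wpM2l// -!peD// pe_le//.
    have hb : (k * b + 2 * b * rr)%:R + b%:R <= r%:R * (eta / K ^+ 2) * (1 * (K - 1)) * b%:R :> R.
      rewrite -natrD.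
      have -> : (k * b + 2 * b * rr + b = (k + 2 * rr + 1) * b)%N by ring.
      rewrite natrM ler_wpM2r//; apply: le_trans hr _.
      have -> : r%:R * (eta / K ^+ 2) * (1 * (K - 1)) = r%:R * (eta / K ^+ 2 * (K - 1)) by ring.
      rewrite ler_wpM2l// ler_wpM2r ?(ltW K1)// ler_wpM2r// invr_ge0 exprn_ge0// ltW.
    have hn : 2 * eps * n.+1%:R - B%:R <= b%:R.
      apply: le_trans bR; rewrite lerD2r [_ * n.+1%:R]mulrC ler_wpM2l//.
      rewrite /eps invfM mulrA -[leRHS]mul1r ler_wpM2r ?invr_ge0 ?(ltW QR)//.
      by rewrite ler_pdivrMr//; lra.
    have hd : d * n.+1%:R <= eps * n.+1%:R by rewrite ler_wpM2r.
    have -> : (eta - d) * n.+1%:R = eta * n.+1%:R - d * n.+1%:R by ring.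
    lra.
  rewrite mulrA [(eta - d) * _ + C2]addrC (peD pp C2) mulrA ler_wpM2r ?pe_ge0//.
  apply: le_trans hC3 _; rewrite mulrC ler_wpM2l ?(ltW g0)//.
  exact: pe_le.
apply: le_trans (lerD h1 h2) _.
by rewrite -mulrDl addrC subrK mul1r.
Qed.

Lemma DecE_tri k : (0 < k)%N -> DecE p k ((tri k)%:R : R).
Proof.
move=> k0; exists 0 => // n; apply: Dec_mono (Dec_trivial (n := n) pp k0).
by rewrite addr0 natrX -exprM -pe_nat mulnC natrM.
Qed.

(** Strong induction on the degree. In a fixed degree the exponent descends from the trivial one in
    steps [d] whose size does not shrink before [eta] is reached. *)
Lemma decoupling k (eta : R) : (0 < k < p)%N -> 0 < eta -> DecE p k eta.
Proof.
elim/ltn_ind: k eta => k IH eta /andP[k0 kp] e0.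
have [k1|k1] := leqP k 1.
  have -> : k = 1%N by lia.
  exists 0 => // n; apply: Dec_mono (Dec1 (n := n) pp).
  by rewrite addr0 -[X in X <= _](powRr0 p%:R) -/(pe p (0 : R)) pe_le// mulr_ge0// ltW.
have [|d d0 H] := DecE_improve k1 kp e0.
  by move=> l /andP[l0 lk] eps; apply: IH => //; rewrite l0 (ltn_trans lk).
have step j : DecE p k (Num.max eta ((tri k)%:R - j%:R * d)).
  elim: j => [|j IHj].
    by apply: DecE_mono (DecE_tri k0); rewrite // mulr0n mul0r subr0 le_max lexx orbT.
  apply: DecE_mono (H _ _ IHj) => //; last by rewrite le_max lexx.
  rewrite lerBlDr maxEle; case: ifP => h.
    by rewrite -lerBlDr le_max -[j.+1%:R]natr1; apply/orP; right; lra.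
  by rewrite -lerBlDr le_max; apply/orP; left; lra.
pose j := (Num.truncn ((tri k)%:R / d : R)).+1.
apply: DecE_mono (step j) => //.
rewrite ge_max lexx /= lerBlDr; apply: le_trans (_ : j%:R * d <= _); last first.
  by rewrite lerDr ltW.
by rewrite -ler_pdivrMr// ltW// truncnS_gt.
Qed.

End MeanValue.

(** * Pairs of tuples with close power sums *)

Fixpoint tup (T : Type) (S : seq T) r : seq (seq T) :=
  if r is r'.+1 then [seq z.1 :: z.2 | z <- [seq (x, a) | x <- S, a <- tup S r']] else [:: [::]].

Definition psum j (a : seq nat) : int := \sum_(x <- a) x%:Z ^+ j.+1.

Section Fibres.
Variable R : realType.

Lemma nrm2_tup (T : Type) (S : seq T) (h : T -> R) r :
  nrm2 (tup S r) (fun a => \sum_(x <- a) h x) = nrm2 S h ^+ r.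
Proof.
elim: r => [|r IH] /=.
  by rewrite /nrm2 !big_seq1 !big_nil cos0 sin0 expr1n expr0n addr0 expr0.
rewrite nrm2_map exprS -IH -nrm2_prod; congr nrm2; apply/funext => z /=.
by rewrite big_cons.
Qed.

Lemma ang_sum q (I : Type) (s : seq I) (v : I -> int) :
  \sum_(i <- s) ang R q (v i) = ang R q (\sum_(i <- s) v i).
Proof.
elim: s => [|i s IH]; last by rewrite !big_cons IH angD.
by rewrite !big_nil /ang mulr0 mul0r.
Qed.

Lemma angN q v : ang R q (- v) = - ang R q v.
Proof. by rewrite /ang intrN mulrN mulNr. Qed.

Definition mono k (j : 'I_k) : {poly int} := 'X^(j.+1).

Lemma cls_mono p k : cls p (@mono k).
Proof. by move=> j i; rewrite coefXn; case: eqP => _; rewrite /= subrr dvdz0. Qed.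

(** Orthogonality counts the pairs whose differences are congruent to [h] modulo q, which can only
    be more; bounding a cosine by one then removes [h]. So the inhomogeneous count is at most the
    mean value. *)
Lemma fibre_le_avg k (S : seq nat) r q (h : 'I_k -> int) : (0 < q)%N ->
  \sum_(a <- tup S r) \sum_(b <- tup S r) ([forall j : 'I_k, psum j a - psum j b == h j])%:R <=
  avg (fun c : vec k q => nrm2 S (fun x => ang R q (comb (@mono k) (vz c)).[x%:Z]) ^+ r).
Proof.
move=> q0.
pose D a b (j : 'I_k) := psum j a - psum j b - h j.
pose G (c : vec k q) a b : R := cos (ang R q (\sum_j vz c j * D a b j)).
apply: le_trans (_ : avg (fun c => \sum_(a <- tup S r) \sum_(b <- tup S r) G c a b) <= _); last first.
  apply: ler_avg => c.
  pose H (a : seq nat) := \sum_(x <- a) ang R q (comb (@mono k) (vz c)).[x%:Z].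
  have HE a : H a = ang R q (\sum_j vz c j * psum j a).
    rewrite /H ang_sum; congr ang; rewrite /comb.
    under eq_bigr => x _ do rewrite horner_sum.
    rewrite exchange_big; apply: eq_bigr => j _ /=.
    by rewrite /psum mulr_sumr; apply: eq_bigr => x _; rewrite hornerZ hornerXn.
  have -> : \sum_(a <- tup S r) \sum_(b <- tup S r) G c a b =
      nrm2 (tup S r) H * cos (- ang R q (\sum_j vz c j * h j)).
    rewrite -nrm2_pair_sum; apply: eq_bigr => a _; apply: eq_bigr => b _.
    rewrite /G !HE -!angN -!angD; congr (cos (ang _ _ _)).
    by rewrite -!sumrN -!big_split; apply: eq_bigr => j _ /=; rewrite /D; ring.
  by rewrite nrm2_tup -[leRHS]mulr1 ler_wpM2l ?cos_le1// exprn_ge0// nrm2_ge0.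
rewrite avg_sum; apply: ler_sum => a _; rewrite avg_sum; apply: ler_sum => b _.
have [dv|nd] := boolP [forall j, (q%:Z %| D a b j)%Z].
  have -> : avg (fun c => G c a b) = avg (fun _ : vec k q => 1).
    apply: eq_avg => c; rewrite /G.
    have [|z ->] := @ang_dvd R q (\sum_j vz c j * D a b j) q0.
      apply: (big_ind (fun z => (_ %| z)%Z)) => [|? ?|j _]; [exact: dvdz0|exact: rpredD|].
      by rewrite dvdz_mull//; exact: (forallP dv).
    by rewrite -[_ * (2 * pi)]add0r cosDz cos0.
  by rewrite (avg_cst _ (0 : vec k q)); case: forallP.
have [j hj] : exists j, ~~ (q%:Z %| D a b j)%Z by apply/existsP; rewrite -negb_forall.
pose phi (i : 'I_k) : {poly int} := (D a b i)%:P * 'X.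
have ev (c : 'I_k -> int) (x : int) : (comb phi c).[x] = (\sum_i c i * D a b i) * x.
  rewrite /comb horner_sum mulr_suml; apply: eq_bigr => i _.
  by rewrite hornerZ hornerM hornerC hornerX mulrA.
have -> : avg (fun c => G c a b) = 0.
  rewrite -[RHS](@avg_cos_eq0 R k q phi (fun i => (i == j)%:Z) 0 1 0 q0).
    apply: eq_avg => c; rewrite /G !ev mulr1 mulr0.
    by rewrite [ang R q 0](_ : _ = 0) ?subr0 ?add0r// /ang mulr0 mul0r.
  rewrite !ev mulr1 mulr0 subr0 (bigD1 j)//= eqxx mul1r big1 ?addr0// => i /negbTE ->.
  by rewrite mul0r.
have -> : [forall j : 'I_k, psum j a - psum j b == h j] = false; last by [].
apply/negbTE/negP => /forallP H; move/negP: hj; apply.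
by rewrite /D (eqP (H j)) subrr dvdz0.
Qed.

(** The Vinogradov mean value theorem. With p^n >= L the pieces modulo p^n are single points, of
    weight 1, or empty, of weight 0, and the weights add up to L. *)
Lemma fibre_bound k (eps : R) : (0 < k)%N -> 0 < eps ->
  exists2 C : R, 0 < C & forall L (h : 'I_k -> int), (0 < L)%N ->
  \sum_(a <- tup (iota 0 L) (tri k)) \sum_(b <- tup (iota 0 L) (tri k))
     ([forall j : 'I_k, psum j a - psum j b == h j])%:R <= C * L%:R ^+ tri k * L%:R `^ eps.
Proof.
move=> k0 eps0.
have [p kp pp] := prime_above k.
have kp' : (0 < k < p)%N by rewrite k0.
have [C C0 D] := decoupling pp kp' eps0.
have p1 : (0 : R) < p%:R by rewrite ltr0n prime_gt0.
exists (pe p C * p%:R `^ eps).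
  by rewrite mulr_gt0 ?pe_gt0// powR_gt0.
move=> L h L0.
pose n := up_log p L.
have Lp : (L <= p ^ n)%N by apply: up_logP; exact: prime_gt1.
have pL : (p ^ n <= p * L)%N.
  have [->|n0] := posnP n; first by rewrite expn0 muln_gt0 prime_gt0.
  rewrite -(prednK n0) expnS leq_mul//; apply: ltnW.
  by move: n0; rewrite up_log_gt0 => /andP[? ?]; exact: up_log_gtn.
have q0 : (0 < p ^ (k * n))%N by rewrite expn_gt0 prime_gt0.
apply: le_trans (fibre_le_avg _ _ h q0) _.
pose w (z : nat) : R := (z < L)%:R.
have wS : \sum_(z < p ^ n) w z = L%:R.
  transitivity (\sum_(z < p ^ n | (z < L)%N) (1 : R)).
    by rewrite [RHS]big_mkcond /=; apply: eq_bigr => z _; rewrite /w; case: ltnP.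
  by rewrite -(big_ord_widen _ (fun=> 1) Lp) sumr_const card_ord.
have := D n (k * n)%N (@mono k) (iota 0 L) (fun=> 0) w (leqnn _) (@cls_mono p k).
rewrite wS => H.
have -> : avg (fun c : vec k (p ^ (k * n)) =>
   nrm2 (iota 0 L) (fun x => ang R (p ^ (k * n)) (comb (@mono k) (vz c)).[x%:Z]) ^+ tri k) =
  avg (fun c : vec k (p ^ (k * n)) => FS (@mono k) (fun=> 0) (iota 0 L) c ^+ tri k).
  by apply: eq_avg => c; congr (_ ^+ _); apply: eq_nrm2 => x _; rewrite add0r.
apply: le_trans (H _ _) _.
- by move=> z; rewrite /w.
- move=> z zp.
  have -> : fr p n z (iota 0 L) = if (z < L)%N then [:: z] else [::].
    transitivity [seq x <- iota 0 L | x == z].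
      apply: eq_in_filter => x; rewrite mem_iota => /= xL.
      by rewrite modn_small// (leq_trans xL).
    case: ifP => zL; first by rewrite filter_pred1_uniq ?iota_uniq// mem_iota.
    rewrite -[RHS](filter_pred0 (iota 0 L)); apply: eq_in_filter => x.
    by rewrite mem_iota /= => xL; case: eqP => // e; rewrite -zL -e xL.
  rewrite /w; case: ifP => zL.
    rewrite expr1n; rewrite -[leRHS](avg_cst 1 (0 : vec k (p ^ (k * n)))).
    apply: ler_avg => c; apply: exprn_ile1; first exact: FS_ge0.
    by apply: le_trans (nrm2_le_size _ _) _; rewrite expr1n.
  rewrite expr0n gtn_eqF ?tri_gt0// /avg big1 ?mul0r// => c _.
  by rewrite FS_nil expr0n gtn_eqF ?tri_gt0.
rewrite -[leRHS]mulrA [_ ^+ _ * _]mulrC mulrA ler_wpM2r ?exprn_ge0//.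
rewrite addrC peD// -mulrA ler_wpM2l ?pe_ge0//.
rewrite -powRM ?ler0n ?(ltW p1)//.
rewrite /pe mulrC powRrM powR_mulrn ?(ltW p1)// -natrX -natrM.
by apply: ge0_ler_powR; rewrite ?nnegrE ?ler_nat// ltW.
Qed.

End Fibres.

(** * Taylor expansion and finite differences of real powers *)

Section PowerFunction.
Variable R : realType.
Implicit Types (theta v x q : R).

Lemma mvt (f df : R -> R) (a b : R) : a <= b ->
  (forall x, a <= x <= b -> is_derive x 1 f (df x)) ->
  exists2 c, a <= c <= b & f b - f a = df c * (b - a).
Proof.
move=> ab H; have [||c hc e] := @MVT_segment R f df a b ab.
- by move=> x; rewrite in_itv /= => /andP[ax xb]; apply: H; rewrite !ltW.
- apply: derivable_within_continuous => x; rewrite in_itv /= => h.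
  by have [] := H x h.
- by exists c => //; move: hc; rewrite in_itv.
Qed.

(** Generalised binomial coefficients, that is, the Taylor coefficients of (1 + u)^theta. *)
Fixpoint cb theta i : R := if i is i'.+1 then theta / i%:R * cb (theta - 1) i' else 1.

(** Falling factorials, the constants in the derivatives of x^theta. *)
Fixpoint fall theta i : R := if i is i'.+1 then theta * fall (theta - 1) i' else 1.

(** Non-integrality of theta enters here and in [fall_neq0]: no Taylor coefficient and no derivative
    of x^theta degenerates. *)
Lemma cb_neq0 theta i : theta \isn't a Num.int -> cb theta i != 0.
Proof.
elim: i theta => [|i IH] theta h /=; first exact: oner_neq0.
rewrite !mulf_neq0 ?invr_eq0 ?pnatr_eq0//.
  by apply: contra h => /eqP ->; exact: rpred0.
by apply: IH; apply: contra h => h; rewrite -(subrK 1 theta) rpredD// rpred1.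
Qed.

Lemma fall_neq0 theta i : theta \isn't a Num.int -> fall theta i != 0.
Proof.
elim: i theta => [|i IH] theta h /=; first exact: oner_neq0.
rewrite mulf_neq0//; first by apply: contra h => /eqP ->; exact: rpred0.
by apply: IH; apply: contra h => h; rewrite -(subrK 1 theta) rpredD// rpred1.
Qed.

Lemma is_derive_powR_shift theta q x : 0 < x + q ->
  is_derive x 1 (fun v => (v + q) `^ theta) (theta * (x + q) `^ (theta - 1)).
Proof.
move=> h.
have h1 : is_derive x 1 (fun v : R => v + q) 1 by exact: is_derive_shift.
have := @is_derive1_comp R (fun v : R => v `^ theta) (fun v => v + q) x _ _ (is_derive1_powR theta h) h1.
by rewrite mulr1.
Qed.

(** By induction on the order: the derivative of the remainder for theta is theta times the
    remainder of one order less for theta - 1. *)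
Lemma taylor_unit K theta : exists2 C, 0 <= C & forall u : R, `|u| <= 2^-1 ->
  `|(u + 1) `^ theta - \sum_(i < K) cb theta i * u ^+ i| <= C * `|u| ^+ K.
Proof.
elim: K theta => [|K IH] theta.
  exists (2 `^ `|theta|); first exact: powR_ge0.
  move=> u; rewrite ler_norml => /andP[u0 u1].
  rewrite big_ord0 subr0 expr0 mulr1 ger0_norm ?powR_ge0//.
  have [t0|t0] := leP 0 theta.
    by rewrite ger0_norm//; apply: ge0_ler_powR => //; rewrite ?nnegrE; lra.
  have h : (2^-1 : R) `^ (- theta) <= (u + 1) `^ (- theta) by apply: ge0_ler_powR; rewrite ?nnegrE; lra.
  have e : (2 : R) `^ (- theta) * 2^-1 `^ (- theta) = 1 by rewrite -powRM ?mulfV ?powR1// invr_ge0.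
  rewrite ltr0_norm// -{1}[theta]opprK powRN -[leLHS]mul1r ler_pdivrMr ?powR_gt0//; last lra.
  by rewrite -[leLHS]e ler_wpM2l// powR_ge0.
have [C C0 HC] := IH (theta - 1).
exists (`|theta| * C); first by rewrite mulr_ge0.
move=> u uh; have := uh; rewrite ler_norml => /andP[u0 u1].
pose P t K' : {poly R} := \poly_(i < K') cb t i.
have PE t K' x : (P t K').[x] = \sum_(i < K') cb t i * x ^+ i by rewrite horner_poly.
have dP : (P theta K.+1)^`() = theta *: P (theta - 1) K.
  apply/polyP => i; rewrite coef_deriv coefZ !coef_poly ltnS.
  case: ltnP => _; rewrite ?mul0rn ?mulr0//=.
  by rewrite -[LHS]mulr_natr mulrAC divfK// pnatr_eq0.
pose f v := (v + 1) `^ theta - (P theta K.+1).[v].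
pose df v := theta * ((v + 1) `^ (theta - 1) - (P (theta - 1) K).[v]).
have dfP x : - 2^-1 <= x -> is_derive x 1 f (df x).
  move=> x0; have hx : 0 < x + 1 by lra.
  have := is_deriveB (is_derive_powR_shift theta hx) (is_derive_poly (P theta K.+1) x).
  by rewrite dP hornerZ -mulrBr.
have f0 : f 0 = 0.
  rewrite /f add0r powR1 PE big_ord_recl /= expr0 mulr1 big1 ?addr0 ?subrr// => i _.
  by rewrite expr0n mulr0.
have [c cu e] : exists2 c, `|c| <= `|u| & `|f u| = `|df c| * `|u|.
  have [u00|u00] := leP 0 u.
    have [|c /andP[c0 cu] e] := @mvt f df 0 u u00; first by move=> x /andP[x0 _]; apply: dfP; lra.
    by exists c; [rewrite !ger0_norm//; lra|rewrite -[f u]subr0 -f0 e subr0 normrM].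
  have [|c /andP[c0 cu] e] := @mvt f df u 0 (ltW u00); first by move=> x /andP[x0 _]; apply: dfP; lra.
  exists c; first by rewrite ler0_norm// ltr0_norm//; lra.
  have -> : f u = - (df c * (0 - u)) by rewrite -e f0 sub0r opprK.
  by rewrite normrN normrM sub0r normrN.
rewrite -PE -/(f u) e /df normrM -!mulrA ler_wpM2l// PE exprSr mulrA ler_wpM2r//.
apply: le_trans (HC c _) _; first exact: le_trans uh.
by rewrite ler_wpM2l// lerXn2r ?nnegrE.
Qed.

Lemma taylor_powR K theta : exists2 C, 0 <= C & forall n x : R, 0 < n -> `|x| <= n / 2 ->
  `|(n + x) `^ theta - \sum_(i < K) cb theta i * (n `^ (theta - i%:R) * x ^+ i)|
    <= C * (n `^ (theta - K%:R) * `|x| ^+ K).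
Proof.
have [C C0 H] := taylor_unit K theta; exists C => // n x n0 xn.
have sc z i : n `^ (theta - i%:R) * z ^+ i = n `^ theta * (z / n) ^+ i.
  rewrite powRB; last by apply/implyP => _; rewrite gt_eqF.
  by rewrite powR_mulrn ?(ltW n0)// exprMn exprVn; ring.
have -> : (n + x) `^ theta = n `^ theta * (x / n + 1) `^ theta.
  rewrite -powRM ?(ltW n0)//; first by congr (_ `^ _); field; rewrite gt_eqF.
  move: xn; rewrite ler_norml => /andP[x1 x2].
  suff : 0 <= (x + n) / n by rewrite mulrDl divff// gt_eqF.
  by rewrite divr_ge0 ?(ltW n0)//; lra.
rewrite (sc `|x| K); under eq_bigr => i _ do rewrite (sc x i) mulrCA.
rewrite -mulr_sumr -mulrBr normrM ger0_norm ?powR_ge0// mulrCA ler_wpM2l ?powR_ge0//.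
have -> : `|x| / n = `|x / n| by rewrite normrM normfV [`|n|]gtr0_norm.
by apply: H; rewrite normrM normfV [`|n|]gtr0_norm// ler_pdivrMr// mulrC.
Qed.

Fixpoint dif (qs : seq R) (f : R -> R) : R -> R :=
  if qs is q :: qs' then fun v => dif qs' f (v + q) - dif qs' f v else f.

Lemma is_derive_dif qs theta x : all (fun q => 0 <= q) qs -> 0 < x ->
  is_derive x 1 (dif qs (fun v : R => v `^ theta)) (theta * dif qs (fun v : R => v `^ (theta - 1)) x).
Proof.
elim: qs x => [|q qs IH] x /= => [_ x0|/andP[q0 hq] x0]; first exact: is_derive1_powR.
have hx : 0 < x + q by lra.
have h1 : is_derive x 1 (fun v : R => v + q) 1 by exact: is_derive_shift.
have h2 := @is_derive1_comp R (dif qs (fun v : R => v `^ theta)) (fun v => v + q) x _ _ (IH _ hq hx) h1.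
have := is_deriveB h2 (IH _ hq x0).
by rewrite mulr1 -mulrBr.
Qed.

(** Each difference is removed by the mean value theorem, so the iterated difference is a single
    derivative of order [size qs] at an intermediate point, times the product of the shifts. *)
Lemma dif_powR qs theta v : all (fun q => 0 <= q) qs -> 0 < v ->
  exists2 xi, v <= xi <= v + \sum_(q <- qs) q &
   dif qs (fun v : R => v `^ theta) v = fall theta (size qs) * \prod_(q <- qs) q * xi `^ (theta - (size qs)%:R).
Proof.
elim: qs theta v => [|q qs IH] theta v /= => [_ v0|/andP[q0 hq] v0].
  by exists v; rewrite !big_nil ?addr0 ?lexx// subr0 !mul1r.
have H x : v <= x <= v + q -> is_derive x 1 (dif qs (fun v : R => v `^ theta))
    (theta * dif qs (fun v : R => v `^ (theta - 1)) x).
  by move=> /andP[vx _]; apply: is_derive_dif => //; exact: lt_le_trans vx.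
have vq : v <= v + q by rewrite lerDl.
have [c /andP[vc cq] e] := mvt vq H.
have [xi /andP[cx xc] e2] := IH (theta - 1) c hq (lt_le_trans v0 vc).
exists xi.
  by rewrite big_cons (le_trans vc cx)/= addrA (le_trans xc)// lerD2r.
rewrite e e2 big_cons.
have -> : v + q - v = q by ring.
rewrite -[(size qs).+1%:R]natr1.
have -> : theta - ((size qs)%:R + 1) = theta - 1 - (size qs)%:R by ring.
ring.
Qed.

End PowerFunction.

(** * Counting integer vectors in chains of short intervals *)

Section Chains.
Variable R : realType.

Lemma size_close_ints (l : R) (D : seq int) : 0 <= l -> uniq D ->
  {in D &, forall d d', `|(d - d')%:~R : R| <= l} -> (size D)%:R <= 2 * l + 1.
Proof.
case: D => [|d0 D'] l0; first by rewrite /=; lra.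
set D := d0 :: D' => uD H.
have [m hm] : exists m, m = Num.truncn l by eexists.
have ml : m%:R <= l by rewrite hm truncn_le.
have lm : l < m.+1%:R by rewrite hm truncnS_gt.
have hD d : d \in D -> (`|d - d0| <= m%:Z)%R.
  move=> dD; have := H d d0 dD (mem_head _ _).
  rewrite -intr_norm => h; rewrite -ltzD1 -(ltr_int R); apply: le_lt_trans h _.
  by rewrite intrD -pmulrn /= natr1.
have : (size D <= size (iota 0 (m + m).+1))%N.
  rewrite -(size_map (fun d : int => absz (d - d0 + m%:Z)%R) D); apply: uniq_leq_size.
    rewrite map_inj_in_uniq// => d d' dD d'D /=.
    by have := hD d dD; have := hD d' d'D; lia.
  move=> z /mapP[d dD ->]; rewrite mem_iota add0n /=.
  by have := hD d dD; lia.
rewrite size_iota -(ler_nat R) => /le_trans; apply.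
by rewrite -natr1 natrD; lra.
Qed.

(* A tree of depth [size ls] whose nodes at depth j have at most 2 l_j + 1 children. *)
Lemma size_chain (ls : seq R) (H : seq (seq int)) : all (fun l => 0 <= l) ls -> uniq H ->
  {in H, forall h, size h = size ls} ->
  {in H &, forall h h' j, (j < size ls)%N -> take j h = take j h' ->
     `|(nth 0 h j - nth 0 h' j)%:~R : R| <= nth 0 ls j} ->
  (size H)%:R <= \prod_(l <- ls) (2 * l + 1).
Proof.
elim: ls H => [|l ls IH] H /=.
  move=> _ uH sH _; rewrite big_nil -[1]/(1%:R) ler_nat.
  apply: (@leq_trans (size [:: [::] : seq int])) => //; apply: uniq_leq_size => // h hH.
  by rewrite (size0nil (sH h hH)).
move=> /andP[l0 ls0] uH sH dH; rewrite big_cons.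
pose hd (h : seq int) := head 0 h.
pose D := undup (map hd H).
have nc h : h \in H -> h = hd h :: behead h.
  by move=> /sH; case: h.
have sumE : size H = (\sum_(d <- D) size [seq h <- H | hd h == d])%N.
  under eq_bigr => d _ do rewrite size_filter -sum1_count big_mkcond.
  rewrite exchange_big /= -sum1_size big_seq [RHS]big_seq; apply: eq_bigr => h hH.
  rewrite -big_mkcond sum1_count; under eq_count do rewrite eq_sym.
  by rewrite (@count_uniq_mem _ D) ?undup_uniq// mem_undup map_f.
have cD d : d \in D -> (size [seq h <- H | hd h == d])%:R <= \prod_(l <- ls) (2 * l + 1).
  move=> _; rewrite -(size_map behead); apply: IH => //.
  - rewrite map_inj_in_uniq ?filter_uniq// => h h'.
    rewrite !mem_filter => /andP[/eqP e hH] /andP[/eqP e' h'H] eb.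
    by rewrite (nc h hH) (nc h' h'H) e e' eb.
  - move=> _ /mapP[h + ->]; rewrite mem_filter => /andP[_ hH].
    by rewrite size_behead sH.
  - move=> _ _ /mapP[h + ->] /mapP[h' + ->]; rewrite !mem_filter.
    move=> /andP[/eqP e hH] /andP[/eqP e' h'H] j jl tj.
    have := dH h h' hH h'H j.+1 jl; rewrite (nc h hH) (nc h' h'H) /= e e' tj.
    exact.
have sD : (size D)%:R <= 2 * l + 1.
  apply: size_close_ints => //; first exact: undup_uniq.
  move=> d d'; rewrite !mem_undup => /mapP[h hH ->] /mapP[h' h'H ->].
  have := dH h h' hH h'H 0%N isT; rewrite !take0 => /(_ erefl).
  by rewrite (nc h hH) (nc h' h'H).
rewrite sumE natr_sum.
apply: le_trans (_ : \sum_(d <- D) \prod_(l <- ls) (2 * l + 1) <= _).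
  by rewrite big_seq [leRHS]big_seq; apply: ler_sum => d; exact: cD.
have [P eP] : exists P, P = \prod_(l <- ls) (2 * l + 1) by eexists.
rewrite -eP big_const_seq count_predT iter_addr_0 -[P *+ _]mulr_natl ler_wpM2r// eP.
rewrite big_seq; apply: prodr_ge0 => x xl; have := allP ls0 x xl; lra.
Qed.

Lemma powR_bounded (e c1 c2 : R) : 0 < c1 ->
  exists2 C, 0 < C & forall t, c1 <= t <= c2 -> t `^ e <= C.
Proof.
move=> c10; exists (c1 `^ e + c2 `^ e).
  by rewrite ltr_pwDl ?powR_gt0// powR_ge0.
move=> t /andP[h1 h2]; have t0 : 0 < t by lra.
have [e0|e0] := leP 0 e.
  apply: le_trans (_ : c2 `^ e <= _); last by rewrite lerDr powR_ge0.
  by apply: ge0_ler_powR; rewrite ?nnegrE; lra.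
apply: le_trans (_ : c1 `^ e <= _); last by rewrite lerDl powR_ge0.
rewrite -[e]opprK !(powRN _ (- e)) lef_pV2 ?posrE ?powR_gt0//.
by apply: ge0_ler_powR; rewrite ?nnegrE; lra.
Qed.

Lemma powR_comparable (e c1 c2 : R) : 0 < c1 -> 0 < c2 ->
  exists2 C, 0 < C & forall z n, 0 < z -> c1 * z <= n <= c2 * z ->
    n `^ e <= C * z `^ e /\ z `^ e <= C * n `^ e.
Proof.
move=> c10 c20.
have [C1 C10 H1] := @powR_bounded e c1 c2 c10.
have [|C2 C20 H2] := @powR_bounded e c2^-1 c1^-1; first by rewrite invr_gt0.
exists (C1 + C2); first lra.
move=> z n z0 /andP[h1 h2].
have n0 : 0 < n by apply: lt_le_trans h1; rewrite mulr_gt0.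
split.
  have -> : n = (n / z) * z by field; rewrite gt_eqF.
  have q0 : 0 < n / z by rewrite divr_gt0.
  rewrite powRM ?(ltW q0) ?(ltW z0)// ler_wpM2r ?powR_ge0//.
  apply: le_trans (H1 _ _) _; last lra.
  by rewrite ler_pdivlMr// ler_pdivrMr// h1.
have q0 : 0 < z / n by rewrite divr_gt0.
rewrite -{1}[z](divfK (lt0r_neq0 n0)) powRM ?(ltW q0) ?(ltW n0)// ler_wpM2r ?powR_ge0//.
apply: le_trans (H2 _ _) _; last lra.
by rewrite ler_pdivlMr// ler_pdivrMr// ler_pdivrMl// ler_pdivlMl// h1 h2.
Qed.

Lemma finite_bound n (f : nat -> R) :
  exists2 D, 1 <= D & forall i, (i < n)%N -> f i <= D.
Proof.
exists (1 + \sum_(i < n) `|f i|); first by rewrite lerDl sumr_ge0.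
move=> i hi; rewrite (bigD1 (Ordinal hi))//= addrCA; apply: le_trans (ler_norm _) _.
by rewrite lerDl addr_ge0// sumr_ge0.
Qed.

End Chains.

Section LinearForms.
Variable R : realType.

Lemma mem_tup (T : eqType) (S : seq T) r a : a \in tup S r -> size a = r /\ {subset a <= S}.
Proof.
elim: r a => [|r IH] a /=; first by rewrite inE => /eqP ->.
move=> /mapP[_ /allpairsP[[x b] [/= xS bS ->]] ->] /=.
have [-> sb] := IH b bS; split=> // z; rewrite inE => /orP[/eqP -> //|]; exact: sb.
Qed.

Lemma prod_powR (y : R) (I : Type) (s : seq I) (g : I -> R) : 0 < y ->
  \prod_(i <- s) y `^ g i = y `^ (\sum_(i <- s) g i).
Proof.
move=> y0; elim: s => [|i s IH]; first by rewrite !big_nil powRr0.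
by rewrite !big_cons IH powRD// (gt_eqF y0) implybT.
Qed.

Lemma powR_ge1 (y e : R) : 1 <= y -> 0 <= e -> 1 <= y `^ e.
Proof. by move=> y1 e0; rewrite -(powRr0 y) ler_powR. Qed.

Lemma powRDr (y d e : R) : 0 < y -> y `^ (d + e) = y `^ d * y `^ e.
Proof. by move=> y0; rewrite powRD// (gt_eqF y0) implybT. Qed.

(* A tuple h of H is determined by successive choices of h_0, ..., h_(k-1). Once a prefix is fixed,
   the size bounds on the later terms confine the next entry to a short interval. *)
Lemma size_linear_form k (alpha E y T : R) (A : nat -> R) (H : seq (seq int)) :
  (0 < k)%N -> 1 <= E -> 1 <= y -> k%:R <= alpha + 1 -> alpha + 1 <= 2 * k%:R -> uniq H ->
  {in H, forall h, size h = k} ->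
  (forall j, (j < k)%N -> y `^ (alpha - 2 * j%:R - 1) <= E * `|A j|) ->
  (forall j h, (j < k)%N -> h \in H -> `|A j * (nth 0 h j)%:~R| <= E * y `^ (alpha - j%:R)) ->
  {in H, forall h : seq int, `|\sum_(j < k) A j * (nth 0 h j)%:~R - T| <= E} ->
  (size H)%:R <= (3 * (E * (2 * E + k%:R * (2 * E)))) ^+ k * y `^ ((tri k)%:R - alpha).
Proof.
move=> k0 E1 y1 ka ak uH sH A1 A2 A3.
have y0 : 0 < y by lra.
(* y^(g j) is the ratio between the size of the terms after j (a bounded size when j is last) and
   the coefficient [A j]. These exponents add up to tri k - alpha. *)
pose g j : R := (if (j.+1 < k)%N then alpha - j%:R - 1 else 0) - (alpha - 2 * j%:R - 1).
have [K eK] : exists K, K = E * (2 * E + k%:R * (2 * E)) by eexists.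
have K1 : 1 <= K.
  have kE : 0 <= k%:R * (2 * E) :> R by rewrite mulr_ge0 ?ler0n//; lra.
  rewrite eK -[1]mulr1 ler_pM//; lra.
have g0 j : (j < k)%N -> 0 <= g j.
  rewrite /g leq_eqVlt => /orP[/eqP e|h]; last by rewrite h; have := ler0n R j; lra.
  have -> : (j.+1 < k)%N = false by rewrite e ltnn.
  have ek : k%:R = j%:R + 1 :> R by rewrite -e -natr1.
  by lra.
have e0 j : (j < k)%N -> 0 <= (if (j.+1 < k)%N then alpha - j%:R - 1 else 0).
  move=> _; case: ltnP => // jk.
  by move: jk; rewrite -(ler_nat R) -!natr1; lra.
have := @size_chain R [seq K * y `^ g j | j <- iota 0 k] H.
rewrite size_map size_iota => /(_ _ uH sH) hc.
apply: le_trans (hc _ _) _.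
- apply/allP => _ /mapP[j _ ->]; rewrite mulr_ge0 ?powR_ge0//; lra.
- move=> h h' hH h'H j jk tj.
  rewrite (nth_map 0%N) ?size_iota// nth_iota// add0n.
  have pre i : (i < j)%N -> nth 0 h i = nth 0 h' i.
    by move=> ij; rewrite -(nth_take 0 ij) tj nth_take.
  have [d ed] : exists d : nat -> R, d = fun i => A i * (nth 0 h i - nth 0 h' i)%:~R by eexists.
  have dj i : (i < k)%N -> `|d i| <= 2 * E * y `^ (alpha - i%:R).
    move=> ik; rewrite ed intrB mulrBr; apply: le_trans (ler_normB _ _) _.
    by have := A2 i h ik hH; have := A2 i h' ik h'H; lra.
  have sd : `|\sum_(i < k) d i| <= 2 * E.
    have -> : \sum_(i < k) d i = (\sum_(i < k) A i * (nth 0 h i)%:~R - T) -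
                                (\sum_(i < k) A i * (nth 0 h' i)%:~R - T).
      rewrite opprB addrA subrK -sumrB; apply: eq_bigr => i _.
      by rewrite ed intrB mulrBr.
    by apply: le_trans (ler_normB _ _) _; have := A3 h hH; have := A3 h' h'H; lra.
  have [w ew] : exists w, w = y `^ (if (j.+1 < k)%N then alpha - j%:R - 1 else 0) by eexists.
  have w1 : 1 <= w by rewrite ew powR_ge1// e0.
  have rest : `|\sum_(i < k | i != j :> nat) d i| <= k%:R * (2 * E * w).
    apply: le_trans (ler_norm_sum _ _ _) _.
    apply: le_trans (_ : \sum_(i < k) 2 * E * w <= _); last first.
      by rewrite sumr_const card_ord [leRHS]mulr_natl.
    rewrite big_mkcond; apply: ler_sum => i _.
    have EW : 0 <= 2 * E * w by rewrite !mulr_ge0//; lra.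
    case: eqP => //= /eqP ij.
    have [lij|] := ltnP i j; first by rewrite ed pre// subrr mulr0 normr0.
    rewrite leq_eqVlt eq_sym (negPf ij) /= => lji.
    apply: le_trans (dj _ (ltn_ord i)) _; rewrite ler_wpM2l ?mulr_ge0//; first lra.
    rewrite ew (leq_ltn_trans lji (ltn_ord i)) ler_powR//.
    by move: lji; rewrite -(ler_nat R) -natr1; lra.
  have main : `|d j| <= (2 * E + k%:R * (2 * E)) * w.
    have -> : d j = \sum_(i < k) d i - \sum_(i < k | i != j :> nat) d i.
      by rewrite (bigD1 (Ordinal jk))//= addrK.
    apply: le_trans (ler_normB _ _) _.
    have : 2 * E <= 2 * E * w by rewrite ler_peMr//; lra.
    by have := rest; lra.
  have yw : y `^ (alpha - 2 * j%:R - 1) * y `^ g j = w.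
    by rewrite -powRDr// ew; congr (_ `^ _); rewrite /g; ring.
  have p0 : 0 < y `^ (alpha - 2 * j%:R - 1) by rewrite powR_gt0.
  rewrite -(ler_pM2l p0) mulrCA yw.
  apply: le_trans (ler_wpM2r (normr_ge0 _) (A1 j jk)) _.
  by rewrite -mulrA -normrM eK -mulrA ler_wpM2l//; [lra|move: main; rewrite ed].
rewrite big_map.
apply: le_trans (_ : \prod_(j <- iota 0 k) (3 * K * y `^ g j) <= _).
  rewrite big_seq [leRHS]big_seq; apply: ler_prod => j; rewrite mem_iota add0n /= => jk.
  have : 1 <= K * y `^ g j by rewrite -[1]mulr1 ler_pM// powR_ge1// g0.
  by move=> h; apply/andP; split; lra.
rewrite big_split /= big_const_seq count_predT size_iota iter_mulr_1 eK ler_wpM2l//.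
  by rewrite exprn_ge0// mulr_ge0// -eK; lra.
rewrite prod_powR//.
have -> // : \sum_(i <- iota 0 k) g i = (tri k)%:R - alpha.
case: k k0 {hc ka ak sH A1 A2 A3 eK g0 e0} @g => // k _ g.
rewrite -addn1 iotaD big_cat big_seq1 add0n {2}/g addn1 ltnn.
have -> : \sum_(i <- iota 0 k) g i = \sum_(i <- iota 0 k) i%:R.
  rewrite big_seq [RHS]big_seq; apply: eq_bigr => i; rewrite mem_iota add0n /= => ik.
  by rewrite /g ltnS ik; ring.
have s2 : (\sum_(i <- iota 0 k) i%:R) * 2 = k%:R * (k%:R - 1) :> R.
  elim: (k) => [|n IH]; first by rewrite big_nil !mul0r.
  by rewrite -addn1 iotaD big_cat big_seq1 add0n mulrDl IH natrD; ring.
move: (tri k.+1) (tri2 k.+1) => t /(congr1 (fun n : nat => n%:R : R)).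
rewrite !natrM -[k.+2%:R]natr1 -[k.+1%:R]natr1 => e3.
suff : \sum_(i <- iota 0 k) i%:R + (0 - (alpha - 2 * k%:R - 1)) = t%:R - alpha by [].
by move: e3 s2; lra.
Qed.

End LinearForms.

(** * Pairs of tuples with close sums of theta-th powers *)

Section PairCount.
Variable R : realType.

Lemma psum_le (L r : nat) a j : a \in tup (iota 0 L) r ->
  `|\sum_(x <- a) (x%:R : R) ^+ j| <= r%:R * L%:R ^+ j.
Proof.
move=> /mem_tup[<- sa]; apply: le_trans (ler_norm_sum _ _ _) _.
apply: le_trans (_ : \sum_(x <- a) (L%:R : R) ^+ j <= _); last first.
  by rewrite big_const_seq count_predT iter_addr_0 [leRHS]mulr_natl.
rewrite big_seq [leRHS]big_seq; apply: ler_sum => x /sa.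
rewrite mem_iota add0n /= => xL; rewrite ger0_norm ?exprn_ge0//.
by rewrite lerXn2r ?nnegrE// ler_nat ltnW.
Qed.

(** Up to constants, at most y^(tri k - (2 theta - 1)) vectors of differences of power sums occur,
    and each comes from at most y^(tri k + eps) pairs by the mean value theorem. Nothing depends on
    the shift [T]. *)
Lemma pair_count (theta c1 c2 eps : R) k : theta \isn't a Num.int -> (1 < k)%N ->
  k%:R <= 2 * theta -> 2 * theta < k.+1%:R -> 0 < c1 -> 0 < c2 -> 0 < eps ->
  exists2 C : R, 0 < C & forall (y n0 T : R) L, 1 <= y -> c1 * y ^+ 2 <= n0 <= c2 * y ^+ 2 ->
    (0 < L)%N -> L%:R <= c2 * y -> L%:R <= n0 / 2 ->
    \sum_(a <- tup (iota 0 L) (tri k)) \sum_(b <- tup (iota 0 L) (tri k))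
      (`|\sum_(x <- a) (n0 + x%:R) `^ theta - \sum_(x <- b) (n0 + x%:R) `^ theta - T| <= 1)%R%:R
    <= C * y `^ (2 * (tri k)%:R + 1 - 2 * theta + eps).
Proof.
move=> ni k1 k2t tk c10 c20 eps0.
have k0 : (0 < k)%N := ltnW k1.
have [Ct Ct0 HT] := taylor_powR k.+1 theta.
have [Cf Cf0 HJ] := fibre_bound k0 eps0.
have HB (i : nat) : exists B, 0 < B /\ forall z n : R, 0 < z -> c1 * z <= n <= c2 * z ->
    n `^ (theta - i%:R) <= B * z `^ (theta - i%:R) /\ z `^ (theta - i%:R) <= B * n `^ (theta - i%:R).
  by have [B B0 H] := @powR_comparable R (theta - i%:R) c1 c2 c10 c20; exists B.
have [fB hB] := choice HB.
have [B B1 hB1] := finite_bound k.+2 fB.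
have [D1 D11 hD1] := finite_bound k.+2 (fun i => `|cb theta i|).
have [D2 D21 hD2] := finite_bound k.+2 (fun i => `|cb theta i|^-1).
have [D4 D41 hD4] := finite_bound k.+2 (fun i => c2 ^+ i).
have [r er] : exists r : nat, r = tri k by eexists.
have r1 : (1 : R) <= r%:R by rewrite er ler1n tri_gt0.
have [M eM] : exists M : R, M = B * D4 by eexists.
have M1 : 1 <= M by rewrite eM -[1]mulr1 ler_pM//; lra.
have DM1 : 1 <= D1 * M by rewrite -[1]mulr1 ler_pM//; lra.
have rDM : 1 <= r%:R * (D1 * M) by rewrite -[1]mulr1 ler_pM//; lra.
have CtM : 0 <= r%:R * (Ct * M) by rewrite !mulr_ge0//; lra.
have D2B : 1 <= D2 * B by rewrite -[1]mulr1 ler_pM//; lra.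
have [E eE] : exists E : R, E = 2 * (r%:R * (D1 * M)) + 2 * (r%:R * (Ct * M)) + D2 * B by eexists.
have E1 : 1 <= E by move: eE rDM CtM D2B; clear; lra.
exists ((3 * (E * (2 * E + k%:R * (2 * E)))) ^+ k * (Cf * c2 ^+ r * c2 `^ eps)).
  rewrite mulr_gt0// ?exprn_gt0// ?mulr_gt0 ?powR_gt0 ?exprn_gt0//; first by move: E1; clear; lra.
  have : 0 <= k%:R * (2 * E) by rewrite mulr_ge0//; move: E1; clear; lra.
  by move: E1; clear; lra.
move=> y n0 T L y1 hn L0 Ly Ln.
have y0 : 0 < y by lra.
have z0 : 0 < y ^+ 2 by rewrite exprn_gt0.
have n00 : 0 < n0 by case/andP: hn => h _; apply: lt_le_trans h; rewrite mulr_gt0.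
have zE i : (y ^+ 2) `^ (theta - i%:R) = y `^ (2 * theta - 2 * i%:R).
  by rewrite -powR_mulrn ?(ltW y0)// -powRrM mulrBr.
have F1 i : (i < k.+2)%N -> n0 `^ (theta - i%:R) <= B * y `^ (2 * theta - 2 * i%:R).
  move=> ik; have [B0 /(_ _ _ z0 hn)[h _]] := hB i.
  by apply: le_trans h _; rewrite zE ler_wpM2r ?powR_ge0// hB1.
have F2 i : (i < k.+2)%N -> y `^ (2 * theta - 2 * i%:R) <= B * n0 `^ (theta - i%:R).
  move=> ik; have [B0 /(_ _ _ z0 hn)[_ h]] := hB i.
  by rewrite -zE; apply: le_trans h _; rewrite ler_wpM2r ?powR_ge0// hB1.
have F3 i : (i < k.+2)%N -> n0 `^ (theta - i%:R) * L%:R ^+ i <= M * y `^ (2 * theta - i%:R).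
  move=> ik.
  have -> : y `^ (2 * theta - i%:R) = y `^ (2 * theta - 2 * i%:R) * y ^+ i.
    by rewrite -powR_mulrn ?(ltW y0)// -powRDr//; congr (_ `^ _); ring.
  apply: le_trans (_ : (B * y `^ (2 * theta - 2 * i%:R)) * (D4 * y ^+ i) <= _).
    rewrite ler_pM ?powR_ge0 ?exprn_ge0// ?F1//.
    apply: le_trans (_ : (c2 * y) ^+ i <= _).
      by rewrite lerXn2r ?nnegrE// mulr_ge0// ltW.
    by rewrite exprMn ler_wpM2r ?exprn_ge0 ?(ltW y0)// hD4.
  by rewrite eM mulrACA.
have [A eA] : exists A : nat -> R, A = fun j => cb theta j.+1 * n0 `^ (theta - j.+1%:R) by eexists.
have [G eG] : exists G : seq nat -> R, G = fun a => \sum_(x <- a) (n0 + x%:R) `^ theta by eexists.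
have GE a : a \in tup (iota 0 L) r ->
    `|G a - \sum_(i < k.+1) cb theta i * (n0 `^ (theta - i%:R) * \sum_(x <- a) x%:R ^+ i)|
      <= r%:R * (Ct * M).
  move=> aT; have [sz sa] := mem_tup aT.
  have -> : \sum_(i < k.+1) cb theta i * (n0 `^ (theta - i%:R) * \sum_(x <- a) x%:R ^+ i) =
     \sum_(x <- a) \sum_(i < k.+1) cb theta i * (n0 `^ (theta - i%:R) * x%:R ^+ i).
    by rewrite exchange_big /=; apply: eq_bigr => i _; rewrite !mulr_sumr.
  rewrite eG -sumrB; apply: le_trans (ler_norm_sum _ _ _) _.
  apply: le_trans (_ : \sum_(x <- a) (Ct * M) <= _); last first.
    by rewrite big_const_seq count_predT iter_addr_0 sz [leRHS]mulr_natl.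
  rewrite big_seq [leRHS]big_seq; apply: ler_sum => x /sa.
  rewrite mem_iota add0n /= => xL.
  have xL' : x%:R <= L%:R :> R by rewrite ler_nat ltnW.
  apply: le_trans (HT n0 x%:R n00 _) _; first by rewrite ger0_norm// (le_trans xL').
  rewrite ler_wpM2l// ger0_norm//.
  apply: le_trans (_ : n0 `^ (theta - k.+1%:R) * L%:R ^+ k.+1 <= _).
    by rewrite ler_wpM2l ?powR_ge0// lerXn2r ?nnegrE.
  (* The Taylor remainder is at most a constant times y^(2 theta - k - 1), hence bounded since 2
     theta < k + 1. *)
  apply: le_trans (F3 _ (ltnSn _)) _.
  rewrite -[leRHS]mulr1 ler_wpM2l ?(le_trans ler01 M1)//.
  by rewrite -[leRHS](powRr0 y) ler_powR// -natr1; move: tk; rewrite -natr1; clear; lra.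
pose hv (a b : seq nat) : seq int := [seq psum j a - psum j b | j <- iota 0 k].
have nth_hv a b j : (j < k)%N ->
    (nth 0 (hv a b) j)%:~R = \sum_(x <- a) x%:R ^+ j.+1 - \sum_(x <- b) x%:R ^+ j.+1 :> R.
  move=> jk; rewrite (nth_map 0%N) ?size_iota// nth_iota// add0n intrB /psum.
  by congr (_ - _); rewrite rmorph_sum; apply: eq_bigr => x _; rewrite rmorphXn.
pose ind a b := `|G a - G b - T| <= 1.
(* The difference vectors that actually occur among the pairs to be counted. *)
have [H eH] : exists H, H = undup [seq hv p.1 p.2 | p <-
    [seq (a, b) | a <- tup (iota 0 L) r, b <- tup (iota 0 L) r] & ind p.1 p.2] by eexists.
have memH h : h \in H -> exists a b, [/\ a \in tup (iota 0 L) r, b \in tup (iota 0 L) r,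
    ind a b & h = hv a b].
  rewrite eH mem_undup => /mapP[p]; rewrite mem_filter => /andP[ip /allpairsP[[a b] [/= aT bT ep]]] ->.
  by exists a, b; split => //; [move: ip; rewrite ep|rewrite ep].
have sizeH : (size H)%:R <= (3 * (E * (2 * E + k%:R * (2 * E)))) ^+ k
    * y `^ ((tri k)%:R - (2 * theta - 1)).
  apply: (@size_linear_form R k (2 * theta - 1) E y T A H) => //; try by move: k2t tk k1 y1 E1; clear; lra.
  - have : (2 : R) <= k%:R by rewrite ler_nat.
    by move: tk; rewrite -natr1; clear; lra.
  - by rewrite eH undup_uniq.
  - by move=> h /memH[a [b [_ _ _ ->]]]; rewrite size_map size_iota.
  - move=> j jk.
    have -> : 2 * theta - 1 - 2 * j%:R - 1 = 2 * theta - 2 * j.+1%:R.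
      by rewrite -natr1; ring.
    apply: le_trans (F2 j.+1 _) _; first by rewrite ltnS (leq_trans jk).
    rewrite eA normrM [`|_ `^ _|]ger0_norm ?powR_ge0// mulrA ler_wpM2r ?powR_ge0//.
    have cp : 0 < `|cb theta j.+1| by rewrite normr_gt0 cb_neq0.
    rewrite -ler_pdivrMr//.
    apply: le_trans (_ : B * D2 <= _); last by rewrite mulrC; move: eE rDM CtM; clear; lra.
    by rewrite ler_wpM2l ?(le_trans ler01 B1)// hD2// ltnS (leq_trans jk).
  - move=> j h jk /memH[a [b [aT bT _ ->]]].
    rewrite nth_hv// eA normrM normrM [`|_ `^ _|]ger0_norm ?powR_ge0//.
    have jk2 : (j.+1 < k.+2)%N by rewrite ltnS (leq_trans jk).
    apply: le_trans (_ : D1 * n0 `^ (theta - j.+1%:R) * (2 * (r%:R * L%:R ^+ j.+1)) <= _).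
      rewrite ler_pM ?mulr_ge0 ?powR_ge0//.
        by rewrite ler_wpM2r ?powR_ge0// hD1.
      apply: le_trans (ler_normB _ _) _.
      by have := psum_le j.+1 aT; have := psum_le j.+1 bT; clear; lra.
    have -> : D1 * n0 `^ (theta - j.+1%:R) * (2 * (r%:R * L%:R ^+ j.+1)) =
      2 * (r%:R * (D1 * (n0 `^ (theta - j.+1%:R) * L%:R ^+ j.+1))) by ring.
    have -> : 2 * theta - 1 - j%:R = 2 * theta - j.+1%:R by rewrite -natr1; ring.
    apply: le_trans (_ : 2 * (r%:R * (D1 * (M * y `^ (2 * theta - j.+1%:R)))) <= _).
      by rewrite ler_wpM2l// ler_wpM2l// ler_wpM2l ?(le_trans ler01 D11)// F3.
    have := powR_ge0 y (2 * theta - j.+1%:R).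
    rewrite !mulrA => p0; rewrite ler_wpM2r//.
    by move: eE CtM D2B; rewrite !mulrA => -> h1 h2; move: h1 h2; clear; lra.
  - move=> h /memH[a [b [aT bT]]]; rewrite /ind => iab ->.
    have [w ew] : exists w, w = \sum_(j < k) A j * (nth 0 (hv a b) j)%:~R by eexists.
    rewrite -ew.
    have wE : w = (\sum_(i < k.+1) cb theta i * (n0 `^ (theta - i%:R) * \sum_(x <- a) x%:R ^+ i))
       - (\sum_(i < k.+1) cb theta i * (n0 `^ (theta - i%:R) * \sum_(x <- b) x%:R ^+ i)).
      rewrite -sumrB big_ord_recl.
      (* The terms of order zero cancel because both tuples have [r] entries. *)
      have sT c : c \in tup (iota 0 L) r -> \sum_(x <- c) x%:R ^+ 0 = r%:R :> R.
        move=> /mem_tup[sc _]; under eq_bigr do rewrite expr0.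
        by rewrite big_const_seq count_predT iter_addr_0 sc.
      rewrite [ord0 : nat]/= !sT// subrr add0r ew; apply: eq_bigr => j _.
      by rewrite nth_hv// eA -!mulrBr mulrA.
    have := GE a aT; have := GE b bT; rewrite wE.
    set P := \sum_(i < k.+1) _ ; set Q := \sum_(i < k.+1) _.
    move: iab; rewrite !ler_norml => /andP[i1 i2] /andP[i3 i4] /andP[i5 i6].
    move: E1 i1 i2 i3 i4 i5 i6 eE D2B rDM CtM; clear => *.
    by apply/andP; split; lra.
rewrite -er.
apply: le_trans (_ : (size H)%:R * (Cf * L%:R ^+ r * L%:R `^ eps) <= _).
  apply: le_trans (_ : \sum_(a <- tup (iota 0 L) r) \sum_(b <- tup (iota 0 L) r) \sum_(h <- H)
     ([forall j : 'I_k, psum j a - psum j b == nth 0 h j])%:R <= _).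
    rewrite big_seq [leRHS]big_seq; apply: ler_sum => a aT.
    rewrite big_seq [leRHS]big_seq; apply: ler_sum => b bT.
    case: (boolP (_ <= 1)) => [iab|_]; last by apply: sumr_ge0 => h _; rewrite ler0n.
    have hH : hv a b \in H.
      rewrite eH mem_undup; apply/mapP; exists (a, b) => //.
      by rewrite mem_filter /ind eG iab /=; apply/allpairsP; exists (a, b).
    rewrite (big_rem _ hH) /=.
    have -> : [forall j : 'I_k, psum j a - psum j b == (hv a b)`_j].
      by apply/forallP => j; rewrite (nth_map 0%N) ?size_iota// nth_iota// add0n.
    by rewrite lerDl; apply: sumr_ge0 => h _; rewrite ler0n.
  under eq_bigr => a _ do rewrite exchange_big.
  rewrite exchange_big /=.
  apply: le_trans (_ : \sum_(h <- H) (Cf * L%:R ^+ r * L%:R `^ eps) <= _); last first.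
    by rewrite big_const_seq count_predT iter_addr_0 [leRHS]mulr_natl.
  by apply: ler_sum => h _; rewrite er; apply: (HJ L (fun j => nth 0 h j) L0).
have -> : 2 * r%:R + 1 - 2 * theta + eps = ((tri k)%:R - (2 * theta - 1)) + (r%:R + eps).
  by rewrite er; ring.
rewrite powRDr// [y `^ (r%:R + eps)]powRDr// powR_mulrn ?(ltW y0)//.
have -> : forall S U V W X Y Z : R, S * (U * V * W) * (X * (Y * Z)) = (S * X) * (U * (V * Y) * (W * Z)).
  by move=> *; ring.
have c2y : 0 <= c2 * y by rewrite mulr_ge0// ltW.
rewrite ler_pM ?mulr_ge0 ?powR_ge0 ?exprn_ge0 ?ler0n ?(ltW Cf0)//.
rewrite -exprMn -powRM ?(ltW c20) ?(ltW y0)//.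
rewrite ler_pM ?mulr_ge0 ?powR_ge0 ?exprn_ge0 ?ler0n ?(ltW Cf0)//.
  by rewrite ler_wpM2l ?(ltW Cf0)// lerXn2r ?nnegrE.
by apply: ge0_ler_powR; rewrite ?nnegrE// ltW.
Qed.

End PairCount.

(** * Van der Corput differencing *)

Section VanDerCorput.
Variable R : realType.

Lemma cos_lip (a b : R) : `|cos a - cos b| <= `|a - b|.
Proof.
wlog ab : a b / a <= b.
  by move=> W; have [|/ltW] := leP a b => h; [exact: W|rewrite distrC [leRHS]distrC; exact: W].
have [c _ e] := @mvt R cos (fun x => - sin x) a b ab.
rewrite distrC e normrM normrN [leRHS]distrC -[leRHS]mul1r ler_wpM2r//.
by rewrite ler_norml sin_geN1 sin_le1.
Qed.

Lemma sin_lip (a b : R) : `|sin a - sin b| <= `|a - b|.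
Proof.
wlog ab : a b / a <= b.
  by move=> W; have [|/ltW] := leP a b => h; [exact: W|rewrite distrC [leRHS]distrC; exact: W].
have [c _ e] := @mvt R sin cos a b ab.
rewrite distrC e normrM [leRHS]distrC -[leRHS]mul1r ler_wpM2r//.
by rewrite ler_norml cos_geN1 cos_le1.
Qed.

Lemma norm_sin_le (x : R) : `|sin x| <= `|x|.
Proof. by have := sin_lip x 0; rewrite sin0 !subr0. Qed.

Lemma cos_ge (x : R) : 1 - x ^+ 2 / 2 <= cos x.
Proof.
have e : cos x = 1 - 2 * sin (x / 2) ^+ 2.
  have -> : cos x = cos (x / 2 + x / 2) by congr cos; field.
  by rewrite cosD; have := cos2Dsin2 (x / 2); lra.
have := norm_sin_le (x / 2); rewrite -ler_sqr ?nnegrE//= !real_normK ?num_real// e.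
by rewrite expr_div_n; lra.
Qed.

Lemma sin_ge (x : R) : 0 <= x <= 1 -> x / 2 <= sin x.
Proof.
move=> /andP[x0 x1].
have [c /andP[c0 cx] e] := @mvt R sin cos 0 x x0.
move: e; rewrite sin0 !subr0 => ->; rewrite mulrC ler_wpM2r//.
have : c ^+ 2 <= 1 by rewrite -(expr1n R 2) lerXn2r ?nnegrE//; lra.
by have := cos_ge c; lra.
Qed.

Lemma sum_iota_shift (f : nat -> R) (L u : nat) : (forall x, `|f x| <= 1) ->
  `|\sum_(x <- iota 0 L) f x - \sum_(x <- iota 0 L) f (x + u)%N| <= 2 * u%:R.
Proof.
move=> f1; elim: u => [|u IH].
  by under [X in _ - X]eq_bigr do rewrite addn0; rewrite subrr normr0 mulr0.
have e : \sum_(x <- iota 0 L) f (x + u.+1)%N = \sum_(x <- iota 0 L) f (x + u)%N + f (L + u)%N - f u.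
  elim: L {IH} => [|L IH]; first by rewrite !big_nil add0r add0n subrr.
  by rewrite -addn1 iotaD !big_cat !big_seq1 !add0n /= IH addn1 addSnnS; ring.
rewrite e; set A := \sum_(x <- _) f x in IH *; set B := \sum_(x <- _) _ in IH *.
have -> : A - (B + f (L + u)%N - f u) = (A - B) + (f u - f (L + u)%N) by ring.
apply: le_trans (ler_normD _ _) _; rewrite -[u.+1%:R]natr1 mulrDr mulr1 lerD//.
by apply: le_trans (ler_normB _ _) _; have := f1 u; have := f1 (L + u)%N; lra.
Qed.

Lemma sqrrD_le2 (a b : R) : (a + b) ^+ 2 <= 2 * a ^+ 2 + 2 * b ^+ 2.
Proof. by have := sqr_ge0 (a - b); rewrite sqrrB sqrrD; lra. Qed.

(** The sum is compared with its mean over the shifts u < H. A shift by u exchanges u terms at each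
    end, and [f] is defined beyond the interval, so nothing has to be truncated. *)
Lemma shift_sum_sq (f : nat -> R) (L H : nat) : (forall x, `|f x| <= 1) ->
  H%:R ^+ 2 * (\sum_(x <- iota 0 L) f x) ^+ 2 <=
  2 * (L%:R * \sum_(x <- iota 0 L) (\sum_(u <- iota 0 H) f (x + u)%N) ^+ 2) + 8 * H%:R ^+ 4.
Proof.
move=> f1; set A := \sum_(x <- iota 0 L) f x.
pose B := \sum_(x <- iota 0 L) \sum_(u <- iota 0 H) f (x + u)%N.
have d : `|H%:R * A - B| <= 2 * H%:R ^+ 2.
  have -> : H%:R * A = \sum_(u <- iota 0 H) A.
    by rewrite big_const_seq count_predT size_iota iter_addr_0 [LHS]mulr_natl.
  have -> : B = \sum_(u <- iota 0 H) \sum_(x <- iota 0 L) f (x + u)%N by exact: exchange_big.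
  rewrite -sumrB; apply: le_trans (ler_norm_sum _ _ _) _.
  apply: le_trans (_ : \sum_(u <- iota 0 H) 2 * H%:R <= _); last first.
    by rewrite big_const_seq count_predT size_iota iter_addr_0 -[leLHS]mulr_natl mulrCA expr2.
  rewrite big_seq [leRHS]big_seq; apply: ler_sum => u; rewrite mem_iota add0n /= => uH.
  by apply: le_trans (sum_iota_shift _ _ f1) _; rewrite ler_wpM2l// ler_nat ltnW.
have := sqrrD_le2 B (H%:R * A - B); rewrite addrC subrK exprMn => /le_trans; apply.
apply: lerD.
  by rewrite ler_wpM2l//; have := sqr_sum_le (iota 0 L) xpredT (fun x => \sum_(u <- iota 0 H) f (x + u)%N); rewrite size_iota.
rewrite -[(_ - B) ^+ 2]real_normK ?num_real//.
apply: le_trans (_ : 2 * (2 * H%:R ^+ 2) ^+ 2 <= _).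
  by rewrite ler_wpM2l// lerXn2r ?nnegrE// mulr_ge0.
by rewrite exprMn -exprM; lra.
Qed.

Lemma cos_norm1 (x : R) : `|cos x| <= 1.
Proof. by rewrite ler_norml cos_geN1 cos_le1. Qed.

Lemma sin_norm1 (x : R) : `|sin x| <= 1.
Proof. by rewrite ler_norml sin_geN1 sin_le1. Qed.

Lemma shift_avg (h : nat -> R) (L H : nat) :
  H%:R ^+ 2 * nrm2 (iota 0 L) h <=
  2 * (L%:R * \sum_(x <- iota 0 L) nrm2 (iota 0 H) (fun u => h (x + u)%N)) + 16 * H%:R ^+ 4.
Proof.
rewrite /nrm2 mulrDr big_split /=.
have := @shift_sum_sq (fun x => cos (h x)) L H (fun x => cos_norm1 _).
have := @shift_sum_sq (fun x => sin (h x)) L H (fun x => sin_norm1 _).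
lra.
Qed.

(** One step of van der Corput differencing. Pairs of shifts closer than [Q1] are bounded trivially,
    because a small difference q would make the differenced phase too flat. The second shift [q']
    only moves the starting point. *)
Lemma vdc_step (h : nat -> R) (L Q Q1 : nat) (b : R) : 0 <= b -> (0 < Q1)%N ->
  (forall q q', (Q1 <= q)%N -> (q + q' < Q)%N ->
    nrm2 (iota 0 L) (fun x => h (x + q' + q)%N - h (x + q')%N) <= (L%:R * b) ^+ 2) ->
  Q%:R * nrm2 (iota 0 L) h <= L%:R ^+ 2 * (4 * Q1%:R + 2 * b * Q%:R) + 16 * Q%:R ^+ 3.
Proof.
move=> b0 Q10 hb.
case: (posnP Q) => [->|Q0].
  by rewrite mul0r addr_ge0 ?mulr_ge0 ?exprn_ge0 ?addr_ge0 ?mulr_ge0// ler0n.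
have Q0' : (0 : R) < Q%:R by rewrite ltr0n.
rewrite -(ler_pM2l Q0') mulrA -expr2; apply: le_trans (shift_avg h L Q) _.
suff S : \sum_(x <- iota 0 L) nrm2 (iota 0 Q) (fun u => h (x + u)%N) <= L%:R * (Q%:R * (2 * Q1%:R + b * Q%:R)).
  apply: le_trans (_ : 2 * (L%:R * (L%:R * (Q%:R * (2 * Q1%:R + b * Q%:R)))) + 16 * Q%:R ^+ 4 <= _).
    by rewrite lerD2r ler_wpM2l// ler_wpM2l.
  by rewrite le_eqVlt; apply/orP; left; apply/eqP; ring.
under eq_bigr => x _.
  rewrite -[nrm2 _ _]mulr1 -(@cos0 R) -nrm2_pair_sum.
  under eq_bigr do under eq_bigr do rewrite addr0.
  over.
rewrite exchange_big /=; under eq_bigr => u _ do rewrite exchange_big /=.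
pose D u v := \sum_(x <- iota 0 L) cos (h (x + u)%N - h (x + v)%N).
have D0 u v : D u v <= L%:R.
  apply: le_trans (_ : \sum_(x <- iota 0 L) 1 <= _); first by apply: ler_sum => x _; exact: cos_le1.
  by rewrite big_const_seq count_predT size_iota iter_addr_0.
have D1 q q' : (Q1 <= q)%N -> (q + q' < Q)%N -> D (q' + q)%N q' <= L%:R * b.
  move=> h1 h2; apply: le_trans (ler_norm _) _.
  rewrite -ler_sqr ?nnegrE ?mulr_ge0// real_normK ?num_real//.
  apply: le_trans (hb q q' h1 h2); rewrite /nrm2 /D.
  by under [in leRHS]eq_bigr do rewrite -addnA; rewrite lerDl sqr_ge0.
have Dsym u v : D u v = D v u by apply: eq_bigr => x _; rewrite -cosN opprB.
have D2 u v : (u < Q)%N -> (v < Q)%N -> D u v <= L%:R * b + L%:R * ((u < v + Q1) && (v < u + Q1))%N%:R.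
  move=> uQ vQ; case: (ltnP u (v + Q1)) => h1 /=; last first.
    rewrite mulr0 addr0; have := @D1 (u - v)%N v; rewrite subnKC; last by lia.
    by apply; lia.
  case: (ltnP v (u + Q1)) => h2 /=; first by rewrite mulr1; apply: le_trans (D0 u v) _; rewrite lerDr mulr_ge0.
  rewrite mulr0 addr0 Dsym; have := @D1 (v - u)%N u; rewrite subnKC; last by lia.
  by apply; lia.
have cnt u : (u < Q)%N -> \sum_(v <- iota 0 Q) ((u < v + Q1) && (v < u + Q1))%N%:R <= 2 * Q1%:R :> R.
  move=> uQ; rewrite -natr_sum -natrM ler_nat.
  have -> : (\sum_(v <- iota 0 Q) ((u < v + Q1) && (v < u + Q1)))%N =
      size [seq v <- iota 0 Q | (u < v + Q1)%N && (v < u + Q1)%N].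
    by rewrite size_filter -sum1_count [RHS]big_mkcond; apply: eq_bigr => v _; case: (_ && _).
  rewrite -(size_iota (u.+1 - Q1) (2 * Q1)); apply: uniq_leq_size.
    by rewrite filter_uniq// iota_uniq.
  by move=> v; rewrite mem_filter !mem_iota => /andP[/andP[h1 h2] _]; lia.
apply: le_trans (_ : \sum_(u <- iota 0 Q) \sum_(v <- iota 0 Q)
    (L%:R * b + L%:R * ((u < v + Q1) && (v < u + Q1))%N%:R) <= _).
  rewrite big_seq [leRHS]big_seq; apply: ler_sum => u; rewrite mem_iota add0n /= => uQ.
  rewrite big_seq [leRHS]big_seq; apply: ler_sum => v; rewrite mem_iota add0n /= => vQ.
  exact: D2.
apply: le_trans (_ : \sum_(u <- iota 0 Q) (Q%:R * (L%:R * b) + L%:R * (2 * Q1%:R)) <= _).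
  rewrite big_seq [leRHS]big_seq; apply: ler_sum => u; rewrite mem_iota add0n /= => uQ.
  rewrite big_split /= lerD//; last by rewrite -mulr_sumr ler_wpM2l// cnt.
  by rewrite big_const_seq count_predT size_iota iter_addr_0 [leRHS]mulr_natl.
rewrite big_const_seq count_predT size_iota iter_addr_0 -[leLHS]mulr_natl.
by rewrite le_eqVlt; apply/orP; left; apply/eqP; ring.
Qed.

(** Each differencing step squares the saving, so [m] steps turn w into w^(2^m). The induction runs
    back from the fully differenced sums, and the factor 4 survives each step since 4 + 8 <= 4^2. *)
Lemma vdc_iter (g : R -> R) (L Q Q1 m : nat) (n0 w : R) : 0 <= w <= 1 -> (0 < Q1 <= Q)%N ->
  4 * Q1%:R + 16 * Q%:R ^+ 3 / L%:R ^+ 2 <= 4 * w ^+ (2 ^ m) * Q%:R -> (0 < L)%N ->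
  (forall (qs : seq nat) v, size qs = m -> all (fun q => Q1 <= q <= Q)%N qs ->
     n0 <= v <= n0 + m%:R * Q%:R ->
     nrm2 (iota 0 L) (fun x => dif [seq q%:R | q <- qs] g (v + x%:R)) <= (4 * L%:R * w ^+ (2 ^ m)) ^+ 2) ->
  nrm2 (iota 0 L) (fun x => g (n0 + x%:R)) <= (4 * L%:R * w) ^+ 2.
Proof.
move=> /andP[w0 w1] /andP[Q10 Q1Q] hQ L0 base.
have Q0 : (0 : R) < Q%:R by rewrite ltr0n; lia.
have L0' : (0 : R) < L%:R by rewrite ltr0n.
(* The list [qs] holds the shifts already applied, and [i] counts those still to come. *)
suff H i : forall (qs : seq nat) v, (size qs + i = m)%N -> all (fun q => Q1 <= q <= Q)%N qs ->
     n0 <= v <= n0 + (size qs)%:R * Q%:R ->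
     nrm2 (iota 0 L) (fun x => dif [seq q%:R | q <- qs] g (v + x%:R)) <= (4 * L%:R * w ^+ (2 ^ size qs)) ^+ 2.
  by have := H m [::] n0 (add0n _) isT; rewrite mul0r addr0 lexx expr1 => ->.
elim: i => [|i IH] qs v.
  by rewrite addn0 => sz aq hv; rewrite sz; apply: base; rewrite // -sz.
rewrite addnS -addSn => sz aq /andP[v1 v2].
have [W eW] : exists W, W = w ^+ (2 ^ (size qs).+1) by eexists.
have W0 : 0 <= W by rewrite eW exprn_ge0.
have WE : (w ^+ (2 ^ size qs)) ^+ 2 = W by rewrite eW -exprM -expnSr.
have := @vdc_step (fun x => dif [seq q%:R | q <- qs] g (v + x%:R)) L Q Q1 (4 * W) _ Q10 _.
move=> /(_ _ _)/wrap[]; first by rewrite mulr_ge0.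
  move=> q q' h1 h2.
  have := IH (q :: qs) (v + q'%:R) _ _ _.
  move=> /(_ _ _ _)/wrap[] //=.
  - by rewrite h1 aq andbT; exact: ltnW (leq_ltn_trans (leq_addr _ _) h2).
  - rewrite (le_trans v1) ?lerDl//=.
    have : q'%:R <= Q%:R :> R by rewrite ler_nat; exact: ltnW (leq_ltn_trans (leq_addl _ _) h2).
    by rewrite -[(size qs).+1%:R]natr1; lra.
  rewrite -eW.
  have -> : L%:R * (4 * W) = 4 * L%:R * W by ring.
  move=> h; apply: le_trans h; rewrite le_eqVlt; apply/orP; left; apply/eqP; apply: eq_nrm2.
  move=> x _ /=; congr (dif _ _ _ - dif _ _ _); rewrite !natrD; ring.
have WW : w ^+ (2 ^ m) <= W by rewrite eW -sz ler_wiXn2l ?w0//; rewrite leq_pexp2l// leq_addr.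
move=> h; rewrite exprMn WE -(ler_pM2l Q0); apply: le_trans h _.
have L2 : (0 : R) < L%:R ^+ 2 by rewrite exprn_gt0.
move: hQ; rewrite -(ler_pM2r L2) mulrDl divfK ?gt_eqF// => hQ.
have : 4 * w ^+ (2 ^ m) * Q%:R * L%:R ^+ 2 <= 4 * W * Q%:R * L%:R ^+ 2.
  by rewrite ler_wpM2r ?(ltW L2)// ler_wpM2r// ler_wpM2l.
have : 0 <= W * (Q%:R * L%:R ^+ 2) by rewrite !mulr_ge0// ltW.
by rewrite exprMn; lra.
Qed.

Lemma nrm2_perturb (I : eqType) (s : seq I) (h h' : I -> R) (e : R) :
  {in s, forall x, `|h x - h' x| <= e} ->
  nrm2 s h <= 2 * nrm2 s h' + 4 * ((size s)%:R * e) ^+ 2.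
Proof.
move=> H.
have K (t : R -> R) : (forall a b, `|t a - t b| <= `|a - b|) ->
    (\sum_(x <- s) t (h x)) ^+ 2 <= 2 * (\sum_(x <- s) t (h' x)) ^+ 2 + 2 * ((size s)%:R * e) ^+ 2.
  move=> tl.
  have d : `|\sum_(x <- s) t (h x) - \sum_(x <- s) t (h' x)| <= (size s)%:R * e.
    rewrite -sumrB; apply: le_trans (ler_norm_sum _ _ _) _.
    apply: le_trans (_ : \sum_(x <- s) e <= _); last first.
      by rewrite big_const_seq count_predT iter_addr_0 [leRHS]mulr_natl.
    rewrite big_seq [leRHS]big_seq; apply: ler_sum => x xs.
    by apply: le_trans (tl _ _) _; exact: H.
  have := sqrrD_le2 (\sum_(x <- s) t (h' x)) (\sum_(x <- s) t (h x) - \sum_(x <- s) t (h' x)).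
  rewrite addrC subrK => /le_trans; apply; rewrite lerD2l ler_wpM2l//.
  rewrite -[(_ - _) ^+ 2]real_normK ?num_real// lerXn2r ?nnegrE//.
  exact: le_trans d.
have := K _ cos_lip; have := K _ sin_lip; rewrite /nrm2; lra.
Qed.

Lemma nrm2_linear (H : nat) (a d : R) : 0 < `|d| <= 1 ->
  nrm2 (iota 0 H) (fun u => a + u%:R * d) <= 16 / d ^+ 2.
Proof.
move=> /andP[d0 d1].
have -> : nrm2 (iota 0 H) (fun u => a + u%:R * d) = nrm2 (iota 0 H) (fun u => u%:R * d).
  by apply: (@nrm2_eqmod _ _ _ _ _ a) => u _; exists 0; rewrite mul0r addr0 addrC.
have s1 : sin (H%:R * d / 2) ^+ 2 <= 1.
  by have := cos2Dsin2 (H%:R * d / 2); have := sqr_ge0 (cos (H%:R * d / 2)); lra.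
have d2 : 0 < d ^+ 2 by rewrite exprn_even_gt0//= -normr_gt0.
have s2 : d ^+ 2 / 16 <= sin (d / 2) ^+ 2.
  have -> : sin (d / 2) ^+ 2 = sin (`|d| / 2) ^+ 2.
    by case: (ger0P d) => // _; rewrite mulNr sinN sqrrN.
  have : `|d| / 2 / 2 <= sin (`|d| / 2) by apply: sin_ge; lra.
  move=> h; have e : d ^+ 2 / 16 = (`|d| / 2 / 2) ^+ 2.
    by rewrite !expr_div_n real_normK ?num_real//; field.
  by rewrite e lerXn2r ?nnegrE//; lra.
rewrite ler_pdivlMr//.
have := nrm2_geometric H d; have := nrm2_ge0 (iota 0 H) (fun u => u%:R * d).
set N := nrm2 _ _ => N0 e.
have : d ^+ 2 / 16 * N <= sin (d / 2) ^+ 2 * N by rewrite ler_wpM2r.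
by rewrite e mulrC; lra.
Qed.

(** On a block of length [H] the phase stays within H^2 rho of a linear one whose step has size
    between [dl] and 1, and the corresponding geometric sum has modulus at most 4 / dl. The blocks
    are then averaged over their starting points. *)
Lemma geometric_bound (h : nat -> R) (L H : nat) (dl rho : R) : (0 < H)%N -> 0 < dl -> 0 <= rho ->
  (forall x, (x < L + H)%N -> dl <= `|h x.+1 - h x| <= 1) ->
  (forall x, (x < L + H)%N -> `|(h x.+2 - h x.+1) - (h x.+1 - h x)| <= rho) ->
  nrm2 (iota 0 L) h <= L%:R ^+ 2 * (64 / (H%:R * dl) ^+ 2 + 8 * (H%:R ^+ 2 * rho) ^+ 2) + 16 * H%:R ^+ 2.
Proof.
move=> H0 dl0 rho0 h1 h2.
have H0' : (0 : R) < H%:R by rewrite ltr0n.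
have lin x u : (x < L)%N -> (u <= H)%N ->
    `|h (x + u)%N - (h x + u%:R * (h x.+1 - h x))| <= H%:R ^+ 2 * rho.
  move=> xL uH.
  have slope v : (v < H)%N -> `|(h (x + v).+1 - h (x + v)%N) - (h x.+1 - h x)| <= v%:R * rho.
    elim: v => [|v IH] vH; first by rewrite addn0 subrr normr0 mul0r.
    rewrite addnS -natr1 mulrDl mul1r.
    have -> : h (x + v).+2 - h (x + v).+1 - (h x.+1 - h x) =
      (h (x + v).+1 - h (x + v)%N - (h x.+1 - h x)) + ((h (x + v).+2 - h (x + v).+1) - (h (x + v).+1 - h (x + v)%N)) by ring.
    apply: le_trans (ler_normD _ _) _; rewrite lerD//; first by apply: IH; lia.
    by apply: h2; lia.
  have : `|h (x + u)%N - (h x + u%:R * (h x.+1 - h x))| <= u%:R * (H%:R * rho).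
    elim: u uH => [|u IH] uH; first by rewrite addn0 !mul0r addr0 subrr normr0.
    rewrite addnS -[u.+1%:R]natr1 !mulrDl !mul1r.
    have -> : h (x + u).+1 - (h x + (u%:R * (h x.+1 - h x) + (h x.+1 - h x))) =
      (h (x + u)%N - (h x + u%:R * (h x.+1 - h x))) + ((h (x + u).+1 - h (x + u)%N) - (h x.+1 - h x)) by ring.
    apply: le_trans (ler_normD _ _) _; rewrite lerD//; first by apply: IH; lia.
    apply: le_trans (slope _ _) _; first by lia.
    by rewrite ler_wpM2r// ler_nat; lia.
  move=> /le_trans; apply; rewrite expr2 -mulrA ler_wpM2r ?mulr_ge0// ler_nat//.
have H2 : 0 < H%:R ^+ 2 :> R by rewrite exprn_gt0.
rewrite -(ler_pM2l H2); apply: le_trans (shift_avg h L H) _.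
have [B eB] : exists B, B = 2 * (16 / dl ^+ 2) + 4 * (H%:R * (H%:R ^+ 2 * rho)) ^+ 2 by eexists.
have blk : \sum_(x <- iota 0 L) nrm2 (iota 0 H) (fun u => h (x + u)%N) <= L%:R * B.
  apply: le_trans (_ : \sum_(x <- iota 0 L) B <= _); last first.
    by rewrite big_const_seq count_predT size_iota iter_addr_0 [leRHS]mulr_natl.
  rewrite big_seq [leRHS]big_seq; apply: ler_sum => x; rewrite mem_iota add0n /= => xL.
  have /andP[d1 d2] := h1 x (ltn_addr H xL).
  apply: le_trans (nrm2_perturb (h' := fun u => h x + u%:R * (h x.+1 - h x)) (e := H%:R ^+ 2 * rho) _) _.
    by move=> u; rewrite mem_iota add0n /= => uH; apply: lin => //; exact: ltnW.
  rewrite size_iota eB lerD2r ler_wpM2l//.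
  apply: le_trans (nrm2_linear _ _ _) _; first by rewrite d2 andbT (lt_le_trans dl0).
  rewrite ler_wpM2l// lef_pV2 ?posrE ?(exprn_gt0 _ dl0)//; last first.
    by rewrite exprn_even_gt0//= -normr_gt0 (lt_le_trans dl0).
  by rewrite -[leRHS]real_normK ?num_real// lerXn2r ?nnegrE// ltW.
apply: le_trans (_ : 2 * (L%:R * (L%:R * B)) + 16 * H%:R ^+ 4 <= _).
  by rewrite lerD2r ler_wpM2l// ler_wpM2l.
rewrite le_eqVlt; apply/orP; left; apply/eqP; rewrite eB; field.
by rewrite !gt_eqF.
Qed.

End VanDerCorput.

(** * Sizes of the differenced phases *)

Section DifferenceSizes.
Variable R : realType.

Lemma near_powR_ge (C e : R) : 0 < e -> \forall y \near +oo, C <= y `^ e.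
Proof.
move=> e0; near=> y.
have y1 : (`|C| + 1) `^ e^-1 <= y by near: y; exact: nbhs_pinfty_ge.
apply: le_trans (_ : `|C| + 1 <= _); first by apply: le_trans (ler_norm _) _; rewrite lerDl.
have C1 : 0 <= `|C| + 1 by rewrite addr_ge0.
rewrite -[leLHS]powRr1// -(@mulVf _ e) ?gt_eqF// powRrM.
apply: ge0_ler_powR; rewrite ?nnegrE ?powR_ge0 ?(ltW e0)// (le_trans _ y1) ?powR_ge0.
Unshelve. all: by end_near. Qed.

Lemma dif_scale (qs : seq R) (b : R) (f : R -> R) v :
  dif qs (fun v => b * f v) v = b * dif qs f v.
Proof. by elim: qs v => //= q qs IH v; rewrite !IH mulrBr. Qed.

(** Both bounds are needed: the lower one keeps the steps of the differenced phase away from zero,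
    the upper one keeps them below one and nearly constant. *)
Lemma dif_size (theta c1 c2 : R) J : theta \isn't a Num.int -> 0 < c1 -> 0 < c2 ->
  exists2 K, 1 <= K & forall y b v (qs : seq R), 0 < y -> 0 <= b -> (size qs <= J)%N ->
    all (fun q => 0 <= q) qs -> c1 * y ^+ 2 <= v -> v + \sum_(q <- qs) q <= c2 * y ^+ 2 ->
    K^-1 * (b * y `^ (2 * theta - 2 * (size qs)%:R) * \prod_(q <- qs) q)
      <= `|dif qs (fun v => b * v `^ theta) v| <=
    K * (b * y `^ (2 * theta - 2 * (size qs)%:R) * \prod_(q <- qs) q).
Proof.
move=> ni c10 c20.
have HB (i : nat) : exists B, 0 < B /\ forall z n : R, 0 < z -> c1 * z <= n <= c2 * z ->
    n `^ (theta - i%:R) <= B * z `^ (theta - i%:R) /\ z `^ (theta - i%:R) <= B * n `^ (theta - i%:R).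
  by have [B B0 H] := @powR_comparable R (theta - i%:R) c1 c2 c10 c20; exists B.
have [fB hB] := choice HB.
have [B B1 hB1] := finite_bound J.+1 fB.
have [D1 D11 hD1] := finite_bound J.+1 (fun i => `|fall theta i|).
have [D2 D21 hD2] := finite_bound J.+1 (fun i => `|fall theta i|^-1).
have [B0 [D10 D20]] : 0 < B /\ 0 < D1 /\ 0 < D2 by lra.
exists (D1 * D2 * B).
  by rewrite -[1]mulr1 ler_pM// ?ler01// -[1]mulr1 ler_pM.
move=> y b v qs y0 b0 sz aq v1 v2.
have z0 : 0 < y ^+ 2 by rewrite exprn_gt0.
have v0 : 0 < v by apply: lt_le_trans v1; rewrite mulr_gt0.
have [xi /andP[x1 x2] ->] : exists2 xi, v <= xi <= v + \sum_(q <- qs) q &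
    dif qs (fun v => b * v `^ theta) v =
    b * (fall theta (size qs) * \prod_(q <- qs) q * xi `^ (theta - (size qs)%:R)).
  by have [xi hx e] := dif_powR theta aq v0; exists xi => //; rewrite dif_scale e.
have P0 : 0 <= \prod_(q <- qs) q.
  by rewrite big_seq; apply: prodr_ge0 => q; exact: (allP aq).
have sJ : (size qs < J.+1)%N by [].
have [_ /(_ _ xi z0)[|h1 h2]] := hB (size qs).
  by rewrite (le_trans v1)//= (le_trans x2).
have zE i : (y ^+ 2) `^ (theta - i%:R) = y `^ (2 * theta - 2 * i%:R).
  by rewrite -powR_mulrn ?(ltW y0)// -powRrM mulrBr.
rewrite zE in h1 h2; rewrite !normrM [`|b|]ger0_norm// [`|\prod_(q <- qs) q|]ger0_norm//.
rewrite [`|_ `^ _|]ger0_norm ?powR_ge0//.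
set Y := y `^ _ in h1 h2 *; set X := xi `^ _ in h1 h2 *; set P := \prod_(q <- qs) q in P0 *.
have X0 : 0 <= X by exact: powR_ge0.
have Y0 : 0 <= Y by exact: powR_ge0.
have F0 : 0 < `|fall theta (size qs)| by rewrite normr_gt0 fall_neq0.
have F1 := hD1 _ sJ; have F2 := hD2 _ sJ; have fB1 := hB1 _ sJ.
have h1' : X <= B * Y by apply: le_trans h1 _; rewrite ler_wpM2r.
have h2' : Y <= B * X by apply: le_trans h2 _; rewrite ler_wpM2r.
set F := `|fall _ _| in F0 F1 F2 *.
apply/andP; split.
  rewrite ler_pdivrMl ?mulr_gt0//.
  have D2F : 1 <= D2 * F by rewrite -ler_pdivrMr// mul1r.
  have -> : D1 * D2 * B * (b * (F * P * X)) = D1 * (D2 * F) * (b * (B * X) * P) by ring.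
  apply: le_trans (_ : b * (B * X) * P <= _).
    by rewrite ler_wpM2r// ler_wpM2l.
  rewrite ler_peMl//; first by rewrite !mulr_ge0// ltW.
  by rewrite -[1]mulr1 ler_pM.
have -> : D1 * D2 * B * (b * Y * P) = D2 * (b * (D1 * P * (B * Y))) by ring.
apply: le_trans (_ : b * (D1 * P * (B * Y)) <= _).
  by rewrite ler_wpM2l// ler_pM ?mulr_ge0// ?(ltW F0)// ler_wpM2r.
by rewrite ler_peMl// !mulr_ge0// ltW.
Qed.

Lemma prod_between (qs : seq R) (a b : R) : 0 <= a -> all (fun q => a <= q <= b) qs ->
  a ^+ size qs <= \prod_(q <- qs) q <= b ^+ size qs.
Proof.
move=> a0; elim: qs => [|q qs IH] /=; first by rewrite big_nil !expr0 lexx.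
move=> /andP[/andP[h1 h2] /IH /andP[h3 h4]]; rewrite big_cons !exprS.
have P0 : 0 <= \prod_(q <- qs) q by apply: le_trans h3; rewrite exprn_ge0.
by rewrite !ler_pM// ?exprn_ge0// (le_trans a0).
Qed.

Lemma sum_le_size (qs : seq R) (b : R) : all (fun q => q <= b) qs ->
  \sum_(q <- qs) q <= (size qs)%:R * b.
Proof.
elim: qs => [|q qs IH] /=; first by rewrite big_nil mul0r.
by move=> /andP[h1 /IH h2]; rewrite big_cons -natr1 mulrDl mul1r addrC lerD.
Qed.

End DifferenceSizes.

(** * The pointwise bound for the exponential sum over the window *)

Section WeylParameters.
Variable R : realType.

(** Q is taken as large as possible subject to Q <= y^(1 - om) and lam Q^m <= c0. The steps of the m
    times differenced phase are then small enough for a geometric sum, while its variation over a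
    length y is still at least y^(1/30). *)
Lemma choose_shift (c0 lam y om : R) m : 0 < c0 -> 0 < lam -> (0 < m)%N -> 1 <= y -> 0 < om ->
  m%:R * om <= 100^-1 -> lam <= y `^ (- 2^-1) -> c0^-1 <= y `^ 10^-1 ->
  (if m == 1%N then y `^ (12^-1 - 2) <= lam else y `^ (- (5 / 2)) <= lam) ->
  exists Q, [/\ y `^ (3 * om) <= Q, Q <= y `^ (1 - om), lam * Q ^+ m <= c0 & y `^ 30^-1 <= lam * Q ^+ m * y].
Proof.
move=> c00 lam0 m0 y1 om0 mom l1 cy l2.
have y0 : 0 < y by lra.
have m1 : 1 <= m%:R :> R by rewrite ler1n.
have om1 : om <= 100^-1 by apply: le_trans mom; rewrite ler_peMl// ltW.
have pX e : (y `^ e) ^+ m = y `^ (m%:R * e).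
  by rewrite -powR_mulrn ?powR_ge0// -powRrM mulrC.
have [h|h] := leP (lam * (y `^ (1 - om)) ^+ m) c0.
  exists (y `^ (1 - om)); split => //; first by apply: ler_powR => //; lra.
  have l3 : y `^ (30^-1 - 1 - m%:R * (1 - om)) <= lam.
    case: eqP l2 => [e|/eqP mn1]; apply: le_trans; apply: ler_powR => //.
      by rewrite e; lra.
    have : 2 <= m%:R :> R by rewrite ler_nat ltn_neqAle eq_sym m0 andbT.
    lra.
  rewrite pX; apply: le_trans (_ : y `^ (30^-1 - 1 - m%:R * (1 - om)) * y `^ (m%:R * (1 - om)) * y <= _).
    by rewrite -{4}[y]powRr1 ?(ltW y0)// -!powRDr// ler_powR//; lra.
  by rewrite ler_wpM2r ?(ltW y0)// ler_wpM2r ?powR_ge0.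
have [Q Q0 eQ] := root_exists m0 (divr_ge0 (ltW c00) (ltW lam0)).
have lQ : lam * Q ^+ m = c0 by rewrite eQ mulrCA divff ?mulr1// gt_eqF.
have ci : y `^ (- 10^-1) <= c0.
  by rewrite powRN -[c0]invrK lef_pV2// posrE ?invr_gt0// powR_gt0.
exists Q; split.
- rewrite -(@ler_pXn2r _ m)// ?nnegrE ?powR_ge0// pX eQ ler_pdivlMr//.
  apply: le_trans (_ : y `^ (m%:R * (3 * om)) * y `^ (- 2^-1) <= _).
    by rewrite ler_wpM2l ?powR_ge0.
  apply: le_trans ci; rewrite -powRDr// ler_powR//; lra.
- rewrite -(@ler_pXn2r _ m)// ?nnegrE ?powR_ge0// eQ ler_pdivrMr// mulrC; exact: ltW.
- by rewrite lQ.
- rewrite lQ; apply: le_trans (_ : y `^ (- 10^-1) * y <= _).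
    by rewrite -{3}[y]powRr1 ?(ltW y0)// -!powRDr// ler_powR//; lra.
  by rewrite ler_wpM2r// ltW.
Qed.

Lemma truncn_half (x : R) : 2 <= x -> x / 2 <= (Num.truncn x)%:R <= x.
Proof.
move=> x2; have := truncnS_gt x; have := @truncn_le _ x; rewrite -natr1.
by move=> h1 h2; rewrite h1 ?andbT; lra.
Qed.

(** [m] is the least positive order for which the derivative of order m + 1 of the phase, of size b
    y^(2 theta - 2 (m + 1)), is at most y^(-1/2). One order costs y^2, so by minimality it is at
    least y^(-5/2). For m = 1 there is no previous order to compare with, and the lower bound on b
    takes its place. *)
Lemma weyl_order (theta y b B : R) J : theta + 1 < J%:R -> 2 < theta -> 1 <= y -> 0 < b <= B ->
  B <= y `^ (3 / 2) -> y `^ (2 - 2 * theta + 12^-1) <= b ->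
  exists m, [/\ (0 < m < J)%N, b * y `^ (2 * theta - 2 * m.+1%:R) <= y `^ (- 2^-1) &
    if m == 1%N then y `^ (12^-1 - 2) <= b * y `^ (2 * theta - 2 * m.+1%:R)
    else y `^ (- (5 / 2)) <= b * y `^ (2 * theta - 2 * m.+1%:R)].
Proof.
move=> Jt t2 y1 /andP[b0 bB] F1 b1; have y0 : 0 < y by lra.
have J1 : (1 < J)%N by rewrite -(ltr_nat R); lra.
pose P m := (0 < m)%N && (b * y `^ (2 * theta - 2 * m.+1%:R) <= y `^ (- 2^-1)).
have PJ : P J.-1.
  rewrite /P prednK ?(ltnW J1)//; apply/andP; split; first by case: J J1 {Jt}.
  apply: le_trans (_ : y `^ (3 / 2) * y `^ (2 * theta - 2 * J%:R) <= _).
    by rewrite ler_wpM2r ?powR_ge0// (le_trans bB).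
  by rewrite -powRDr// ler_powR//; lra.
case: (ex_minnP (ex_intro (fun m => is_true (P m)) _ PJ)) => m /andP[m0 hm] mmin.
exists m; split => //.
  by rewrite m0; have := mmin _ PJ; move: J1; clear; lia.
case: eqP => [e|/eqP mn1].
  rewrite e; apply: le_trans (_ : y `^ (2 - 2 * theta + 12^-1) * y `^ (2 * theta - 2 * 2) <= _).
    by rewrite -powRDr// ler_powR//; lra.
  by rewrite ler_wpM2r ?powR_ge0.
have nP : ~~ P m.-1 by apply/negP => /mmin; move: m0; clear; lia.
have h : y `^ (- 2^-1) < b * y `^ (2 * theta - 2 * m%:R).
  move: nP; rewrite /P prednK// ltNge; case: (posnP m.-1) => //.
  by move: mn1 m0; clear; lia.
have -> : 2 * theta - 2 * m.+1%:R = (2 * theta - 2 * m%:R) + (- 2) by rewrite -[m.+1%:R]natr1; ring.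
rewrite powRDr// mulrA; apply: le_trans (_ : y `^ (- 2^-1) * y `^ (- 2) <= _).
  by rewrite -powRDr// ler_powR//; lra.
by rewrite ler_wpM2r ?powR_ge0// ltW.
Qed.

(** Integral versions of the lengths: up to constants Q is Qr, the least admissible difference Q1 is
    Q y^(-om), and the block length H is y^(1 - om). *)
Lemma weyl_params (y om Qr c3 : R) (L : nat) : 1 <= y -> 0 < om <= 300^-1 -> 4 <= y `^ om ->
  y `^ (3 * om) <= Qr -> Qr <= y `^ (1 - om) -> 0 < c3 -> 16 / c3 ^+ 2 <= y `^ om -> c3 * y <= L%:R ->
  exists Q Q1 H : nat, [/\ [/\ (0 < Q1 <= Q)%N, (0 < H)%N & Q%:R <= Qr], Qr * y `^ (- om) / 4 <= Q1%:R,
    y `^ (1 - om) / 2 <= H%:R <= y `^ (1 - om),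
    4 * Q1%:R + 16 * Q%:R ^+ 3 / L%:R ^+ 2 <= 5 * y `^ (- om) * Q%:R &
    16 * H%:R ^+ 2 <= L%:R ^+ 2 * y `^ (- om)].
Proof.
move=> y1 /andP[om0 om1] F5 Q1r Q2r c30 F4 L1.
have y0 : 0 < y by lra.
have yom3 : 4 <= y `^ (3 * om).
  by apply: le_trans F5 _; rewrite ler_powR//; lra.
have [Q [Qa Qb]] : exists Q : nat, Qr / 2 <= Q%:R /\ Q%:R <= Qr.
  exists (Num.truncn Qr); apply/andP; apply: truncn_half; lra.
have yN : y `^ (- om) * y `^ om = 1 by rewrite -powRDr// addNr powRr0.
have yN0 : 0 < y `^ (- om) by rewrite powR_gt0.
have yN1 : y `^ (- om) <= 1 by rewrite -[leRHS](powRr0 y) ler_powR//; lra.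
have Q4 : 2 <= Q%:R :> R by lra.
have T2 : 2 <= Q%:R * y `^ (- om).
  apply: le_trans (_ : y `^ (3 * om) / 2 * y `^ (- om) <= _); last first.
    by rewrite ler_wpM2r ?(ltW yN0)//; lra.
  rewrite mulrAC -powRDr//.
  have : y `^ om <= y `^ (3 * om + - om) by rewrite ler_powR//; lra.
  lra.
have [Q1 [Q1a Q1b]] : exists Q1 : nat, Q%:R * y `^ (- om) / 2 <= Q1%:R /\ Q1%:R <= Q%:R * y `^ (- om).
  by exists (Num.truncn (Q%:R * y `^ (- om))); apply/andP; exact: truncn_half.
have [H [Ha Hb]] : exists H : nat, y `^ (1 - om) / 2 <= H%:R /\ H%:R <= y `^ (1 - om).
  by exists (Num.truncn (y `^ (1 - om))); apply/andP; apply: truncn_half; lra.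
have Q10 : (0 < Q1)%N by rewrite -(ltr0n R); lra.
have H0 : (0 < H)%N by rewrite -(ltr0n R); lra.
have L0' : 0 < L%:R :> R by apply: lt_le_trans L1; rewrite mulr_gt0.
have Q0 : 0 < Q%:R :> R by lra.
have Qle : Q1%:R <= Q%:R :> R by apply: le_trans Q1b _; rewrite ler_piMr// ltW.
have ysq e : (y `^ e) ^+ 2 = y `^ (2 * e) by rewrite -powR_mulrn ?powR_ge0// -powRrM mulrC.
have y2 : y ^+ 2 = y `^ 2 by rewrite -powR_mulrn ?(ltW y0).
have A16 : 16 * y `^ (- om) <= c3 ^+ 2.
  have c32 : 0 < c3 ^+ 2 by rewrite exprn_gt0.
  move: F4; rewrite ler_pdivrMr// => h.
  have := ler_wpM2r (ltW yN0) h; rewrite mulrAC [y `^ om * _]mulrC yN mul1r.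
  exact.
have hL2 : c3 ^+ 2 * y ^+ 2 <= L%:R ^+ 2.
  by rewrite -exprMn lerXn2r ?nnegrE ?mulr_ge0 ?(ltW c30) ?(ltW y0).
have ysplit : (y `^ (1 - om)) ^+ 2 = y ^+ 2 * y `^ (- om) * y `^ (- om).
  by rewrite ysq y2 -!powRDr//; congr (_ `^ _); ring.
have cL : 16 * (y `^ (1 - om)) ^+ 2 <= L%:R ^+ 2 * y `^ (- om).
  rewrite ysplit; apply: le_trans (_ : (c3 ^+ 2 * y ^+ 2) * y `^ (- om) <= _).
    have -> : 16 * (y ^+ 2 * y `^ (- om) * y `^ (- om)) = 16 * y `^ (- om) * (y ^+ 2 * y `^ (- om)) by ring.
    rewrite -[leRHS]mulrA; apply: ler_wpM2r => //.
    by rewrite mulr_ge0 ?sqr_ge0 ?(ltW yN0)//.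
  by rewrite ler_wpM2r ?(ltW yN0)//.
exists Q, Q1, H; split.
- by split => //; rewrite Q10 -(ler_nat R).
- have := ler_wpM2r (ltW yN0) Qa; move: Q1a; clear; lra.
- by rewrite Ha.
- have L2' : 0 < L%:R ^+ 2 :> R by rewrite exprn_gt0.
  have h1 : 16 * Q%:R ^+ 3 / L%:R ^+ 2 <= Q%:R * y `^ (- om).
    rewrite ler_pdivrMr// exprS mulrCA -[leRHS]mulrA ler_wpM2l ?(ltW Q0)// [y `^ _ * _]mulrC.
    apply: le_trans cL; rewrite ler_wpM2l// lerXn2r ?nnegrE ?powR_ge0//.
    exact: le_trans Qb Q2r.
  by move: h1 Q1b; clear; lra.
- apply: le_trans cL; rewrite ler_wpM2l// lerXn2r ?nnegrE ?powR_ge0//.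
Qed.

End WeylParameters.

Section WeylBound.
Variable R : realType.

(** Prepending one or two unit shifts to [qs] gives the first and second differences in x of the
    differenced phase, and these satisfy the hypotheses of [geometric_bound]. *)
Lemma weyl_base (theta c1 c2 K y om n0 b Qr : R) (J m L Q Q1 H : nat) (qs : seq nat) (v : R) :
  0 < c2 -> 1 <= K ->
  (forall y b v (qs : seq R), 0 < y -> 0 <= b -> (size qs <= J.+1)%N ->
    all (fun q => 0 <= q) qs -> c1 * y ^+ 2 <= v ->
    v + \sum_(q <- qs) q <= (2 * c2 + 2 * J%:R + 5) * y ^+ 2 ->
    K^-1 * (b * y `^ (2 * theta - 2 * (size qs)%:R) * \prod_(q <- qs) q)
      <= `|dif qs (fun v => b * v `^ theta) v| <=
    K * (b * y `^ (2 * theta - 2 * (size qs)%:R) * \prod_(q <- qs) q)) ->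
  1 <= y -> 0 < b -> (0 < m < J)%N -> 0 < om <= 300^-1 -> m%:R * om <= 100^-1 ->
  c1 * y ^+ 2 <= n0 <= c2 * y ^+ 2 -> L%:R <= c2 * y ->
  16 * 4 ^+ J * K <= y `^ 60^-1 ->
  0 < Qr -> Qr <= y `^ (1 - om) ->
  b * y `^ (2 * theta - 2 * m.+1%:R) * Qr ^+ m <= K^-1 ->
  y `^ 30^-1 <= b * y `^ (2 * theta - 2 * m.+1%:R) * Qr ^+ m * y ->
  Q%:R <= Qr -> Qr * y `^ (- om) / 4 <= Q1%:R -> (0 < H)%N ->
  y `^ (1 - om) / 2 <= H%:R <= y `^ (1 - om) ->
  16 * H%:R ^+ 2 <= L%:R ^+ 2 * y `^ (- om) ->
  size qs = m -> all (fun q => Q1 <= q <= Q)%N qs -> n0 <= v <= n0 + m%:R * Q%:R ->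
  nrm2 (iota 0 L) (fun x => dif [seq q%:R | q <- qs] (fun v => b * v `^ theta) (v + x%:R))
    <= 10 * (L%:R ^+ 2 * y `^ (- om)).
Proof.
move=> c20 K1 hK y1 b0 /andP[m0 mJ] /andP[om0 om1] mom /andP[n1 n2] L2 F3 Qr0 Q2r Q3r Q4r
  Qb Q1a H0 /andP[Ha Hb] cL sq aq /andP[v1 v2].
have y0 : 0 < y by lra.
have [g eg] : exists g, g = (fun v : R => b * v `^ theta) by eexists.
have [lam elam] : exists lam, lam = b * y `^ (2 * theta - 2 * m.+1%:R) by eexists.
have lam0 : 0 < lam by rewrite elam mulr_gt0// powR_gt0.
rewrite -elam in Q3r Q4r; rewrite -eg.
have K0 : 0 < K by lra.
have [ps eps] : exists ps : seq R, ps = [seq q%:R | q <- qs] by eexists.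
have sps : size ps = m by rewrite eps size_map.
have aps : all (fun q : R => Q1%:R <= q <= Q%:R) ps.
  rewrite eps all_map; apply: sub_all aq => q /andP[h1 h2] /=.
  by rewrite !ler_nat h1 h2.
have apos : all (fun q : R => 0 <= q) ps.
  by apply: sub_all aps => q /andP[h1 _]; apply: le_trans h1.
have aQ : all (fun q : R => q <= Q%:R) ps by apply: sub_all aps => q /andP[].
have /andP[P1 P2] := prod_between (ler0n R Q1) aps.
have sumQ := sum_le_size aQ; rewrite sps in P1 P2 sumQ.
rewrite -eps.
have yle1 : y `^ (1 - om) <= y by rewrite -[leRHS]powRr1 ?(ltW y0)// ler_powR//; lra.
have Qy : Q%:R <= y by apply: le_trans Qb _; apply: le_trans Q2r _.
have Hy : H%:R <= y by apply: le_trans Hb _.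
have yy : y <= y ^+ 2 by rewrite expr2 ler_peMl// ltW.
have y21 : 1 <= y ^+ 2 by apply: le_trans yy.
have mQ : m%:R * Q%:R <= J%:R * y ^+ 2.
  by rewrite ler_pM// ?ler_nat ?(ltnW mJ)// (le_trans Qy).
have rng x : (x < L + H)%N -> c1 * y ^+ 2 <= v + x%:R /\
    v + x%:R + 2 + m%:R * Q%:R <= (2 * c2 + 2 * J%:R + 5) * y ^+ 2.
  move=> xLH; have x0 : 0 <= x%:R :> R by [].
  split; first by move: n1 v1 x0; clear; lra.
  have : x%:R <= L%:R + H%:R :> R by rewrite -natrD ler_nat ltnW.
  have : c2 * y <= c2 * y ^+ 2 by rewrite ler_wpM2l// ltW.
  by move: n2 v2 L2 Hy yy y21 mQ; clear; lra.
have Q1r : 0 <= Q1%:R :> R by [].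
have QrQ1 : Qr ^+ m * y `^ (- (m%:R * om)) / 4 ^+ m <= Q1%:R ^+ m.
  have -> : Qr ^+ m * y `^ (- (m%:R * om)) / 4 ^+ m = (Qr * y `^ (- om) / 4) ^+ m.
    rewrite exprMn exprVn exprMn; congr (_ * _ / _).
    by rewrite -mulrN -[in RHS]powR_mulrn ?powR_ge0// -powRrM mulrC.
  by rewrite lerXn2r ?nnegrE// !mulr_ge0 ?powR_ge0// ltW.
have QQ : Q%:R ^+ m <= Qr ^+ m by rewrite lerXn2r ?nnegrE// ltW.
have s1 : size (1 :: ps) = m.+1 by rewrite /= sps.
have s2 : size (1 :: 1 :: ps) = m.+2 by rewrite /= sps.
have D1 x : (x < L + H)%N -> lam * Q1%:R ^+ m / K <= `|dif (1 :: ps) g (v + x%:R)| <= 1.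
  move=> /rng[r1 r2].
  have := hK y b (v + x%:R) (1 :: ps) y0 (ltW b0); rewrite s1 !big_cons mul1r -elam -eg => /(_ _ _ r1) h.
  have a1 : all (fun q : R => 0 <= q) (1 :: ps) by rewrite /= ler01.
  have sm : v + x%:R + (1 + \sum_(j <- ps) j) <= (2 * c2 + 2 * J%:R + 5) * y ^+ 2.
    by move: r2 sumQ; clear; lra.
  have /andP[h1 h2] := h (leqW mJ) a1 sm; apply/andP; split.
    by apply: le_trans h1; rewrite mulrC ler_wpM2l ?invr_ge0 ?(ltW K0)// ler_wpM2l// ltW.
  apply: le_trans h2 _; rewrite -[leRHS](mulfV (lt0r_neq0 K0)) ler_wpM2l ?(ltW K0)//.
  apply: le_trans Q3r; rewrite ler_wpM2l ?(ltW lam0)//; exact: le_trans QQ.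
have ym2 : 0 < y `^ (- 2) by rewrite powR_gt0.
have D2 x : (x < L + H)%N -> `|dif (1 :: 1 :: ps) g (v + x%:R)| <= y `^ (- 2).
  move=> /rng[r1 r2].
  have e2 : 2 * theta - 2 * m.+2%:R = (2 * theta - 2 * m.+1%:R) + - 2 by rewrite -[m.+2%:R]natr1; ring.
  have := hK y b (v + x%:R) (1 :: 1 :: ps) y0 (ltW b0).
  have e3 : b * y `^ (2 * theta - 2 * m.+2%:R) = lam * y `^ (- 2) by rewrite e2 powRDr// mulrA -elam.
  rewrite s2 !big_cons !mul1r e3 -eg => /(_ _ _ r1) h.
  have a1 : all (fun q : R => 0 <= q) (1 :: 1 :: ps) by rewrite /= ler01.
  have sm : v + x%:R + (1 + (1 + \sum_(j <- ps) j)) <= (2 * c2 + 2 * J%:R + 5) * y ^+ 2.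
    by move: r2 sumQ; clear; lra.
  have /andP[_ h2] := h mJ a1 sm.
  apply: le_trans h2 _; rewrite [lam * _ * _]mulrAC mulrA -[leRHS]mul1r ler_wpM2r ?(ltW ym2)//.
  rewrite -[leRHS](mulfV (lt0r_neq0 K0)) ler_wpM2l ?(ltW K0)//.
  apply: le_trans Q3r; rewrite ler_wpM2l ?(ltW lam0)//; exact: le_trans QQ.
have dl0 : 0 < lam * Q1%:R ^+ m / K.
  rewrite divr_gt0// mulr_gt0// (lt_le_trans _ QrQ1)// divr_gt0 ?exprn_gt0//.
  by rewrite mulr_gt0 ?exprn_gt0// powR_gt0.
have vS x : v + x.+1%:R = v + x%:R + 1 by rewrite -[x.+1%:R]natr1 addrA.
have G := @geometric_bound R (fun x => dif ps g (v + x%:R)) L H _ _ H0 dl0 (ltW ym2) _ _.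
apply: le_trans (G _ _) _.
- by move=> x xLH; rewrite vS; exact: D1.
- by move=> x xLH; rewrite !vS; exact: D2.
have [A eA] : exists A, A = y `^ (- om) by eexists.
have A0 : 0 < A by rewrite eA powR_gt0.
have A1 : A <= 1 by rewrite eA -[leRHS](powRr0 y) ler_powR//; move: om0; clear; lra.
have ysq e : (y `^ e) ^+ 2 = y `^ (2 * e) by rewrite -powR_mulrn ?powR_ge0// -powRrM mulrC.
have y2 : y ^+ 2 = y `^ 2 by rewrite -powR_mulrn ?(ltW y0).
have ysplit : (y `^ (1 - om)) ^+ 2 * y `^ (- 2) = A ^+ 2.
  by rewrite eA !ysq -!powRDr//; congr (_ `^ _); ring.
have T2 : (H%:R ^+ 2 * y `^ (- 2)) ^+ 2 <= A.
  apply: le_trans (_ : (A ^+ 2) ^+ 2 <= _).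
    apply: lerXn2r; rewrite ?nnegrE ?sqr_ge0// ?mulr_ge0 ?sqr_ge0 ?(ltW ym2)//.
    by rewrite -ysplit ler_wpM2r ?(ltW ym2)// lerXn2r ?nnegrE ?powR_ge0.
  by rewrite -exprM -[leRHS]expr1 ler_wiXn2l ?(ltW A0).
(* Over a block the phase advances by at least 8 y^(om / 2), which makes the geometric term at most
   y^(-om). *)
have Hdl : 8 * y `^ (om / 2) <= H%:R * (lam * Q1%:R ^+ m / K).
  have p4 : 0 < 4 ^+ m :> R by rewrite exprn_gt0.
  apply: le_trans (_ : (lam * Qr ^+ m * y) * (y `^ (- om) * y `^ (- (m%:R * om))) / (2 * 4 ^+ m * K) <= _).
    rewrite ler_pdivlMr ?mulr_gt0//.
    apply: le_trans (_ : y `^ 30^-1 * (y `^ (- om) * y `^ (- (m%:R * om))) <= _); last first.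
      by rewrite ler_wpM2r ?mulr_ge0 ?powR_ge0.
    apply: le_trans (_ : y `^ (om / 2) * (16 * 4 ^+ J * K) <= _).
      have -> : 8 * y `^ (om / 2) * (2 * 4 ^+ m * K) = y `^ (om / 2) * (16 * 4 ^+ m * K) by ring.
      rewrite ler_wpM2l ?powR_ge0// ler_wpM2r ?(ltW K0)// ler_wpM2l// ler_weXn2l ?(ltnW mJ)//.
      by rewrite ler1n.
    apply: le_trans (_ : y `^ (om / 2) * y `^ 60^-1 <= _); first by rewrite ler_wpM2l ?powR_ge0.
    by rewrite -!powRDr// ler_powR//; move: om0 om1 mom; clear; lra.
  rewrite ler_pdivrMr ?mulr_gt0//.
  have -> : H%:R * (lam * Q1%:R ^+ m / K) * (2 * 4 ^+ m * K) =
    (2 * H%:R) * (lam * (Q1%:R ^+ m * 4 ^+ m)) by field; rewrite gt_eqF.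
  have yo : y `^ (1 - om) = y * y `^ (- om) by rewrite powRDr// powRr1// ltW.
  apply: le_trans (_ : y `^ (1 - om) * (lam * (Qr ^+ m * y `^ (- (m%:R * om)))) <= _).
    by rewrite yo le_eqVlt; apply/orP; left; apply/eqP; ring.
  have q0 : 0 <= Qr ^+ m by rewrite exprn_ge0// ltW.
  rewrite ler_pM ?mulr_ge0 ?powR_ge0 ?(ltW lam0)//.
    by move: Ha; clear; lra.
  rewrite ler_wpM2l ?(ltW lam0)// -ler_pdivrMr//.
have T1 : 64 / (H%:R * (lam * Q1%:R ^+ m / K)) ^+ 2 <= A.
  have w0 : 0 < 8 * y `^ (om / 2) by rewrite mulr_gt0// powR_gt0.
  apply: le_trans (_ : 64 / (8 * y `^ (om / 2)) ^+ 2 <= _).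
    rewrite ler_wpM2l// lef_pV2 ?posrE ?(exprn_gt0 _ w0) ?(exprn_gt0 _ (lt_le_trans w0 Hdl))//.
    by rewrite lerXn2r ?nnegrE ?(ltW w0) ?(le_trans (ltW w0)).
  rewrite exprMn ysq.
  have -> : 2 * (om / 2) = om by field.
  rewrite eA powRN le_eqVlt; apply/orP; left; apply/eqP; field.
  by rewrite gt_eqF// powR_gt0.
apply: le_trans (_ : L%:R ^+ 2 * (A + 8 * A) + L%:R ^+ 2 * A <= _).
  by rewrite lerD ?eA// -eA ler_wpM2l ?sqr_ge0// lerD// ler_wpM2l.
by rewrite eA; move: (L%:R ^+ 2) (y `^ (- om)); clear => ? ?; lra.
Qed.

(** The saving [sg] is built from theta alone. The upper limit [B] of the frequencies, through which
    tau will enter, only affects how large y must be. *)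
Lemma weyl_bound (theta c1 c2 c3 : R) : 2 < theta -> theta \isn't a Num.int ->
  0 < c1 -> 0 < c2 -> 0 < c3 ->
  exists2 sg : R, 0 < sg & forall B : R, \forall y \near +oo, forall (n0 b : R) (L : nat),
    c1 * y ^+ 2 <= n0 <= c2 * y ^+ 2 -> c3 * y <= L%:R <= c2 * y ->
    y `^ (2 - 2 * theta + 12^-1) <= b <= B ->
    nrm2 (iota 0 L) (fun x => b * (n0 + x%:R) `^ theta) <= (4 * L%:R * y `^ (- sg)) ^+ 2.
Proof.
move=> t2 ni c10 c20 c30.
(* With theta + 1 < J some order m < J is admissible even for b as large as y^(3/2). *)
have [J eJ] : exists J, J = (Num.truncn theta).+2 by eexists.
have Jt : theta + 1 < J%:R.
  by have := truncnS_gt theta; rewrite eJ -[_.+2%:R]natr1; lra.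
have J4 : 3 < J%:R :> R by lra.
have J0 : 0 < J%:R :> R by lra.
have [om eom] : exists om : R, om = (100 * J%:R)^-1 by eexists.
have om0 : 0 < om by rewrite eom invr_gt0 mulr_gt0.
have Jom : J%:R * om = 100^-1 by rewrite eom; field; rewrite gt_eqF.
have om1 : om <= 300^-1.
  have : 3 * om <= J%:R * om by rewrite ler_wpM2r ?ltW.
  lra.
have omr : 0 < om <= 300^-1 by rewrite om0.
have c40 : 0 < 2 * c2 + 2 * J%:R + 5 by lra.
have [K K1 hK] := @dif_size R theta c1 _ J.+1 ni c10 c40.
have p2 : 0 < 2 ^+ J :> R by rewrite exprn_gt0.
have K0 : 0 < K by lra.
exists (om / (4 * 2 ^+ J)); first by rewrite divr_gt0// mulr_gt0.
set sg := om / _ => B.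
near=> y => n0 b L hn /andP[L1 L2] /andP[b1 b2].
have y1 : 1 <= y by near: y; exact: nbhs_pinfty_ge.
have F1 : B <= y `^ (3 / 2) by near: y; apply: near_powR_ge; rewrite divr_gt0.
have F2 : K <= y `^ 10^-1 by near: y; apply: near_powR_ge; rewrite invr_gt0.
have F3 : 16 * 4 ^+ J * K <= y `^ 60^-1 by near: y; apply: near_powR_ge; rewrite invr_gt0.
have F4 : 16 / c3 ^+ 2 <= y `^ om by near: y; exact: near_powR_ge.
have F5 : 4 <= y `^ om by near: y; exact: near_powR_ge.
have F6 : 5 <= y `^ (om / 2) by near: y; apply: near_powR_ge; rewrite divr_gt0.
have y0 : 0 < y by rewrite (lt_le_trans ltr01).
have b0 : 0 < b by apply: lt_le_trans b1; exact: powR_gt0.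
have bB : 0 < b <= B by rewrite b0.
have [m [mJ hm lamlow]] := weyl_order Jt t2 y1 bB F1 b1.
have /andP[m0 mJ'] := mJ.
have lam0 : 0 < b * y `^ (2 * theta - 2 * m.+1%:R) by rewrite mulr_gt0// powR_gt0.
have mom : m%:R * om <= 100^-1 by rewrite -Jom ler_wpM2r ?(ltW om0)// ler_nat ltnW.
have K0' : 0 < K^-1 by rewrite invr_gt0.
have F2' : K^-1^-1 <= y `^ 10^-1 by rewrite invrK.
have [Qr [Q1r Q2r Q3r Q4r]] := choose_shift K0' lam0 m0 y1 om0 mom hm F2' lamlow.
have [Q [Q1 [H [[hQ1 H0 Qb] Q1a hH hE cL]]]] := weyl_params y1 omr F5 Q1r Q2r c30 F4 L1.
have Qr0 : 0 < Qr by apply: lt_le_trans Q1r; exact: powR_gt0.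
have Lp : (0 < L)%N by rewrite -(ltr0n R) (lt_le_trans _ L1)// mulr_gt0.
have wpow : y `^ (- (om / 4)) <= (y `^ (- sg)) ^+ (2 ^ m).
  rewrite -[leRHS]powR_mulrn ?powR_ge0// -powRrM ler_powR//.
  rewrite mulNr lerN2 natrX.
  have -> : om / 4 = sg * 2 ^+ J by rewrite /sg; field; rewrite gt_eqF.
  rewrite ler_wpM2l ?divr_ge0 ?(ltW om0) ?mulr_ge0 ?(ltW p2)//.
  by rewrite ler_weXn2l ?ler1n// ltnW.
have ysq e : (y `^ e) ^+ 2 = y `^ (2 * e) by rewrite -powR_mulrn ?powR_ge0// -powRrM mulrC.
have A5 : 5 * y `^ (- om) <= y `^ (- (om / 2)).
  have -> : - (om / 2) = om / 2 + - om by field.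
  by rewrite powRDr// ler_wpM2r ?powR_ge0.
have om2 : y `^ (- (om / 2)) <= y `^ (- (om / 4)).
  rewrite ler_powR// lerN2 ler_wpM2l ?(ltW om0)// lef_pV2 ?posrE//.
  by rewrite ler_nat.
apply: (@vdc_iter R (fun v => b * v `^ theta) L Q Q1 m n0 (y `^ (- sg))) => //.
- rewrite powR_ge0/= -[leRHS](powRr0 y) ler_powR// lerNl oppr0 divr_ge0 ?(ltW om0)//.
- apply: le_trans hE _; rewrite ler_wpM2r//.
  apply: le_trans A5 _; apply: le_trans om2 _; apply: le_trans wpow _.
  by rewrite ler_peMl ?exprn_ge0 ?powR_ge0// ler1n.
- move=> qs v sq aq hv.
  apply: le_trans (weyl_base c20 K1 hK y1 b0 mJ omr mom hn L2 F3 Qr0 Q2r Q3r Q4r Qb Q1a H0 hH cL sq aq hv) _.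
  apply: le_trans (_ : 16 * L%:R ^+ 2 * y `^ (- (om / 2)) <= _).
    have := ler_wpM2l (sqr_ge0 (L%:R : R)) A5; have : 0 <= L%:R ^+ 2 * y `^ (- om) by rewrite mulr_ge0 ?sqr_ge0 ?powR_ge0.
    by move: (L%:R ^+ 2) (y `^ (- om)) (y `^ (- (om / 2))); clear => ? ? ?; lra.
  rewrite !exprMn.
  have -> : 4 ^+ 2 = 16 :> R by rewrite -natrX.
  rewrite ler_wpM2l ?mulr_ge0 ?sqr_ge0//.
  have -> : y `^ (- (om / 2)) = (y `^ (- (om / 4))) ^+ 2 by rewrite ysq; congr (_ `^ _); field.
  by rewrite lerXn2r ?nnegrE ?powR_ge0 ?exprn_ge0 ?powR_ge0.
Unshelve. all: by end_near. Qed.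

End WeylBound.

(** * The coarse count *)

Section TupleSums.
Variable R : realType.

Lemma size_tup (T : Type) (S : seq T) k : size (tup S k) = (size S ^ k)%N.
Proof. by elim: k => //= k IH; rewrite size_map size_allpairs IH expnS. Qed.

Lemma sum_tupS (T : Type) (S : seq T) k (f : seq T -> R) :
  \sum_(a <- tup S k.+1) f a = \sum_(x <- S) \sum_(a <- tup S k) f (x :: a).
Proof. by rewrite /= big_map big_allpairs. Qed.

Lemma sum_tup_cat (T : Type) (S : seq T) k l (f : seq T -> R) :
  \sum_(a <- tup S (k + l)) f a = \sum_(a <- tup S k) \sum_(b <- tup S l) f (a ++ b).
Proof.
elim: k f => [|k IH] f; first by rewrite [RHS]big_seq1.
rewrite addSn !sum_tupS; apply: eq_bigr => x _.
by rewrite (IH (fun a => f (x :: a))).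
Qed.

Lemma sum_sub (T : eqType) (S S' : seq T) (f : T -> R) : uniq S' -> {subset S' <= S} ->
  {in S, forall x, 0 <= f x} -> \sum_(x <- S') f x <= \sum_(x <- S) f x.
Proof.
elim: S' S => [|x S' IH] S /=.
  by move=> _ _ f0; rewrite big_nil big_seq; apply: sumr_ge0.
move=> /andP[xS' uS'] sS f0; have xS : x \in S by rewrite sS ?mem_head.
rewrite big_cons (perm_big _ (perm_to_rem xS)) big_cons /= lerD2l; apply: IH => //.
  move=> z zS'; have zS : z \in S by rewrite sS// inE zS' orbT.
  have := perm_mem (perm_to_rem xS) z; rewrite zS inE => /esym/orP[/eqP e|//].
  by rewrite -e zS' in xS'.
by move=> z /mem_rem zS; exact: f0.
Qed.

Lemma sum_tup_sub (T : eqType) (S S' : seq T) k (f : seq T -> R) : uniq S' -> {subset S' <= S} ->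
  (forall a, 0 <= f a) -> \sum_(a <- tup S' k) f a <= \sum_(a <- tup S k) f a.
Proof.
move=> uS' sS; elim: k f => [|k IH] f f0 //.
rewrite !sum_tupS; apply: le_trans (_ : \sum_(x <- S') \sum_(a <- tup S k) f (x :: a) <= _).
  by apply: ler_sum => x _; exact: (IH (fun a => f (x :: a))).
by apply: (@sum_sub _ _ _ (fun x => \sum_(a <- tup S k) f (x :: a))) => // x _; apply: sumr_ge0.
Qed.

(** Once the sequence has become nonnegative, its next [K] values stay within K steps of zero, so a
    sign change yields [K] small values rather than one. *)
Lemma discrete_ivt (v : nat -> R) (n K : nat) (Dl W : R) : 0 < Dl -> K%:R * Dl <= W ->
  v 0%N < 0 -> W <= v n -> (forall i, (i < n)%N -> `|v i.+1 - v i| <= Dl) ->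
  K%:R <= \sum_(i <- iota 0 n.+1) (`|v i| <= W)%R%:R :> R.
Proof.
move=> Dl0 KW v0 vn st.
have [->|K0] := posnP K; first by apply: sumr_ge0 => i _; rewrite ler0n.
have W0 : 0 < W by apply: lt_le_trans KW; rewrite mulr_gt0// ltr0n.
have exP : exists i, 0 <= v i by exists n; apply: le_trans vn; exact: ltW.
case: (ex_minnP exP) => i0 vi0 imin.
have i0n : (i0 <= n)%N by apply: imin; apply: le_trans vn; exact: ltW.
case: i0 vi0 imin i0n => [|i1] vi0 imin i0n; first by move: v0; rewrite ltNge vi0.
have vi1 : v i1 < 0 by rewrite ltNge; apply/negP => /imin; rewrite ltnn.
have up k : (i1.+1 + k <= n)%N -> - (k%:R * Dl) <= v (i1.+1 + k)%N < k.+1%:R * Dl.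
  elim: k => [|k IH] hk.
    have := st i1 i0n; rewrite addn0 mul0r oppr0 vi0 mul1r /= ler_norml => /andP[_ h].
    by move: h vi1; clear; lra.
  have hk' : (i1.+1 + k <= n)%N by apply: leq_trans hk; rewrite leq_add2l.
  have /andP[h1 h2] := IH hk'.
  have := st (i1.+1 + k)%N; rewrite -addnS => /(_ hk); rewrite ler_norml => /andP[h3 h4].
  rewrite -[k.+2%:R]natr1 -[in X in - X]natr1 !mulrDl !mul1r.
  by apply/andP; split; move: h1 h2 h3 h4; rewrite -?natr1 ?mulrDl ?mul1r; clear; lra.
have iK : (i1.+1 + K <= n.+1)%N.
  rewrite leqNgt; apply/negP => h.
  have [/andP[_ h2]] : - ((n - i1.+1)%N%:R * Dl) <= v (i1.+1 + (n - i1.+1))%N < (n - i1.+1).+1%:R * Dl.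
    by apply: up; rewrite subnKC.
  move: h2; rewrite subnKC// => h2.
  have : (n - i1.+1).+1%:R * Dl <= K%:R * Dl by rewrite ler_pM2r// ler_nat; lia.
  by move: h2 vn KW; clear; lra.
rewrite -natr_sum ler_nat.
have -> : (\sum_(i <- iota 0 n.+1) (`|v i| <= W)%R)%N = size [seq i <- iota 0 n.+1 | (`|v i| <= W)%R].
  by rewrite size_filter -sum1_count [RHS]big_mkcond; apply: eq_bigr => i _; case: (_ <= _).
rewrite -[leqLHS](size_iota i1.+1 K); apply: uniq_leq_size; first exact: iota_uniq.
move=> i; rewrite mem_filter !mem_iota add0n /= => /andP[h1 h2].
rewrite (leq_trans h2 iK) andbT.
have e : i = (i1.+1 + (i - i1.+1))%N by rewrite subnKC.
have i_n : (i1.+1 + (i - i1.+1) <= n)%N by rewrite -e -ltnS (leq_trans h2 iK).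
have /andP[h3 h4] := up _ i_n.
rewrite -e in h3 h4.
have h5 : (i - i1.+1).+1%:R * Dl <= K%:R * Dl by rewrite ler_pM2r// ler_nat -(ltn_add2l i1.+1) subnKC.
rewrite -[_.+1%:R]natr1 mulrDl mul1r in h4 h5.
by rewrite ler_norml; apply/andP; split; move: h3 h4 h5 KW Dl0; clear; lra.
Qed.

End TupleSums.

(** * Moving a pair of variables with constant sum *)

Section PairMoves.
Variable R : realType.

(** The remainder is of size y^(2 theta - 6) (c y)^3, a multiple of y^(2 theta - 3), which is
    therefore the unit of accuracy in the coarse problem. *)
Lemma taylor2 (theta c : R) : 0 < c -> exists2 C, 0 <= C & forall y z : R, 1 <= y -> 2 * c <= y ->
  `|z| <= c * y ->
  `|(y ^+ 2 + z) `^ theta - (y ^+ 2) `^ theta - theta * (y `^ (2 * theta - 3) * y) * z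
    - theta * (theta - 1) / 2 * (y `^ (2 * theta - 3) / y) * z ^+ 2| <= C * y `^ (2 * theta - 3).
Proof.
move=> c0; have [C C0 H] := taylor_powR 3 theta; exists (C * c ^+ 3).
  by rewrite mulr_ge0// exprn_ge0// ltW.
move=> y z y1 yc zc; have y0 : 0 < y by lra.
have y20 : 0 < y ^+ 2 by rewrite exprn_gt0.
have zE e i : e = 2 * theta - 2 * i%:R -> (y ^+ 2) `^ (theta - i%:R) = y `^ e.
  by move=> ->; rewrite -powR_mulrn ?(ltW y0)// -powRrM mulrBr.
have := H (y ^+ 2) z y20; rewrite !big_ord_recl big_ord0 /= /bump /= => /(_ _)/wrap[].
  apply: le_trans zc _; rewrite expr2 mulrAC ler_wpM2r ?(ltW y0)//; lra.
rewrite subr0 expr0 expr1 !(add0n, addn0) ?(addr0, mulr1, mul1r).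
set U := y `^ (2 * theta - 3).
rewrite (zE (2 * theta - 2) 1%N) ?mulr1// (zE (2 * theta - 4) 2%N); last by ring.
rewrite (zE (2 * theta - 6) 3%N); last by ring.
have -> : y `^ (2 * theta - 2) = U * y.
  by rewrite -{2}[y]powRr1 ?(ltW y0)// -powRDr//; congr (_ `^ _); ring.
have -> : y `^ (2 * theta - 4) = U / y.
  by rewrite -[y^-1]powR_inv1 ?(ltW y0)// -powRDr//; congr (_ `^ _); ring.
have -> : y `^ (2 * theta - 6) = U / y ^+ 3.
  have -> : (y ^+ 3)^-1 = y `^ (- 3) by rewrite powRN -powR_mulrn// ltW.
  by rewrite -powRDr//; congr (_ `^ _); ring.
move=> h; apply: le_trans (_ : C * (U / y ^+ 3 * `|z| ^+ 3) <= _).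
  apply: le_trans h; rewrite le_eqVlt; apply/orP; left; apply/eqP; congr `|_|; field.
  by rewrite gt_eqF.
have -> : C * (U / y ^+ 3 * `|z| ^+ 3) = C * U * (`|z| ^+ 3 / y ^+ 3) by ring.
have -> : C * c ^+ 3 * U = C * U * c ^+ 3 by ring.
rewrite ler_wpM2l ?mulr_ge0 ?powR_ge0// ler_pdivrMr ?exprn_gt0// -exprMn.
apply: lerXn2r; rewrite ?nnegrE//.
by rewrite mulr_ge0// ltW.
Qed.

Lemma sum_taylor2 (theta c C y : R) (a : seq nat) :
  (forall z : R, `|z| <= c * y ->
  `|(y ^+ 2 + z) `^ theta - (y ^+ 2) `^ theta - theta * (y `^ (2 * theta - 3) * y) * z
    - theta * (theta - 1) / 2 * (y `^ (2 * theta - 3) / y) * z ^+ 2| <= C * y `^ (2 * theta - 3)) ->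
  {in a, forall x, `|x%:R - y ^+ 2| <= c * y} ->
  `|\sum_(x <- a) x%:R `^ theta - (size a)%:R * (y ^+ 2) `^ theta
    - theta * (y `^ (2 * theta - 3) * y) * (\sum_(x <- a) (x%:R - y ^+ 2))
    - theta * (theta - 1) / 2 * (y `^ (2 * theta - 3) / y) * (\sum_(x <- a) (x%:R - y ^+ 2) ^+ 2)|
  <= (size a)%:R * (C * y `^ (2 * theta - 3)).
Proof.
move=> H; elim: a => [|x a IH] ha.
  by rewrite !big_nil /= !mulr0 !mul0r !subr0 normr0.
rewrite !big_cons /= -[(size a).+1%:R]natr1 [leRHS]mulrDl mul1r.
have := H (x%:R - y ^+ 2) (ha x (mem_head _ _)); rewrite [y ^+ 2 + _]addrC subrK => h1.
have ha' : {in a, forall x, `|x%:R - y ^+ 2| <= c * y} by move=> z za; apply: ha; rewrite inE za orbT.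
have h2 := IH ha'.
apply: le_trans (lerD h2 h1); apply: le_trans (ler_normD _ _).
rewrite le_eqVlt; apply/orP; left; apply/eqP; congr `|_|; ring.
Qed.

(** With the other variables fixed, keeping x1 + x2 constant keeps the total sum equal to [N], so up
    to an error O(U) only the quadratic term varies. As x1 crosses y^2 + b y the value changes sign
    in steps O(U), and a number of steps proportional to q stays within U q of the target. *)
Lemma rest_count (theta c C y U q b e w b0 h : R) (p s K N : nat) (S a : seq nat) :
  let k0 := theta * (theta - 1) / 2 in
  2 < theta -> 0 < U -> 0 < y -> 0 < c -> 0 <= C -> 0 < (K%:R : R) * (6 * k0 * c + 2 * s%:R * C) <= q ->
  (forall a : seq nat, {in a, forall x, `|x%:R - y ^+ 2| <= c * y} ->
    `|\sum_(x <- a) x%:R `^ theta - (size a)%:R * (y ^+ 2) `^ theta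
    - theta * (U * y) * (\sum_(x <- a) (x%:R - y ^+ 2))
    - k0 * (U / y) * (\sum_(x <- a) (x%:R - y ^+ 2) ^+ 2)| <= (size a)%:R * (C * U)) ->
  (1 < s)%N -> size a = (s - 2)%N -> (0 < p)%N -> N%:R = s%:R * y ^+ 2 + h ->
  theta * h + k0 * 2 * p%:R * b ^+ 2 = 0 ->
  0 < b0 -> b0 <= b -> 0 < e -> 2 * e <= b0 -> b + 2 * e <= c -> 0 <= w -> 2 * w <= e ->
  2 * c * w + w ^+ 2 + w <= b0 * e -> 20 <= e * y -> 2 * c <= y -> q + s%:R * C <= k0 * b0 * e * y ->
  {in a, forall x, `|x%:R - y ^+ 2| <= c * y} ->
  `|\sum_(x <- a) (x%:R - y ^+ 2) - h| <= w * y ->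
  `|\sum_(x <- a) (x%:R - y ^+ 2) ^+ 2 - 2 * (p%:R - 1) * (b ^+ 2 * y ^+ 2)| <= w * y ^+ 2 ->
  (forall x : nat, `|(x%:R : R) - y ^+ 2| < c * y -> x \in S) ->
  (K%:R : R) <= \sum_(x1 <- S) \sum_(x2 <- S)
    (`|\sum_(x <- [:: x1, x2 & a]) x%:R `^ theta - s%:R * (y ^+ 2) `^ theta| <= U * q)%R%:R.
Proof.
move=> k0 t2 U0 y0 c0 C0 /andP[K0 Kq] HT s1 sza p0 NE hb b00 bb e0 eb bc w0 we wb ey yc big aw a1 a2 HS.
have [es ees] : exists es, es = h - \sum_(x <- a) (x%:R - y ^+ 2) by eexists.
have [Sa eSa] : exists Sa, Sa = \sum_(x <- a) (x%:R - y ^+ 2) ^+ 2 - 2 * (p%:R - 1) * (b ^+ 2 * y ^+ 2) by eexists.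
have es1 : `|es| <= w * y by rewrite ees distrC.
rewrite -eSa in a2.
have y20 : 2 * (e * y) <= b * y by rewrite mulrA ler_wpM2r ?(ltW y0)// (le_trans eb bb).
(* x1 runs over A + i for i <= n, from about y^2 + b y - e y to beyond y^2 + b y + e y. *)
have [A [A1 A2]] : exists A : nat, A%:R <= y ^+ 2 + b * y - e * y /\ y ^+ 2 + b * y - e * y < A%:R + 1.
  exists (Num.truncn (y ^+ 2 + b * y - e * y)); rewrite natr1 truncnS_gt truncn_le; split=> //.
  by have := sqr_ge0 y; lra.
have [n [n1 n2]] : exists n : nat, 2 * (e * y) + 1 <= n%:R /\ n%:R <= 2 * (e * y) + 2.
  exists (Num.truncn (2 * (e * y))).+2; have := truncnS_gt (2 * (e * y)).
  have := @truncn_le _ (2 * (e * y)); rewrite -[_.+2%:R]natr1 -[_.+1%:R]natr1; lra.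
have ey0 : 0 < e * y by rewrite mulr_gt0.
have ecy : b * y + 2 * (e * y) <= c * y by rewrite mulrA -mulrDl ler_wpM2r ?(ltW y0).
have wey : 2 * (w * y) <= e * y by rewrite mulrA ler_wpM2r ?(ltW y0).
have cyy : 2 * (c * y) <= y ^+ 2 by rewrite expr2 mulrA ler_wpM2r ?(ltW y0).
move: es1; rewrite ler_norml => /andP[es1 es2].
have suma : \sum_(x <- a) (x%:R : R) = (s%:R - 2) * y ^+ 2 + (h - es).
  have -> : h - es = \sum_(x <- a) (x%:R - y ^+ 2) by rewrite ees; ring.
  rewrite sumrB big_const_seq count_predT iter_addr_0 sza.
  by rewrite -[y ^+ 2 *+ _]mulr_natl natrB//; ring.
have [M eM] : exists M, M = (N - \sum_(x <- a) x)%N by eexists.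
have MR : M%:R = 2 * y ^+ 2 + es :> R.
  rewrite eM natrB ?natr_sum ?suma ?NE; first by ring.
  by rewrite -(ler_nat R) natr_sum suma NE; move: es1 es2 wey ecy y20 cyy ey0; clear; lra.
have AnM : (A + n <= M)%N by rewrite -(ler_nat R) natrD MR; move: A1 n2 es1 es2 wey ecy y20 cyy ey; clear; lra.
have [t et] : exists t : nat -> R, t = fun i => A%:R + i%:R - y ^+ 2 - b * y by eexists.
have tb i : (i <= n)%N -> - (e * y) - 1 <= t i <= e * y + 2.
  move=> i_n; have : i%:R <= n%:R :> R by rewrite ler_nat.
  by have : 0 <= i%:R :> R by []; move: A1 A2 n2; rewrite et; clear; lra.
have z1 i : (A + i)%N%:R - y ^+ 2 = b * y + t i by rewrite et natrD; ring.
have z2 i : (i <= n)%N -> (M - (A + i))%N%:R - y ^+ 2 = es - (b * y + t i).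
  move=> i_n; rewrite natrB ?MR ?et ?natrD; last by apply: leq_trans AnM; rewrite leq_add2l.
  ring.
have z1b i : (i <= n)%N -> `|(A + i)%N%:R - y ^+ 2| < c * y.
  move=> /tb /andP[t1 t3]; rewrite z1 ltr_norml.
  by apply/andP; split; move: t1 t3 ey0 ecy wey y20 ey; clear; lra.
have z2b i : (i <= n)%N -> `|(M - (A + i))%N%:R - y ^+ 2| < c * y.
  move=> i_n; have /andP[t1 t3] := tb i i_n; rewrite z2// ltr_norml.
  by apply/andP; split; move: es1 es2 t1 t3 ey0 ecy wey y20 ey; clear; lra.
have [v ev] : exists v : nat -> R, v = fun i =>
    \sum_(x <- [:: (A + i)%N, (M - (A + i))%N & a]) x%:R `^ theta - s%:R * (y ^+ 2) `^ theta by eexists.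
(* Deviation of the sum of squares from the balanced value 2 p b^2 y^2, at which the terms of first
   and second order cancel. *)
have [Q eQ] : exists Q : nat -> R, Q = fun i => 4 * (b * y) * t i + 2 * t i ^+ 2
    - 2 * (b * y + t i) * es + es ^+ 2 + Sa by eexists.
have hv i : (i <= n)%N -> `|v i - k0 * (U / y) * Q i| <= s%:R * C * U.
  move=> i_n.
  have := HT [:: (A + i)%N, (M - (A + i))%N & a].
  have -> : size [:: (A + i)%N, (M - (A + i))%N & a] = s by rewrite /= sza -addn2 subnK.
  move=> /(_ _)/wrap[].
    move=> x; rewrite !inE => /or3P[/eqP ->|/eqP ->|]; [exact: ltW (z1b i i_n)|exact: ltW (z2b i i_n)|exact: aw].
  rewrite -[s%:R * C * U]mulrA => h1; apply: le_trans h1; rewrite le_eqVlt; apply/orP; left; apply/eqP.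
  congr `|_|; rewrite ev -!addrA; congr (_ + (_ + _)).
  rewrite -opprD; congr (- _).
  have -> : \sum_(x <- [:: (A + i)%N, (M - (A + i))%N & a]) (x%:R - y ^+ 2) = h.
    by rewrite !big_cons z1 z2// ees; ring.
  have -> : \sum_(x <- [:: (A + i)%N, (M - (A + i))%N & a]) (x%:R - y ^+ 2) ^+ 2 =
     Q i + 2 * p%:R * b ^+ 2 * y ^+ 2.
    rewrite !big_cons z1 z2// eQ.
    have -> : \sum_(j <- a) (j%:R - y ^+ 2) ^+ 2 = Sa + 2 * (p%:R - 1) * (b ^+ 2 * y ^+ 2) by rewrite eSa subrK.
    ring.
  have yn : y != 0 by rewrite gt_eqF.
  have -> : k0 * (U / y) * (Q i + 2 * p%:R * b ^+ 2 * y ^+ 2) =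
    k0 * (U / y) * Q i + U * y * (k0 * 2 * p%:R * b ^+ 2) by field.
  have -> : k0 * 2 * p%:R * b ^+ 2 = - (theta * h) by move: hb; clear; lra.
  by ring.
have k00 : 0 < k0 by rewrite /k0 divr_gt0// mulr_gt0// ?(lt_trans _ t2)//; move: t2; clear; lra.
have Uy : 0 < U / y by rewrite divr_gt0.
have K1 : 0 < k0 * (U / y) by rewrite mulr_gt0.
(* Errors coming from the other variables. The smallness of [w] keeps them below the change 4 b y t
   at the two ends. *)
have Qerr i : (i <= n)%N -> `|Q i - (4 * (b * y) * t i + 2 * t i ^+ 2)| <= b0 * e * y ^+ 2.
  move=> i_n; have -> : Q i - (4 * (b * y) * t i + 2 * t i ^+ 2) = es ^+ 2 + Sa - 2 * ((b * y + t i) * es).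
    by rewrite eQ; ring.
  have b1 : `|(b * y + t i) * es| <= (c * y) * (w * y).
    rewrite normrM -z1 ler_pM//; first exact: ltW (z1b i i_n).
    by rewrite ler_norml es1.
  have b2 : es ^+ 2 <= (w * y) ^+ 2.
    rewrite -[leLHS]real_normK ?num_real//; apply: lerXn2r; rewrite ?nnegrE ?mulr_ge0 ?(ltW y0)//.
    by rewrite ler_norml es1.
  have b3 : (2 * c * w + w ^+ 2 + w) * y ^+ 2 <= b0 * e * y ^+ 2 by rewrite ler_wpM2r ?sqr_ge0.
  move: b1 b2 b3 a2 (sqr_ge0 es); rewrite !ler_norml exprMn.
  have -> : c * y * (w * y) = c * w * y ^+ 2 by ring.
  move=> /andP[g1 g2] g3 g4 /andP[g5 g6] g7.
  by apply/andP; split; move: g1 g2 g3 g4 g5 g6 g7; clear; lra.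
have bey : b0 * e * y ^+ 2 <= (b * y) * (e * y).
  have -> : (b * y) * (e * y) = b * e * y ^+ 2 by ring.
  by rewrite ler_wpM2r ?sqr_ge0// ler_wpM2r// ltW.
have by0 : 0 < b * y by rewrite mulr_gt0// (lt_le_trans b00 bb).
have QnP : 3 * (b0 * e * y ^+ 2) <= Q n.
  have := Qerr n (leqnn n); rewrite ler_norml => /andP[g1 _].
  have tn : e * y <= t n by rewrite et; move: A2 n1; clear; lra.
  have : (b * y) * (e * y) <= (b * y) * t n by rewrite ler_wpM2l// ltW.
  by have := sqr_ge0 (t n); move: g1 bey; clear; lra.
have Q0N : Q 0%N <= - (3 / 2 * (b0 * e * y ^+ 2)).
  have := Qerr 0%N (leq0n n); rewrite ler_norml => /andP[_ g1].
  have t01 : t 0%N <= - (e * y) by rewrite et addr0; move: A1; clear; lra.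
  have /andP[t02 _] := tb 0%N (leq0n n).
  have p1 : 29 / 20 * (b * y) <= 2 * (b * y) + t 0%N by move: t02 y20 ey; clear; lra.
  have p2 : (e * y) * (29 / 20 * (b * y)) <= (- t 0%N) * (2 * (b * y) + t 0%N).
    by apply: ler_pM; move: t01 p1 ey0 by0; clear; lra.
  have X0 : 0 <= b0 * e * y ^+ 2 by rewrite mulr_ge0 ?sqr_ge0// mulr_ge0// ltW.
  by move: g1 p2 bey X0; clear; lra.
have kE x : k0 * (U / y) * (x * (b0 * e * y ^+ 2)) = U * (x * (k0 * b0 * e * y)).
  by field; rewrite gt_eqF.
have bigU : U * q + s%:R * C * U <= U * (k0 * b0 * e * y).
  by rewrite [s%:R * C * U]mulrC -mulrDr ler_wpM2l// ltW.
have q0 : 0 < q by apply: lt_le_trans Kq.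
have sC : 0 <= s%:R * C * U by rewrite !mulr_ge0// ltW.
have Uq : 0 < U * q by rewrite mulr_gt0.
have vn : U * q <= v n.
  have := hv n (leqnn n); rewrite ler_norml => /andP[g1 _].
  have := ler_wpM2l (ltW K1) QnP; rewrite kE.
  by move: g1 bigU sC Uq; move: (k0 * b0 * e * y) => X; clear; lra.
have v0 : v 0%N < 0.
  have := hv 0%N (leq0n n); rewrite ler_norml => /andP[_ g1].
  have := ler_wpM2l (ltW K1) Q0N; rewrite mulrN kE.
  by move: g1 bigU sC Uq; move: (k0 * b0 * e * y) => X; clear; lra.
have [Dl eDl] : exists Dl, Dl = U * (6 * k0 * c + 2 * s%:R * C) by eexists.
have step i : (i < n)%N -> `|v i.+1 - v i| <= Dl.
  move=> i_n; have := hv i (ltnW i_n); have := hv i.+1 i_n.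
  have Qd : Q i.+1 - Q i = 2 * (((A + i)%N%:R - y ^+ 2) - ((M - (A + i))%N%:R - y ^+ 2) + 1).
    by rewrite z1 z2 ?(ltnW i_n)// eQ et -[i.+1%:R]natr1; ring.
  have Qb : `|Q i.+1 - Q i| <= 6 * (c * y).
    rewrite Qd; have := z1b i (ltnW i_n); have := z2b i (ltnW i_n).
    rewrite !ltr_norml ler_norml => /andP[g1 g2] /andP[g3 g4].
    by apply/andP; split; move: g1 g2 g3 g4 ecy ey y20; clear; lra.
  have kb : `|k0 * (U / y) * (Q i.+1 - Q i)| <= k0 * (U / y) * (6 * (c * y)).
    by rewrite normrM [`|k0 * _|]gtr0_norm// ler_wpM2l// ltW.
  have e6 : k0 * (U / y) * (6 * (c * y)) = U * (6 * k0 * c) by field; rewrite gt_eqF.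
  move: kb; rewrite e6 mulrBr eDl !ler_norml.
  move: (k0 * (U / y) * Q i.+1) (k0 * (U / y) * Q i) => X1 X2.
  move=> /andP[g1 g2] /andP[g3 g4] /andP[g5 g6].
  rewrite mulrDr.
  have -> : U * (2 * s%:R * C) = 2 * (s%:R * C * U) by ring.
  by apply/andP; split; move: g1 g2 g3 g4 g5 g6; clear; lra.
have Dl0 : 0 < Dl.
  rewrite eDl mulr_gt0// ltr_pwDl ?mulr_ge0//.
  by rewrite mulr_gt0// mulr_gt0.
have KD : K%:R * Dl <= U * q by rewrite eDl mulrCA ler_wpM2l// ltW.
apply: le_trans (discrete_ivt Dl0 KD v0 vn step) _.
apply: le_trans (_ : \sum_(x1 <- iota A n.+1) (`|v (x1 - A)%N| <= U * q)%R%:R <= _).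
  have -> : iota A n.+1 = map (addn A) (iota 0 n.+1) by rewrite -iotaDl addn0.
  rewrite big_map; apply: ler_sum => i _.
  by rewrite addKn.
have AS x1 : x1 \in iota A n.+1 -> x1 \in S.
  rewrite mem_iota => /andP[g1 g2]; apply: HS.
  by have := z1b (x1 - A)%N; rewrite subnKC//; apply; rewrite leq_subLR -ltnS -addnS.
apply: le_trans (@sum_sub _ _ S _ (fun x1 => \sum_(x2 <- S)
    (`|\sum_(x <- [:: x1, x2 & a]) x%:R `^ theta - s%:R * (y ^+ 2) `^ theta| <= U * q)%R%:R) (iota_uniq A n.+1) AS _); last first.
  by move=> x _; apply: sumr_ge0.
rewrite big_seq [leRHS]big_seq; apply: ler_sum => x1; rewrite mem_iota => /andP[g1 g2].
have i_n : (x1 - A <= n)%N by rewrite leq_subLR -ltnS -addnS.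
have xA : x1 = (A + (x1 - A))%N by rewrite subnKC.
have x2S : (M - x1)%N \in S by rewrite xA; apply: HS; exact: z2b.
rewrite (perm_big _ (perm_to_rem x2S)) big_cons /=.
rewrite ev -xA lerDl; exact: sumr_ge0.
Qed.

End PairMoves.

Section CoarseCount.
Variable R : realType.

Lemma window_sums (y c g b : R) (A m k : nat) (a : seq nat) : 0 < y -> 0 <= g <= c -> `|b| <= c * y ->
  1 <= g * y -> A%:R <= y ^+ 2 + b < A.+1%:R -> m%:R <= g * y -> a \in tup (iota A.+1 m) k ->
  [/\ {in a, forall x, 0 <= x%:R - (y ^+ 2 + b) <= 2 * g * y},
    `|\sum_(x <- a) (x%:R - y ^+ 2) - k%:R * b| <= k%:R * (2 * g * y) &
    `|\sum_(x <- a) (x%:R - y ^+ 2) ^+ 2 - k%:R * b ^+ 2| <= k%:R * (8 * c * g * y ^+ 2)].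
Proof.
move=> y0 /andP[g0 gc] bc gy /andP[A1 A2] mg /mem_tup[<- sa].
have H : {in a, forall x, 0 <= x%:R - (y ^+ 2 + b) <= 2 * g * y}.
  move=> x /sa; rewrite mem_iota => /andP[x1 x2].
  have : A.+1%:R <= x%:R :> R by rewrite ler_nat.
  have : x.+1%:R <= (A.+1 + m)%:R :> R by rewrite ler_nat.
  rewrite natrD -[x.+1%:R]natr1 -[A.+1%:R]natr1 in A2 *.
  by move: A1 A2 mg gy; clear; lra.
split => //.
  have -> : \sum_(x <- a) (x%:R - y ^+ 2) - (size a)%:R * b = \sum_(x <- a) (x%:R - (y ^+ 2 + b)).
    by rewrite !sumrB !big_const_seq !count_predT !iter_addr_0 -[y ^+ 2 *+ _]mulr_natl -[(y ^+ 2 + b) *+ _]mulr_natl; ring.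
  apply: le_trans (ler_norm_sum _ _ _) _.
  apply: le_trans (_ : \sum_(x <- a) 2 * g * y <= _); last first.
    by rewrite big_const_seq count_predT iter_addr_0 [leRHS]mulr_natl.
  rewrite big_seq [leRHS]big_seq; apply: ler_sum => x /H /andP[h1 h2].
  by rewrite ger0_norm.
have -> : \sum_(x <- a) (x%:R - y ^+ 2) ^+ 2 - (size a)%:R * b ^+ 2 =
    \sum_(x <- a) ((x%:R - y ^+ 2) ^+ 2 - b ^+ 2).
  by rewrite sumrB big_const_seq count_predT iter_addr_0 -[b ^+ 2 *+ size a]mulr_natl.
apply: le_trans (ler_norm_sum _ _ _) _.
apply: le_trans (_ : \sum_(x <- a) 8 * c * g * y ^+ 2 <= _); last first.
  by rewrite big_const_seq count_predT iter_addr_0 [leRHS]mulr_natl.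
rewrite big_seq [leRHS]big_seq; apply: ler_sum => x /H /andP[h1 h2].
have -> : (x%:R - y ^+ 2) ^+ 2 - b ^+ 2 = (x%:R - (y ^+ 2 + b)) * ((x%:R - (y ^+ 2 + b)) + 2 * b) by ring.
rewrite normrM (ger0_norm h1).
have -> : 8 * c * g * y ^+ 2 = (2 * g * y) * (4 * c * y) by ring.
rewrite ler_pM//; apply: le_trans (ler_normD _ _) _; rewrite (ger0_norm h1) normrM [`|2|]ger0_norm//.
have : g * y <= c * y by rewrite ler_wpM2r// ltW.
by move: h2 bc; clear; lra.
Qed.

(** A moving pair, floor(s/2) - 1 variables on either side, and a central one when s is odd. *)
Lemma split_half s : (0 < s./2)%N -> s = ((s./2).-1 + ((s./2).-1 + odd s)).+2 :> nat.
Proof. by have := odd_double_half s; lia. Qed.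

Lemma near_ge (C : R) : \forall y \near +oo, C <= y.
Proof. exact: (nbhs_pinfty_ge (num_real C)). Qed.

(* About half of the variables are put near y^2 + b y and half near y^2 - b y, with the total sum
   equal to an integer N slightly below s y^2 and b chosen so that the second order term cancels
   the first. Moving one pair x1 + x2 = const then makes the value change sign in small steps.
   The hypothesis on c is what makes b < c possible. *)
Lemma coarse_count (theta c : R) (s : nat) : 2 < theta -> 0 < c -> (0 < s./2)%N ->
  1 < (s./2)%:R * (theta - 1) * c ^+ 2 ->
  exists2 c0 : R, 0 < c0 & \forall y \near +oo, forall S : seq nat,
    (forall x : nat, `|(x%:R : R) - y ^+ 2| < c * y -> x \in S) ->
    c0 * (y ^+ (s - 2) * y `^ 4^-1) <= \sum_(a <- tup S s)
      (`|\sum_(x <- a) x%:R `^ theta - s%:R * (y ^+ 2) `^ theta| <= y `^ (2 * theta - 3) * y `^ 4^-1)%R%:R.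
Proof.
set p := s./2 => t2 c0 p0 hG.
have [C C0 HC] := taylor2 theta c0.
have p1 : 1 <= p%:R :> R by rewrite ler1n.
have [G eG] : exists G, G = p%:R * (theta - 1) by eexists.
have G0 : 0 < G by rewrite eG mulr_gt0//; lra.
(* The distance of the integer N below s y^2 is only known to lie in an interval of length one,
   taken as [dl, 1 + dl]. The matching b then runs from [b0] to [b1], and the hypothesis on c leaves
   room for some dl > 0 with b1 < c. *)
have [dl edl] : exists dl, dl = (G * c ^+ 2 - 1) / 2 by eexists.
have dl0 : 0 < dl by rewrite edl eG; lra.
have Gc : G * c ^+ 2 = 1 + 2 * dl by rewrite edl; field.
have [b0 eb0] : exists b0, b0 = Num.sqrt (dl / G) by eexists.
have [b1 eb1] : exists b1, b1 = Num.sqrt ((1 + dl) / G) by eexists.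
have b00 : 0 < b0 by rewrite eb0 sqrtr_gt0 divr_gt0.
have b1c : b1 < c.
  rewrite eb1 -[c](ger0_norm (ltW c0)) -sqrtr_sqr ltr_sqrt ?exprn_gt0//.
  by rewrite ltr_pdivrMr// mulrC Gc; lra.
have b10 : 0 <= b1 by rewrite eb1 sqrtr_ge0.
have [e [e0 eb ec]] : exists e, [/\ 0 < e, 2 * e <= b0 & b1 + 2 * e <= c].
  exists (Num.min (b0 / 2) ((c - b1) / 2)); split; first by rewrite lt_min; apply/andP; split; lra.
    have : Num.min (b0 / 2) ((c - b1) / 2) <= b0 / 2 by rewrite ge_min lexx.
    lra.
  have : Num.min (b0 / 2) ((c - b1) / 2) <= (c - b1) / 2 by rewrite ge_min lexx orbT.
  lra.
have [w [w0 we wb]] : exists w, [/\ 0 < w, 2 * w <= e & 2 * c * w + w ^+ 2 + w <= b0 * e].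
  have be : 0 < b0 * e by rewrite mulr_gt0.
  have c2 : 0 < 2 * c + 2 by lra.
  pose w := Num.min (e / 2) (Num.min 1 (b0 * e / (2 * c + 2))).
  have w0 : 0 < w by rewrite !lt_min ltr01 divr_gt0//= divr_gt0.
  have h1 : w <= e / 2 by rewrite ge_min lexx.
  have h2 : w <= 1 by rewrite /w !ge_min lexx orbT.
  have h3 : w <= b0 * e / (2 * c + 2) by rewrite /w !ge_min lexx !orbT.
  exists w; split => //; first lra.
  have : w ^+ 2 <= w by rewrite expr2 ler_piMl// ltW.
  move: h3; rewrite ler_pdivlMr// => h3.
  by move: h3; clear; lra.
have s0 : 0 < s%:R :> R by rewrite ltr0n; move: p0; rewrite /p; case: (s).
(* The variables that do not move range over windows of length about g y, with [g] so small that
   their sum and sum of squares stay within [w] of the balanced values. *)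
have [g [g0 gc gs gsc]] : exists g, [/\ 0 < g, g <= c, s%:R * (2 * g) <= w / 2 & s%:R * (8 * c * g) <= w].
  pose g := Num.min c (Num.min (w / (4 * s%:R)) (w / (8 * c * s%:R))).
  have h1 : g <= c by rewrite ge_min lexx.
  have h2 : g <= w / (4 * s%:R) by rewrite /g !ge_min lexx orbT.
  have h3 : g <= w / (8 * c * s%:R) by rewrite /g !ge_min lexx !orbT.
  exists g; split => //.
  - by rewrite !lt_min c0 !divr_gt0// !mulr_gt0.
  - by move: h2; rewrite ler_pdivlMr ?mulr_gt0// => h2; lra.
  - by move: h3; rewrite ler_pdivlMr ?mulr_gt0// => h3; lra.
have [k0 ek0] : exists k0, k0 = theta * (theta - 1) / 2 by eexists.
have k00 : 0 < k0 by rewrite ek0 divr_gt0// mulr_gt0//; lra.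
have [C3 eC3] : exists C3, C3 = 6 * k0 * c + 2 * s%:R * C by eexists.
have C30 : 0 < C3 by rewrite eC3 ltr_pwDl ?mulr_ge0 ?(ltW s0)// !mulr_gt0.
exists ((g / 2) ^+ (s - 2) / (2 * C3)).
  by rewrite divr_gt0 ?exprn_gt0 ?divr_gt0// mulr_gt0.
near=> y => S HS.
have y1 : 1 <= y by near: y; exact: near_ge.
have y0 : 0 < y := lt_le_trans ltr01 y1.
have big C' r : 0 < r -> C' / r <= y -> C' <= r * y by move=> r0; rewrite ler_pdivrMr// mulrC.
have ey : 20 <= e * y by apply: big => //; near: y; exact: near_ge.
have gy : 2 <= g * y by apply: big => //; near: y; exact: near_ge.
have yc : 2 * c <= y by near: y; exact: near_ge.
have wy : 2 * (1 + dl) <= w * y by apply: big => //; near: y; exact: near_ge.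
have sy : dl <= s%:R * y by apply: big => //; near: y; exact: near_ge.
have kbe : 0 < k0 * b0 * e by rewrite !mulr_gt0.
have ky1 : 2 * (s%:R * C) <= k0 * b0 * e * y by apply: big => //; near: y; exact: near_ge.
have ky2 : 2 / (k0 * b0 * e) <= y `^ (3 / 4) by near: y; apply: near_powR_ge; rewrite divr_gt0.
have qC : 2 * C3 <= y `^ 4^-1 by near: y; apply: near_powR_ge; rewrite invr_gt0.
have [q eq] : exists q, q = y `^ 4^-1 by eexists.
have q0 : 0 < q by rewrite eq powR_gt0.
rewrite -eq in qC *.
have [U eU] : exists U, U = y `^ (2 * theta - 3) by eexists.
have U0 : 0 < U by rewrite eU powR_gt0.
have HT (a : seq nat) := sum_taylor2 (theta := theta) (a := a) (fun z => HC y z y1 yc).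
rewrite -eU -ek0 in HT; rewrite -eU.
have kq : q + s%:R * C <= k0 * b0 * e * y.
  have : 2 * q <= k0 * b0 * e * y.
    have yq : y `^ (3 / 4) * q = y.
      by rewrite eq -powRDr// -[RHS]powRr1 ?(ltW y0)//; congr (_ `^ _); field.
    by move: (ler_wpM2r (ltW q0) ky2); rewrite yq mulrAC ler_pdivrMr// mulrC [y * _]mulrC.
  by move: ky1; clear; lra.
have y2y : y <= y ^+ 2 by rewrite expr2 ler_peMl// ltW.
have sy2 : dl <= s%:R * y ^+ 2 by apply: le_trans sy _; rewrite ler_wpM2l// ltW.
have [N [N1 N2]] : exists N : nat, N%:R <= s%:R * y ^+ 2 - dl /\ s%:R * y ^+ 2 - dl < N%:R + 1.
  exists (Num.truncn (s%:R * y ^+ 2 - dl)); rewrite natr1 truncnS_gt truncn_le; split=> //.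
  by rewrite subr_ge0.
have [h eh] : exists h, h = N%:R - s%:R * y ^+ 2 by eexists.
have NE : N%:R = s%:R * y ^+ 2 + h by rewrite eh addrC subrK.
have h1 : - h <= 1 + dl by move: N2; rewrite eh; clear; lra.
have h2 : dl <= - h by move: N1; rewrite eh; clear; lra.
have [b eb'] : exists b, b = Num.sqrt (- h / G) by eexists.
have b2 : b ^+ 2 = - h / G by rewrite eb' sqr_sqrtr// divr_ge0 ?(ltW G0)// (le_trans _ h2)// ltW.
have bb0 : b0 <= b by rewrite eb0 eb' ler_wsqrtr// ler_wpM2r// invr_ge0 ltW.
have bb1 : b <= b1 by rewrite eb1 eb' ler_wsqrtr// ler_wpM2r// invr_ge0 ltW.
have hb : theta * h + k0 * 2 * p%:R * b ^+ 2 = 0.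
  rewrite b2 ek0 eG; field; apply/andP; split; last by rewrite gt_eqF//; move: p1; clear; lra.
  by rewrite gt_eqF//; move: t2; clear; lra.
have bcy : `|b * y| <= c * y.
  rewrite ger0_norm; first by rewrite ler_wpM2r ?(ltW y0)//; move: bb1 b1c; clear; lra.
  by rewrite mulr_ge0 ?(ltW y0)//; move: bb0 b00; clear; lra.
have [m [m1 m2]] : exists m : nat, g / 2 * y <= m%:R /\ m%:R <= g * y.
  by exists (Num.truncn (g * y)); have /andP[? ?] := truncn_half gy; split=> //; rewrite mulrAC.
have win b' : `|b' * y| <= c * y -> exists A : nat, A%:R <= y ^+ 2 + b' * y < A.+1%:R.
  rewrite ler_norml => /andP[g1 g2]; exists (Num.truncn (y ^+ 2 + b' * y)).
  rewrite truncnS_gt truncn_le andbT.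
  have : 2 * (c * y) <= y ^+ 2 by rewrite expr2 mulrA ler_wpM2r ?(ltW y0).
  by move: g1 (mulr_gt0 c0 y0); clear; lra.
have bcyN : `|- b * y| <= c * y by rewrite mulNr normrN.
have bcy0 : `|0 * y| <= c * y by rewrite mul0r normr0 mulr_ge0 ?(ltW c0) ?(ltW y0).
have [Ap hAp] := win b bcy; have [Am hAm] := win (- b) bcyN; have [Ao hAo] := win 0 bcy0.
have ggc : 0 <= g <= c by rewrite (ltW g0).
have gy1 : 1 <= g * y by move: gy; clear; lra.
have WP k a := @window_sums y c g (b * y) Ap m k a y0 ggc bcy gy1 hAp m2.
have WM k a := @window_sums y c g (- b * y) Am m k a y0 ggc bcyN gy1 hAm m2.
have WO k a := @window_sums y c g (0 * y) Ao m k a y0 ggc bcy0 gy1 hAo m2.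
have [P1 eP1] : exists P1, P1 = p.-1 by eexists.
have P1R : P1%:R = p%:R - 1 :> R by rewrite eP1 -subn1 natrB.
have [od eod] : exists od : nat, od = odd s by eexists.
have sE : s = ((P1 + (P1 + od)).+2)%N.
  by rewrite eP1 eod; exact: split_half.
have s2 : (s - 2)%N = (P1 + (P1 + od))%N by rewrite sE -addn2 addnK.
have sR : s%:R = P1%:R + (P1%:R + od%:R) + 2 :> R by rewrite {1}sE -addn2 !natrD.
have g2e : 2 * g <= e.
  have : 2 * g <= s%:R * (2 * g) by rewrite ler_peMl ?mulr_ge0 ?(ltW g0)// ler1n sE.
  by move: gs we e0; clear; lra.
have g2ey : 2 * g * y <= e * y by rewrite ler_wpM2r// ltW.
have rest ap am ao : ap \in tup (iota Ap.+1 m) P1 -> am \in tup (iota Am.+1 m) P1 ->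
    ao \in tup (iota Ao.+1 m) od ->
    [/\ {in ap ++ am ++ ao, forall x, `|x%:R - y ^+ 2| <= c * y},
    `|\sum_(x <- ap ++ am ++ ao) (x%:R - y ^+ 2) - h| <= w * y &
    `|\sum_(x <- ap ++ am ++ ao) (x%:R - y ^+ 2) ^+ 2 - 2 * (p%:R - 1) * (b ^+ 2 * y ^+ 2)| <= w * y ^+ 2].
  move=> /WP[p_1 p_2 p_3] /WM[m_1 m_2 m_3] /WO[oo_1 oo_2 oo_3].
  have bc : b * y + 2 * (e * y) <= c * y.
    by rewrite mulrA -mulrDl ler_wpM2r ?(ltW y0)//; move: bb1 ec; clear; lra.
  have by0 : 0 < b * y by rewrite mulr_gt0//; move: bb0 b00; clear; lra.
  have ey0 : 0 < e * y by rewrite mulr_gt0.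
  split.
  - move=> x; rewrite !mem_cat => /or3P[/p_1|/m_1|/oo_1] /andP[g1 g2];
    by rewrite ler_norml; apply/andP; split; move: g1 g2 bc by0 ey0 g2ey; rewrite ?mulNr ?mul0r; clear; lra.
  - rewrite !big_cat /=; move: p_2 m_2 oo_2; rewrite !ler_norml mulNr mul0r.
    move=> /andP[p3 p4] /andP[m3 m4] /andP[oo3 oo4].
    have E : (P1%:R + (P1%:R + od%:R)) * (2 * g * y) <= w / 2 * y.
      apply: le_trans (_ : s%:R * (2 * g) * y <= _); last by rewrite ler_wpM2r// ltW.
      rewrite -[leRHS]mulrA ler_wpM2r//; first by rewrite !mulr_ge0 ?(ltW g0) ?(ltW y0).
      by rewrite sR; clear; lra.
    apply/andP; split; move: p3 p4 m3 m4 oo3 oo4 E h1 h2 wy dl0; clear.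
      by move=> *; lra.
    by move=> *; lra.
  - rewrite !big_cat /=; move: p_3 m_3 oo_3; rewrite !ler_norml mulNr mul0r sqrrN expr0n /= mulr0.
    move=> /andP[p3 p4] /andP[m3 m4] /andP[oo3 oo4].
    have E : (P1%:R + (P1%:R + od%:R)) * (8 * c * g * y ^+ 2) <= w * y ^+ 2.
      apply: le_trans (_ : s%:R * (8 * c * g) * y ^+ 2 <= _); last by rewrite ler_wpM2r// sqr_ge0.
      rewrite -[leRHS]mulrA ler_wpM2r//; first by rewrite !mulr_ge0 ?(ltW g0) ?(ltW c0) ?sqr_ge0.
      by rewrite sR; clear; lra.
    rewrite -P1R; move: p3 p4 m3 m4 oo3 oo4 E; rewrite exprMn; clear.
    by move=> *; apply/andP; split; lra.
(* For each choice of the other variables the moving pair has a number of good positions of order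
   y^(1/4). *)
have [K [K1 K2 K3]] : exists K : nat, [/\ q / (2 * C3) <= K%:R, K%:R * C3 <= q & 0 < K%:R :> R].
  have q2 : 2 <= q / C3 by rewrite ler_pdivlMr.
  exists (Num.truncn (q / C3)); have /andP[g1 g2] := truncn_half q2.
  rewrite ler_pdivlMr// in g2; split=> //; last by move: g1 q2; clear; lra.
  by apply: le_trans g1; rewrite le_eqVlt; apply/orP; left; apply/eqP; field; rewrite gt_eqF.
have KC : 0 < (K%:R : R) * (6 * k0 * c + 2 * s%:R * C) <= q by rewrite -eC3 K2 mulr_gt0.
rewrite ek0 in HT KC hb kq.
have s1 : (1 < s)%N by rewrite sE.
have bec : b + 2 * e <= c by move: bb1 ec; clear; lra.
have fin ap am ao : ap \in tup (iota Ap.+1 m) P1 -> am \in tup (iota Am.+1 m) P1 ->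
    ao \in tup (iota Ao.+1 m) od ->
    K%:R <= \sum_(x1 <- S) \sum_(x2 <- S) (`|\sum_(x <- [:: x1, x2 & ap ++ am ++ ao]) x%:R `^ theta
       - s%:R * (y ^+ 2) `^ theta| <= U * q)%R%:R :> R.
  move=> hp hm ho; have [r1 r2 r3] := rest _ _ _ hp hm ho.
  have [sp _] := mem_tup hp; have [sm _] := mem_tup hm; have [so _] := mem_tup ho.
  have sz : size (ap ++ am ++ ao) = (s - 2)%N by rewrite !size_cat sp sm so s2.
  exact: (@rest_count R theta c C y U q b e w b0 h p s K N S _ t2 U0 y0 c0 C0 KC HT s1 sz p0 NE hb b00 bb0 e0 eb
    bec (ltW w0) we wb ey yc kq r1 r2 r3 HS).
have sub (A : nat) b' : `|b' * y| + 2 * (e * y) <= c * y -> A%:R <= y ^+ 2 + b' * y < A.+1%:R ->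
    {subset iota A.+1 m <= S}.
  move=> hb' /andP[A1 A2] x; rewrite mem_iota => /andP[x1 x2]; apply: HS.
  have x1' : A.+1%:R <= x%:R :> R by rewrite ler_nat.
  have : x.+1%:R <= (A.+1 + m)%:R :> R by rewrite ler_nat.
  rewrite natrD -[x.+1%:R]natr1 -[A.+1%:R]natr1 in A2 x1' * => x2'.
  have := ler_norm (b' * y); have := ler_norm (- (b' * y)); rewrite normrN ltr_norml => g1 g2.
  by apply/andP; split; move: g1 g2 hb' A1 A2 x1' x2' m2 g2ey ey gy1; clear; lra.
have bce : `|b * y| + 2 * (e * y) <= c * y.
  rewrite ger0_norm; first by rewrite mulrA -mulrDl ler_wpM2r// ltW.
  by rewrite mulr_ge0 ?(ltW y0)//; move: bb0 b00; clear; lra.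
have subP := sub _ _ bce hAp.
have subM : {subset iota Am.+1 m <= S} by apply: sub hAm; rewrite mulNr normrN.
have subO : {subset iota Ao.+1 m <= S}.
  by apply: sub hAo; rewrite mul0r normr0; apply: le_trans bce; rewrite lerD2r.
have [f ef] : exists f : seq nat -> R, f = fun a => (`|\sum_(x <- a) x%:R `^ theta
       - s%:R * (y ^+ 2) `^ theta| <= U * q)%R%:R by eexists.
have -> : \sum_(a <- tup S s) (`|\sum_(x <- a) x%:R `^ theta
       - s%:R * (y ^+ 2) `^ theta| <= U * q)%R%:R = \sum_(a <- tup S s) f a by rewrite ef.
have f0 a : 0 <= f a by rewrite ef ler0n.
have -> : tup S s = tup S (P1 + (P1 + od)).+2 by rewrite -sE.
rewrite sum_tupS; under eq_bigr => x _ do rewrite sum_tupS exchange_big.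
rewrite exchange_big /= sum_tup_cat; under eq_bigr => a _ do rewrite sum_tup_cat.
pose F a := \sum_(i <- S) \sum_(j <- S) f [:: i, j & a].
have F0 a : 0 <= F a by rewrite /F; apply: sumr_ge0 => i _; apply: sumr_ge0 => j _.
apply: le_trans (_ : \sum_(a <- tup (iota Ap.+1 m) P1) \sum_(a' <- tup (iota Am.+1 m) P1)
   \sum_(a'' <- tup (iota Ao.+1 m) od) F (a ++ a' ++ a'') <= _); last first.
  apply: le_trans (@sum_tup_sub R _ S _ P1 (fun a => \sum_(a' <- tup S P1) \sum_(a'' <- tup S od) F (a ++ a' ++ a'')) (iota_uniq _ _) subP _).
    apply: ler_sum => a _.
    apply: le_trans (@sum_tup_sub R _ S _ P1 (fun a' => \sum_(a'' <- tup S od) F (a ++ a' ++ a'')) (iota_uniq _ _) subM _).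
      by apply: ler_sum => a' _; apply: (@sum_tup_sub R _ S _ od (fun a'' => F (a ++ a' ++ a'')) (iota_uniq _ _) subO).
    by move=> a'; apply: sumr_ge0.
  by move=> a; apply: sumr_ge0 => a' _; apply: sumr_ge0.
apply: le_trans (_ : \sum_(a <- tup (iota Ap.+1 m) P1) \sum_(a' <- tup (iota Am.+1 m) P1)
   \sum_(a'' <- tup (iota Ao.+1 m) od) K%:R <= _); last first.
  rewrite big_seq [leRHS]big_seq; apply: ler_sum => a ha.
  rewrite big_seq [leRHS]big_seq; apply: ler_sum => a' ha'.
  rewrite big_seq [leRHS]big_seq; apply: ler_sum => a'' ha''.
  by rewrite /F ef; exact: fin.
have cst (T : Type) (t : seq T) (x : R) : \sum_(i <- t) x = (size t)%:R * x.
  by rewrite big_const_seq count_predT iter_addr_0 [RHS]mulr_natl.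
rewrite !cst !size_tup !size_iota !natrX !mulrA -!exprD -addnA -s2.
apply: le_trans (_ : (g / 2 * y) ^+ (s - 2) * (q / (2 * C3)) <= _).
  rewrite le_eqVlt; apply/orP; left; apply/eqP; rewrite [(g / 2 * y) ^+ _]exprMn.
  by move: ((g / 2) ^+ _) (y ^+ _) ((2 * C3)^-1) => X1 X2 X3; ring.
have gy0 : 0 <= g / 2 * y by rewrite !mulr_ge0 ?(ltW g0) ?(ltW y0)// invr_ge0.
rewrite ler_pM ?exprn_ge0// ?divr_ge0 ?(ltW q0) ?mulr_ge0 ?(ltW C30)//.
by apply: lerXn2r; rewrite ?nnegrE.
Unshelve. all: by end_near. Qed.
End CoarseCount.

(** * Tent kernels *)

Section TentKernel.
Variable R : realType.
Variables (a : nat -> R) (N : nat).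
Hypotheses (a0 : a 0%N = 0) (aN : forall j, (N <= j)%N -> a j = 0).

Definition autoc (f : nat -> R) m := \sum_(j <- iota 0 N) f j * f (j + m)%N.

Definition slope j := a j.+1 - a j.

Lemma telescope_iota (f : nat -> R) m n : \sum_(j <- iota m n) (f j.+1 - f j) = f (m + n)%N - f m.
Proof.
elim: n => [|n IH]; first by rewrite big_nil addn0 subrr.
by rewrite -addn1 iotaD big_cat big_seq1 IH addn1 addnS /=; ring.
Qed.

(** Summation by parts; the boundary terms vanish because [a] is zero at 0 and from [N] on. *)
Lemma autoc_second m : autoc a m.+2 + autoc a m - 2 * autoc a m.+1 = - autoc slope m.+1.
Proof.
apply/eqP; rewrite -subr_eq0 opprK; apply/eqP.
have <- : \sum_(j <- iota 0 N) (a j.+1 * slope (j.+1 + m) - a j * slope (j + m)) = 0.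
  by rewrite (telescope_iota (fun j => a j * slope (j + m)%N)) add0n a0 aN// !mul0r subrr.
rewrite /autoc mulr_sumr -big_split -sumrB -big_split /=; apply: eq_bigr => j _.
by rewrite /slope !addnS addSn; ring.
Qed.

(** The analogue of [autoc_second] centred at 0: the autocorrelation is even, so its second
    difference there is twice its first difference. *)
Lemma autoc_first : autoc a 1 - autoc a 0 = - autoc slope 0 / 2.
Proof.
have e : 2 * (autoc a 1 - autoc a 0) + autoc slope 0 = 0.
  have <- : \sum_(j <- iota 0 N) (a j.+1 ^+ 2 - a j ^+ 2) = 0.
    by rewrite (telescope_iota (fun j => a j ^+ 2)) add0n a0 aN// subrr.
  rewrite /autoc -sumrB mulr_sumr -big_split /=; apply: eq_bigr => j _.
  by rewrite /slope !addn0 addn1; ring.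
by move: e; lra.
Qed.

Lemma autoc_geN m : (N <= m)%N -> autoc a m = 0.
Proof. by move=> h; apply: big1 => j _; rewrite [a (j + m)%N]aN ?mulr0// (leq_trans h)// leq_addl. Qed.

Definition cospoly (k : nat -> R) n (u : R) := k 0%N + 2 * \sum_(m <- iota 1 n) k m * cos (m%:R * u).

Definition kern (u : R) :=
  (\sum_(j <- iota 0 N) a j * cos (j%:R * u)) ^+ 2 + (\sum_(j <- iota 0 N) a j * sin (j%:R * u)) ^+ 2.

Lemma kernE u : kern u = cospoly (autoc a) N u.
Proof.
pose F j k := a j * a k * cos (k%:R * u - j%:R * u).
have -> : kern u = \sum_(j <- iota 0 N) \sum_(k <- iota 0 N) F j k.
  rewrite /kern !expr2 !mulr_suml -big_split /=; apply: eq_bigr => j _.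
  by rewrite !mulr_sumr -big_split /=; apply: eq_bigr => k _; rewrite /F cosB; ring.
have split3 j k : F j k = F j k * (j < k)%N%:R + F j k * (k < j)%N%:R + F j k * (j == k)%N%:R.
  by case: ltngtP => _; rewrite ?mulr1 ?mulr0 ?addr0 ?add0r.
under eq_bigr => j _ do under eq_bigr => k _ do rewrite split3.
under eq_bigr => j _ do rewrite !big_split /=.
rewrite !big_split /= [X in _ + X + _]exchange_big /=.
have up : \sum_(j <- iota 0 N) \sum_(k <- iota 0 N) F j k * (j < k)%N%:R =
    \sum_(m <- iota 1 N) autoc a m * cos (m%:R * u).
  under [RHS]eq_bigr => m _ do rewrite /autoc mulr_suml.
  rewrite [RHS]exchange_big /= big_seq [RHS]big_seq; apply: eq_bigr => j.
  rewrite mem_iota add0n /= => jN.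
  have -> : \sum_(m <- iota 1 N) a j * a (j + m)%N * cos (m%:R * u) = \sum_(k <- iota j.+1 N) F j k.
    have -> : iota j.+1 N = map (addn j) (iota 1 N) by rewrite -iotaDl addn1.
    rewrite big_map; apply: eq_bigr => m _.
    by rewrite /F natrD mulrDl addrAC subrr add0r.
  have e1 : iota 0 N = iota 0 j.+1 ++ iota j.+1 (N - j.+1) by rewrite -iotaD subnKC.
  have e2 : iota j.+1 N = iota j.+1 (N - j.+1) ++ iota N j.+1.
    by rewrite -{3}(subnKC jN) -iotaD subnK.
  rewrite e1 e2 !big_cat /= big_seq big1 ?add0r; last first.
    by move=> k; rewrite -[_ :: _]/(iota 0 j.+1) mem_iota add0n /= ltnS => kj; rewrite ltnNge kj mulr0.
  rewrite [X in _ = _ + X]big_seq [X in _ = _ + X]big1 ?addr0; last first.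
    by move=> k; rewrite -[_ :: _]/(iota N j.+1) mem_iota => /andP[h _]; rewrite /F (aN h) mulr0 mul0r.
  by rewrite big_seq [RHS]big_seq; apply: eq_bigr => k; rewrite mem_iota => /andP[-> _]; rewrite mulr1.
have -> : \sum_(j <- iota 0 N) \sum_(i <- iota 0 N) F i j * (j < i)%N%:R =
    \sum_(m <- iota 1 N) autoc a m * cos (m%:R * u).
  rewrite -up; apply: eq_bigr => j _; apply: eq_bigr => k _; congr (_ * _).
  by rewrite /F -cosN opprB; ring.
rewrite up /cospoly.
have -> : \sum_(j <- iota 0 N) \sum_(k <- iota 0 N) F j k * (j == k)%:R = autoc a 0.
  rewrite big_seq [RHS]big_seq; apply: eq_bigr => j jN.
  rewrite (bigD1_seq j) ?iota_uniq//= eqxx mulr1 big1 ?addr0.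
    by rewrite /F subrr cos0 mulr1 addn0.
  by move=> k kj; rewrite eq_sym (negPf kj) mulr0.
by ring.
Qed.

(** Multiplication by cos u averages the two neighbouring coefficients, that is, adds half a second
    difference, which is an autocorrelation of the slope. *)
Lemma kern_shiftE (w u : R) :
  (cos u - w) * kern u = cospoly (fun m => (1 - w) * autoc a m - autoc slope m / 2) N u.
Proof.
pose q := autoc a; pose c m := cos (m%:R * u).
have c2 m : 2 * cos u * c m.+1 = c m.+2 + c m.
  rewrite /c -[m.+2%:R]natr1.
  have -> : (m.+1%:R + 1) * u = m.+1%:R * u + u by ring.
  have -> : m%:R * u = m.+1%:R * u - u by rewrite -[m.+1%:R]natr1; ring.
  by rewrite cosD cosB; ring.
have t1 : \sum_(m <- iota 1 N) (q m * c m.+1 - q m.-1 * c m) = - (q 0%N * cos u).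
  rewrite (telescope_iota (fun m => q m.-1 * c m)) /= add1n /q /= autoc_geN// mul0r sub0r.
  by rewrite /c mul1r.
have t2 : \sum_(m <- iota 1 N) (q m.+1 * c m - q m * c m.-1) = - q 1%N.
  rewrite (telescope_iota (fun m => q m * c m.-1)) add1n /q /= autoc_geN// mul0r sub0r.
  by rewrite /c mul0r cos0 mulr1.
have t3 : \sum_(m <- iota 1 N) (2 * cos u * (q m * c m)) =
    \sum_(m <- iota 1 N) (2 * q m - autoc slope m) * c m - q 0%N * cos u + q 1%N.
  rewrite -t1 -[q 1%N]opprK -t2 -big_split -sumrB /= big_seq [RHS]big_seq.
  apply: eq_bigr => m; rewrite mem_iota => /andP[m0 _].
  case: m m0 => // m _; rewrite -[autoc slope _]opprK -autoc_second mulrCA c2 /= /q; ring.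
have q1 : q 1%N = q 0%N - autoc slope 0 / 2 by have := autoc_first; rewrite -/q mulNr; lra.
rewrite kernE /cospoly -/q -/(c) !mulrDr.
have -> : (cos u - w) * (2 * \sum_(m <- iota 1 N) q m * c m) =
   \sum_(m <- iota 1 N) (2 * cos u * (q m * c m)) - 2 * w * \sum_(m <- iota 1 N) q m * c m.
  by rewrite -mulr_sumr; ring.
rewrite t3 q1.
have -> : \sum_(m <- iota 1 N) ((1 - w) * q m - autoc slope m / 2) * c m =
   2^-1 * \sum_(m <- iota 1 N) (2 * q m - autoc slope m) * c m - w * \sum_(m <- iota 1 N) q m * c m.
  by rewrite !mulr_sumr -sumrB; apply: eq_bigr => m _; field.
by field.
Qed.

End TentKernel.

Section Tent.
Variable R : realType.

Definition tent (h j : nat) : R := (minn j (2 * h - j))%:R.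

Lemma tent0 h : tent h 0 = 0. Proof. by rewrite /tent min0n. Qed.

Lemma tent_eq0 h j : (2 * h <= j)%N -> tent h j = 0.
Proof. by move=> hj; rewrite /tent (eqP (_ : (2 * h - j)%N == 0%N)) ?minn0 ?subn_eq0. Qed.

Lemma tent_ge0 h j : 0 <= tent h j. Proof. exact: ler0n. Qed.

Lemma tent_le h j : tent h j <= h%:R.
Proof. by rewrite /tent ler_nat; lia. Qed.

Lemma slope_tent h j : slope (tent h) j = (j < h)%N%:R - ((h <= j) && (j < 2 * h))%N%:R.
Proof.
rewrite /slope /tent; case: (ltnP j h) => /= h1.
  have -> : minn j.+1 (2 * h - j.+1) = j.+1 by lia.
  have -> : minn j (2 * h - j) = j by lia.
  by rewrite -natr1 subr0; ring.
case: (ltnP j (2 * h)) => h2 /=.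
  have -> : minn j.+1 (2 * h - j.+1) = (2 * h - j.+1)%N by lia.
  have -> : minn j (2 * h - j) = (2 * h - j.+1).+1 by lia.
  by rewrite -natr1; ring.
have -> : minn j.+1 (2 * h - j.+1) = 0%N by lia.
have -> : minn j (2 * h - j) = 0%N by lia.
by rewrite !subrr.
Qed.

Lemma slope_tent_le h j : `|slope (tent h) j| <= 1.
Proof.
rewrite slope_tent; case: (ltnP j h) => h1 /=; first by rewrite subr0 normr1.
by rewrite sub0r normrN normr_nat lern1; case: (j < _)%N.
Qed.

Lemma slope_tent_var h j :
  `|slope (tent h) j.+1 - slope (tent h) j| <= 2 * (j.+1 == h)%N%:R + (j.+1 == 2 * h)%N%:R.
Proof.
rewrite !slope_tent.
have [e|h1] := eqVneq j.+1 h.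
  have -> : (j.+1 < h)%N = false by lia.
  have -> : (j < h)%N by lia.
  have -> : (h <= j)%N = false by lia.
  rewrite e leqnn /=; case: (_ < _)%N => /=; rewrite ?subr0 ?sub0r;
    by rewrite -?opprD ?normrN ger0_norm //; have := ler0n R (h == 2 * h)%N; lra.
have [e|h2] := eqVneq j.+1 (2 * h)%N.
  have -> : (j.+1 < h)%N = false by lia.
  have -> : (j < h)%N = false by lia.
  have -> : (h <= j)%N by lia.
  have -> : (j < 2 * h)%N by lia.
  by rewrite e ltnn andbF /= subr0 !sub0r opprK normr1 mulr0 add0r.
have -> : (j.+1 < h)%N = (j < h)%N by lia.
have -> : (h <= j.+1)%N = (h <= j)%N by lia.
have -> : (j.+1 < 2 * h)%N = (j < 2 * h)%N by lia.
by rewrite subrr normr0 mulr0 addr0.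
Qed.

Lemma sum_count1 (m n c : nat) : \sum_(j <- iota m n) (j == c)%:R <= 1 :> R.
Proof.
rewrite -natr_sum -[1]/(1%:R) ler_nat.
have -> : (\sum_(j <- iota m n) (j == c))%N = count_mem c (iota m n).
  by rewrite -sum1_count [RHS]big_mkcond; apply: eq_bigr => j _ /=; case: eqP.
by rewrite count_uniq_mem ?iota_uniq//; case: (_ \in _).
Qed.

Lemma autoc_slope_le h m : `|autoc (2 * h) (slope (tent h)) m| <= 2 * h%:R.
Proof.
apply: le_trans (ler_norm_sum _ _ _) _; apply: le_trans (_ : \sum_(j <- iota 0 (2 * h)) 1 <= _).
  by apply: ler_sum => j _; rewrite normrM -[1]mulr1 ler_pM ?slope_tent_le.
by rewrite big_const_seq count_predT size_iota iter_addr_0 natrM.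
Qed.

(** The constant 3 is the variation of the slope: a jump 2 at the top of the tent and a jump 1 at
    its end. *)
Lemma autoc_slope_lip h m :
  `|autoc (2 * h) (slope (tent h)) m - autoc (2 * h) (slope (tent h)) 0| <= 3 * m%:R.
Proof.
elim: m => [|m IH]; first by rewrite subrr normr0 mulr0.
set D := autoc _ _ in IH *.
have -> : D m.+1 - D 0%N = (D m.+1 - D m) + (D m - D 0%N) by ring.
rewrite -[m.+1%:R]natr1 mulrDr mulr1 addrC; apply: le_trans (ler_normD _ _) _.
rewrite lerD// /D /autoc -sumrB; apply: le_trans (ler_norm_sum _ _ _) _.
apply: le_trans (_ : \sum_(j <- iota 0 (2 * h)) (2 * ((j + m).+1 == h)%:R + ((j + m).+1 == 2 * h)%N%:R) <= _).
  apply: ler_sum => j _; rewrite -mulrBr normrM -[leRHS]mul1r.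
  by apply: ler_pM => //; [exact: slope_tent_le|rewrite addnS; exact: slope_tent_var].
rewrite big_split /= -mulr_sumr.
have cnt c : \sum_(j <- iota 0 (2 * h)) ((j + m).+1 == c)%:R <= 1 :> R.
  have := sum_count1 m.+1 (2 * h) c.
  have -> : iota m.+1 (2 * h) = map (addn m.+1) (iota 0 (2 * h)) by rewrite -iotaDl addn0.
  by rewrite big_map; under eq_bigr => j _ do rewrite addSn addnC.
have := cnt h; have := cnt (2 * h)%N; lra.
Qed.

Lemma sum_tent h : \sum_(j <- iota 0 (2 * h)) tent h j = h%:R ^+ 2.
Proof.
rewrite mul2n -addnn iotaD big_cat /= add0n.
have -> : iota h h = map (addn h) (iota 0 h) by rewrite -iotaDl addn0.
rewrite big_map -big_split /=.
have -> : \sum_(j <- iota 0 h) (tent h j + tent h (h + j)) = \sum_(j <- iota 0 h) h%:R.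
  rewrite big_seq [RHS]big_seq; apply: eq_bigr => j; rewrite mem_iota add0n /= => jh.
  by rewrite /tent -natrD; congr (_%:R); lia.
by rewrite big_const_seq count_predT size_iota iter_addr_0 -[LHS]mulr_natl expr2.
Qed.

Lemma autoc_tent0 h : (0 < h)%N -> h%:R ^+ 3 / 2 <= autoc (2 * h) (tent h) 0 <= h%:R ^+ 3.
Proof.
move=> h0; have h0' : 0 < h%:R :> R by rewrite ltr0n.
apply/andP; split.
  have := sqr_sum_le (iota 0 (2 * h)) xpredT (tent h); rewrite sum_tent size_iota => H.
  rewrite ler_pdivrMr// -(ler_pM2l h0').
  have -> : autoc (2 * h) (tent h) 0 = \sum_(j <- iota 0 (2 * h)) tent h j ^+ 2.
    by apply: eq_bigr => j _; rewrite addn0 expr2.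
  by move: H; rewrite natrM -exprS -exprM; lra.
rewrite exprS -sum_tent mulr_sumr; apply: ler_sum => j _.
by rewrite addn0 ler_wpM2r ?tent_ge0 ?tent_le.
Qed.

Lemma autoc_tent_le h m : `|autoc (2 * h) (tent h) m| <= h%:R ^+ 3.
Proof.
apply: le_trans (ler_norm_sum _ _ _) _.
rewrite exprSr -sum_tent mulr_suml; apply: ler_sum => j _.
by rewrite normrM !ger0_norm ?tent_ge0// ler_wpM2l ?tent_ge0 ?tent_le.
Qed.

(** Quadratic in m because the autocorrelation is even and its second differences are at most 2
    h. *)
Lemma autoc_tent_lip h m :
  `|autoc (2 * h) (tent h) m - autoc (2 * h) (tent h) 0| <= 2 * h%:R * m%:R ^+ 2.
Proof.
set q := autoc _ _.
have tN j : (2 * h <= j)%N -> tent h j = 0 by exact: tent_eq0.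
have D m' : `|q m'.+1 - q m'| <= 2 * h%:R * m'.+1%:R.
  elim: m' => [|m' IH].
    rewrite /q (autoc_first (tent0 h) tN) normrM normrN mulr1.
    have := autoc_slope_le h 0; rewrite [`|2^-1|]ger0_norm// => hh.
    by have := normr_ge0 (autoc (2 * h) (slope (tent h)) 0); lra.
  have := autoc_second (tent0 h) tN m'; rewrite -/(q m'.+2) -/(q m') -/(q m'.+1) => e.
  have -> : q m'.+2 - q m'.+1 = (q m'.+1 - q m') - autoc (2 * h) (slope (tent h)) m'.+1 by move: e; lra.
  apply: le_trans (ler_normB _ _) _; rewrite -[m'.+2%:R]natr1 mulrDr mulr1 lerD//.
  exact: autoc_slope_le.
elim: m => [|m IH]; first by rewrite subrr normr0 expr0n mulr0.
have -> : q m.+1 - q 0%N = (q m.+1 - q m) + (q m - q 0%N) by ring.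
apply: le_trans (ler_normD _ _) _; apply: le_trans (lerD (D m) IH) _.
rewrite -mulrDr ler_wpM2l ?mulr_ge0// -natr1 sqrrD1 -mulr_natl.
have := ler0n R m; lra.
Qed.

Lemma kern_tent_le h u : kern (tent h) (2 * h) u <= 2 * h%:R ^+ 4.
Proof.
have H (t : nat -> R) : (forall j, `|t j| <= 1) ->
    (\sum_(j <- iota 0 (2 * h)) tent h j * t j) ^+ 2 <= h%:R ^+ 4.
  move=> t1; rewrite -[_ ^+ 2]real_normK ?num_real// -[4%N]/(2 * 2)%N exprM.
  apply: lerXn2r; rewrite ?nnegrE ?exprn_ge0// -sum_tent.
  apply: le_trans (ler_norm_sum _ _ _) _; apply: ler_sum => j _.
  by rewrite normrM ger0_norm ?tent_ge0// ler_piMr ?tent_ge0.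
rewrite /kern mulr_natl mulr2n lerD// H// => j; [exact: cos_norm1|exact: sin_norm1].
Qed.

Lemma kern_ge0 (a : nat -> R) N u : 0 <= kern a N u.
Proof. by rewrite addr_ge0// sqr_ge0. Qed.

(** For such u every cosine in the sum is at least 1/2. *)
Lemma kern_tent_ge h u : 2 * h%:R * `|u| <= 1 -> h%:R ^+ 4 / 4 <= kern (tent h) (2 * h) u.
Proof.
move=> hu; apply: le_trans (_ : (\sum_(j <- iota 0 (2 * h)) tent h j * cos (j%:R * u)) ^+ 2 <= _).
  have -> : h%:R ^+ 4 / 4 = (h%:R ^+ 2 / 2) ^+ 2 :> R by field.
  have H : h%:R ^+ 2 / 2 <= \sum_(j <- iota 0 (2 * h)) tent h j * cos (j%:R * u).
    rewrite -sum_tent mulr_suml big_seq [leRHS]big_seq; apply: ler_sum => j.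
    rewrite mem_iota add0n /= => jh; rewrite ler_wpM2l ?tent_ge0//.
    have ju : `|j%:R * u| <= 1.
      rewrite normrM ger0_norm//; apply: le_trans hu; rewrite ler_wpM2r// -natrM ler_nat; exact: ltnW.
    have : (j%:R * u) ^+ 2 <= 1.
      by rewrite -real_normK ?num_real// expr_le1.
    by have := cos_ge (j%:R * u); lra.
  by apply: lerXn2r; rewrite ?nnegrE// ?(le_trans _ H)// divr_ge0// exprn_ge0.
by rewrite lerDl sqr_ge0.
Qed.

(** Coefficients up to [m1] are replaced by [k 0], and those beyond are estimated through the high
    frequency sums. What remains is [k 0] times a core that does not depend on the kernel, and this
    makes two kernels comparable. *)
Lemma kernel_compare (I : Type) (s : seq I) (al : I -> R) (k : nat -> R) (N m1 : nat) (B del : R) :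
  (m1 <= N)%N -> (forall m, (m <= m1)%N -> `|k m - k 0%N| <= del) ->
  (forall m, (m1 < m <= N)%N -> `|k m| <= B) ->
  `|\sum_(i <- s) cospoly k N (al i) - k 0%N * \sum_(i <- s) cospoly (fun=> 1) m1 (al i)| <=
  2 * (m1%:R * del * (size s)%:R + B * \sum_(m <- iota m1.+1 (N - m1)) `|\sum_(i <- s) cos (m%:R * al i)|).
Proof.
move=> m1N kd kB.
pose cc m := \sum_(i <- s) cos (m%:R * al i).
have E (k' : nat -> R) n : \sum_(i <- s) cospoly k' n (al i) = k' 0%N * (size s)%:R + 2 * \sum_(m <- iota 1 n) k' m * cc m.
  rewrite big_split /=; congr (_ + _).
    by rewrite big_const_seq count_predT iter_addr_0 [RHS]mulr_natr.
  rewrite -mulr_sumr exchange_big /=; congr (_ * _); apply: eq_bigr => m _.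
  by rewrite mulr_sumr.
rewrite !E.
have -> : iota 1 N = iota 1 m1 ++ iota m1.+1 (N - m1) by rewrite -add1n -iotaD subnKC.
rewrite big_cat /= -/(cc _).
have -> : forall x y z w t : R, x + 2 * (y + z) - k 0%N * (1 * w + 2 * t) = (x - k 0%N * w) + 2 * ((y - k 0%N * t) + z).
  by move=> *; ring.
rewrite subrr add0r normrM ger0_norm// ler_wpM2l//.
apply: le_trans (ler_normD _ _) _; apply: lerD.
  rewrite mulr_sumr -sumrB; apply: le_trans (ler_norm_sum _ _ _) _.
  apply: le_trans (_ : \sum_(m <- iota 1 m1) del * (size s)%:R <= _); last first.
    by rewrite big_const_seq count_predT size_iota iter_addr_0 -[leLHS]mulr_natl mulrA.
  rewrite big_seq [leRHS]big_seq; apply: ler_sum => m; rewrite mem_iota => /andP[_ hm].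
  rewrite mul1r -mulrBl normrM ler_pM ?kd//.
  apply: le_trans (ler_norm_sum _ _ _) _; apply: le_trans (_ : \sum_(i <- s) 1 <= _).
    by apply: ler_sum => i _; exact: cos_norm1.
  by rewrite big_const_seq count_predT iter_addr_0.
rewrite mulr_sumr; apply: le_trans (ler_norm_sum _ _ _) _.
rewrite big_seq [leRHS]big_seq; apply: ler_sum => m; rewrite mem_iota => /andP[h1 h2].
rewrite normrM ler_wpM2r// kB// h1 /=; move: h2; rewrite addSn subnKC//.
Qed.

End Tent.

(** * High frequencies and the lower bound *)

Section Moments.
Variable R : realType.

Lemma sum_inv_sq K : \sum_(k <- iota 1 K) (k%:R ^+ 2)^-1 <= 2 :> R.
Proof.
have H : \sum_(k <- iota 1 K.+1) (k%:R ^+ 2)^-1 <= 2 - K.+1%:R^-1 :> R.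
  elim: K => [|K IH]; first by rewrite big_seq1 expr1n invr1; lra.
  have -> : iota 1 K.+2 = iota 1 K.+1 ++ [:: K.+2] by rewrite -{1}(addn1 K.+1) iotaD.
  rewrite big_cat big_seq1.
  have K0 : 0 < K.+1%:R :> R by rewrite ltr0n.
  have K1 : K.+2%:R = K.+1%:R + 1 :> R by rewrite -natr1.
  apply: le_trans (lerD IH (lexx _)) _; rewrite K1.
  move: (K.+1%:R) K0 => x x0.
  have -> : 2 - x^-1 + ((x + 1) ^+ 2)^-1 = 2 - (x + 1)^-1 - (x * (x + 1) ^+ 2)^-1.
    by field; rewrite !gt_eqF//; lra.
  by rewrite lerBlDr lerDl invr_ge0 mulr_ge0 ?(ltW x0)// sqr_ge0.
apply: le_trans (_ : \sum_(k <- iota 1 K.+1) (k%:R ^+ 2)^-1 <= _).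
  have -> : iota 1 K.+1 = iota 1 K ++ [:: K.+1] by rewrite -{1}(addn1 K) iotaD.
  by rewrite big_cat /= lerDl big_seq1 invr_ge0 sqr_ge0.
by apply: le_trans H _; rewrite gerDl oppr_le0 invr_ge0.
Qed.

(** Each m <= n is the difference of at least n pairs j, k below 2 n. The full double sum over j and
    k is a sum over pairs of tuples of Fejer kernels at A (G a - G b), which decay like the inverse
    square. Grouping the pairs by the integer part of |G a - G b| leaves a convergent series of
    counts bounded by [Q]. *)
Lemma moment_bound (L r n : nat) (F : nat -> R) (A Q : R) : 0 < A -> 0 <= Q ->
  {in tup (iota 0 L) r &, forall a b, `|A * (\sum_(x <- a) F x - \sum_(x <- b) F x)| <= 1} ->
  (forall T, \sum_(a <- tup (iota 0 L) r) \sum_(b <- tup (iota 0 L) r)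
     (`|\sum_(x <- a) F x - \sum_(x <- b) F x - T| <= 1)%R%:R <= Q) ->
  n%:R * \sum_(m <- iota 0 n.+1) nrm2 (iota 0 L) (fun x => m%:R * A * F x) ^+ r
    <= 2 * Q * (4 * n%:R ^+ 2 + 32 / A ^+ 2).
Proof.
move=> A0 Q0 hA hQ; set TT := tup _ _ in hA hQ.
pose G (a : seq nat) := \sum_(x <- a) F x.
pose Dm (z : R) := nrm2 TT (fun a => z * A * G a).
have DmE z : Dm z = nrm2 (iota 0 L) (fun x => z * A * F x) ^+ r.
  by rewrite -nrm2_tup /Dm; congr nrm2; apply/funext => a; rewrite /G mulr_sumr.
have cst (T : Type) (t : seq T) (x : R) : \sum_(i <- t) x = (size t)%:R * x.
  by rewrite big_const_seq count_predT iter_addr_0 [RHS]mulr_natl.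
have D0 z : 0 <= Dm z by exact: nrm2_ge0.
have step1 : n%:R * \sum_(m <- iota 0 n.+1) nrm2 (iota 0 L) (fun x => m%:R * A * F x) ^+ r <=
    \sum_(k <- iota 0 (2 * n)) \sum_(j <- iota 0 (2 * n)) Dm (j%:R - k%:R).
  apply: le_trans (_ : \sum_(k <- iota 0 n) \sum_(j <- iota 0 (2 * n)) Dm (j%:R - k%:R) <= _); last first.
    apply: (@sum_sub _ _ _ _ (fun k : nat => \sum_(j <- iota 0 (2 * n)) Dm (j%:R - k%:R))).
    - exact: iota_uniq.
    - by move=> k; rewrite !mem_iota; lia.
    - by move=> k _; apply: sumr_ge0.
  rewrite -{1}[n](size_iota 0) -cst big_seq [leRHS]big_seq; apply: ler_sum => k.
  rewrite mem_iota add0n /= => kn.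
  apply: le_trans (_ : \sum_(j <- iota k n.+1) Dm (j%:R - k%:R) <= _).
    have -> : iota k n.+1 = map (addn k) (iota 0 n.+1) by rewrite -iotaDl addn0.
    rewrite big_map; apply: ler_sum => m _.
    by rewrite -DmE natrD addrAC subrr add0r.
  apply: (@sum_sub _ _ _ _ (fun j : nat => Dm (j%:R - k%:R))) => //; first exact: iota_uniq.
  by move=> j; rewrite !mem_iota; lia.
apply: le_trans step1 _.
have -> : \sum_(k <- iota 0 (2 * n)) \sum_(j <- iota 0 (2 * n)) Dm (j%:R - k%:R) =
    \sum_(a <- TT) \sum_(b <- TT) nrm2 (iota 0 (2 * n)) (fun j => j%:R * (A * (G a - G b))).
  have sq I (s : seq I) (h : I -> R) : nrm2 s h = \sum_(x <- s) \sum_(y <- s) cos (h x - h y).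
    rewrite -[LHS]mulr1 -(@cos0 R) -nrm2_pair_sum.
    by apply: eq_bigr => x _; apply: eq_bigr => z _; rewrite addr0.
  under eq_bigr => k _ do under eq_bigr => j _ do rewrite /Dm sq.
  under eq_bigr => k _ do rewrite exchange_big.
  rewrite exchange_big /=; apply: eq_bigr => a _.
  under eq_bigr => k _ do rewrite exchange_big.
  rewrite exchange_big /=; apply: eq_bigr => b _.
  rewrite sq; apply: eq_bigr => k _; apply: eq_bigr => j _.
  by rewrite -cosN; congr cos; ring.
pose bound k : R := if k == 0%N then 4 * n%:R ^+ 2 else 16 / (A ^+ 2 * k%:R ^+ 2).
have bound0 k : 0 <= bound k.
  by rewrite /bound; case: eqP => _; [rewrite mulr_ge0// sqr_ge0|rewrite divr_ge0// mulr_ge0// sqr_ge0].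
have [K eK] : exists K, K = Num.truncn A^-1 by eexists.
have pw a b : a \in TT -> b \in TT -> nrm2 (iota 0 (2 * n)) (fun j => j%:R * (A * (G a - G b))) <=
    \sum_(k <- iota 0 K.+1) bound k * ((`|G a - G b - k%:R| <= 1)%R%:R + (`|G a - G b - - k%:R| <= 1)%R%:R).
  move=> aT bT; have := hA a b aT bT; rewrite -/(G a) -/(G b).
  move: (G a - G b) => u hu.
  have Au : `|u| <= A^-1 by move: hu; rewrite normrM gtr0_norm// -ler_pdivlMl// mulr1.
  have [k0 ek0] : exists k, k = Num.truncn `|u| by eexists.
  have k01 : k0%:R <= `|u| by rewrite ek0 truncn_le.
  have k02 : `|u| < k0%:R + 1 by rewrite ek0 natr1 truncnS_gt.
  have k0K : k0 \in iota 0 K.+1.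
    by rewrite mem_iota add0n /= -(ltr_nat R) (le_lt_trans k01)// (le_lt_trans Au)// eK truncnS_gt.
  rewrite (perm_big _ (perm_to_rem k0K)) big_cons /=.
  apply: le_trans (_ : bound k0 <= _); last first.
    apply: le_trans (_ : bound k0 * ((`|u - k0%:R| <= 1)%R%:R + (`|u - - k0%:R| <= 1)%R%:R) <= _).
      rewrite ler_peMr//; have [u0|u0] := leP 0 u.
        have -> : `|u - k0%:R| <= 1.
          by move: k01 k02; rewrite (ger0_norm u0) ler_norml => h1 h2; apply/andP; split; lra.
        by rewrite lerDl.
      have -> : `|u - - k0%:R| <= 1.
        by move: k01 k02; rewrite (ltr0_norm u0) ler_norml => h1 h2; apply/andP; split; lra.
      by rewrite lerDr.
    by rewrite lerDl; apply: sumr_ge0 => k _; rewrite mulr_ge0// addr_ge0.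
  rewrite /bound; case: eqP => [_|/eqP kn0].
    apply: le_trans (nrm2_le_size _ _) _; rewrite size_iota natrM exprMn.
    by rewrite ler_wpM2r ?sqr_ge0// -natrX.
  have k00 : 0 < k0%:R :> R by rewrite ltr0n lt0n.
  have u0 : 0 < `|u| by apply: lt_le_trans k01.
  have d0 : 0 < `|A * u| by rewrite normrM mulr_gt0// gtr0_norm.
  have := @nrm2_linear R (2 * n) 0 (A * u); rewrite d0 hu => /(_ isT).
  have -> : nrm2 (iota 0 (2 * n)) (fun v => 0 + v%:R * (A * u)) = nrm2 (iota 0 (2 * n)) (fun j => j%:R * (A * u)).
    by apply: eq_nrm2 => j _; rewrite add0r.
  have p1 : 0 < (A * u) ^+ 2 by rewrite -[_ ^+ 2]real_normK ?num_real// exprn_gt0.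
  have p2 : 0 < A ^+ 2 * k0%:R ^+ 2 by rewrite mulr_gt0// exprn_gt0.
  move=> /le_trans; apply; rewrite ler_wpM2l// lef_pV2 ?posrE//.
  by rewrite exprMn ler_wpM2l ?sqr_ge0// -[leRHS]real_normK ?num_real//; apply: lerXn2r; rewrite ?nnegrE.
apply: le_trans (_ : \sum_(a <- TT) \sum_(b <- TT) \sum_(k <- iota 0 K.+1)
    bound k * ((`|G a - G b - k%:R| <= 1)%R%:R + (`|G a - G b - - k%:R| <= 1)%R%:R) <= _).
  rewrite big_seq [leRHS]big_seq; apply: ler_sum => a aT.
  by rewrite big_seq [leRHS]big_seq; apply: ler_sum => b bT; exact: pw.
under eq_bigr => a _ do rewrite exchange_big.
rewrite exchange_big /=.
apply: le_trans (_ : \sum_(k <- iota 0 K.+1) bound k * (2 * Q) <= _).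
  apply: ler_sum => k _.
  under eq_bigr => a _ do rewrite -mulr_sumr big_split /=.
  rewrite -mulr_sumr big_split /= ler_wpM2l//.
  by have := hQ k%:R; have := hQ (- k%:R); rewrite -/(G _); lra.
rewrite -mulr_suml mulrC ler_wpM2l ?mulr_ge0//.
have -> : iota 0 K.+1 = 0%N :: iota 1 K by [].
rewrite big_cons {1}/bound eqxx lerD2l.
have -> : \sum_(k <- iota 1 K) bound k = 16 / A ^+ 2 * \sum_(k <- iota 1 K) (k%:R ^+ 2)^-1.
  rewrite mulr_sumr big_seq [RHS]big_seq; apply: eq_bigr => k; rewrite mem_iota => /andP[k0 _].
  by rewrite /bound gtn_eqF// invfM mulrA.
have -> : 32 / A ^+ 2 = 16 / A ^+ 2 * 2 by ring.
by rewrite ler_wpM2l ?sum_inv_sq// divr_ge0// sqr_ge0.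
Qed.

End Moments.

Section MinorSum.
Variable R : realType.

(** Of the s factors, 2 r are kept for the mean value, one takes the pointwise bound [E], and the
    others are bounded trivially. *)
Lemma tuple_cos_le (T : eqType) (S : seq T) (F : T -> R) (s r : nat) (t w E Lr : R) : 0 <= E ->
  (size S)%:R <= Lr -> (2 * r < s)%N -> nrm2 S (fun x => t * F x) <= E ^+ 2 ->
  `|\sum_(a <- tup S s) cos (t * (\sum_(x <- a) F x - w))| <=
    nrm2 S (fun x => t * F x) ^+ r * (E * Lr ^+ (s - 2 * r - 1)).
Proof.
move=> E0 SL rs hE; set nu := nrm2 _ _ in hE *.
have nu0 : 0 <= nu by exact: nrm2_ge0.
have Lr0 : 0 <= Lr by apply: le_trans SL.
have nuL : nu <= Lr ^+ 2.
  apply: le_trans (nrm2_le_size _ _) _; apply: lerXn2r; rewrite ?nnegrE//.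
have e : nrm2 (tup S s) (fun a => t * (\sum_(x <- a) F x - w)) = nu ^+ s.
  rewrite /nu -nrm2_tup; apply: (@nrm2_eqmod _ _ _ _ _ (- (t * w))) => a _; exists 0.
  by rewrite mul0r addr0 -mulr_sumr mulrBr.
have sq : (\sum_(a <- tup S s) cos (t * (\sum_(x <- a) F x - w))) ^+ 2 <= nu ^+ s.
  by rewrite -e /nrm2 lerDl sqr_ge0.
rewrite -ler_sqr ?nnegrE ?mulr_ge0 ?exprn_ge0//; rewrite real_normK ?num_real//.
apply: le_trans sq _; have -> : s = (r * 2 + 1 + (s - 2 * r - 1))%N by lia.
have -> : (r * 2 + 1 + (s - 2 * r - 1) - 2 * r - 1 = s - 2 * r - 1)%N by lia.
rewrite !exprD expr1 exprMn exprM -mulrA ler_wpM2l ?sqr_ge0// exprMn.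
rewrite ler_pM ?exprn_ge0// -exprM [(_ * 2)%N]mulnC exprM; apply: lerXn2r; rewrite ?nnegrE ?exprn_ge0//.
Qed.

(** The pointwise saving y^(-sg) exceeds the loss y^(sg / 2) in the pair count. The remaining saving
    is chosen before tau, which only enters [C] and the threshold for y. *)
Lemma minor_sum (theta c K5 : R) (s k : nat) : 2 < theta -> theta \isn't a Num.int -> 0 < c -> 0 < K5 ->
  (1 < k)%N -> k%:R <= 2 * theta -> 2 * theta < k.+1%:R -> (2 * tri k < s)%N ->
  exists2 sg : R, 0 < sg & forall tau : R, 0 < tau -> exists2 C : R, 0 < C &
  \forall y \near +oo, forall (n0 L n m1 : nat) (A w : R),
    2^-1 * y ^+ 2 <= n0%:R <= (2 + 3 * c) * y ^+ 2 -> c * y <= L%:R <= 3 * c * y ->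
    A = (s%:R * K5 * y `^ (2 * theta - 1))^-1 ->
    {in iota n0 L, forall x, `|x%:R `^ theta - (y ^+ 2) `^ theta| <= K5 * y `^ (2 * theta - 1)} ->
    8 / (A * tau) <= n%:R <= 32 / (A * tau) -> s%:R * K5 * y `^ (13 / 12) <= m1.+1%:R ->
    \sum_(m <- iota m1.+1 (n - m1))
      `|\sum_(a <- tup (iota n0 L) s) cos (m%:R * (A * (\sum_(x <- a) x%:R `^ theta - w)))|
    <= C * (y ^+ s * y `^ (- sg)).
Proof.
move=> t2 ni c0 K50 k1 k2t tk rs.
have [r er] : exists r, r = tri k by eexists.
rewrite -er in rs.
have h20 : 0 < 2^-1 :> R by rewrite invr_gt0.
have c20 : 0 < 2 + 3 * c by lra.
have [sg sg0 HW] := weyl_bound t2 ni h20 c20 c0.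
have eps0 : 0 < sg / 2 by rewrite divr_gt0.
have [Cq Cq0 HQ] := pair_count ni k1 k2t tk h20 c20 eps0.
exists (sg / 2) => // tau tau0.
have s0 : 0 < s%:R :> R by rewrite ltr0n; move: rs; clear; lia.
have tt0 : 0 < 128 / tau + 4 * tau by rewrite addr_gt0 ?divr_gt0// mulr_gt0.
exists (4 * (3 * c) ^+ (s - 2 * r) * (2 * Cq * (s%:R * K5) * (128 / tau + 4 * tau))).
  by rewrite !mulr_gt0// exprn_gt0// mulr_gt0.
near=> y => n0 L n m1 A w hn0 /andP[L1 L2] eA hK /andP[n1 n2] hm1.
have y1 : 1 <= y by near: y; exact: near_ge.
have y0 : 0 < y := lt_le_trans ltr01 y1.
have yc1 : 12 * c <= y by near: y; exact: near_ge.
have WB : forall (n0 b : R) (L : nat), 2^-1 * y ^+ 2 <= n0 <= (2 + 3 * c) * y ^+ 2 ->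
    c * y <= L%:R <= (2 + 3 * c) * y -> y `^ (2 - 2 * theta + 12^-1) <= b <= 32 / tau ->
    nrm2 (iota 0 L) (fun x => b * (n0 + x%:R) `^ theta) <= (4 * L%:R * y `^ (- sg)) ^+ 2.
  by near: y; exact: HW.
have Yp : 0 < y `^ (2 * theta - 1) by rewrite powR_gt0.
have sK0 : 0 < s%:R * K5 by rewrite mulr_gt0.
have A0 : 0 < A by rewrite eA invr_gt0 mulr_gt0.
have Ai : A^-1 = s%:R * K5 * y `^ (2 * theta - 1) by rewrite eA invrK.
have L0' : 0 < L%:R :> R by apply: lt_le_trans L1; rewrite mulr_gt0.
have L0 : (0 < L)%N by rewrite -(ltr0n R).
have L2' : L%:R <= (2 + 3 * c) * y by apply: le_trans L2 _; rewrite ler_wpM2r ?(ltW y0)//; move: c0; clear; lra.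
have hL : c * y <= L%:R <= (2 + 3 * c) * y by rewrite L1.
have Ln0 : L%:R <= (n0%:R : R) / 2.
  have /andP[h _] := hn0; have : 12 * c * y <= y ^+ 2 by rewrite expr2 ler_wpM2r// ltW.
  by move: h L2; clear; lra.
have eS : iota n0 L = map (addn n0) (iota 0 L) by rewrite -iotaDl addn0.
have nuE t : nrm2 (iota n0 L) (fun x => t * x%:R `^ theta) =
    nrm2 (iota 0 L) (fun x => t * (n0%:R + x%:R) `^ theta).
  by rewrite eS nrm2_map; apply: eq_nrm2 => x _ /=; rewrite natrD.
have [E eE] : exists E, E = 4 * L%:R * y `^ (- sg) by eexists.
have E0 : 0 <= E by rewrite eE !mulr_ge0// powR_ge0.
have term m : (m1 < m <= n)%N -> `|\sum_(a <- tup (iota n0 L) s) cos (m%:R * (A * (\sum_(x <- a) x%:R `^ theta - w)))| <=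
    nrm2 (iota 0 L) (fun x => m%:R * A * (n0%:R + x%:R) `^ theta) ^+ r * (E * L%:R ^+ (s - 2 * r - 1)).
  move=> /andP[m1m mn]; rewrite -nuE.
  under eq_bigr => a _ do rewrite mulrA.
  apply: tuple_cos_le => //; first by rewrite size_iota.
  rewrite nuE eE; apply: WB => //; apply/andP; split.
    (* Beyond [m1] the product m A is at least y^(13/12 - (2 theta - 1)), which is the lower limit
       of the range of the pointwise bound. *)
    apply: le_trans (_ : m1.+1%:R * A <= _); last by rewrite ler_wpM2r ?(ltW A0)// ler_nat.
    apply: le_trans (_ : s%:R * K5 * y `^ (13 / 12) * A <= _); last by rewrite ler_wpM2r ?(ltW A0).
    have -> : 2 - 2 * theta + 12^-1 = 13 / 12 + - (2 * theta - 1) by field.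
    rewrite eA powRDr// powRN le_eqVlt; apply/orP; left; apply/eqP.
    by field; rewrite !gt_eqF.
  apply: le_trans (_ : n%:R * A <= _); first by rewrite ler_wpM2r ?(ltW A0)// ler_nat.
  by move: n2; rewrite !ler_pdivlMr ?mulr_gt0// mulrA.
apply: le_trans (_ : \sum_(m <- iota m1.+1 (n - m1)) nrm2 (iota 0 L) (fun x => m%:R * A * (n0%:R + x%:R) `^ theta) ^+ r
   * (E * L%:R ^+ (s - 2 * r - 1)) <= _).
  rewrite big_seq [leRHS]big_seq; apply: ler_sum => m; rewrite mem_iota => hm; apply: term; move: hm; clear; lia.
rewrite -mulr_suml.
have EL0 : 0 <= E * L%:R ^+ (s - 2 * r - 1) by rewrite mulr_ge0// exprn_ge0.
have nu0 m : 0 <= nrm2 (iota 0 L) (fun x => m%:R * A * (n0%:R + x%:R) `^ theta) ^+ r.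
  by rewrite exprn_ge0// nrm2_ge0.
have [Q eQ] : exists Q, Q = Cq * y `^ (2 * r%:R + 1 - 2 * theta + sg / 2) by eexists.
have Q0 : 0 <= Q by rewrite eQ mulr_ge0 ?(ltW Cq0)// powR_ge0.
have s2r : (s - 2 * r = (s - 2 * r - 1).+1)%N by move: rs; clear; lia.
have n0' : 0 < n%:R :> R by apply: lt_le_trans n1; rewrite divr_gt0// mulr_gt0.
have mom : \sum_(m <- iota 0 n.+1) nrm2 (iota 0 L) (fun x => m%:R * A * (n0%:R + x%:R) `^ theta) ^+ r
    <= 2 * Q * ((128 / tau + 4 * tau) / A).
  have := @moment_bound R L r n (fun x => (n0%:R + x%:R) `^ theta) A Q A0 Q0.
  move=> /(_ _ _)/wrap[].
  - move=> a b aT bT; rewrite normrM gtr0_norm// -ler_pdivlMl// mulr1 Ai.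
    have dev t : t \in tup (iota 0 L) r -> `|\sum_(x <- t) (n0%:R + x%:R) `^ theta - r%:R * (y ^+ 2) `^ theta|
        <= r%:R * (K5 * y `^ (2 * theta - 1)).
      move=> /mem_tup[<- st].
      have -> : \sum_(x <- t) (n0%:R + x%:R) `^ theta - (size t)%:R * (y ^+ 2) `^ theta =
          \sum_(x <- t) ((n0%:R + x%:R) `^ theta - (y ^+ 2) `^ theta).
        by rewrite sumrB big_const_seq count_predT iter_addr_0 -[(y ^+ 2) `^ theta *+ _]mulr_natl.
      apply: le_trans (ler_norm_sum _ _ _) _.
      apply: le_trans (_ : \sum_(x <- t) K5 * y `^ (2 * theta - 1) <= _); last first.
        by rewrite big_const_seq count_predT iter_addr_0 [leRHS]mulr_natl.
      rewrite big_seq [leRHS]big_seq; apply: ler_sum => x /st xL.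
      by rewrite -natrD; apply: hK; rewrite eS map_f.
    have -> : \sum_(x <- a) (n0%:R + x%:R) `^ theta - \sum_(x <- b) (n0%:R + x%:R) `^ theta =
      (\sum_(x <- a) (n0%:R + x%:R) `^ theta - r%:R * (y ^+ 2) `^ theta) -
      (\sum_(x <- b) (n0%:R + x%:R) `^ theta - r%:R * (y ^+ 2) `^ theta) by ring.
    apply: le_trans (ler_normB _ _) _; apply: le_trans (lerD (dev a aT) (dev b bT)) _.
    rewrite -mulrDl -natrD -mulrA ler_wpM2r ?mulr_ge0 ?(ltW K50) ?(ltW Yp)// ler_nat.
    by move: rs; clear; lia.
  - move=> T; rewrite eQ er; apply: (HQ y n0%:R T L) => //.
  move=> h; rewrite -(ler_pM2l n0'); apply: le_trans h _.
  have tA : 0 < A * tau by rewrite mulr_gt0.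
  have h1 : 4 * n%:R ^+ 2 <= n%:R * (128 / tau / A).
    rewrite expr2 mulrCA ler_wpM2l ?(ltW n0')//.
    have -> : 128 / tau / A = 4 * (32 / (A * tau)) by field; rewrite !gt_eqF.
    by rewrite ler_wpM2l.
  have h2 : 32 / A ^+ 2 <= n%:R * (4 * tau / A).
    have -> : 32 / A ^+ 2 = 8 / (A * tau) * (4 * tau / A) by field; rewrite !gt_eqF.
    by rewrite ler_wpM2r ?divr_ge0 ?mulr_ge0 ?(ltW tau0) ?(ltW A0).
  rewrite [leRHS]mulrCA ler_wpM2l ?mulr_ge0//.
  by rewrite [X in n%:R * X]mulrDl [leRHS]mulrDr lerD.
have tail : \sum_(m <- iota m1.+1 (n - m1)) nrm2 (iota 0 L) (fun x => m%:R * A * (n0%:R + x%:R) `^ theta) ^+ r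
    <= 2 * Q * ((128 / tau + 4 * tau) / A).
  apply: le_trans mom.
  apply: (@sum_sub _ _ _ _ (fun m : nat => nrm2 (iota 0 L) (fun x => m%:R * A * (n0%:R + x%:R) `^ theta) ^+ r)) => //.
    exact: iota_uniq.
  by move=> m; rewrite !mem_iota; clear; lia.
apply: le_trans (ler_wpM2r EL0 tail) _.
have EL : E * L%:R ^+ (s - 2 * r - 1) <= 4 * (3 * c * y) ^+ (s - 2 * r) * y `^ (- sg).
  have -> : E * L%:R ^+ (s - 2 * r - 1) = 4 * L%:R ^+ (s - 2 * r) * y `^ (- sg).
    by rewrite eE [in RHS]s2r exprS; move: (L%:R ^+ _) => X; ring.
  rewrite ler_wpM2r ?powR_ge0// ler_wpM2l//; apply: lerXn2r; rewrite ?nnegrE//.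
  by rewrite !mulr_ge0// ltW.
apply: le_trans (_ : 2 * Q * ((128 / tau + 4 * tau) / A) * (4 * (3 * c * y) ^+ (s - 2 * r) * y `^ (- sg)) <= _).
  by rewrite ler_wpM2l// !mulr_ge0 ?invr_ge0 ?(ltW A0)// ltW.
rewrite eQ Ai exprMn.
have -> : y ^+ s * y `^ (- (sg / 2)) = y ^+ (s - 2 * r) * (y `^ (2 * r%:R + 1 - 2 * theta + sg / 2) *
     y `^ (2 * theta - 1) * y `^ (- sg)).
  rewrite -!powRDr//.
  have -> : 2 * r%:R + 1 - 2 * theta + sg / 2 + (2 * theta - 1) + - sg = (2 * r)%N%:R + - (sg / 2).
    by rewrite natrM; field.
  rewrite powRDr// powR_mulrn ?(ltW y0)// mulrA -exprD subnK//; exact: ltnW.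
rewrite le_eqVlt; apply/orP; left; apply/eqP.
move: ((3 * c) ^+ (s - 2 * r)) (y ^+ (s - 2 * r)) (128 / tau + 4 * tau) => X1 X2 X3.
by move: (y `^ (2 * r%:R + 1 - 2 * theta + sg / 2)) (y `^ (2 * theta - 1)) (y `^ (- sg)) => X4 X5 X6; ring.
Unshelve. all: by end_near. Qed.
End MinorSum.

(** * Comparison of the fine and the coarse kernel *)

Section CountLower.
Variable R : realType.

(* Fourier coefficients of (cos u - w) |sum_j tent_j e^(iju)|^2; by autoc_second the shift by one
   in the frequency turns into the autocorrelation of the slope. *)
Definition fine_coef (w : R) h m : R :=
  (1 - w) * autoc (2 * h) (@tent R h) m - autoc (2 * h) (slope (@tent R h)) m / 2.

(** The condition 8 <= om h makes z h^3 at least 8 h, so the tent part of the coefficient dominates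
    the slope part, which is at most h. *)
Lemma fine_kernel (om : R) h (z := 1 - cos om) : 0 < om <= 1 -> 8 <= om * h%:R ->
  [/\ 0 < z, 3 / 8 * (z * h%:R ^+ 3) <= fine_coef (cos om) h 0,
    forall m, `|fine_coef (cos om) h m| <= 3 * fine_coef (cos om) h 0 &
    forall m, `|fine_coef (cos om) h m - fine_coef (cos om) h 0| <=
      fine_coef (cos om) h 0 * (6 * m%:R ^+ 2 / h%:R ^+ 2 + m%:R / h%:R)].
Proof.
move=> /andP[om0 om1] omh.
have h0 : 0 < h%:R :> R by rewrite -(pmulr_rgt0 _ om0); lra.
have zl : om ^+ 2 / 8 <= z.
  have s1 : om / 2 / 2 <= sin (om / 2) by apply: sin_ge; lra.
  have s2 : (om / 2 / 2) ^+ 2 <= sin (om / 2) ^+ 2 by apply: lerXn2r; rewrite ?nnegrE//; lra.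
  have e : cos om = cos (om / 2 + om / 2) by congr cos; field.
  have := cos2Dsin2 (om / 2); move: s2; rewrite /z e cosD -!expr2 !expr_div_n.
  by move: (cos (om / 2) ^+ 2) (sin (om / 2) ^+ 2); move=> X Y; clear; lra.
have om2 : 0 < om ^+ 2 by rewrite exprn_gt0.
have z0 : 0 < z by move: zl om2; clear; lra.
have hz : 8 * h%:R <= z * h%:R ^+ 3.
  apply: le_trans (_ : om ^+ 2 / 8 * h%:R ^+ 3 <= _); last first.
    by rewrite ler_wpM2r ?exprn_ge0// ltW.
  have -> : om ^+ 2 / 8 * h%:R ^+ 3 = (om * h%:R) ^+ 2 / 8 * h%:R by ring.
  rewrite ler_wpM2r ?(ltW h0)//.
  have : 8 ^+ 2 <= (om * h%:R) ^+ 2 by apply: lerXn2r; rewrite ?nnegrE//; lra.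
  by move: ((om * h%:R) ^+ 2) => X; rewrite expr2; lra.
have hN : (0 < h)%N by rewrite -(ltr0n R).
have /andP[q1 q2] := autoc_tent0 R hN.
set Z := z * h%:R ^+ 3 in hz *.
have D0 := autoc_slope_le R h 0.
have q1' : Z / 2 <= z * autoc (2 * h) (tent R h) 0.
  by rewrite /Z -mulrA ler_wpM2l// ltW.
have t0 : 3 / 8 * Z <= fine_coef (cos om) h 0.
  rewrite /fine_coef -/z; move: D0; rewrite ler_norml => /andP[_ D0].
  by move: hz q1' D0; clear; lra.
split=> //.
- move=> m; apply: le_trans (_ : Z + h%:R <= _); last by move: t0 hz; clear; lra.
  rewrite /fine_coef -/z; apply: le_trans (ler_normB _ _) _; apply: lerD.
    by rewrite normrM gtr0_norm// ler_wpM2l ?(ltW z0)// autoc_tent_le.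
  by rewrite normrM [`|2^-1|]ger0_norm// ler_pdivrMr// mulrC; exact: autoc_slope_le.
- move=> m; set t := fine_coef (cos om) h 0 in t0 *.
  have -> : fine_coef (cos om) h m - t = z * (autoc (2 * h) (tent R h) m - autoc (2 * h) (tent R h) 0)
     - (autoc (2 * h) (slope (tent R h)) m - autoc (2 * h) (slope (tent R h)) 0) / 2.
    by rewrite /t /fine_coef -/z; ring.
  apply: le_trans (ler_normB _ _) _.
  apply: le_trans (_ : z * (2 * h%:R * m%:R ^+ 2) + 3 * m%:R / 2 <= _).
    rewrite !normrM gtr0_norm// [`|2^-1|]ger0_norm// lerD//.
      by rewrite ler_wpM2l ?(ltW z0)// autoc_tent_lip.
    by rewrite ler_wpM2r// autoc_slope_lip.
  rewrite mulrDr; apply: lerD.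
    have -> : z * (2 * h%:R * m%:R ^+ 2) = (2 * Z) * (m%:R ^+ 2 / h%:R ^+ 2).
      by rewrite /Z; field; rewrite gt_eqF.
    have -> : t * (6 * m%:R ^+ 2 / h%:R ^+ 2) = (6 * t) * (m%:R ^+ 2 / h%:R ^+ 2) by ring.
    rewrite ler_wpM2r ?divr_ge0 ?sqr_ge0//; have : 0 < Z by move: hz h0; clear; lra.
    by move: t0; clear; lra.
  have -> : 3 * m%:R / 2 = (3 / 2 * h%:R) * (m%:R / h%:R) :> R by field; rewrite gt_eqF.
  by rewrite ler_wpM2r ?divr_ge0//; move: t0 hz h0; clear; lra.
Qed.

Lemma cos_le_far (u w : R) : 0 <= w -> w <= `|u| -> `|u| <= 1 -> cos u <= cos w.
Proof.
move=> w0 wu u1; have -> : cos u = cos `|u| by case: (ger0P u) => // _; rewrite cosN.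
have [c /andP[c1 c2] e] := @mvt R cos (fun x => - sin x) w `|u| wu.
have : 0 <= sin c by apply: le_trans (sin_ge _) => //; [rewrite divr_ge0//|apply/andP; split]; lra.
move=> s0; rewrite -subr_le0 e mulNr oppr_le0 mulr_ge0// subr_ge0//.
Qed.

(** The coarse kernel is nonnegative everywhere and large where |V| <= W, so the coarse count bounds
    the common core from below. The fine kernel is at most zero where |V| >= tau, so the core bounds
    the fine count from below. Both comparisons lose only coefficient errors at low frequencies and
    multiples of [Mn]. *)
Lemma count_lower (I : eqType) (s : seq I) (V : I -> R) (A tau W Mn K1 : R) (h hW m1 : nat) :
  0 < A -> 0 < tau -> A * tau <= 1 -> {in s, forall i, `|A * V i| <= 1} ->
  8 <= A * tau * h%:R <= 16 -> (0 < hW <= h)%N -> 2 * hW%:R * (A * W) <= 1 ->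
  (m1 <= 2 * hW)%N ->
  \sum_(m <- iota m1.+1 (2 * h - m1)) `|\sum_(i <- s) cos (m%:R * (A * V i))| <= Mn ->
  0 <= K1 ->
  K1 <= hW%:R / 4 * (\sum_(i <- s) (`|V i| <= W)%R%:R) - 4 * (m1%:R ^+ 3 / hW%:R ^+ 2 * (size s)%:R) - 8 * Mn
    - 2 * (m1%:R * (6 * m1%:R ^+ 2 / h%:R ^+ 2 + m1%:R / h%:R) * (size s)%:R) ->
  3 / 256 * (A * tau) * K1 <= \sum_(i <- s) (`|V i| < tau)%R%:R.
Proof.
move=> A0 tau0 om1 hV /andP[oh1 oh2] /andP[hW0 hWh] hAW m1W hMn K10 hK1.
have om0 : 0 < A * tau by rewrite mulr_gt0.
have omr : 0 < A * tau <= 1 by rewrite om0.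
have [z0 t0 tm td] := fine_kernel omr oh1.
set z := 1 - cos (A * tau) in z0 t0.
set t := fine_coef _ _ in t0 tm td.
have h0 : 0 < h%:R :> R by rewrite -(pmulr_rgt0 _ om0); lra.
have hW0' : 0 < hW%:R :> R by rewrite ltr0n.
pose al i := A * V i.
pose Core := \sum_(i <- s) cospoly (fun=> 1) m1 (al i).
have t00 : 0 < t 0%N by apply: lt_le_trans t0; rewrite mulr_gt0// mulr_gt0// exprn_gt0.
have Mn0 : 0 <= Mn by apply: le_trans hMn; apply: sumr_ge0.
have cW0 : 0 <= \sum_(i <- s) (`|V i| <= W)%R%:R :> R by apply: sumr_ge0 => i _; exact: ler0n.
have tent0' := tent0 R; have tN := tent_eq0 R.
have /andP[qW1 qW2] := autoc_tent0 R hW0.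
have hW3 : 0 < hW%:R ^+ 3 :> R by rewrite exprn_gt0.
have coarse : hW%:R ^+ 4 / 4 * \sum_(i <- s) (`|V i| <= W)%R%:R <=
    autoc (2 * hW) (tent R hW) 0 * Core + 2 * (m1%:R * (2 * hW%:R * m1%:R ^+ 2) * (size s)%:R + hW%:R ^+ 3 * Mn).
  apply: le_trans (_ : \sum_(i <- s) kern (tent R hW) (2 * hW) (al i) <= _).
    rewrite mulr_sumr; apply: ler_sum => i _; case: (boolP (_ <= W)) => hi; last by rewrite mulr0 kern_ge0.
    rewrite mulr1; apply: kern_tent_ge; apply: le_trans hAW; rewrite ler_wpM2l ?mulr_ge0//.
    by rewrite normrM gtr0_norm// ler_wpM2l// ltW.
  under eq_bigr => i _ do rewrite (kernE (a := tent R hW) (tN hW)).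
  have := @kernel_compare R I s al (autoc (2 * hW) (tent R hW)) (2 * hW) m1 (hW%:R ^+ 3)
     (2 * hW%:R * m1%:R ^+ 2) m1W _ _.
  move=> /(_ _ _)/wrap[].
  - move=> m mm1; apply: le_trans (autoc_tent_lip R hW m) _; rewrite ler_wpM2l ?mulr_ge0//.
    by apply: lerXn2r; rewrite ?nnegrE// ler_nat.
  - by move=> m _; exact: autoc_tent_le.
  rewrite ler_norml => /andP[_]; rewrite lerBlDr addrC => /le_trans; apply.
  rewrite lerD2l ler_wpM2l// lerD2l ler_wpM2l ?(ltW hW3)//; apply: le_trans hMn.
  apply: (@sum_sub _ _ _ _ (fun m : nat => `|\sum_(i <- s) cos (m%:R * al i)|)) => //; first exact: iota_uniq.
  by move=> m; rewrite !mem_iota; move: hWh m1W; clear; lia.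
pose e1 := 4 * (m1%:R ^+ 3 / hW%:R ^+ 2 * (size s)%:R) : R.
pose e3 := 2 * (m1%:R * (6 * m1%:R ^+ 2 / h%:R ^+ 2 + m1%:R / h%:R) * (size s)%:R) : R.
have e30 : 0 <= e3 by rewrite /e3 !mulr_ge0// addr_ge0// !mulr_ge0 ?invr_ge0 ?sqr_ge0.
rewrite -/e1 -/e3 in hK1.
have K0 : K1 + 6 * Mn + e3 <= Core.
  have p : hW%:R ^+ 3 * (K1 + 6 * Mn + e3) <= autoc (2 * hW) (tent R hW) 0 * Core.
    have : hW%:R ^+ 3 * (K1 + 6 * Mn + e3) <= hW%:R ^+ 3 * (hW%:R / 4 * (\sum_(i <- s) (`|V i| <= W)%R%:R) - e1 - 2 * Mn).
      by rewrite ler_wpM2l ?(ltW hW3)//; move: hK1; clear; lra.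
    have -> : hW%:R ^+ 3 * (hW%:R / 4 * (\sum_(i <- s) (`|V i| <= W)%R%:R) - e1 - 2 * Mn) =
      hW%:R ^+ 4 / 4 * \sum_(i <- s) (`|V i| <= W)%R%:R
      - 2 * (m1%:R * (2 * hW%:R * m1%:R ^+ 2) * (size s)%:R + hW%:R ^+ 3 * Mn).
      by rewrite /e1; field; rewrite gt_eqF.
    by move: coarse; clear; lra.
  have q0 : 0 < autoc (2 * hW) (tent R hW) 0 by apply: lt_le_trans qW1; rewrite divr_gt0.
  rewrite -(ler_pM2l q0); apply: le_trans p; rewrite ler_wpM2r//.
  by rewrite !addr_ge0// mulr_ge0.
have fine : t 0%N * Core - 2 * (m1%:R * (t 0%N * (6 * m1%:R ^+ 2 / h%:R ^+ 2 + m1%:R / h%:R)) * (size s)%:R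
     + 3 * t 0%N * Mn) <= (\sum_(i <- s) (`|V i| < tau)%R%:R) * (z * (2 * h%:R ^+ 4)).
  apply: le_trans (_ : \sum_(i <- s) (cos (al i) - cos (A * tau)) * kern (tent R h) (2 * h) (al i) <= _).
    under [leRHS]eq_bigr => i _ do rewrite (kern_shiftE (tent0' h) (tN h)).
    have := @kernel_compare R I s al t (2 * h) m1 (3 * t 0%N)
       (t 0%N * (6 * m1%:R ^+ 2 / h%:R ^+ 2 + m1%:R / h%:R)) _ _ _.
    move=> /(_ _ _ _)/wrap[].
    - by move: hWh m1W; clear; lia.
    - move=> m mm1; apply: le_trans (td m) _; rewrite ler_wpM2l ?(ltW t00)// lerD//.
        rewrite ler_wpM2r ?invr_ge0 ?sqr_ge0// ler_wpM2l//.
        by apply: lerXn2r; rewrite ?nnegrE// ler_nat.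
      by rewrite ler_wpM2r ?invr_ge0// ler_nat.
    - by move=> m _; exact: tm.
    rewrite ler_norml => /andP[hc _].
    have mm : 2 * (m1%:R * (t 0%N * (6 * m1%:R ^+ 2 / h%:R ^+ 2 + m1%:R / h%:R)) * (size s)%:R + 3 * t 0%N *
       \sum_(m <- iota m1.+1 (2 * h - m1)) `|\sum_(i <- s) cos (m%:R * al i)|) <=
      2 * (m1%:R * (t 0%N * (6 * m1%:R ^+ 2 / h%:R ^+ 2 + m1%:R / h%:R)) * (size s)%:R + 3 * t 0%N * Mn).
      by rewrite ler_wpM2l// lerD2l ler_wpM2l ?mulr_ge0 ?(ltW t00).
    move: hc mm; rewrite -/Core.
    move: (2 * (_ + _)) (2 * (_ + _)) => X Y; clear; move=> *; lra.
  rewrite big_seq mulr_suml [leRHS]big_seq; apply: ler_sum => i /hV hi.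
  have k2 := kern_tent_le h (al i); have k0 := kern_ge0 (tent R h) (2 * h) (al i).
  have cz : cos (al i) - cos (A * tau) <= z by rewrite /z lerD2r cos_le1.
  case: (ltP `|V i| tau) => hi2.
    rewrite mul1r; apply: le_trans (_ : z * kern (tent R h) (2 * h) (al i) <= _).
      by rewrite ler_wpM2r.
    by rewrite ler_wpM2l// ltW.
  rewrite mul0r; rewrite mulr_le0_ge0// subr_le0 cos_le_far ?(ltW om0)//.
  by rewrite normrM gtr0_norm// ler_wpM2l// ltW.
have tK : t 0%N * K1 <= (\sum_(i <- s) (`|V i| < tau)%R%:R) * (z * (2 * h%:R ^+ 4)).
  apply: le_trans fine; have := ler_wpM2l (ltW t00) K0.
  by rewrite /e3; move=> h5; rewrite -subr_ge0 in h5; rewrite -subr_ge0; apply: le_trans h5 _; rewrite le_eqVlt; apply/orP; left; apply/eqP; ring.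
(* The fine kernel is at most 2 z h^4 and its constant coefficient at least 3/8 z h^3; with h <= 16
   / (A tau) this produces the constant 3/256. *)
have zh : 0 < z * (2 * h%:R ^+ 4) by rewrite !mulr_gt0// exprn_gt0.
rewrite -(ler_pM2r zh); apply: le_trans tK.
apply: le_trans (_ : 3 / 8 * (z * h%:R ^+ 3) * K1 <= _); last by rewrite ler_wpM2r.
have -> : 3 / 256 * (A * tau) * K1 * (z * (2 * h%:R ^+ 4)) =
  (3 / 128 * (z * h%:R ^+ 3) * K1) * (A * tau * h%:R) by field.
have -> : 3 / 8 * (z * h%:R ^+ 3) * K1 = (3 / 128 * (z * h%:R ^+ 3) * K1) * 16 by field.
by rewrite ler_wpM2l// !mulr_ge0// ?divr_ge0// ?exprn_ge0// ltW.
Qed.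

End CountLower.

Section ListCount.
Variable R : realType.

(** Up to constants the kernel lengths are 1 / (A tau) for [h] and y^(7/4) for [hW], and [m1] is
    y^(13/12). Relative to y^s the errors are m1^3 / hW^2 of order y^(-1/4), m1^2 / h at most of
    order y^(-5/6), and the high frequency part y^(-sg). All tend to zero for fixed tau, so [C] does
    not depend on tau. *)
Lemma list_count (theta c : R) (s k : nat) : 2 < theta -> theta \isn't a Num.int -> 0 < c ->
  1 < (s./2)%:R * (theta - 1) * c ^+ 2 -> (1 < k)%N -> k%:R <= 2 * theta -> 2 * theta < k.+1%:R ->
  (2 * tri k < s)%N ->
  exists2 C : R, 0 < C & forall tau : R, 0 < tau -> \forall y \near +oo, forall n0 L : nat,
    {in iota n0 L, forall x, `|x%:R - y ^+ 2| <= c * y} ->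
    (forall x : nat, `|(x%:R : R) - y ^+ 2| < c * y -> x \in iota n0 L) ->
    2^-1 * y ^+ 2 <= n0%:R <= (2 + 3 * c) * y ^+ 2 -> c * y <= L%:R <= 3 * c * y ->
    C * (tau * (y ^+ s * y `^ (1 - 2 * theta))) <=
    \sum_(a <- tup (iota n0 L) s) (`|\sum_(x <- a) x%:R `^ theta - s%:R * (y ^+ 2) `^ theta| < tau)%R%:R.
Proof.
move=> t2 ni c0 hG k1 k2t tk rs.
have s2 : (1 < s)%N by have := tri_gt0 (ltnW k1); move: rs; clear; lia.
have p0 : (0 < s./2)%N by rewrite half_gt0.
have [Ct Ct0 HT] := taylor2 theta c0.
have [c1 c10 Hcoarse] := coarse_count t2 c0 p0 hG.
have [k0 ek0] : exists k0, k0 = theta * (theta - 1) / 2 by eexists.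
have k00 : 0 < k0 by rewrite ek0 divr_gt0// mulr_gt0//; lra.
have [K5 eK5] : exists K5, K5 = Ct + theta * c + k0 * c ^+ 2 by eexists.
have tc0 : 0 < theta * c by rewrite mulr_gt0//; lra.
have kc0 : 0 < k0 * c ^+ 2 by rewrite mulr_gt0// exprn_gt0.
have K50 : 0 < K5 by lra.
have [sg sg0 Hminor] := minor_sum t2 ni c0 K50 k1 k2t tk rs.
have s0 : 0 < s%:R :> R by rewrite ltr0n ltnW.
have [K6 eK6] : exists K6, K6 = s%:R * K5 by eexists.
have K60 : 0 < K6 by rewrite eK6 mulr_gt0.
(* The main term hW / 4 times the coarse count, measured in units of y^s. *)
have [ka eka] : exists ka, ka = K6 * c1 / 16 by eexists.
have ka0 : 0 < ka by rewrite eka divr_gt0// mulr_gt0.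
exists (3 / 256 / K6 * (ka / 2)).
  have q0 : 0 < 3 / 256 :> R by clear; lra.
  exact: mulr_gt0 (divr_gt0 q0 K60) (divr_gt0 ka0 (ltr0Sn _ 1)).
move=> tau tau0; have [Cm Cm0 HM] := Hminor tau tau0.
have [c3 ec3] : exists c3, c3 = (3 * c) ^+ s by eexists.
have c30 : 0 < c3 by rewrite ec3 exprn_gt0// mulr_gt0.
near=> y => n0 L hS1 hS2 hn0 hL.
have y1 : 1 <= y by near: y; exact: near_ge.
have y0 : 0 < y := lt_le_trans ltr01 y1.
have yc : 2 * c <= y by near: y; exact: near_ge.
have [U eU] : exists U, U = y `^ (2 * theta - 3) by eexists.
have U0 : 0 < U by rewrite eU powR_gt0.
have Y1 : y `^ (2 * theta - 1) = U * y ^+ 2.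
  have -> : y ^+ 2 = y `^ 2 by rewrite -powR_mulrn ?(ltW y0).
  by rewrite eU -powRDr//; congr (_ `^ _); ring.
have yy : y <= y ^+ 2 by rewrite expr2 ler_peMl// ltW.
have y21 : 1 <= y ^+ 2 by apply: le_trans yy.
have hK : {in iota n0 L, forall x, `|x%:R `^ theta - (y ^+ 2) `^ theta| <= K5 * y `^ (2 * theta - 1)}.
  move=> x /hS1 hx; have := HT y (x%:R - y ^+ 2) y1 yc hx.
  rewrite [y ^+ 2 + _]addrC subrK -eU -ek0 Y1; set d := _ - (y ^+ 2) `^ theta.
  set z := x%:R - y ^+ 2 in hx *.
  have b1 : `|theta * (U * y) * z| <= theta * c * (U * y ^+ 2).
    rewrite normrM gtr0_norm ?mulr_gt0//; last by move: t2; clear; lra.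
    have -> : theta * c * (U * y ^+ 2) = theta * (U * y) * (c * y) by ring.
    by rewrite ler_wpM2l ?mulr_ge0 ?(ltW U0) ?(ltW y0)//; move: t2; clear; lra.
  have b2 : `|k0 * (U / y) * z ^+ 2| <= k0 * c ^+ 2 * (U * y ^+ 2).
    have kU : 0 < k0 * (U / y) by rewrite mulr_gt0// divr_gt0.
    rewrite normrM normrX gtr0_norm//.
    apply: le_trans (_ : k0 * (U / y) * (c * y) ^+ 2 <= _).
      rewrite ler_wpM2l ?(ltW kU)//.
      by apply: lerXn2r; rewrite ?nnegrE// mulr_ge0// ltW.
    have -> : k0 * (U / y) * (c * y) ^+ 2 = k0 * c ^+ 2 * (U * y) by field; rewrite gt_eqF.
    by rewrite ler_wpM2l ?(ltW kc0)// ler_wpM2l// ltW.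
  have b3 : Ct * U <= Ct * (U * y ^+ 2) by rewrite ler_wpM2l// ler_peMr// ltW.
  move=> h.
  have -> : d = (d - theta * (U * y) * z - k0 * (U / y) * z ^+ 2) + theta * (U * y) * z + k0 * (U / y) * z ^+ 2 by ring.
  apply: le_trans (ler_normD _ _) _.
  have := ler_normD (d - theta * (U * y) * z - k0 * (U / y) * z ^+ 2) (theta * (U * y) * z).
  by rewrite eK5; move: h b1 b2 b3; rewrite !mulrDl; clear; lra.
have [A eA] : exists A, A = (s%:R * K5 * y `^ (2 * theta - 1))^-1 by eexists.
have Yp : 0 < y `^ (2 * theta - 1) by rewrite powR_gt0.
have A0 : 0 < A by rewrite eA invr_gt0 !mulr_gt0.
have Ai : A^-1 = K6 * y `^ (2 * theta - 1) by rewrite eA invrK eK6.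
have y3 : y ^+ 3 <= y `^ (2 * theta - 1).
  by rewrite -powR_mulrn ?(ltW y0)// ler_powR//; move: t2; clear; lra.
have y31 : y <= y ^+ 3 by rewrite exprS ler_peMr// ltW.
have F1 : tau / K6 <= y by near: y; exact: near_ge.
have om1 : A * tau <= 1.
  rewrite -ler_pdivlMl// mulr1 Ai mulrC -ler_pdivrMr//.
  exact: le_trans F1 (le_trans y31 y3).
have om0 : 0 < A * tau by rewrite mulr_gt0.
have om16 : 2 <= 16 / (A * tau) by rewrite ler_pdivlMr//; move: om1; clear; lra.
have [h [h1 h2]] : exists h : nat, 16 / (A * tau) / 2 <= h%:R /\ h%:R <= 16 / (A * tau).
  by exists (Num.truncn (16 / (A * tau))); apply/andP; exact: truncn_half.
have oh1 : 8 <= A * tau * h%:R.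
  have e8 : 16 / (A * tau) / 2 * (A * tau) = 8 by field; rewrite !gt_eqF.
  by have := ler_wpM2r (ltW om0) h1; rewrite e8 [h%:R * _]mulrC.
have oh2 : A * tau * h%:R <= 16 by move: h2; rewrite ler_pdivlMr// mulrC.
have F2 : 4 / K6 <= y by near: y; exact: near_ge.
have y74 : y <= y `^ (7 / 4) by rewrite -[leLHS]powRr1 ?(ltW y0)// ler_powR//; clear; lra.
have hW2 : 2 <= K6 / 2 * y `^ (7 / 4).
  move: F2; rewrite ler_pdivrMr// => F2.
  have : K6 * y <= K6 * y `^ (7 / 4) by rewrite ler_wpM2l// ltW.
  by move: F2; rewrite [y * _]mulrC; clear; lra.
have [hW [hW3 hW4]] : exists hW : nat, K6 / 4 * y `^ (7 / 4) <= hW%:R /\ hW%:R <= K6 / 2 * y `^ (7 / 4).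
  exists (Num.truncn (K6 / 2 * y `^ (7 / 4))); have /andP[g1 g2] := truncn_half hW2; split=> //.
  by move: g1; clear; lra.
have [m1 [m11 m12]] : exists m1 : nat, m1%:R <= K6 * y `^ (13 / 12) /\ K6 * y `^ (13 / 12) <= m1.+1%:R.
  exists (Num.truncn (K6 * y `^ (13 / 12))); rewrite truncn_le (ltW (truncnS_gt _)).
  by rewrite mulr_ge0 ?powR_ge0// ltW.
have inv C e : C / ka <= y `^ e -> C * y `^ (- e) <= ka.
  move=> hC; rewrite powRN ler_pdivrMr ?powR_gt0// mulrC -ler_pdivrMr//.
have G1 : 2048 * K6 * c3 * y `^ (- 4^-1) <= ka by apply: inv; near: y; apply: near_powR_ge; rewrite invr_gt0.
have G2 : 64 * Cm * y `^ (- sg) <= ka by apply: inv; near: y; exact: near_powR_ge.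
have G3 : 2 * K6 * tau * c3 * y `^ (- (5 / 6)) <= ka by apply: inv; near: y; apply: near_powR_ge; rewrite divr_gt0.
have F3 : tau <= y by near: y; exact: near_ge.
have F4 : 2 <= y `^ (2 / 3) by near: y; apply: near_powR_ge; rewrite divr_gt0.
have hlow : 8 * K6 / tau * y ^+ 3 <= h%:R.
  apply: le_trans h1; rewrite invfM Ai.
  have -> : 16 * (K6 * y `^ (2 * theta - 1) / tau) / 2 = 8 * K6 / tau * y `^ (2 * theta - 1) by field; rewrite gt_eqF.
  by rewrite ler_wpM2l ?mulr_ge0 ?invr_ge0 ?(ltW tau0) ?(ltW K60).
have hW0 : 0 < hW%:R :> R by apply: lt_le_trans hW3; rewrite mulr_gt0 ?powR_gt0// divr_gt0.
have hWh : hW%:R <= h%:R :> R.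
  apply: le_trans hW4 _; apply: le_trans hlow.
  have a1 : y `^ (7 / 4) <= y ^+ 2.
    have -> : y ^+ 2 = y `^ 2 by rewrite -powR_mulrn ?(ltW y0).
    by rewrite ler_powR//; clear; lra.
  have a2 : 8 * K6 * y ^+ 2 <= 8 * K6 / tau * y ^+ 3.
    have -> : 8 * K6 / tau * y ^+ 3 = 8 * K6 * y ^+ 2 * (y / tau) by field; rewrite gt_eqF.
    by rewrite ler_peMr ?mulr_ge0 ?sqr_ge0 ?(ltW K60)// ler_pdivlMr// mul1r.
  apply: le_trans a2; apply: le_trans (_ : K6 / 2 * y ^+ 2 <= _).
    by rewrite ler_wpM2l ?divr_ge0// ltW.
  by rewrite ler_wpM2r ?sqr_ge0//; move: K60; clear; lra.
have h0 : 0 < h%:R :> R by apply: lt_le_trans hWh.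
have mhW : m1%:R <= 2 * hW%:R :> R.
  apply: le_trans m11 _; have -> : K6 * y `^ (13 / 12) = K6 / 2 * (y `^ (13 / 12) * 2) by field.
  apply: le_trans (_ : K6 / 2 * y `^ (7 / 4) <= _); last by move: hW3; clear; lra.
  rewrite ler_wpM2l ?divr_ge0 ?(ltW K60)//.
  have -> : 7 / 4 = 13 / 12 + 2 / 3 :> R by field.
  by rewrite powRDr// ler_wpM2l ?powR_ge0.
have HMy : forall (n0 L n m1 : nat) (A w : R),
    2^-1 * y ^+ 2 <= n0%:R <= (2 + 3 * c) * y ^+ 2 -> c * y <= L%:R <= 3 * c * y ->
    A = (s%:R * K5 * y `^ (2 * theta - 1))^-1 ->
    {in iota n0 L, forall x, `|x%:R `^ theta - (y ^+ 2) `^ theta| <= K5 * y `^ (2 * theta - 1)} ->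
    8 / (A * tau) <= n%:R <= 32 / (A * tau) -> s%:R * K5 * y `^ (13 / 12) <= m1.+1%:R ->
    \sum_(m <- iota m1.+1 (n - m1))
      `|\sum_(a <- tup (iota n0 L) s) cos (m%:R * (A * (\sum_(x <- a) x%:R `^ theta - w)))|
    <= Cm * (y ^+ s * y `^ (- sg)) by near: y; exact: HM.
have HCy : forall S : seq nat, (forall x : nat, `|(x%:R : R) - y ^+ 2| < c * y -> x \in S) ->
    c1 * (y ^+ (s - 2) * y `^ 4^-1) <= \sum_(a <- tup S s)
      (`|\sum_(x <- a) x%:R `^ theta - s%:R * (y ^+ 2) `^ theta| <= y `^ (2 * theta - 3) * y `^ 4^-1)%R%:R.
  by near: y; exact: Hcoarse.
pose V (a : seq nat) := \sum_(x <- a) x%:R `^ theta - s%:R * (y ^+ 2) `^ theta.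
have hV : {in tup (iota n0 L) s, forall a, `|A * V a| <= 1}.
  move=> a /mem_tup[sa ma]; rewrite normrM gtr0_norm// -ler_pdivlMl// mulr1 Ai eK6 /V -sa.
  have -> : \sum_(x <- a) x%:R `^ theta - (size a)%:R * (y ^+ 2) `^ theta = \sum_(x <- a) (x%:R `^ theta - (y ^+ 2) `^ theta).
    by rewrite sumrB big_const_seq count_predT iter_addr_0 -[(y ^+ 2) `^ theta *+ _]mulr_natl.
  apply: le_trans (ler_norm_sum _ _ _) _.
  apply: le_trans (_ : \sum_(x <- a) K5 * y `^ (2 * theta - 1) <= _); last first.
    by rewrite big_const_seq count_predT iter_addr_0 -[leLHS]mulr_natl mulrA.
  by rewrite big_seq [leRHS]big_seq; apply: ler_sum => x /ma; exact: hK.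
have hAW : 2 * hW%:R * (A * (U * y `^ 4^-1)) <= 1.
  apply: le_trans (_ : K6 * y `^ (7 / 4) * (A * (U * y `^ 4^-1)) <= _).
    by rewrite ler_wpM2r ?mulr_ge0 ?powR_ge0 ?(ltW A0) ?(ltW U0)//; move: hW4; clear; lra.
  have y74' : y `^ (7 / 4) * y `^ 4^-1 = y ^+ 2.
    by rewrite -powRDr// -powR_mulrn ?(ltW y0)//; congr (_ `^ _); field.
  have -> : K6 * y `^ (7 / 4) * (A * (U * y `^ 4^-1)) = A * (K6 * (U * (y `^ (7 / 4) * y `^ 4^-1))) by ring.
  by rewrite y74' -Y1 -Ai divff// gt_eqF.
have hWN : (0 < hW <= h)%N by rewrite -(ltr0n R) hW0 -(ler_nat R).
have m1N : (m1 <= 2 * hW)%N by rewrite -(ler_nat R) natrM.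
have h2n : 8 / (A * tau) <= (2 * h)%N%:R <= 32 / (A * tau).
  have -> : 8 / (A * tau) = 16 / (A * tau) / 2 by field; rewrite !gt_eqF.
  have -> : 32 / (A * tau) = 2 * (16 / (A * tau)) by field; rewrite !gt_eqF.
  rewrite natrM; apply/andP; split; move: h1 h2 h0; clear; lra.
have hm1 : s%:R * K5 * y `^ (13 / 12) <= m1.+1%:R by rewrite -eK6.
have hMn : \sum_(m <- iota m1.+1 (2 * h - m1)) `|\sum_(a <- tup (iota n0 L) s) cos (m%:R * (A * V a))|
   <= Cm * (y ^+ s * y `^ (- sg)) by exact: (HMy n0 L (2 * h)%N m1 A (s%:R * (y ^+ 2) `^ theta) hn0 hL eA hK h2n hm1).
have ys0 : 0 < y ^+ s by rewrite exprn_gt0.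
have K10 : 0 <= ka / 2 * y ^+ s by rewrite mulr_ge0 ?divr_ge0// ltW.
have oh : 8 <= A * tau * h%:R <= 16 by rewrite oh1.
have final := @count_lower R _ (tup (iota n0 L) s) V A tau _ _ _ h hW m1 A0 tau0 om1 hV oh hWN hAW m1N hMn K10.
have cW := HCy _ hS2; rewrite -eU in cW.
have cW' : ka * y ^+ s <= hW%:R / 4 * \sum_(a <- tup (iota n0 L) s) (`|V a| <= U * y `^ 4^-1)%R%:R.
  apply: le_trans (_ : K6 / 4 * y `^ (7 / 4) / 4 * (c1 * (y ^+ (s - 2) * y `^ 4^-1)) <= _); last first.
    apply: ler_pM; [|by rewrite !mulr_ge0 ?exprn_ge0 ?powR_ge0 ?(ltW c10) ?(ltW y0)|by rewrite ler_wpM2r|exact: cW].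
    by rewrite !mulr_ge0 ?powR_ge0 ?invr_ge0 ?(ltW K60).
  have y74' : y `^ (7 / 4) * y `^ 4^-1 = y ^+ 2.
    by rewrite -powRDr// -powR_mulrn ?(ltW y0)//; congr (_ `^ _); field.
  have -> : K6 / 4 * y `^ (7 / 4) / 4 * (c1 * (y ^+ (s - 2) * y `^ 4^-1)) =
    ka * (y ^+ (s - 2) * (y `^ (7 / 4) * y `^ 4^-1)) by rewrite eka; field.
  by rewrite y74' -exprD subnK.
have szE : (size (tup (iota n0 L) s))%:R <= c3 * y ^+ s :> R.
  rewrite size_tup size_iota natrX ec3 -exprMn; have /andP[_ L2] := hL.
  by apply: lerXn2r; rewrite ?nnegrE// !mulr_ge0// ltW.
set sz := (size _)%:R in szE final.
have sz0 : 0 <= sz by exact: ler0n.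
have m1c : m1%:R ^+ 3 <= K6 ^+ 3 * y `^ (13 / 4).
  apply: le_trans (_ : (K6 * y `^ (13 / 12)) ^+ 3 <= _).
    by apply: lerXn2r; rewrite ?nnegrE// mulr_ge0 ?powR_ge0// ltW.
  rewrite exprMn -[(y `^ _) ^+ 3]powR_mulrn ?powR_ge0// -powRrM.
  by have -> : 13 / 12 * 3 = 13 / 4 :> R by field.
have m1s : m1%:R ^+ 2 <= K6 ^+ 2 * y `^ (13 / 6).
  apply: le_trans (_ : (K6 * y `^ (13 / 12)) ^+ 2 <= _).
    by apply: lerXn2r; rewrite ?nnegrE// mulr_ge0 ?powR_ge0// ltW.
  rewrite exprMn -[(y `^ _) ^+ 2]powR_mulrn ?powR_ge0// -powRrM.
  by have -> : 13 / 12 * 2 = 13 / 6 :> R by field.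
have hW2' : K6 ^+ 2 / 16 * y `^ (7 / 2) <= hW%:R ^+ 2.
  apply: le_trans (_ : (K6 / 4 * y `^ (7 / 4)) ^+ 2 <= _); last first.
    by apply: lerXn2r; rewrite ?nnegrE// mulr_ge0 ?powR_ge0 ?divr_ge0 ?(ltW K60).
  rewrite exprMn -[(y `^ _) ^+ 2]powR_mulrn ?powR_ge0// -powRrM.
  have -> : 7 / 4 * 2 = 7 / 2 :> R by field.
  by rewrite ler_wpM2r ?powR_ge0// le_eqVlt; apply/orP; left; apply/eqP; field.
have hW20 : 0 < hW%:R ^+ 2 :> R by rewrite exprn_gt0.
have r1 : m1%:R ^+ 3 / hW%:R ^+ 2 <= 16 * K6 * y `^ (- 4^-1).
  rewrite ler_pdivrMr//; apply: le_trans m1c _.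
  apply: le_trans (_ : 16 * K6 * y `^ (- 4^-1) * (K6 ^+ 2 / 16 * y `^ (7 / 2)) <= _); last first.
    by rewrite ler_wpM2l// mulr_ge0 ?powR_ge0// mulr_ge0// ltW.
  have -> : 13 / 4 = - 4^-1 + 7 / 2 :> R by field.
  by rewrite powRDr// le_eqVlt; apply/orP; left; apply/eqP; field.
have r2 : m1%:R ^+ 3 / h%:R ^+ 2 <= 16 * K6 * y `^ (- 4^-1).
  apply: le_trans r1; rewrite ler_wpM2l ?exprn_ge0// lef_pV2 ?posrE ?exprn_gt0//.
  by apply: lerXn2r; rewrite ?nnegrE.
have r3 : m1%:R ^+ 2 / h%:R <= K6 * tau / 8 * y `^ (- (5 / 6)).
  rewrite ler_pdivrMr//; apply: le_trans m1s _.
  apply: le_trans (_ : K6 * tau / 8 * y `^ (- (5 / 6)) * (8 * K6 / tau * y ^+ 3) <= _); last first.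
    by rewrite ler_wpM2l// mulr_ge0 ?powR_ge0// divr_ge0// mulr_ge0// ltW.
  have -> : 13 / 6 = - (5 / 6) + 3 :> R by field.
  rewrite powRDr// -[y ^+ 3]powR_mulrn ?(ltW y0)//.
  by rewrite le_eqVlt; apply/orP; left; apply/eqP; field; rewrite gt_eqF.
have szb a b : 0 <= a -> a * c3 <= b -> a * sz <= b * y ^+ s.
  move=> a0 ab; apply: le_trans (_ : a * (c3 * y ^+ s) <= _); first by rewrite ler_wpM2l.
  by rewrite mulrA ler_wpM2r// ltW.
have yN4 : 0 <= y `^ (- 4^-1) by exact: powR_ge0.
have E1 : 4 * (m1%:R ^+ 3 / hW%:R ^+ 2 * sz) <= ka / 8 * y ^+ s.
  rewrite mulrA; apply: szb; first by rewrite mulr_ge0// divr_ge0// exprn_ge0.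
  have := ler_wpM2r (ltW c30) r1; have := G1; move: (m1%:R ^+ 3 / hW%:R ^+ 2) => X.
  have : 0 <= K6 * c3 * y `^ (- 4^-1) by rewrite !mulr_ge0// ltW.
  by clear; move: (y `^ (- 4^-1)) => Y; lra.
have E2 : 8 * (Cm * (y ^+ s * y `^ (- sg))) <= ka / 8 * y ^+ s.
  have := ler_wpM2r (ltW ys0) G2; move: (y `^ (- sg)) (y ^+ s) => X Y; clear; lra.
have E3 : 2 * (m1%:R * (6 * m1%:R ^+ 2 / h%:R ^+ 2 + m1%:R / h%:R) * sz) <= ka / 4 * y ^+ s.
  rewrite mulrA; apply: szb; first by rewrite !mulr_ge0// addr_ge0// ?divr_ge0 ?mulr_ge0 ?exprn_ge0.
  have -> : 2 * (m1%:R * (6 * m1%:R ^+ 2 / h%:R ^+ 2 + m1%:R / h%:R)) =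
     12 * (m1%:R ^+ 3 / h%:R ^+ 2) + 2 * (m1%:R ^+ 2 / h%:R) :> R by field; rewrite gt_eqF.
  have := ler_wpM2r (ltW c30) r2; have := ler_wpM2r (ltW c30) r3; have := G1; have := G3.
  have : 0 <= K6 * c3 * y `^ (- 4^-1) by rewrite !mulr_ge0// ltW.
  move: (m1%:R ^+ 3 / h%:R ^+ 2) (m1%:R ^+ 2 / h%:R) (y `^ (- 4^-1)) (y `^ (- (5 / 6))) => X Z Y T; clear; lra.
apply: le_trans (final _); last first.
  by rewrite -/sz; move: cW' E1 E2 E3; clear; lra.
rewrite eA -eK6 -[1 - _]opprB powRN le_eqVlt; apply/orP; left; apply/eqP.
by field; rewrite !gt_eqF.
Unshelve. all: by end_near. Qed.
End ListCount.

(** * From lists of integers to the counting function *)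

Section Translation.
Variable R : realType.

Lemma uniq_tup (T : eqType) (S : seq T) k : uniq S -> uniq (tup S k).
Proof.
move=> uS; elim: k => //= k IH; rewrite map_inj_uniq; first by rewrite allpairs_uniq// => -[x a] [x' a'] _ _ [-> ->].
by move=> [x a] [x' a'] [-> ->].
Qed.

Lemma near_central (s : nat) (theta B : R) : (0 < s)%N -> 0 < theta ->
  \forall r \near +oo, B <= Num.sqrt (central s theta r).
Proof.
move=> s0 t0; near=> r.
have s0' : 0 < s%:R :> R by rewrite ltr0n.
have r1 : s%:R * (B ^+ 2) `^ theta <= r by near: r; exact: near_ge.
apply: le_trans (ler_norm B) _; rewrite -sqrtr_sqr ler_wsqrtr// /central.
have -> : B ^+ 2 = ((B ^+ 2) `^ theta) `^ theta^-1.
  by rewrite -powRrM mulfV ?gt_eqF// powRr1// sqr_ge0.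
have h : (B ^+ 2) `^ theta <= r / s%:R by rewrite ler_pdivlMr// mulrC.
apply: ge0_ler_powR; rewrite ?nnegrE ?invr_ge0 ?(ltW t0) ?powR_ge0//.
by apply: le_trans h; exact: powR_ge0.
Unshelve. all: by end_near. Qed.

Lemma Ncount_ge (s n0 L : nat) (theta tau r Y : R) : (0 < n0)%N ->
  (forall x, x \in iota n0 L -> central s theta r - Y < x%:R <= central s theta r + Y) ->
  \sum_(a <- tup (iota n0 L) s) (`|\sum_(x <- a) x%:R `^ theta - r| < tau)%R%:R
    <= (Ncount s theta tau r Y)%:R :> R.
Proof.
move=> n00 hS; rewrite -natr_sum ler_nat /Ncount.
have -> : (\sum_(a <- tup (iota n0 L) s) (`|\sum_(x <- a) (x%:R : R) `^ theta - r| < tau)%R)%N =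
    size [seq a <- tup (iota n0 L) s | (`|\sum_(x <- a) (x%:R : R) `^ theta - r| < tau)%R].
  by rewrite size_filter -sum1_count [RHS]big_mkcond; apply: eq_bigr => a _; case: (_ < _).
rewrite -[leqRHS](size_map val); apply: uniq_leq_size.
  by rewrite filter_uniq// uniq_tup// iota_uniq.
move=> a; rewrite mem_filter => /andP[ha /mem_tup[/eqP sa ma]].
apply/mapP; exists (Tuple sa) => //.
rewrite in_fset_set; last exact: finite_solutions.
apply: mem_set; split.
- move=> i; have := ma _ (mem_tnth i (Tuple sa)); rewrite mem_iota => /andP[h _].
  exact: leq_trans h.
- by rewrite -(big_tuple _ _ (Tuple sa) xpredT (fun x => x%:R `^ theta)).
- by move=> i; exact: hS (ma _ (mem_tnth i (Tuple sa))).
Qed.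

End Translation.

Theorem theorem1 (R : realType) (theta : R) (s : nat) (c : R)
    (theta_gt2 : 2 < theta)
    (theta_nint : theta \isn't a Num.int)
    (s_large : (Num.floor (2 * theta) + 1) * (Num.floor (2 * theta) + 2) + 1
               <= s%:Z)
    (c_large : ((s./2)%:R * (theta - 1)) `^ (- 2^-1) < c) :
  exists2 C : R, 0 < C &
    forall tau : R, 0 < tau ->
      \forall r \near +oo,
        let X := central s theta r in
        let Y := c * Num.sqrt X in
        C * (tau * X `^ (1 - theta) * Y ^+ (s - 1))
          <= (Ncount s theta tau r Y)%:R.
Proof.
have [k ek] : exists k, k = Num.truncn (2 * theta) by eexists.
have k2t : k%:R <= 2 * theta by rewrite ek truncn_le; lra.
have tk : 2 * theta < k.+1%:R by rewrite ek truncnS_gt.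
have k1 : (1 < k)%N by rewrite -ltnS -(ltr_nat R); apply: lt_trans tk; lra.
have fk : Num.floor (2 * theta) = k%:Z.
  by apply: floor_def; rewrite intrD -!pmulrn natr1 k2t.
(* With 2 tri k = k (k + 1) averaged factors at least one more remains for the pointwise bound. *)
have rs : (2 * tri k < s)%N.
  have := tri2 k; rewrite mulnC => ->; move: s_large; rewrite fk; clear; nia.
have s1 : (1 < s)%N by apply: leq_trans rs; have := tri_gt0 (ltnW k1); lia.
have s0 : 0 < s%:R :> R by rewrite ltr0n ltnW.
have p0 : 0 < (s./2)%:R :> R by rewrite ltr0n half_gt0.
have c0 : 0 < c by apply: le_lt_trans c_large; exact: powR_ge0.
have G0 : 0 < (s./2)%:R * (theta - 1) by rewrite mulr_gt0//; lra.
have hG : 1 < (s./2)%:R * (theta - 1) * c ^+ 2.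
  rewrite -ltr_pdivrMl// mulr1.
  have -> : ((s./2)%:R * (theta - 1))^-1 = (((s./2)%:R * (theta - 1)) `^ (- 2^-1)) ^+ 2.
    rewrite -powR_mulrn ?powR_ge0// -powRrM; have -> : - 2^-1 * 2 = - 1 :> R by field.
    by rewrite powR_inv1// ltW.
  by rewrite ltr_pXn2r// nnegrE ?powR_ge0// ltW.
have t0 : 0 < theta by lra.
have [C C0 HC] := list_count theta_gt2 theta_nint c0 hG k1 k2t tk rs.
have cs : 0 < c ^+ (s - 1) by rewrite exprn_gt0.
(* The power of Y contributes c^(s - 1), which is divided out here. *)
exists (C / c ^+ (s - 1)); first by rewrite divr_gt0.
move=> tau tau0; have [M [_ HM]] := HC tau tau0.
near=> r; rewrite /=; set X := central s theta r; set Y := c * Num.sqrt X.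
have [y ey] : exists y, y = Num.sqrt X by eexists.
have yM : `|M| + 1 <= y by rewrite ey /X; near: r; exact: near_central (ltnW s1) t0.
have yc : 2 * c <= y by rewrite ey /X; near: r; exact: near_central (ltnW s1) t0.
have yc' : c^-1 <= y by rewrite ey /X; near: r; exact: near_central (ltnW s1) t0.
have y2 : 2 <= y by rewrite ey /X; near: r; exact: near_central (ltnW s1) t0.
have r0 : 0 <= r by near: r; exact: near_ge.
have y0 : 0 < y by move: y2; clear; lra.
have X0 : 0 <= X by exact: powR_ge0.
have Xy : X = y ^+ 2 by rewrite ey sqr_sqrtr.
have Yy : Y = c * y by rewrite ey.
have rE : r = s%:R * (y ^+ 2) `^ theta.
  rewrite -Xy /X /central -powRrM mulVf ?gt_eqF// powRr1 ?divr_ge0// ?(ltW s0)//.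
  by field; rewrite gt_eqF.
have cy : 1 <= c * y by rewrite -ler_pdivrMl// mulr1.
have c2y : 2 * (c * y) <= y ^+ 2 by rewrite expr2 mulrA ler_wpM2r// ltW.
have y22 : 1 <= y ^+ 2 by rewrite exprn_ege1// (le_trans _ y2)// ler1n.
have [a ea] : exists a, a = Num.truncn (y ^+ 2 - c * y) by eexists.
have [b eb] : exists b, b = Num.truncn (y ^+ 2 + c * y) by eexists.
have a1 : a%:R <= y ^+ 2 - c * y by rewrite ea truncn_le; move: c2y cy; clear; lra.
have a2 : y ^+ 2 - c * y < a.+1%:R by rewrite ea truncnS_gt.
have b1 : b%:R <= y ^+ 2 + c * y by rewrite eb truncn_le; move: c2y cy; clear; lra.
have b2 : y ^+ 2 + c * y < b.+1%:R by rewrite eb truncnS_gt.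
have ab : (a < b)%N.
  by rewrite -ltnS -(ltr_nat R); apply: le_lt_trans b2; rewrite -[a.+1%:R]natr1; move: a1 cy; clear; lra.
(* The half-open window consists exactly of the integers from a + 1 to b. *)
have hS x : (x \in iota a.+1 (b - a)) = (y ^+ 2 - c * y < x%:R <= y ^+ 2 + c * y).
  rewrite mem_iota addSn subnKC ?(ltnW ab)// ltnS; apply/andP/andP => -[h1 h2]; split.
  - by apply: lt_le_trans a2 _; rewrite ler_nat.
  - by apply: le_trans b1; rewrite ler_nat.
  - by rewrite -(ltr_nat R); exact: le_lt_trans a1 h1.
  - by rewrite -ltnS -(ltr_nat R); exact: le_lt_trans h2 b2.
apply: le_trans (@Ncount_ge R s a.+1 (b - a) theta tau r Y (ltn0Sn a) _); last first.
  by move=> x; rewrite hS -/X Xy Yy.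
have My : M < y by apply: lt_le_trans yM; apply: le_lt_trans (ler_norm M) _; rewrite ltrDl.
have := HM y My a.+1 (b - a)%N; rewrite -rE => /(_ _ _ _ _)/wrap[].
- by move=> x; rewrite hS => /andP[h1 h2]; rewrite ler_norml; move: h1 h2; clear => *; apply/andP; split; lra.
- by move=> x; rewrite hS ltr_norml => /andP[h1 h2]; move: h1 h2; clear => *; apply/andP; split; lra.
- have cyy : 0 <= c * y ^+ 2 by rewrite mulr_ge0 ?sqr_ge0// ltW.
  by move: a1 a2; rewrite -natr1; move: c2y cy y22 cyy; clear => *; apply/andP; split; lra.
- by rewrite natrB ?(ltnW ab)//; move: a1 a2 b1 b2; rewrite -!natr1; move: cy; clear => *; apply/andP; split; lra.
move=> h; apply: le_trans h; rewrite Xy Yy exprMn.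
have -> : y ^+ s = y ^+ (s - 1) * y by rewrite -exprSr -addn1 subnK// ltnW.
have -> : (y ^+ 2) `^ (1 - theta) = y * y `^ (1 - 2 * theta).
  rewrite -powR_mulrn ?(ltW y0)// -powRrM -{2}[y]powRr1 ?(ltW y0)// -powRDr//.
  by congr (_ `^ _); ring.
rewrite le_eqVlt; apply/orP; left; apply/eqP.
move: (c ^+ (s - 1)) cs (y ^+ (s - 1)) (y `^ (1 - 2 * theta)) => z z0 u v.
by field; rewrite gt_eqF.
Unshelve. all: by end_near. Qed.
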